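(* Let $n\ge 1$ be an integer, $0<\alpha,\beta<\min\{2,n\}$, let $k,l\ge 0$ be integers, and let $a,b,p,q\ge 0$ be real numbers. Suppose that either (1) $0<2k+\alpha<n$, $0<2l+\beta<n$, $0<p\le\frac{n+2k+\alpha+2a}{n-2l-\beta}$, $0<q\le\frac{n+2l+\beta+2b}{n-2k-\alpha}$ and $(p,q)\ne\left(\frac{n+2k+\alpha+2a}{n-2l-\beta},\frac{n+2l+\beta+2b}{n-2k-\alpha}\right)$; or (2) $\max\{2k+\alpha,2l+\beta\}\ge n$ and $n\ge 2$. Then the system $$(-\Delta)^{k+\frac{\alpha}{2}}u(x)=|x|^a v^p(x),\qquad (-\Delta)^{l+\frac{\beta}{2}}v(x)=|x|^b u^q(x),\qquad u(x)\ge 0,\ v(x)\ge 0,\qquad x\in\mathbb{R}^n,$$ admits no non-trivial solutions, i.e. no solution (in the sense specified in the context) other than $(u,v)=(0,0)$.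
   Context: For $t\in\mathbb{R}$, $[t]$ is the integer part of $t$ and $\{t\}:=t-[t]$. For $0<\alpha<2$, $\mathcal{L}_\alpha(\mathbb{R}^n):=\{u:\mathbb{R}^n\to\mathbb{R} \mid \int_{\mathbb{R}^n}\frac{|u(x)|}{1+|x|^{n+\alpha}}\,dx<\infty\}$. For $u\in C^{[\alpha],\{\alpha\}+\epsilon}_{loc}(\mathbb{R}^n)\cap\mathcal{L}_\alpha(\mathbb{R}^n)$ with some (arbitrarily small) $\epsilon>0$, the fractional Laplacian is defined pointwise by $$(-\Delta)^{\frac{\alpha}{2}}u(x)=C_{n,\alpha}\lim_{\varepsilon\to 0}\int_{|y-x|\ge\varepsilon}\frac{u(x)-u(y)}{|x-y|^{n+\alpha}}\,dy,$$ where $C_{n,\alpha}>0$ is the usual normalization constant. For an integer $m\ge 0$ and $f\in C^{2m+[\alpha],\{\alpha\}+\epsilon}_{loc}(\mathbb{R}^n)\cap\mathcal{L}_\alpha(\mathbb{R}^n)$, $(-\Delta)^{m+\frac{\alpha}{2}}f:=(-\Delta)^m(-\Delta)^{\frac{\alpha}{2}}f$ (under this regularity $(-\Delta)^{\frac{\alpha}{2}}f\in C^{2m}(\mathbb{R}^n)$). A solution $(u,v)$ of the system is a pair of functions with $u\in C^{2k+[\alpha],\{\alpha\}+\epsilon}_{loc}(\mathbb{R}^n)\cap\mathcal{L}_\alpha(\mathbb{R}^n)$ and $v\in C^{2l+[\beta],\{\beta\}+\epsilon}_{loc}(\mathbb{R}^n)\cap\mathcal{L}_\beta(\mathbb{R}^n)$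 for some arbitrarily small $\epsilon>0$, satisfying the equations and sign conditions pointwise in all of $\mathbb{R}^n$. *)

(* Defs.v *)
(* Points of R^n are row vectors; integrals over R^n are taken over n.-tuple R. *)
From HB Require Import structures.
From mathcomp Require Import all_boot all_order all_algebra.
From mathcomp Require Import all_classical all_reals all_analysis.

Set Implicit Arguments.
Unset Strict Implicit.
Unset Printing Implicit Defensive.

Import Order.TTheory GRing.Theory Num.Theory.
Import numFieldNormedType.Exports.

Local Open Scope classical_set_scope.
Local Open Scope ring_scope.

Section LebesgueRn.
Context (R : realType).

Definition tuple_cons (n : nat)
    (z : n.-tuple (measurableTypeR R) * measurableTypeR R) :
    n.+1.-tuple (measurableTypeR R) := [tuple of z.2 :: z.1].

Lemma measurable_tuple_cons (n : nat) :
  measurable_fun [set: n.-tuple (measurableTypeR R) * measurableTypeR R]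
    (@tuple_cons n).
Proof. exact: measurable_cons measurable_snd measurable_fst. Qed.

Definition lebesgue_step (n : nat)
    (m : {measure set (n.-tuple (measurableTypeR R)) -> \bar R}) :
    set (n.+1.-tuple (measurableTypeR R)) -> \bar R :=
  pushforward (m \x (@lebesgue_measure R))%E (@tuple_cons n).

HB.instance Definition _ (n : nat)
    (m : {measure set (n.-tuple (measurableTypeR R)) -> \bar R}) :=
  Measure.copy (lebesgue_step m)
    (measure_function_pushforward__canonical__measure_function_Measure
       (m \x (@lebesgue_measure R))%E (@measurable_tuple_cons n)).

(* n-dimensional Lebesgue measure on Borel sets, the image of the product
   measure on n.-tuple R * R under (t, x) |-> x :: t at each step. *)
Fixpoint lebesgue_tuple (n : nat) :
    {measure set (n.-tuple (measurableTypeR R)) -> \bar R} :=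
  match n with
  | 0 => \d_ ([tuple] : 0.-tuple (measurableTypeR R))
  | m.+1 => lebesgue_step (lebesgue_tuple m)
  end.

End LebesgueRn.

Section Space.
Context (R : realType) (n : nat).
Implicit Types (x y : 'rV[R]_n) (f u : 'rV[R]_n -> R).

Definition row_of_tuple (t : n.-tuple (measurableTypeR R)) : 'rV[R]_n :=
  \row_i tnth t i.

Definition Rn_integrable f : Prop :=
  (lebesgue_tuple R n).-integrable setT (fun t => (f (row_of_tuple t))%:E).

Definition Rn_integral (D : set 'rV[R]_n) f : R :=
  \int[lebesgue_tuple R n]_(t in row_of_tuple @^-1` D) f (row_of_tuple t).

(* Euclidean norm; the library norm on 'rV[R]_n is the sup norm. *)
Definition enorm x : R := Num.sqrt (\sum_(i < n) x ord0 i ^+ 2).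

Definition partial (i : 'I_n) f : 'rV[R]_n -> R :=
  fun x => 'D_(delta_mx ord0 i) f x.

Definition partials (s : seq 'I_n) f : 'rV[R]_n -> R := foldr partial f s.

Definition holder_loc (g : R) f : Prop :=
  forall K : set 'rV[R]_n, compact K ->
    exists C : R, forall x y, K x -> K y ->
      `|f x - f y| <= C * enorm (x - y) `^ g.

Definition CkHolder_loc (k : nat) (g : R) f : Prop :=
  [/\ forall s : seq 'I_n, (size s < k)%N ->
        forall i x, derivable (partials s f) x (delta_mx ord0 i),
      forall s : seq 'I_n, (size s <= k)%N -> continuous (partials s f) &
      forall s : seq 'I_n, size s = k -> holder_loc g (partials s f)].

Definition in_L (alpha : R) u : Prop :=
  Rn_integrable (fun x => `|u x| / (1 + enorm x `^ (n%:R + alpha))).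

Definition laplacian f : 'rV[R]_n -> R :=
  fun x => \sum_(i < n) partial i (partial i f) x.

Definition neg_laplacian f : 'rV[R]_n -> R := fun x => - laplacian f x.

Definition Gamma (s : R) : R :=
  \int[@lebesgue_measure R]_(t in `]0, +oo[) (t `^ (s - 1) * expR (- t)).

(* 2^alpha Gamma((n+alpha)/2) / (pi^(n/2) |Gamma(-alpha/2)|), with
   |Gamma(-alpha/2)| = Gamma(1-alpha/2) / (alpha/2) for 0 < alpha < 2;
   it gives the operator the Fourier symbol |xi|^alpha. *)
Definition frac_const (alpha : R) : R :=
  2 `^ alpha * Gamma ((n%:R + alpha) / 2) /
    (pi `^ (n%:R / 2) * (Gamma (1 - alpha / 2) / (alpha / 2))).

Definition frac_laplacian (alpha : R) u : 'rV[R]_n -> R := fun x =>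
  frac_const alpha *
  lim ((fun e : R => Rn_integral [set y | e <= enorm (y - x)]
          (fun y => (u x - u y) / enorm (x - y) `^ (n%:R + alpha))) @ 0^'+).

(* (-Delta)^(m + alpha/2) *)
Definition poly_frac_laplacian (m : nat) (alpha : R) u : 'rV[R]_n -> R :=
  iter m neg_laplacian (frac_laplacian alpha u).

(* Num.truncn alpha is the integer part, since it is used for alpha > 0. *)
Definition admissible (m : nat) (alpha : R) u : Prop :=
  (exists eps : R,
    [/\ 0 < eps,
        alpha - (Num.truncn alpha)%:R + eps < 1 &
        CkHolder_loc (2 * m + Num.truncn alpha)
          (alpha - (Num.truncn alpha)%:R + eps) u]) /\
  in_L alpha u.

(* The library power satisfies 0 `^ 0 = 1. *)
Definition is_solution (k l : nat) (alpha beta a b p q : R)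
    (u v : 'rV[R]_n -> R) : Prop :=
  [/\ admissible k alpha u,
      admissible l beta v,
      forall x, poly_frac_laplacian k alpha u x = enorm x `^ a * v x `^ p,
      forall x, poly_frac_laplacian l beta v x = enorm x `^ b * u x `^ q &
      forall x, 0 <= u x /\ 0 <= v x].

End Space.

(* Main.v *)
(** Test the equation (-Delta)^(k + alpha/2) u = f against Gaussians and their time derivatives: the
    Marchaud formula for the fractional Laplacian turns it, for s = alpha/2 + k, into
      \int u G_t(. - c) = l + C \int_0^oo r^(s-1) (\int f G_(t+r)(. - c)) dr,
    where a Harnack inequality for the Gaussian makes l independent of c. If 2s >= n, the integral
    diverges unless f = 0. If 2s < n, letting t -> 0 yields the Riesz representation
    u = l + C |x|^(2s-n) * f, and likewise for v; growth of the potentials forces l = 0. The integral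
    equations are then compared with their Kelvin transforms by scaling spheres (subcriticality makes
    the comparison strict), which gives u >= C |x|^(s-n/2) for |x| >= 1; feeding such a lower bound into
    the two equations improves the exponent by a fixed amount until the potentials diverge. *)
Require Import Defs.
From HB Require Import structures.
From mathcomp Require Import all_boot all_order all_algebra.
From mathcomp Require Import all_classical all_reals all_analysis.
From mathcomp Require Import measurable_realfun.
From mathcomp Require Import ring lra zify.

Set Implicit Arguments.
Unset Strict Implicit.
Unset Printing Implicit Defensive.

Import Order.TTheory GRing.Theory Num.Theory.
Import numFieldNormedType.Exports.

Local Open Scope classical_set_scope.
Local Open Scope ring_scope.

Local Notation mfunT := (measurable_fun setT).

(** The obstacle is how little is known at infinity: u is merely integrable against (1 +
    |x|)^(-n-alpha), and the sources have no growth bound at all. Gaussians suit both sides. Their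
    fractional Laplacian is explicit, because |z|^(-n-alpha) is itself a superposition of Gaussians
    and these form a semigroup, and it decays like the weight that u tolerates. On the side of the
    sources, nonnegativity stands in for growth bounds, through Tonelli and Fatou. Since theta =
    alpha/2 < 1, every time derivative of the heat flow of u vanishes at late times; only the last
    integration in time can leave a limit, and this is l.

    Scaling spheres act on the integral equations, where the comparison of kernels is pointwise and
    regularity beyond continuity plays no part. The numbers nu + s0 + a - (nu - s1) p and nu + s1 +
    b - (nu - s0) q, where nu = n/2 and 2 s0, 2 s1 are the orders, are nonnegative exactly in the
    admissible range. One of them may be 0: strictness then passes from one unknown to the other
    through the coupling. The same two numbers give the gain of each round of the final
    iteration. *)

Fact row_display : measure_display. Proof. by []. Qed.

(** * Measure theory on row vectors *)

Section RowMeasurable.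
Context (R : realType) (n : nat).

(** The sigma-algebra of tuples is transported to rows, which makes [row_of_tuple] measurable by
    construction. That continuous functions are measurable for it becomes a theorem,
    [continuous_measurable_row]. *)
Definition row_measurable : set (set 'rV[R]_n) :=
  [set A | measurable ((@row_of_tuple R n) @^-1` A)].

Let row0 : row_measurable set0.
Proof. by rewrite /row_measurable/= preimage_set0. Qed.

Let rowC A : row_measurable A -> row_measurable (~` A).
Proof. by rewrite /row_measurable/= preimage_setC; exact: measurableC. Qed.

Let row_bigcup (F : (set 'rV[R]_n)^nat) :
  (forall i, row_measurable (F i)) -> row_measurable (\bigcup_i F i).
Proof.
by move=> mF; rewrite /row_measurable/= preimage_bigcup; apply: bigcupT_measurable.
Qed.

HB.instance Definition _ := @isMeasurable.Build row_display 'rV[R]_n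
  row_measurable row0 rowC row_bigcup.

Definition tuple_of_row (x : 'rV[R]_n) : n.-tuple (measurableTypeR R) :=
  [tuple x ord0 i | i < n].

Lemma row_of_tupleK : cancel (@row_of_tuple R n) tuple_of_row.
Proof.
by move=> t; apply: eq_from_tnth => i; rewrite tnth_mktuple mxE.
Qed.

Lemma tuple_of_rowK : cancel tuple_of_row (@row_of_tuple R n).
Proof. by move=> x; apply/rowP => i; rewrite mxE tnth_mktuple. Qed.

Lemma measurable_row_of_tuple : mfunT (@row_of_tuple R n).
Proof. by move=> _ A mA; rewrite setTI. Qed.

Lemma measurable_coord (i : 'I_n) :
  mfunT (fun x : 'rV[R]_n => x ord0 i).
Proof.
move=> _ A mA; rewrite setTI; rewrite /measurable/= /row_measurable/=.
have := @measurable_tnth _ (measurableTypeR R) n i measurableT A mA.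
rewrite setTI; congr (measurable _); apply/seteqP; split => t /=; by rewrite mxE.
Qed.

Lemma measurable_row (d : measure_display) (T : measurableType d)
    (f : T -> 'rV[R]_n) :
  (forall i, mfunT (fun x => f x ord0 i)) -> mfunT f.
Proof.
move=> mf.
have mt : mfunT (tuple_of_row \o f).
  apply/measurable_fun_tnthP => i.
  rewrite (_ : _ \o _ = fun x => f x ord0 i); first exact: mf.
  by apply/funext => x /=; rewrite tnth_mktuple.
rewrite (_ : f = @row_of_tuple R n \o (tuple_of_row \o f)).
  exact: measurableT_comp measurable_row_of_tuple mt.
by apply/funext => x /=; rewrite tuple_of_rowK.
Qed.

End RowMeasurable.

Section SigmaFiniteCopy.
Context d (T : measurableType d) (R : realType) (m : {measure set T -> \bar R}).

(** An alias whose purpose is the proof [H]: sigma-finiteness of [lebesgue_tuple] comes out of an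
    induction as a proposition, and the alias turns it into the structure that Fubini expects. *)
Definition sf_copy of sigma_finite setT m : set T -> \bar R := m.

Variable H : sigma_finite setT m.

HB.instance Definition _ := Measure.copy (sf_copy H) m.
HB.instance Definition _ := Measure_isSigmaFinite.Build _ _ _ (sf_copy H) H.

End SigmaFiniteCopy.

Lemma product_sigma_finite d1 d2 (T1 : measurableType d1) (T2 : measurableType d2)
    (R : realType) (m1 : {sigma_finite_measure set T1 -> \bar R})
    (m2 : {sigma_finite_measure set T2 -> \bar R}) :
  sigma_finite setT (m1 \x m2)%E.
Proof.
have [F FT Foo] := sigma_finiteT m1; have [G GT Goo] := sigma_finiteT m2.
(* Rectangles indexed by pairs are enumerated through the countable encoding; a number that encodes
   no pair repeats the rectangle of index (0, 0), which is harmless. *)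
pose un i := odflt (0%N, 0%N) (@unpickle (nat * nat)%type i).
exists (fun i => F (un i).1 `*` G (un i).2).
  apply/seteqP; split => // -[x y] _.
  have [i _ Fi] : (\bigcup_i F i) x by rewrite -FT.
  have [j _ Gj] : (\bigcup_i G i) y by rewrite -GT.
  by exists (pickle (i, j)) => //=; rewrite /un pickleK.
move=> i; have [mF F1] := Foo (un i).1; have [mG G1] := Goo (un i).2.
split; first exact: measurableX.
by rewrite product_measure1E// lte_mul_pinfty// ge0_fin_numE.
Qed.

Section LebRow.
Context (R : realType).

Definition leb (n : nat) : set 'rV[R]_n -> \bar R :=
  pushforward (lebesgue_tuple R n) (@row_of_tuple R n).
Arguments leb : clear implicits.

HB.instance Definition _ n := Measure.copy (leb n)
    (measure_function_pushforward__canonical__measure_function_Measure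
       (lebesgue_tuple R n) (@measurable_row_of_tuple R n)).

(** Induction on the dimension: [tuple_cons] has a measurable inverse, along which an exhaustion of
    the product by sets of finite measure is pulled back. *)
Lemma lebesgue_tuple_sigma_finite n :
  sigma_finite setT (lebesgue_tuple R n).
Proof.
elim: n => [|n IH].
  exists (fun=> setT); first by rewrite bigcup_const.
  by move=> _; split => //=; rewrite diracT ltry.
pose m1 : {sigma_finite_measure set _ -> \bar R} := sf_copy IH.
have [F FT Foo] := product_sigma_finite m1 (@lebesgue_measure R).
have mc := @measurable_tuple_cons R n.
pose un (t : n.+1.-tuple (measurableTypeR R)) :
  n.-tuple (measurableTypeR R) * measurableTypeR R := ([tuple of behead t], thead t).
have unK : cancel (@tuple_cons R n) un by move=> [t x]; rewrite /un theadE; congr pair; apply: val_inj.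
have mun : mfunT un.
  apply/measurable_fun_pairP; split; first exact: measurable_behead.
  exact: measurable_tnth.
exists (fun i => un @^-1` F i).
  by rewrite -preimage_bigcup -FT preimage_setT.
move=> i; have [mF Fi] := Foo i; split.
  by rewrite -[X in measurable X]setTI; exact: mun.
rewrite /= /lebesgue_step /pushforward/= -comp_preimage.
rewrite (_ : _ @^-1` _ = F i) //.
by apply/seteqP; split => z /=; rewrite unK.
Qed.

Lemma leb_sigma_finite n : sigma_finite setT (leb n).
Proof.
have [F FT Foo] := lebesgue_tuple_sigma_finite n.
exists (fun i => @tuple_of_row R n @^-1` F i).
  by rewrite -preimage_bigcup -FT preimage_setT.
move=> i; have [mF Fi] := Foo i.
have E : @row_of_tuple R n @^-1` (@tuple_of_row R n @^-1` F i) = F i.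
  by apply/seteqP; split => z /=; rewrite row_of_tupleK.
by split; rewrite ?/leb ?/pushforward/measurable/= ?/row_measurable/= ?E.
Qed.

HB.instance Definition _ n := Measure_isSigmaFinite.Build _ _ _ (leb n)
  (@leb_sigma_finite n).

Definition rcons0 n (r : R) (x : 'rV[R]_n) : 'rV[R]_n.+1 :=
  \row_i (if unlift ord0 i is Some j then x ord0 j else r).

Lemma rcons0_0 n r (x : 'rV[R]_n) : rcons0 r x ord0 ord0 = r.
Proof. by rewrite mxE unlift_none. Qed.

Lemma rcons0_S n r (x : 'rV[R]_n) i : rcons0 r x ord0 (lift ord0 i) = x ord0 i.
Proof. by rewrite mxE liftK. Qed.

Lemma rcons0_eta n (x : 'rV[R]_n.+1) :
  x = rcons0 (x ord0 ord0) (\row_i x ord0 (lift ord0 i)).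
Proof.
by apply/rowP => i; rewrite mxE; case: unliftP => [j ->|->]; rewrite ?mxE.
Qed.

Lemma rcons0D n r s (x y : 'rV[R]_n) : rcons0 r x + rcons0 s y = rcons0 (r + s) (x + y).
Proof. by apply/rowP => i; rewrite !mxE; case: unliftP => // j _; rewrite mxE. Qed.

Lemma rcons0Z n c s (y : 'rV[R]_n) : c *: rcons0 s y = rcons0 (c * s) (c *: y).
Proof. by apply/rowP => i; rewrite !mxE; case: unliftP => // j _; rewrite mxE. Qed.

Lemma measurable_rcons0 n :
  mfunT (fun z : 'rV[R]_n * measurableTypeR R => rcons0 z.2 z.1).
Proof.
apply: measurable_row => i; under eq_fun do rewrite mxE.
case: unliftP => [j _|_]; last exact: measurable_snd.
exact: (measurableT_comp (@measurable_coord R n j) measurable_fst).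
Qed.

Lemma ge0_integral_leb n (f : 'rV[R]_n -> \bar R) : mfunT f ->
  (forall x, 0 <= f x)%E ->
  (\int[leb n]_x f x = \int[lebesgue_tuple R n]_t f (row_of_tuple t))%E.
Proof.
move=> mf f0.
have := @ge0_integral_pushforward _ _ _ _ R _ (@measurable_row_of_tuple R n) (lebesgue_tuple R n) setT f measurableT mf (fun x _ => f0 x).
by rewrite preimage_setT.
Qed.

(** The recursion behind [lebesgue_tuple], read on rows. It is the link between dimensions n and n +
    1 on which the inductions on the dimension rest. *)
Lemma ge0_integral_lebS n (f : 'rV[R]_n.+1 -> \bar R) : mfunT f ->
  (forall x, 0 <= f x)%E ->
  (\int[leb n.+1]_x f x =
   \int[leb n]_x \int[@lebesgue_measure R]_r f (rcons0 r x))%E.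
Proof.
move=> mf f0.
rewrite ge0_integral_leb//=.
pose m1 : {sigma_finite_measure set _ -> \bar R} := sf_copy (lebesgue_tuple_sigma_finite n).
have mg : mfunT (fun t => f (@row_of_tuple R n.+1 t)).
  exact: measurableT_comp mf (@measurable_row_of_tuple R n.+1).
have -> : (\int[lebesgue_step (lebesgue_tuple R n)]_x f (row_of_tuple x) =
   \int[(m1 \x (@lebesgue_measure R))]_z f (row_of_tuple (tuple_cons z)))%E.
  have := @ge0_integral_pushforward _ _ _ _ R _ (@measurable_tuple_cons R n) (m1 \x (@lebesgue_measure R))%E setT _ measurableT mg (fun x _ => f0 _).
  by rewrite preimage_setT.
rewrite fubini_tonelli1//; last first.
  exact: measurableT_comp mg (@measurable_tuple_cons R n).
rewrite ge0_integral_leb.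
- apply: eq_integral => t _; rewrite /fubini_F; apply: eq_integral => r _.
  congr (f _); apply/rowP => i; rewrite !mxE.
  case: unliftP => [j ->|->]; last by rewrite tnth0.
  by rewrite tnthS mxE.
- apply: (@measurable_fun_fubini_tonelli_F _ _ _ _ R (@lebesgue_measure R)
    (fun z : 'rV[R]_n * measurableTypeR R => f (rcons0 z.2 z.1))).
    exact: measurableT_comp mf (@measurable_rcons0 n).
  by move=> ?; exact: f0.
- by move=> x; apply: integral_ge0.
Qed.

End LebRow.
Arguments leb : clear implicits.

(** * Affine changes of variable *)

Section Affine1.
Context (R : realType).
Notation lam := (@lebesgue_measure R).

Lemma measurable_affine (c a : R) :
  mfunT (fun r : measurableTypeR R => c * r + a : measurableTypeR R).
Proof.
by apply: measurable_funD => //; apply: measurable_funM.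
Qed.

Lemma ge0_integral_affine (c a : R) (f : R -> \bar R) : c != 0 ->
  mfunT f -> (forall x, 0 <= f x)%E ->
  (\int[lam]_r f (c * r + a)%R = (`|c|^-1)%R%:E * \int[lam]_r f r)%E.
Proof.
move=> c0 mf f0.
pose m : {measure set (measurableTypeR R) -> \bar R} :=
  measure_function_pushforward__canonical__measure_function_Measure lam (measurable_affine c a).
have nc : 0 <= `|c| by [].
(* Lebesgue measure is determined by its values on the intervals ]p, q]. A negative [c] reverses
   such an interval into one that is open at the other end, hence the two cases. *)
have E : forall A, measurable A -> lam A = mscale (NngNum nc) m A.
  apply: lebesgue_measure_unique => X [[p q] _ <-] /=.
  rewrite /mscale/= /pushforward/=.
  have pre : (fun r : R => c * r + a) @^-1` `]p, q]%classic =
     if 0 < c then [set` `](p - a) / c, (q - a) / c]] else [set` `[(q - a) / c, (p - a) / c[].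
  { case: ifPn => hc; [|have {}hc : c < 0 by rewrite lt_neqAle c0 leNgt].
    all: apply/seteqP; split => r /=; rewrite !in_itv/= => /andP[h1 h2]; apply/andP; split.
    - by rewrite ltr_pdivrMr// ltrBlDr mulrC.
    - by rewrite ler_pdivlMr// lerBrDr mulrC.
    - by move: h1; rewrite ltr_pdivrMr// ltrBlDr mulrC.
    - by move: h2; rewrite ler_pdivlMr// lerBrDr mulrC.
    - by rewrite ler_ndivrMr// lerBrDr mulrC.
    - by rewrite ltr_ndivlMr// ltrBlDr mulrC.
    - by move: h2; rewrite ltr_ndivlMr// ltrBlDr mulrC.
    - by move: h1; rewrite ler_ndivrMr// lerBrDr mulrC. }
  rewrite pre {pre}.
  case: ifPn => hc.
    rewrite !lebesgue_measure_itv/= !lte_fin.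
    rewrite ltr_pM2r ?invr_gt0// ltrBDr subrK; case: ltP => pq; last by rewrite mule0.
    by rewrite -!EFinB -EFinM gtr0_norm//; congr EFin; field; rewrite gt_eqF.
  have {}hc : c < 0 by rewrite lt_neqAle c0 leNgt.
  rewrite !lebesgue_measure_itv/= !lte_fin.
  rewrite ltr_nM2r ?invr_lt0// ltrBDr subrK; case: ltP => pq; last by rewrite mule0.
  by rewrite -!EFinB -EFinM ltr0_norm//; congr EFin; field.
have -> : (\int[lam]_r f r = \int[mscale (NngNum nc) m]_r f r)%E.
  by apply: eq_measure_integral => A mA _; exact: E.
rewrite ge0_integral_mscale// ge0_integral_pushforward//=; last exact: measurable_affine.
rewrite ?preimage_setT muleA -EFinM.
by rewrite mulVf ?normr_eq0// mul1e.
Qed.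

End Affine1.

Section LebAffine.
Context (R : realType).
Notation lam := (@lebesgue_measure R).

Lemma measurable_lebS n (f : 'rV[R]_n.+1 -> \bar R) : mfunT f ->
  (forall x, 0 <= f x)%E ->
  mfunT (fun x : 'rV[R]_n => \int[lam]_r f (rcons0 r x))%E.
Proof.
move=> mf f0; apply: (@measurable_fun_fubini_tonelli_F _ _ _ _ R lam
    (fun z : 'rV[R]_n * measurableTypeR R => f (rcons0 z.2 z.1))).
  exact: measurableT_comp mf (@measurable_rcons0 R n).
by move=> ?; exact: f0.
Qed.

Lemma measurable_row_affine n (c : R) (a : 'rV[R]_n) :
  mfunT (fun x : 'rV[R]_n => c *: x + a).
Proof.
apply: measurable_row => i; under eq_fun do rewrite !mxE.
apply: measurable_funD => //; apply: measurable_funM => //.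
exact: measurable_coord.
Qed.

Lemma measurable_rcons0r n (x : 'rV[R]_n) : mfunT (fun r : measurableTypeR R => rcons0 r x).
Proof.
apply: measurable_row => i; under eq_fun do rewrite mxE.
by case: unliftP => [j _|_]; [exact: measurable_cst|exact: measurable_id].
Qed.

Lemma ge0_integral_leb_affine n (c : R) (a : 'rV[R]_n) (f : 'rV[R]_n -> \bar R) :
  c != 0 -> mfunT f -> (forall x, 0 <= f x)%E ->
  (\int[leb R n]_x f (c *: x + a)%R = (`|c| ^- n)%R%:E * \int[leb R n]_x f x)%E.
Proof.
move=> c0; elim: n a f => [|n IH] a f mf f0.
  rewrite expr0 invr1 mul1e; apply: eq_integral => x _.
  by congr (f _); apply/rowP => -[].
have mfa := measurableT_comp mf (measurable_row_affine c a).
rewrite (ge0_integral_lebS mfa (fun x => f0 _)).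
transitivity (\int[leb R n]_x (`|c|^-1%:E * (\int[lam]_r f (rcons0 r (c *: x + \row_i a ord0 (lift ord0 i))%R))))%E.
  apply: eq_integral => x _.
  rewrite -(@ge0_integral_affine _ c (a ord0 ord0) (fun r => f (rcons0 r _)))//.
    apply: eq_integral => r _; congr (f _).
    by rewrite [in LHS](rcons0_eta a) rcons0Z rcons0D.
  exact: measurableT_comp mf (measurable_rcons0r _).
have mF := measurable_lebS mf f0.
have F0 x : (0 <= \int[lam]_r f (rcons0 r x))%E by apply: integral_ge0.
rewrite ge0_integralZl//; last first.
  exact: measurableT_comp mF (measurable_row_affine _ _).
rewrite (IH _ _ mF F0) muleA -EFinM -ge0_integral_lebS//.
by rewrite exprS invfM.
Qed.

End LebAffine.

Section Restrict.
Context d (T : measurableType d) (R : realType) (mu : {measure set T -> \bar R}).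
Local Open Scope ereal_scope.

(** [mu] is the sum of its restrictions to [D] and to the complement of [D]; on each piece one of
    the two integrands contributes nothing. *)
Lemma ge0_integral_mrestr (D : set T) (mD : measurable D) (f : T -> \bar R) :
  mfunT f -> (forall x, 0 <= f x) ->
  \int[mrestr mu mD]_x f x = \int[mu]_(x in D) f x.
Proof.
move=> mf f0; have mC := measurableC mD.
have mfD : mfunT (f \_ D) by apply/(measurable_restrictT f mD); exact: measurable_funTS.
have fD0 x : 0 <= (f \_ D) x by rewrite patchE; case: ifP.
rewrite [RHS]integral_mkcond.
transitivity (\int[measure_add (mrestr mu mD) (mrestr mu mC)]_x (f \_ D) x); last first.
  apply: eq_measure_integral => A mA _.
  rewrite [LHS]measure_addE /= /mrestr -measureU.
  - by rewrite -setIUr setUv setIT.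
  - exact: measurableI.
  - exact: measurableI.
  - by rewrite setIACA setICr setI0.
rewrite ge0_integral_measure_add//.
rewrite [X in _ = _ + X](@ge0_negligible_integral _ _ _ _ _ D)//; last first.
  by rewrite /= /mrestr setICr.
rewrite [X in _ = _ + X]integral0_eq ?adde0; last first.
  by move=> x [_ Dx]; rewrite patchE memNset.
rewrite [LHS](@ge0_negligible_integral _ _ _ _ _ (~` D))//; last first.
  by rewrite /= /mrestr setICl.
rewrite [RHS](@ge0_negligible_integral _ _ _ _ _ (~` D))//; last first.
  by rewrite /= /mrestr setICl.
apply: eq_integral => x; rewrite inE/= => -[_ Dx].
by rewrite patchE mem_set//; apply: contrapT.
Qed.

End Restrict.

(** * Lebesgue measure on the open half line *)

Section HalfLine.
Context (R : realType).
Notation lam := (@lebesgue_measure R).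

Let mpos : measurable (`]0, +oo[%classic : set (measurableTypeR R)).
Proof. exact: measurable_itv. Qed.

(** Half-line integrals become integrals over the whole type against a sigma-finite measure, so that
    Fubini and dominated convergence apply without mention of a domain. Values at nonpositive
    arguments are discarded by [hl_ae]. *)
Definition hl : set (measurableTypeR R) -> \bar R := mrestr lam mpos.

HB.instance Definition _ := Measure.on hl.

Lemma hl_sigma_finite : sigma_finite setT hl.
Proof.
have [F FT Foo] := sigma_finiteT lam.
exists F => // i; have [mF Fi] := Foo i; split => //.
by apply: le_lt_trans Fi; apply: le_measure; rewrite ?inE//; exact: measurableI.
Qed.

HB.instance Definition _ := Measure_isSigmaFinite.Build _ _ _ hl hl_sigma_finite.

Lemma hl_ae (P : R -> Prop) : (forall x, 0 < x -> P x) -> {ae hl, forall x, P x}.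
Proof.
move=> h; exists (~` `]0, +oo[%classic); split.
- exact: measurableC.
- by rewrite /hl /mrestr setICl measure0.
- by move=> x /= nP; rewrite in_itv/= andbT => x0; apply: nP; exact: h.
Qed.

Local Open Scope ereal_scope.

Lemma ge0_integral_hl (f : R -> \bar R) : mfunT f ->
  (forall x, 0 <= f x) -> \int[hl]_x f x = \int[lam]_(x in `]0%R, +oo[) f x.
Proof. by move=> mf f0; rewrite /hl ge0_integral_mrestr. Qed.

(* Lebesgue measure on the half line is the image under [expR] of the measure of
   density [expR]; that density measure is read off the region under its graph. *)
Lemma ge0_integral_hl_exp (f : R -> \bar R) : mfunT f ->
  (forall x, 0 <= f x) ->
  \int[hl]_x f x = \int[lam]_r ((expR r)%:E * f (expR r)).
Proof.
move=> mf f0.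
pose D := [set z : measurableTypeR R * measurableTypeR R | (0 < z.2 < expR z.1)%R].
have mexp : mfunT (fun z : measurableTypeR R * measurableTypeR R => expR z.1 : measurableTypeR R).
  exact: (measurableT_comp (@measurable_expR R) measurable_fst).
have mD : measurable D.
  have -> : D = (snd @^-1` `]0%R, +oo[%classic) `&`
      ((fun z => expR z.1 - z.2)%R @^-1` `]0%R, +oo[%classic).
    by apply/seteqP; split => z; rewrite /D/= !in_itv/= !andbT subr_gt0 => /andP.
  apply: measurableI.
    by rewrite -[X in measurable X]setTI; exact: measurable_snd.
  rewrite -[X in measurable X]setTI.
  have mB : mfunT (fun z : measurableTypeR R * measurableTypeR R => expR z.1 - z.2)%R.
    by apply: measurable_funB => //; exact: measurable_snd.
  exact: mB.
pose m : {measure set (measurableTypeR R) -> \bar R} :=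
  measure_function_pushforward__canonical__measure_function_Measure
   (mrestr (product_measure1 lam lam) mD) mexp.
have Im (g : R -> \bar R) : mfunT g -> (forall x, 0 <= g x) ->
    \int[m]_x g x = \int[lam]_r ((expR r)%:E * g (expR r)).
  move=> mg g0; have mge := measurableT_comp mg mexp.
  have -> := @ge0_integral_pushforward _ _ _ _ R _ mexp (mrestr (product_measure1 lam lam) mD) setT g measurableT mg (fun x _ => g0 x).
  rewrite preimage_setT.
  rewrite (@ge0_integral_mrestr _ _ _ _ _ mD _ mge (fun x => g0 _)) integral_mkcond.
  rewrite fubini_tonelli1; [|exact/(measurable_restrictT _ mD)/measurable_funTS|
    by move=> x; rewrite patchE; case: ifP => // _; exact: g0].
  apply: eq_integral => r _; rewrite /fubini_F.
  rewrite (_ : (fun y => _) = (fun y => g (expR r) * (\1_(`]0%R, expR r[%classic) y)%:E)).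
    rewrite ge0_integralZl//; last exact/measurable_EFinP.
    rewrite integral_indic// setIT [X in _ * X]lebesgue_measure_itv/= lte_fin expR_gt0.
    by rewrite -EFinB subr0 muleC.
  apply/funext => y; rewrite patchE indicE; case: ifPn.
    by rewrite inE /D/= => h; rewrite mem_set ?mule1//= in_itv.
  rewrite notin_setE /D/= => h; rewrite memNset ?mule0//= in_itv//.
rewrite -Im//.
apply: eq_measure_integral => A mA _.
rewrite /hl /mrestr.
(* The uniqueness of Lebesgue measure concerns the whole line, so the image measure [m] is completed
   by Lebesgue measure on the nonpositive half line. *)
suff E : forall A, measurable A -> lam A = measure_add m (mrestr lam (measurableC mpos)) A.
  rewrite [LHS]E; last exact: measurableI.
  rewrite [LHS]measure_addE.
  rewrite [X in _ + X = _](_ : _ = 0) ?adde0; last first.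
    by rewrite /= /mrestr -setIA setICr setI0 measure0.
  rewrite /m/= /pushforward/=; congr (mrestr _ _ _).
  by apply/seteqP; split => z /=; [case|split => //]; rewrite in_itv/= expR_gt0.
apply: lebesgue_measure_unique => X [[a b] _ <-] /=.
rewrite [RHS]measure_addE.
have mP (Y : set R) : m Y = m (Y `&` `]0%R, +oo[%classic).
  rewrite /m/= /pushforward/= preimage_setI (_ : _ @^-1` `]0%R, +oo[ = setT) ?setIT//.
  by apply/seteqP; split => // z _ /=; rewrite in_itv/= expR_gt0.
(* The mass of ]0, c] is the integral of exp over ]-oo, ln c]. A reflection turns it into the
   integral of exp(-r) over [-ln c, +oo[, to which the fundamental theorem applies. *)
have M0 (c : R) : (0 < c)%R -> m `]0%R, c]%classic = c%:E.
  move=> c0; rewrite -[X in m X]setIT -integral_indic//.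
  rewrite Im; [|exact/measurable_EFinP|by move=> x; rewrite lee_fin].
  rewrite -[LHS](mul1e _) -[X in X * _](_ : (`|-1|^-1)%R%:E = 1)//; last by rewrite normrN1 invr1.
  have N10 : ((-1)%R : R) != 0%R by rewrite oppr_eq0 oner_eq0.
  rewrite -(@ge0_integral_affine R (-1)%R 0%R _ N10); last 2 first.
  - apply: emeasurable_funM; first exact/measurable_EFinP.
    by apply/measurable_EFinP; apply: measurableT_comp => //.
  - by move=> r; rewrite mule_ge0 ?lee_fin ?expR_ge0.
  rewrite (_ : (fun r => _) = ((fun r => (expR (- r))%:E) \_ `[(- ln c)%R, +oo[)); last first.
    apply/funext => r; rewrite patchE addr0 mulN1r indicE.
    have -> : (expR (- r) \in `]0%R, c]%classic) = (r \in `[(- ln c)%R, +oo[%classic).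
      have K : (expR (- r) <= c)%R = (- ln c <= r)%R by rewrite -{1}[c]lnK ?posrE// ler_expR lerNl.
      by apply/idP/idP; rewrite !inE/= !in_itv/= expR_gt0/= andbT K.
    by case: ifP; rewrite ?mule1 ?mule0.
  rewrite -integral_mkcond.
  rewrite (@ge0_continuous_FTC2y _ _ (fun r => - expR (- r))%R _ 0%R).
  - by rewrite opprK lnK// sub0e -EFinN opprK.
  - by move=> x _; exact: expR_ge0.
  - apply: continuous_subspaceT => x.
    by apply: continuous_comp; [exact: oppr_continuous|exact: continuous_expR].
  - rewrite -oppr0; apply: cvgN; exact: cvgr_expR.
  - by move=> x _; apply: derivableN; exact: ex_derive.
  - apply: cvg_at_right_filter.
    apply: cvgN; apply: continuous_comp; [exact: oppr_continuous|exact: continuous_expR].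
  - by move=> x _; rewrite derive1E derive_val; lra.
have [ba|ab] := leP b a.
  by rewrite set_itv_ge ?bnd_simp -?leNgt// !measure0 adde0.
have [b0|b0] := leP b 0%R.
  rewrite mP [X in m X](_ : _ = set0); last first.
    apply/seteqP; split => // x [] /=; rewrite !in_itv/= andbT => /andP[_ xb] x0.
    by have := le_lt_trans b0 x0; lra.
  rewrite measure0 add0e /= /mrestr setIidl// => x /=; rewrite !in_itv/= andbT => /andP[_ xb].
  by apply/negP; rewrite -leNgt (le_trans xb).
have [a0|a0] := leP 0%R a.
  rewrite [X in _ = _ + X](_ : _ = 0) ?adde0; last first.
    rewrite /= /mrestr (_ : _ `&` _ = set0) ?measure0//; apply/seteqP; split => // x [] /=.
    by rewrite !in_itv/= andbT => /andP[ax _]; apply; exact: le_lt_trans ax.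
  rewrite lebesgue_measure_itv/= lte_fin ab -[RHS]/(m `]a, b]%classic).
  move: a0; rewrite le_eqVlt => /orP[/eqP <-|a0]; first by rewrite M0// -EFinB subr0.
  have : m (`]0%R, b]%classic) = m (`]0%R, a]%classic) + m (`]a, b]%classic).
    rewrite -measureU//; last first.
      apply/seteqP; split => // x [] /=; rewrite !in_itv/= => /andP[_ h1] /andP[h2 _]; lra.
    congr (m _); apply/seteqP; split => x /=; rewrite !in_itv/=.
      by move=> /andP[h1 h2]; have [?|?] := leP x a; [left|right]; lra.
    by move=> [|] /andP[h1 h2]; lra.
  rewrite !M0// -EFinB; move: (m `]a, b]%classic) => -[M|//|//].
  by rewrite -EFinD => -[->]; congr EFin; lra.
rewrite mP (_ : _ `&` _ = `]0%R, b]%classic); last first.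
  by apply/seteqP; split => x /=; rewrite !in_itv/= andbT; [move=> [] /andP[? ?] ?|move=> /andP[? ?]; split]; lra.
rewrite M0// /= /mrestr (_ : _ `&` _ = `]a, 0%R]%classic); last first.
  apply/seteqP; split => x /=; rewrite !in_itv/= andbT; first by move=> [] /andP[? ?] /negP; lra.
  by move=> /andP[? ?]; split; [|apply/negP]; lra.
by rewrite !lebesgue_measure_itv/= !lte_fin ab a0 -!EFinD; congr EFin; lra.
Qed.

End HalfLine.

(** * Real-valued integrals: dominated convergence and Fubini *)

Section L1.
Context d (T : measurableType d) (R : realType) (mu : {measure set T -> \bar R}).

Implicit Types f g : T -> R.

Definition L1 (f : T -> R) : Prop := mu.-integrable setT (EFin \o f).

Lemma L1_meas f : L1 f -> mfunT f.
Proof. by move=> /integrableP[/measurable_EFinP]. Qed.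

Lemma L1_lty f : L1 f -> (\int[mu]_x `|f x|%:E < +oo)%E.
Proof. by move=> /integrableP[]. Qed.

Lemma L1P f : mfunT f -> (\int[mu]_x `|f x|%:E < +oo)%E -> L1 f.
Proof. by move=> mf h; apply/integrableP; split => //; exact/measurable_EFinP. Qed.

Lemma L1_le g f : mfunT f -> (forall x, `|f x| <= g x) -> L1 g -> L1 f.
Proof.
move=> mf fg; apply: le_integrable => //; first exact/measurable_EFinP.
by move=> x _ /=; rewrite lee_fin (le_trans (fg x))// ler_norm.
Qed.

Lemma L1D f g : L1 f -> L1 g -> L1 (fun x => f x + g x).
Proof. by move=> /integrableD h /h; apply => //. Qed.

Lemma L1B f g : L1 f -> L1 g -> L1 (fun x => f x - g x).
Proof. by move=> /integrableB h /h; apply => //. Qed.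

Lemma L1Z c f : L1 f -> L1 (fun x => c * f x).
Proof. by move=> /(integrableZl measurableT c). Qed.

Lemma L1_norm f : L1 f -> L1 (fun x => `|f x|).
Proof. by move=> h; apply: L1P; [exact/measurableT_comp/L1_meas|under eq_integral do rewrite normr_id; exact: L1_lty]. Qed.

Lemma L1_sum (I : Type) (s : seq I) (f : I -> T -> R) :
  (forall i, L1 (f i)) -> L1 (fun x => \sum_(i <- s) f i x).
Proof.
move=> h; elim: s => [|i s IH].
  by under eq_fun do rewrite big_nil; exact: integrable0.
by under eq_fun do rewrite big_cons; exact: L1D.
Qed.

Lemma L1_EFin f : L1 f -> (\int[mu]_x (f x)%:E)%E = (\int[mu]_x f x)%:E.
Proof. by move=> h; rewrite /Rintegral fineK//; exact: integrable_fin_num. Qed.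

Lemma ge0_L1_EFin f : mfunT f -> (forall x, 0 <= f x) ->
  L1 f <-> (\int[mu]_x (f x)%:E < +oo)%E.
Proof.
move=> mf f0; have E : (\int[mu]_x `|f x|%:E = \int[mu]_x (f x)%:E)%E.
  by apply: eq_integral => x _; rewrite ger0_norm.
by split => h; [rewrite -E; exact: L1_lty|apply: L1P => //; rewrite E].
Qed.

Lemma RID f g : L1 f -> L1 g ->
  \int[mu]_x (f x + g x) = \int[mu]_x f x + \int[mu]_x g x.
Proof. exact: RintegralD. Qed.

Lemma RIB f g : L1 f -> L1 g ->
  \int[mu]_x (f x - g x) = \int[mu]_x f x - \int[mu]_x g x.
Proof. exact: RintegralB. Qed.

Lemma RIZ c f : L1 f -> \int[mu]_x (c * f x) = c * \int[mu]_x f x.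
Proof. exact: RintegralZl. Qed.

Lemma RI_sum (I : Type) (s : seq I) (f : I -> T -> R) :
  (forall i, L1 (f i)) ->
  \int[mu]_x (\sum_(i <- s) f i x) = \sum_(i <- s) \int[mu]_x f i x.
Proof.
move=> h; elim: s => [|i s IH].
  rewrite big_nil; under eq_Rintegral do rewrite big_nil.
  by rewrite /Rintegral integral0.
rewrite big_cons -IH -RID//; last exact: L1_sum.
by apply: eq_Rintegral => x _; rewrite big_cons.
Qed.

Lemma RI_le f g : L1 f -> L1 g -> (forall x, f x <= g x) ->
  \int[mu]_x f x <= \int[mu]_x g x.
Proof. by move=> hf hg h; exact: le_Rintegral. Qed.

Lemma RI_norm f : L1 f -> `|\int[mu]_x f x| <= \int[mu]_x `|f x|.
Proof. exact: le_normr_Rintegral. Qed.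

Lemma RI_ge0 f : (forall x, 0 <= f x) -> 0 <= \int[mu]_x f x.
Proof. by move=> h; apply: Rintegral_ge0. Qed.

Lemma RI_dct (f_ : nat -> T -> R) f g : (forall n, mfunT (f_ n)) ->
  (forall x, f_ n x @[n --> \oo] --> f x) -> L1 g ->
  (forall n x, `|f_ n x| <= g x) ->
  L1 f /\ \int[mu]_x f_ n x @[n --> \oo] --> \int[mu]_x f x.
Proof.
move=> mf_ cf Lg fg.
have mf : mfunT f by apply: (measurable_fun_cvg mf_) => x _; exact: cf.
have Lf : L1 f.
  apply: (L1_le mf _ Lg) => x.
  have : `|f_ n x| @[n --> \oo] --> `|f x| by apply: cvg_norm; exact: cf.
  move=> h; have <- := cvg_lim (@Rhausdorff R) h.
  by apply: limr_le; [apply/cvg_ex; exists (`|f x|)|exact: nearW].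
split => //.
have Lf_ n : L1 (f_ n) by exact: L1_le (fg n) Lg.
apply: fine_cvg; rewrite -/(Rintegral mu setT f) -(L1_EFin Lf).
apply: (@dominated_cvg _ _ _ mu setT measurableT _ (EFin \o f) (EFin \o g)) => //.
- by move=> n; exact/measurable_EFinP.
- by move=> x _; apply: cvg_EFin => //; [exact: nearW|exact: cf].
- by move=> n x _; rewrite lee_fin.
Qed.

Lemma ae_RI_eq f g : mfunT f -> mfunT g ->
  {ae mu, forall x, f x = g x} -> \int[mu]_x f x = \int[mu]_x g x.
Proof.
move=> mf mg h; rewrite /Rintegral; congr fine.
apply: ae_eq_integral => //; [exact/measurable_EFinP|exact/measurable_EFinP|].
by apply: filterS h => x /= -> _.
Qed.

Lemma ae_L1_le g f : mfunT f -> {ae mu, forall x, `|f x| <= g x} ->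
  L1 g -> L1 f.
Proof.
move=> mf fg Lg; apply: L1P => //; apply: le_lt_trans (L1_lty Lg).
apply: ae_ge0_le_integral => //.
- by apply/measurable_EFinP; exact: measurableT_comp.
- by apply/measurable_EFinP/measurableT_comp => //; exact: L1_meas.
- by apply: filterS fg => x h _; rewrite lee_fin (le_trans h)// ler_norm.
Qed.

End L1.

Section Fubini.
Context d1 d2 (T1 : measurableType d1) (T2 : measurableType d2) (R : realType).
Variables (m1 : {sigma_finite_measure set T1 -> \bar R})
  (m2 : {sigma_finite_measure set T2 -> \bar R}) (f : T1 * T2 -> R).
Hypothesis mf : mfunT f.

Lemma fubini_mE : mfunT (EFin \o f).
Proof. exact/measurable_EFinP. Qed.

Lemma swap_lty : (\int[m1]_x \int[m2]_y `|f (x, y)|%:E < +oo ->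
  \int[m2]_y \int[m1]_x `|f (x, y)|%:E < +oo)%E.
Proof.
move=> h; rewrite -(@fubini_tonelli _ _ _ _ _ m1 m2 (fun z => `|f z|%:E)) //.
by apply/measurable_EFinP; exact: measurableT_comp.
Qed.

Hypothesis fin : (\int[m1]_x \int[m2]_y `|f (x, y)|%:E < +oo)%E.

Lemma fubini_int : (product_measure1 m1 m2).-integrable setT (EFin \o f).
Proof. exact: (integrable12ltyP m1 m2 fubini_mE).2 fin. Qed.

(** Where the inner integral is infinite, [fine] makes the real one 0; so the real inner integral is
    everywhere dominated by the extended one. *)
Lemma L1_fubini1 : L1 m1 (fun x => \int[m2]_y f (x, y)).
Proof.
have h := integrable_fubini_F fubini_int.
have /integrableP[mF _] := h.
apply: L1P.
  have mfi : mfunT (fun x => fine (fubini_F m2 (EFin \o f) x)).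
    by apply: measurableT_comp mF => //; exact: measurable_fine.
  exact: mfi.
have /integrableP[_] := h; apply: le_lt_trans; apply: ge0_le_integral => //.
- apply/measurable_EFinP/measurableT_comp => //.
  by apply: measurableT_comp mF => //; exact: measurable_fine.
- exact: measurableT_comp.
- move=> x _; rewrite /Rintegral -[fubini_F _ _ _]/(\int[m2]_y (f (x, y))%:E)%E.
  by move: (\int[m2]_y (f (x, y))%:E)%E => [r| |]//=; rewrite normr0 leey.
Qed.

End Fubini.

Section Fubini2.
Context d1 d2 (T1 : measurableType d1) (T2 : measurableType d2) (R : realType).
Variables (m1 : {sigma_finite_measure set T1 -> \bar R})
  (m2 : {sigma_finite_measure set T2 -> \bar R}) (f : T1 * T2 -> R).
Hypothesis mf : mfunT f.
Hypothesis fin : (\int[m1]_x \int[m2]_y `|f (x, y)|%:E < +oo)%E.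

Lemma fubini2_mE : mfunT (EFin \o f).
Proof. exact/measurable_EFinP. Qed.

Lemma fubini2_int : (product_measure1 m1 m2).-integrable setT (EFin \o f).
Proof. exact: (integrable12ltyP m1 m2 fubini2_mE).2 fin. Qed.

Lemma measurable_fun_swap : mfunT (fun z : T2 * T1 => f (z.2, z.1)).
Proof.
have h : mfunT (fun z : T2 * T1 => (z.2, z.1)) by exact: measurable_fun_pair.
exact: (measurableT_comp mf h).
Qed.

Lemma L1_fubini2 : L1 m2 (fun y => \int[m1]_x f (x, y)).
Proof. exact: (L1_fubini1 measurable_fun_swap (swap_lty mf fin)). Qed.

Lemma RI_fubini :
  \int[m1]_x \int[m2]_y f (x, y) = \int[m2]_y \int[m1]_x f (x, y).
Proof.
have E1 : (\int[m1]_x (\int[m2]_y f (x, y))%:E = \int[m1]_x \int[m2]_y (f (x, y))%:E)%E.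
  apply: ae_eq_integral => //.
  - by apply/measurable_EFinP; exact: L1_meas (L1_fubini1 mf fin).
  - by have /integrableP[] := integrable_fubini_F fubini2_int.
  - apply: filterS (ae_integrable1 fubini2_int) => x h _.
    by rewrite -L1_EFin.
have E2 : (\int[m2]_y (\int[m1]_x f (x, y))%:E = \int[m2]_y \int[m1]_x (f (x, y))%:E)%E.
  apply: ae_eq_integral => //.
  - by apply/measurable_EFinP; exact: L1_meas L1_fubini2.
  - have mE : mfunT (fun z : T2 * T1 => (f (z.2, z.1))%:E).
      by apply/measurable_EFinP; exact: measurable_fun_swap.
    have := (integrable12ltyP m2 m1 mE).2 (swap_lty mf fin).
    by move=> /integrable_fubini_F/integrableP[].
  - apply: filterS (ae_integrable2 fubini2_int) => x h _.
    by rewrite -L1_EFin.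
rewrite /Rintegral; congr fine.
rewrite [LHS]E1 [RHS]E2; exact: (Fubini fubini2_int).
Qed.

End Fubini2.

(** * Substitutions and integrability tests on the half line *)

Section HalfLineTools.
Context (R : realType).
Notation lam := (@lebesgue_measure R).
Notation hl := (@hl R).

Lemma ge0_eq_hl (f g : R -> \bar R) : mfunT f -> mfunT g ->
  (forall s, 0 <= f s)%E -> (forall s, 0 <= g s)%E ->
  (forall s, 0 < s -> f s = g s) -> (\int[hl]_s f s = \int[hl]_s g s)%E.
Proof.
move=> mf mg f0 g0 h; apply: ge0_ae_eq_integral => //.
by apply: hl_ae => s s0 _; exact: h.
Qed.

Lemma ge0_le_hl (f g : R -> \bar R) : mfunT f -> mfunT g ->
  (forall s, 0 <= f s)%E -> (forall s, 0 <= g s)%E ->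
  (forall s : R, (0 < s)%R -> (f s <= g s)%E) -> (\int[hl]_s f s <= \int[hl]_s g s)%E.
Proof.
move=> mf mg f0 g0 h; apply: ae_ge0_le_integral => //.
by apply: hl_ae => s s0 _; exact: h.
Qed.

Lemma RI_eq_hl (f g : R -> R) : mfunT f -> mfunT g ->
  (forall s, 0 < s -> f s = g s) -> \int[hl]_s f s = \int[hl]_s g s.
Proof. by move=> mf mg h; apply: ae_RI_eq => //; exact: hl_ae. Qed.

Lemma L1_le_hl (g f : R -> R) : mfunT f ->
  (forall s, 0 < s -> `|f s| <= g s) -> L1 hl g -> L1 hl f.
Proof. by move=> mf h; apply: ae_L1_le => //; exact: hl_ae. Qed.

Lemma ge0_integral_hl_scale (c : R) (f : R -> \bar R) : 0 < c ->
  mfunT f -> (forall x, 0 <= f x)%E ->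
  (\int[hl]_s f (c * s)%R = (c^-1)%R%:E * \int[hl]_s f s)%E.
Proof.
move=> c0 mf f0.
have mfc : mfunT (fun s : R => f (c * s)).
  by apply: measurableT_comp mf _; exact: measurable_funM.
rewrite !ge0_integral_hl_exp//.
pose h := fun r : R => ((expR r)%:E * f (expR r))%E.
have mh : mfunT h.
  by apply: emeasurable_funM; [exact/measurable_EFinP|exact: measurableT_comp mf _].
have h0 r : (0 <= h r)%E by rewrite mule_ge0 ?lee_fin ?expR_ge0.
have := @ge0_integral_affine R 1 (ln c) h (oner_neq0 _) mh h0.
rewrite normr1 invr1 mul1e => <-.
rewrite -ge0_integralZl//=; last 2 first.
- by apply: measurableT_comp mh _; exact: measurable_affine.
- by rewrite lee_fin invr_ge0 ltW.
apply: eq_integral => r _; rewrite /h mul1r expRD lnK// muleA -EFinM.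
by rewrite [c * _]mulrC; congr (_%:E * _)%E; field; rewrite gt_eqF.
Qed.

(** Writing s^-1 = s (s^2)^(-1) reduces the discontinuous inverse to the measurable power function,
    and respects the convention that the inverse of 0 is 0. *)
Lemma measurable_funV : mfunT (fun s : R => s^-1).
Proof.
have -> : (fun s : R => s^-1) = (fun s => s * (s ^+ 2) `^ (-1)).
  apply/funext => s; rewrite powR_inv1 ?sqr_ge0//.
  by have [->|s0] := eqVneq s 0; [rewrite invr0 mul0r|field].
apply: measurable_funM => //; apply: (measurableT_comp (@measurable_powR R (-1))).
exact: measurable_funX.
Qed.

Lemma ge0_integral_hl_inv (f : R -> \bar R) :
  mfunT f -> (forall x, 0 <= f x)%E ->
  (\int[hl]_s ((s ^- 2)%R%:E * f (s^-1)%R) = \int[hl]_s f s)%E.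
Proof.
move=> mf f0.
have mi : mfunT (fun s : R => s^-1) by exact: measurable_funV.
have mfc : mfunT (fun s : R => (s ^- 2)%:E * f (s^-1)%R)%E.
  apply: emeasurable_funM; last exact: measurableT_comp mf mi.
  apply/measurable_EFinP; under eq_fun do rewrite -exprVn.
  exact: measurable_funX.
rewrite !ge0_integral_hl_exp//; last first.
  by move=> x; rewrite mule_ge0// lee_fin invr_ge0 sqr_ge0.
pose h := fun r : R => ((expR r)%:E * f (expR r))%E.
have mh : mfunT h.
  by apply: emeasurable_funM; [exact/measurable_EFinP|exact: measurableT_comp mf _].
have h0 r : (0 <= h r)%E by rewrite mule_ge0 ?lee_fin ?expR_ge0.
have N1 : (-1 : R) != 0 by rewrite oppr_eq0 oner_eq0.
have := @ge0_integral_affine R (-1) 0 h N1 mh h0.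
rewrite normrN1 invr1 mul1e => <-.
apply: eq_integral => r _; rewrite /h addr0 mulN1r muleA -EFinM -!expRN.
by congr (_%:E * _)%E; rewrite expRN; field; rewrite gt_eqF// expR_gt0.
Qed.

Lemma exp_tail (p : R) : 0 < p ->
  (\int[lam]_(r in `[0%R, +oo[) (expR (- (p * r)))%:E = (p^-1)%R%:E)%E.
Proof.
move=> p0; rewrite (@ge0_continuous_FTC2y _ _ (fun r => - expR (- (p * r)) / p) _ 0).
- by rewrite mulr0 oppr0 expR0 -EFinB; congr EFin; field; rewrite gt_eqF.
- by move=> x _; exact: expR_ge0.
- apply: continuous_subspaceT => x; apply: continuous_comp; last exact: continuous_expR.
  by apply: continuousN; apply: mulrl_continuous.
- rewrite -(mul0r p^-1) -oppr0; apply: cvgMl; apply: cvgN.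
  apply: (cvg_comp (fun r => p * r) (fun r => expR (- r))); last exact: cvgr_expR.
  by apply: gt0_cvgMry => //; exact: cvg_id.
- by move=> x _; apply: ex_derive.
- apply: cvg_at_right_filter.
  apply: cvgMl; apply: cvgN; apply: continuous_comp; last exact: continuous_expR.
  by apply: continuousN; apply: mulrl_continuous.
- by move=> x _; rewrite derive1E derive_val; rewrite !scaler0 !add0r /GRing.scale/=; field; rewrite gt_eqF.
Qed.

Lemma measurable_ind (A : set R) (f : R -> R) : measurable (A : set (measurableTypeR R)) ->
  mfunT f -> mfunT (fun s => f s * \1_A s).
Proof. by move=> mA mf; apply: measurable_funM => //. Qed.

Lemma powRDp (x r s : R) : 0 < x -> x `^ (r + s) = x `^ r * x `^ s.
Proof. by move=> x0; rewrite powRD// (gt_eqF x0) implybT. Qed.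

Lemma powR_expR (a p : R) : expR a `^ p = expR (a * p).
Proof. by rewrite /powR gt_eqF ?expR_gt0// expRK mulrC. Qed.

Lemma hl_pow_tail (p : R) : 0 < p ->
  (\int[hl]_s (s `^ (- p - 1) * \1_(`[1%R, +oo[%classic) s)%:E = (p^-1)%R%:E)%E.
Proof.
move=> p0; rewrite ge0_integral_hl_exp; last 2 first.
- by apply/measurable_EFinP; apply: measurable_ind => //; exact: measurable_powR.
- by move=> x; rewrite lee_fin mulr_ge0 ?powR_ge0.
rewrite -exp_tail// [RHS]integral_mkcond; apply: eq_integral => r _.
rewrite patchE -EFinM indicE.
have -> : (expR r \in `[1, +oo[%classic) = (r \in `[0, +oo[%classic).
  by apply/idP/idP; rewrite !inE/= !in_itv/= !andbT -expR0 ler_expR.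
case: ifP => _; last by rewrite !mulr0.
congr EFin; rewrite mulr1 powR_expR -expRD; congr expR; ring.
Qed.

Lemma hl_pow_head (p : R) : 0 < p ->
  (\int[hl]_s (s `^ (p - 1) * \1_(`]-oo, 1%R]%classic) s)%:E = (p^-1)%R%:E)%E.
Proof.
move=> p0; rewrite -hl_pow_tail// -ge0_integral_hl_inv; last 2 first.
- by apply/measurable_EFinP; apply: measurable_ind => //; exact: measurable_powR.
- by move=> x; rewrite lee_fin mulr_ge0 ?powR_ge0.
apply: ge0_eq_hl.
- apply: emeasurable_funM; apply/measurable_EFinP.
    by under eq_fun do rewrite -exprVn; apply: measurable_funX; exact: measurable_funV.
  have h : mfunT (fun s : R => s `^ (p - 1) * \1_(`]-oo, 1%R]%classic) s).
    by apply: measurable_ind => //; exact: measurable_powR.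
  exact: measurableT_comp h measurable_funV.
- by apply/measurable_EFinP; apply: measurable_ind => //; exact: measurable_powR.
- by move=> s; rewrite -EFinM lee_fin !mulr_ge0 ?powR_ge0// invr_ge0 sqr_ge0.
- by move=> s; rewrite lee_fin mulr_ge0 ?powR_ge0.
move=> s s0; rewrite -EFinM; congr EFin; rewrite mulrA !indicE.
have -> : (s^-1 \in `]-oo, 1]%classic) = (s \in `[1, +oo[%classic).
  by apply/idP/idP; rewrite !inE/= !in_itv/= andbT invf_le1.
congr (_ * _); rewrite -powR_invn ?ltW// -powR_inv1 ?ltW// -powRrM -powRDp//.
congr powR; ring.
Qed.

(** The standard test for half-line integrals in this development. The exponents are shifted by 1 so
    that convergence at both ends reads p > 0 and q > 0. *)
Lemma hl_L1_crit (f : R -> R) (p q C : R) : 0 < p -> 0 < q -> mfunT f ->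
  (forall s, 0 < s <= 1 -> `|f s| <= C * s `^ (p - 1)) ->
  (forall s, 1 <= s -> `|f s| <= C * s `^ (- q - 1)) -> L1 hl f.
Proof.
move=> p0 q0 mf h0 h1.
pose g s := C * (s `^ (p - 1) * \1_(`]-oo, 1%R]%classic) s + s `^ (- q - 1) * \1_(`[1%R, +oo[%classic) s).
have C0 : 0 <= C by have := h1 1 (lexx _); rewrite powR1 mulr1; exact: le_trans.
apply: (@L1_le_hl g) => //; last first.
  apply: L1Z; apply: L1D; apply/ge0_L1_EFin.
  - by apply: measurable_ind => //; exact: measurable_powR.
  - by move=> s; rewrite mulr_ge0 ?powR_ge0.
  - by rewrite hl_pow_head// ltry.
  - by apply: measurable_ind => //; exact: measurable_powR.
  - by move=> s; rewrite mulr_ge0 ?powR_ge0.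
  - by rewrite hl_pow_tail// ltry.
move=> s s0; rewrite /g mulrDr !indicE.
have [s1|s1] := leP s 1.
  apply: (le_trans (h0 s _)); first by rewrite s0 s1.
  rewrite mem_set ?mulr1 /= ?in_itv//= lerDl !mulr_ge0 ?powR_ge0//.
apply: (le_trans (h1 s (ltW s1))).
rewrite [in leRHS]mulrA [X in _ <= _ + _ * (_ * X)](_ : _ = 1) ?mulr1; last by rewrite mem_set//= in_itv/= ltW.
by rewrite lerDr !mulr_ge0 ?powR_ge0.
Qed.

Lemma hl_inv_div (c : R) : 0 < c ->
  (\int[hl]_s (s^-1 * \1_(`[c, +oo[%classic) s)%:E = +oo)%E.
Proof.
(* The absolute value makes the integrand nonnegative on the whole line, as the exponential
   substitution requires; it changes nothing for s >= c. *)
move=> c0; pose f s := (`|s|^-1 * \1_(`[c, +oo[%classic) s)%:E.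
have mf : mfunT f.
  apply/measurable_EFinP; apply: measurable_ind => //.
  by apply: measurableT_comp => //; exact: measurable_funV.
have f0 s : (0 <= f s)%E by rewrite lee_fin mulr_ge0.
transitivity (\int[hl]_s f s)%E.
  apply: eq_integral => s _; rewrite /f indicE.
  case: (boolP (s \in _)); rewrite ?mulr0// inE/= in_itv/= andbT => cs.
  by rewrite ger0_norm// (le_trans _ cs)// ltW.
rewrite ge0_integral_hl_exp//.
rewrite (_ : (fun r => _) = ((fun=> 1%E) \_ `[ln c, +oo[)); last first.
  apply/funext => r; rewrite patchE /f -EFinM ger0_norm ?expR_ge0// indicE.
  have -> : (expR r \in `[c, +oo[%classic) = (r \in `[ln c, +oo[%classic).
    have K : (c <= expR r) = (ln c <= r) by rewrite -{1}[c]lnK// ler_expR.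
    by apply/idP/idP; rewrite !inE/= !in_itv/= !andbT K.
  by rewrite mulrA divff ?mul1r ?gt_eqF ?expR_gt0//; case: ifP.
rewrite -integral_mkcond integral_cst// mul1e [LHS]lebesgue_measure_itv/=.
by rewrite ltry.
Qed.

(** From x/p <= exp(x/p), raised to the power p; division by p sets the case p = 0 apart. *)
Lemma powR_expR_le (p x : R) : 0 <= p -> 0 <= x -> x `^ p * expR (- x) <= p `^ p.
Proof.
move=> p0 x0; have [->|pn0] := eqVneq p 0.
  by rewrite !powRr0 mul1r expR_le1 oppr_le0.
have pp : 0 < p by rewrite lt_neqAle eq_sym pn0.
rewrite expRN ler_pdivrMr ?expR_gt0//.
have -> : expR x = (expR (x / p)) `^ p by rewrite powR_expR divfK.
rewrite -powRM ?expR_ge0// ge0_ler_powR ?nnegrE ?mulr_ge0 ?expR_ge0//.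
apply: (@le_trans _ _ (p * (1 + x / p))).
  by rewrite mulrDr mulr1 mulrC divfK// lerDr.
by rewrite ler_pM2l// expR_ge1Dx.
Qed.

Lemma hl_gamma (p : R) : 0 < p -> L1 hl (fun s => s `^ (p - 1) * expR (- s)).
Proof.
move=> p0; apply: (@hl_L1_crit _ p 1 (1 + (p + 1) `^ (p + 1))) => //.
- apply: measurable_funM; first exact: measurable_powR.
  by apply: measurableT_comp => //; exact: measurableT_comp.
- move=> s /andP[s0 s1]; rewrite ger0_norm ?mulr_ge0 ?powR_ge0 ?expR_ge0//.
  rewrite mulrC ler_wpM2r ?powR_ge0// (@le_trans _ _ 1)//.
    by rewrite -expR0 ler_expR oppr_le0 ltW.
  by rewrite lerDl powR_ge0.
- move=> s s1; have s0 : 0 < s by lra.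
  rewrite ger0_norm ?mulr_ge0 ?powR_ge0 ?expR_ge0//.
  have -> : s `^ (p - 1) * expR (- s) = (s `^ (p + 1) * expR (- s)) * s `^ (- 1 - 1).
    have -> : p - 1 = (p + 1) + (- 1 - 1) by ring.
    by rewrite powRDp//; ring.
  rewrite ler_wpM2r ?powR_ge0//.
  have := @powR_expR_le (p + 1) s; move=> /(_ _ _)/le_trans; apply; rewrite ?lerDr//; lra.
Qed.

End HalfLineTools.

(** * The squared Euclidean norm; continuous functions are measurable *)

Section EuclideanRow.
Context (R : realType) (n : nat).
Implicit Types x y z : 'rV[R]_n.

(** Used in place of [enorm] because it is polynomial. A power of |x| becomes a power of [sq x] with
    half the exponent ([enorm_powR]): n/2 + alpha/2 stands for n + alpha, and radii appear
    squared. *)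
Definition sq x : R := \sum_i x ord0 i ^+ 2.

Lemma sq_ge0 x : 0 <= sq x.
Proof. by apply: sumr_ge0 => i _; exact: sqr_ge0. Qed.

Lemma coord_le_sq x i : x ord0 i ^+ 2 <= sq x.
Proof. by rewrite /sq (bigD1 i)//= lerDl sumr_ge0// => j _; exact: sqr_ge0. Qed.

Lemma sq0 : sq 0 = 0.
Proof. by rewrite /sq big1// => i _; rewrite mxE expr0n. Qed.

Lemma sq_eq0 x : (sq x == 0) = (x == 0).
Proof.
apply/eqP/eqP => [h|->]; last exact: sq0.
apply/rowP => i; rewrite mxE; apply/eqP; rewrite -sqrf_eq0 eq_le sqr_ge0 andbT -h.
exact: coord_le_sq.
Qed.

Lemma sqN x : sq (- x) = sq x.
Proof. by apply: eq_bigr => i _; rewrite mxE sqrrN. Qed.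

Lemma sqZ c x : sq (c *: x) = c ^+ 2 * sq x.
Proof. by rewrite /sq mulr_sumr; apply: eq_bigr => i _; rewrite mxE exprMn. Qed.

Lemma sqBC x y : sq (x - y) = sq (y - x).
Proof. by rewrite -sqN opprB. Qed.

(* Peter-Paul; it replaces the Euclidean triangle inequality throughout. *)
Lemma sqD_le e x y : 0 < e -> sq (x + y) <= (1 + e) * sq x + (1 + e^-1) * sq y.
Proof.
move=> e0; rewrite /sq !mulr_sumr -big_split/=; apply: ler_sum => i _; rewrite mxE.
set a := x _ _; set b := y _ _.
rewrite -subr_ge0 (_ : _ - _ = e^-1 * (e * a - b) ^+ 2).
  by rewrite mulr_ge0 ?invr_ge0 ?sqr_ge0// ltW.
by field; rewrite gt_eqF.
Qed.

Lemma sqD_le2 x y : sq (x + y) <= 2 * sq x + 2 * sq y.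
Proof. by have := @sqD_le 1 x y ltr01; rewrite invr1. Qed.

Lemma measurable_sq : mfunT sq.
Proof. by apply: measurable_sum => i; apply: measurable_funX; exact: measurable_coord. Qed.

Lemma enormE x : enorm x = Num.sqrt (sq x).
Proof. by []. Qed.

Lemma enorm_powR x p : enorm x `^ p = sq x `^ (p / 2).
Proof. by rewrite enormE -powR12_sqrt ?sq_ge0// -powRrM; congr powR; ring. Qed.

Lemma nbhs_rowP x (P : set 'rV[R]_n) : nbhs x P <->
  exists2 e : R, 0 < e & forall y, (forall i, `|x ord0 i - y ord0 i| < e) -> P y.
Proof.
split.
  move=> /nbhs_ballP[e /= e0 h]; exists e => // y xy; apply: h; split => // i j.
  by rewrite (ord1 i); exact: xy.
move=> [e e0 h]; apply/nbhs_ballP; exists e => //= y [_ xy]; apply: h => i.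
exact: xy.
Qed.

Lemma cvg_row (T : Type) (F : set_system T) (FF : Filter F) (f : T -> 'rV[R]_n) x :
  (forall i, f t ord0 i @[t --> F] --> x ord0 i) -> f t @[t --> F] --> x.
Proof.
move=> h; apply/cvg_ballP => e e0.
have : \forall t \near F, forall i : 'I_n, `|x ord0 i - f t ord0 i| < e.
  apply: filter_forall => i; have /cvgrPdist_lt := h i; exact.
by apply: filterS => t ht; split => // i j; rewrite (ord1 i); exact: ht.
Qed.

Lemma continuous_sq : continuous sq.
Proof.
rewrite /sq; elim: (index_enum _) => [|i s IH].
  by under eq_fun do rewrite big_nil; exact: cst_continuous.
under eq_fun do rewrite big_cons.
move=> x; apply: (@continuousD _ _ _ (fun y : 'rV[R]_n => y ord0 i ^+ 2)); last exact: IH.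
apply: (@continuous_comp _ _ _ (fun y : 'rV[R]_n => y ord0 i) (fun r : R => r ^+ 2)).
  exact: coord_continuous.
exact: exprn_continuous.
Qed.

(** Rounding down to the grid of mesh 1/(m+1). It takes countably many values, each on a measurable
    cell, so every function composed with it is measurable; a continuous function is the limit of
    such compositions. *)
Definition disc (m : nat) x : 'rV[R]_n :=
  \row_i ((Num.floor (x ord0 i * m.+1%:R))%:~R / m.+1%:R).

Lemma cvg_disc x : disc m x @[m --> \oo] --> x.
Proof.
apply: cvg_row => i; under eq_fun do rewrite mxE.
apply/cvgrPdist_le => e e0; near=> m.
have m0 : 0 < m.+1%:R :> R by [].
set y := x _ _; have /andP[h1 h2] := floor_itv (y * m.+1%:R).
rewrite intrD in h2.
have -> : y - (Num.floor (y * m.+1%:R))%:~R / m.+1%:R =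
   (y * m.+1%:R - (Num.floor (y * m.+1%:R))%:~R) / m.+1%:R.
  by field; rewrite gt_eqF.
rewrite ger0_norm; last by rewrite divr_ge0// subr_ge0.
apply: (@le_trans _ _ (m.+1%:R^-1)).
  by rewrite ler_pdivrMr// mulVf ?gt_eqF// lerBlDl ltW.
near: m; have := @near_infty_natSinv_lt R (PosNum e0).
by apply: filterS => m; exact: ltW.
Unshelve. all: by end_near. Qed.

Lemma measurable_disc m (Y : set 'rV[R]_n) : measurable (disc m @^-1` Y).
Proof.
pose emb (z : 'rV[int]_n) : 'rV[R]_n := \row_i ((z ord0 i)%:~R / m.+1%:R).
pose cell (z : 'rV[int]_n) := [set x : 'rV[R]_n | forall i, Num.floor (x ord0 i * m.+1%:R) = z ord0 i].
have m0 : 0 < m.+1%:R :> R by [].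
have mcell (z : 'rV[int]_n) : measurable (cell z).
  have -> : cell z = \bigcap_(i in [set: 'I_n])
      ((fun x : 'rV[R]_n => x ord0 i) @^-1`
        `[(z ord0 i)%:~R / m.+1%:R, (z ord0 i + 1)%:~R / m.+1%:R[%classic).
    apply/seteqP; split => x.
      move=> xz i _ /=; rewrite in_itv/= ler_pdivrMr// ltr_pdivlMr// -xz.
      exact: floor_itv.
    move=> xz i; apply: floor_def; have := xz i I.
    by rewrite /= in_itv/= ler_pdivrMr// ltr_pdivlMr.
  apply: fin_bigcap_measurable => // i _.
  by rewrite -[X in measurable X]setTI; apply: measurable_coord.
have -> : disc m @^-1` Y = \bigcup_k
   (if @unpickle 'rV[int]_n k is Some z then (if `[< Y (emb z) >] then cell z else set0) else set0).
  apply/seteqP; split => x.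
    move=> Yx; pose z : 'rV[int]_n := \row_i Num.floor (x ord0 i * m.+1%:R).
    exists (pickle z) => //; rewrite pickleK.
    have -> : emb z = disc m x by apply/rowP => i; rewrite !mxE.
    by rewrite asboolT// => i; rewrite mxE.
  move=> [k _]; case: unpickle => // z; case: asboolP => // Yz xz.
  rewrite /=; suff -> : disc m x = emb z by [].
  by apply/rowP => i; rewrite !mxE xz.
apply: bigcupT_measurable => k; case: unpickle => // z.
by case: asboolP.
Qed.

Lemma continuous_measurable_row (f : 'rV[R]_n -> R) : continuous f -> mfunT f.
Proof.
move=> cf; apply: (@measurable_fun_cvg _ _ _ setT (fun m => f \o disc m)).
  by move=> m _ A mA; rewrite setTI comp_preimage; exact: measurable_disc.
by move=> x _; apply: continuous_cvg; [exact: cf|exact: cvg_disc].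
Qed.

End EuclideanRow.

Section RowMeas.
Context (R : realType) (n : nat).
Lemma measurable_addr_row (d : measure_display) (T : measurableType d) (f g : T -> 'rV[R]_n) :
  mfunT f -> mfunT g -> mfunT (fun t => f t + g t).
Proof.
move=> mf mg; apply: measurable_row => i; under eq_fun do rewrite mxE.
by apply: measurable_funD; [exact: measurableT_comp (measurable_coord i) mf|exact: measurableT_comp (measurable_coord i) mg].
Qed.
Lemma measurable_oppr_row (d : measure_display) (T : measurableType d) (f : T -> 'rV[R]_n) :
  mfunT f -> mfunT (fun t => - f t).
Proof.
move=> mf; apply: measurable_row => i; under eq_fun do rewrite mxE.
by apply: measurableT_comp => //; exact: measurableT_comp (measurable_coord i) mf.
Qed.
End RowMeas.

(** [munfold] and [mleaf] are hooks of the tactic [mfun], which proves measurability by following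
    the shape of the function and then searching the context. They are redefined by [::=] as further
    functions become available. *)
Ltac munfold := fail.

Ltac mleaf := fail.

Ltac mfun := lazymatch goal with
  | |- measurable_fun _ fst => exact: measurable_fst
  | |- measurable_fun _ snd => exact: measurable_snd
  | |- measurable_fun _ (fun x => (@?f x)%:E) => apply/(@measurable_EFinP _ _ _ _ f); mfun
  | |- measurable_fun _ (EFin \o ?f) => apply/(@measurable_EFinP _ _ _ _ f); mfun
  | |- measurable_fun _ (fun x => x) => exact: measurable_id
  | |- measurable_fun _ (fun x => x.1) => exact: measurable_fst
  | |- measurable_fun _ (fun x => x.2) => exact: measurable_snd
  | |- measurable_fun _ (fun x => (@?f x).1) => apply: (measurableT_comp measurable_fst (g := f)); mfun
  | |- measurable_fun _ (fun x => (@?f x).2) => apply: (measurableT_comp measurable_snd (g := f)); mfun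
  | |- measurable_fun _ (fun x => @?f x + @?g x)%R =>
    first [apply: (measurable_funD (f := f) (g := g))|apply: (measurable_addr_row (f := f) (g := g))]; mfun
  | |- measurable_fun _ (fun x => @?f x * @?g x)%R => apply: (measurable_funM (f := f) (g := g)); mfun
  | |- measurable_fun _ (fun x => @?f x * @?g x)%E => apply: (emeasurable_funM (f := f) (g := g)); mfun
  | |- measurable_fun _ (fun x => @?f x + @?g x)%E => apply: (emeasurable_funD (f := f) (g := g)); mfun
  | |- measurable_fun _ (fun x => (@?f x, @?g x)) => apply: measurable_fun_pair; mfun
  | |- measurable_fun _ (fun x => fun_of_matrix (@?f x) ord0 ?i) =>
    apply: (measurableT_comp (@measurable_coord _ _ i) (g := f)); mfun
  | |- measurable_fun _ (fun x => @?f x ^+ _)%R => apply: (measurable_funX (f := f)); mfun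
  | |- measurable_fun _ (fun x => - @?f x)%R =>
    first [apply: (measurableT_comp (@oppr_measurable _ _) (g := f))|apply: (measurable_oppr_row (f := f))]; mfun
  | |- measurable_fun _ (fun x => `|@?f x|)%R =>
    apply: (measurableT_comp (@normr_measurable _ _) (g := f)); mfun
  | |- measurable_fun _ (fun x => expR (@?f x)) =>
    apply: (measurableT_comp (@measurable_expR _) (g := f)); mfun
  | |- measurable_fun _ (fun x => (@?f x)^-1)%R =>
    apply: (measurableT_comp (@measurable_funV _) (g := f)); mfun
  | |- measurable_fun _ (fun x => @?f x `^ _) =>
    apply: (measurableT_comp (measurable_powR _) (g := f)); mfun
  | |- measurable_fun _ (fun x => sq (@?f x)) =>
    apply: (measurableT_comp (@measurable_sq _ _) (g := f)); mfun
  | |- measurable_fun _ (indic _) => exact: measurable_indic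
  | |- measurable_fun _ (fun x => \1__ (@?f x)) =>
    apply: (measurableT_comp _ (g := f)); [exact: measurable_indic|mfun]
  | |- _ => mhyp
  end
with mhyp := match goal with
  | H : measurable_fun _ ?f |- measurable_fun _ ?f => exact: H
  | H : forall x, measurable_fun _ (?h x) |- measurable_fun _ (?h _) => exact: H
  | H : measurable_fun _ ?h |- measurable_fun _ (fun x => ?h (@?f x)) =>
    apply: (measurableT_comp H (g := f)); mfun
  | H : forall x, measurable_fun _ (?h x) |- measurable_fun _ (fun x => ?h ?a (@?f x)) =>
    apply: (measurableT_comp (H a) (g := f)); mfun
  | H : continuous ?h |- measurable_fun _ ?h => exact: (continuous_measurable_row H)
  | H : continuous ?h |- measurable_fun _ (fun x => ?h (@?f x)) =>
    apply: (measurableT_comp (continuous_measurable_row H) (g := f)); mfun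
  | L : L1 _ ?f |- measurable_fun _ ?f => exact: (L1_meas L)
  | L : L1 _ ?h |- measurable_fun _ (fun x => ?h (@?f x)) =>
    apply: (measurableT_comp (L1_meas L) (g := f)); mfun
  | |- measurable_fun _ ?f => is_var f; progress unfold f; mfun
  | |- measurable_fun _ (fun x => ?c) => exact: (measurable_cst c)
  | |- _ => mleaf
  end.

Ltac mleaf ::= progress munfold; mfun.

(** * Gaussians and Gamma integrals *)

Section Gauss.
Context (R : realType) (n : nat).
Notation mu := (leb R n).
Notation hl := (@hl R).
Notation nu := (n%:R / 2 : R).
Implicit Types (x y z : 'rV[R]_n) (t s p : R).

Lemma measurable_sq_exp n' (c : R) :
  mfunT (fun x : 'rV[R]_n' => expR (c * sq x)).
Proof. by mfun. Qed.

Definition gmass : R := Num.sqrt pi ^+ n.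

Lemma gmass_gt0 : 0 < gmass.
Proof. by rewrite exprn_gt0// sqrtr_gt0 pi_gt0. Qed.

Lemma sq_rcons0 n' (r : R) (x : 'rV[R]_n') : sq (rcons0 r x) = r ^+ 2 + sq x.
Proof.
rewrite /sq big_ord_recl rcons0_0; congr (_ + _); apply: eq_bigr => i _.
by rewrite rcons0_S.
Qed.

Lemma integral_exp_sq : (\int[mu]_x (expR (- sq x))%:E = gmass%:E)%E.
Proof.
rewrite /gmass; elim: n => [|n' IH].
  transitivity (\int[leb R 0]_x (cst 1%E x))%E.
    apply: eq_integral => x _; rewrite /sq big_ord0 oppr0 expR0//.
  have -> : (\int[leb R 0]_x cst 1%E x = leb R 0 setT)%E by rewrite integral_cst// mul1e.
  by rewrite expr0 /leb /= /pushforward /= diracT.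
rewrite ge0_integral_lebS.
- transitivity (\int[leb R n']_x ((Num.sqrt pi)%:E * (expR (- sq x))%:E))%E.
    apply: eq_integral => x _.
    rewrite -integralT_gauss -ge0_integralZr//.
    - by apply: eq_integral => r _; rewrite /gauss_fun -EFinM -expRD sq_rcons0 opprD.
    - by apply/measurable_EFinP; exact: measurable_gauss_fun.
    - by move=> r _; rewrite lee_fin gauss_fun_ge0.
  rewrite ge0_integralZl ?IH -?EFinM ?exprS ?lee_fin ?sqrtr_ge0//.
    by mfun.
- by mfun.
- by move=> x; rewrite lee_fin expR_ge0.
Qed.

Lemma ge0_integral_shift (a : 'rV[R]_n) (f : 'rV[R]_n -> \bar R) :
  mfunT f -> (forall x, 0 <= f x)%E ->
  (\int[mu]_x f (x + a)%R = \int[mu]_x f x)%E.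
Proof.
move=> mf f0; have := @ge0_integral_leb_affine R n 1 a f (oner_neq0 _) mf f0.
rewrite normr1 expr1n invr1 mul1e => <-.
by apply: eq_integral => x _; rewrite scale1r.
Qed.

Lemma ge0_integral_reflect (a : 'rV[R]_n) (f : 'rV[R]_n -> \bar R) :
  mfunT f -> (forall x, 0 <= f x)%E ->
  (\int[mu]_x f (a - x)%R = \int[mu]_x f x)%E.
Proof.
move=> mf f0; have N1 : (-1 : R) != 0 by rewrite oppr_eq0 oner_eq0.
have := @ge0_integral_leb_affine R n (-1) a f N1 mf f0.
rewrite normrN1 expr1n invr1 mul1e => <-.
by apply: eq_integral => x _; rewrite scaleN1r addrC.
Qed.

Lemma integral_exp_sq_scale t (a : 'rV[R]_n) : 0 < t ->
  (\int[mu]_x (expR (- (sq (x - a) / t)))%:E = (gmass * t `^ nu)%:E)%E.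
Proof.
move=> t0.
have st : 0 < Num.sqrt t by rewrite sqrtr_gt0.
have mg : mfunT (fun x : 'rV[R]_n => (expR (- sq x))%:E) by mfun.
have := @ge0_integral_leb_affine R n ((Num.sqrt t)^-1) (- (Num.sqrt t)^-1 *: a)
   (fun x => (expR (- sq x))%:E) _ mg (fun x => _).
rewrite invr_eq0 gt_eqF// => /(_ isT (fun x => expR_ge0 _)).
rewrite integral_exp_sq => h.
rewrite -[LHS](_ : (\int[mu]_x (expR (- sq ((Num.sqrt t)^-1 *: x - (Num.sqrt t)^-1 *: a)))%:E = _)%E).
  under eq_integral do rewrite -scaleNr; rewrite h -EFinM; congr EFin.
  rewrite mulrC; congr (_ * _); rewrite ger0_norm ?invr_ge0 ?ltW//.
  rewrite exprVn invrK -powR12_sqrt ?ltW// -powR_mulrn ?powR_ge0// -powRrM.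
  by congr powR; ring.
apply: eq_integral => x _; rewrite -scalerBr sqZ exprVn sqr_sqrtr ?ltW//.
by rewrite mulrC.
Qed.

(** The heat kernel at time t/4 without its factor pi^(-n/2): every [G t] has mass [gmass] =
    pi^(n/2), and the Laplacian of G is 4 times its derivative in t. *)
Definition G t x : R := t `^ (- nu) * expR (- (sq x / t)).

Lemma G_ge0 t x : 0 <= G t x.
Proof. by rewrite mulr_ge0 ?powR_ge0 ?expR_ge0. Qed.

Lemma GN t x : G t (- x) = G t x.
Proof. by rewrite /G sqN. Qed.

Lemma measurable_G t : mfunT (G t).
Proof.
apply: measurable_funM => //; under eq_fun do rewrite mulrC -mulNr; exact: measurable_sq_exp.
Qed.

Lemma measurable_Gt x : mfunT (G ^~ x).
Proof.
apply: measurable_funM; first exact: measurable_powR.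
Proof. by mfun. Qed.

Lemma integral_G t : 0 < t -> (\int[mu]_x (G t x)%:E = gmass%:E)%E.
Proof.
move=> t0; rewrite /G; under eq_integral do rewrite EFinM.
rewrite ge0_integralZl ?lee_fin ?powR_ge0//; last first.
  by mfun.
have <- : (\int[mu]_x (expR (- (sq (x - 0) / t)))%:E = \int[mu]_x (expR (- (sq x / t)))%:E)%E.
  by apply: eq_integral => x _; rewrite subr0.
rewrite integral_exp_sq_scale// -EFinM mulrCA powRN mulVf ?mulr1// gt_eqF// powR_gt0//.
Qed.

Lemma G_semigroup s t x : 0 < s -> 0 < t ->
  (\int[mu]_z (G s z * G t (x - z))%:E = (gmass * G (s + t) x)%:E)%E.
Proof.
move=> s0 t0; have st0 : 0 < s + t by rewrite addr_gt0.
(* Completion of the square in |z|^2/s + |x - z|^2/t: centre [b], width [r], remainder |x|^2/(s +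
   t). *)
pose r := s * t / (s + t); have r0 : 0 < r by rewrite divr_gt0 ?mulr_gt0.
pose b : 'rV[R]_n := (s / (s + t)) *: x.
pose c := s `^ (- nu) * t `^ (- nu) * expR (- (sq x / (s + t))).
have c0 : 0 <= c by rewrite !mulr_ge0 ?powR_ge0 ?expR_ge0.
transitivity (\int[mu]_z (c%:E * (expR (- (sq (z - b) / r)))%:E))%E.
  apply: eq_integral => z _; rewrite -EFinM; congr EFin.
  rewrite /G /c mulrACA -!mulrA; congr (_ * (_ * _)); rewrite -!expRD; congr expR.
  rewrite -!opprD; congr (- _).
  rewrite /sq !mulr_suml -!big_split/=; apply: eq_bigr => i _; rewrite !mxE /r.
  by field; rewrite !gt_eqF.
rewrite ge0_integralZl ?lee_fin//; last first.
  by mfun.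
rewrite integral_exp_sq_scale// -EFinM; congr EFin.
have key : r `^ nu * s `^ (- nu) * t `^ (- nu) = (s + t) `^ (- nu).
  rewrite /r powRM ?mulr_ge0 ?invr_ge0 ?ltW// powRM ?ltW// -[(s + t)^-1]powR_inv1 ?ltW// -powRrM mulN1r.
  by rewrite !powRN; field; rewrite !gt_eqF ?powR_gt0.
by rewrite /c /G -key; ring.
Qed.

Definition Gam p : R := \int[hl]_s (s `^ (p - 1) * expR (- s)).

Lemma Gam_E p : 0 < p -> (\int[hl]_s (s `^ (p - 1) * expR (- s))%:E = (Gam p)%:E)%E.
Proof. by move=> p0; rewrite (L1_EFin (hl_gamma p0)). Qed.

Lemma Gam_gt0 p : 0 < p -> 0 < Gam p.
Proof.
move=> p0; rewrite -lte_fin -Gam_E// lt_neqAle integral_ge0 ?andbT; last first.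
  by move=> s _; rewrite lee_fin mulr_ge0 ?powR_ge0 ?expR_ge0.
apply/eqP => h.
pose g (s : R) := expR (-1) * (s `^ (p - 1) * \1_(`]-oo, 1%R]%classic) s).
have mg0 : mfunT (fun s : R => s `^ (p - 1) * \1_(`]-oo, 1%R]%classic) s) by mfun.
have : (\int[hl]_s (g s)%:E <= \int[hl]_s (s `^ (p - 1) * expR (- s))%:E)%E.
  apply: ge0_le_hl.
  - by apply/measurable_EFinP; exact: measurable_funM.
  - by mfun.
  - by move=> s; rewrite lee_fin !mulr_ge0 ?powR_ge0 ?expR_ge0.
  - by move=> s; rewrite lee_fin mulr_ge0 ?powR_ge0 ?expR_ge0.
  move=> s s0; rewrite lee_fin /g indicE; case: (boolP (s \in _)); last first.
    by rewrite !mulr0 mulr_ge0 ?powR_ge0 ?expR_ge0.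
  rewrite inE/= in_itv/= => s1; rewrite mulr1 mulrC ler_wpM2l ?powR_ge0//.
  by rewrite ler_expR lerN2.
rewrite -h /g; under eq_integral do rewrite EFinM.
rewrite ge0_integralZl ?lee_fin ?expR_ge0//; last 2 first.
- by mfun.
- by move=> s _; rewrite lee_fin mulr_ge0 ?powR_ge0.
rewrite hl_pow_head// -EFinM lee_fin leNgt mulr_gt0 ?expR_gt0 ?invr_gt0//.
Qed.

Lemma hl_exp_pow p r : 0 < p -> 0 < r ->
  (\int[hl]_s (s `^ (p - 1) * expR (- (r * s)))%:E = (Gam p * r `^ (- p))%:E)%E.
Proof.
move=> p0 r0.
have mg : mfunT (fun s : R => (s `^ (p - 1) * expR (- s))%:E) by mfun.
have := @ge0_integral_hl_scale R r _ r0 mg.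
move=> /(_ (fun s => _)); rewrite Gam_E//.
move=> /(_ (fun s => mulr_ge0 (powR_ge0 _ _) (expR_ge0 _))) h.
transitivity (\int[hl]_s ((r `^ (1 - p))%:E * ((r * s) `^ (p - 1) * expR (- (r * s)))%:E))%E.
  apply: ge0_eq_hl.
  - by mfun.
  - by mfun.
  - by move=> s; rewrite lee_fin mulr_ge0 ?powR_ge0 ?expR_ge0.
  - by move=> s; rewrite -EFinM lee_fin !mulr_ge0 ?powR_ge0 ?expR_ge0.
  move=> s s0; rewrite -EFinM powRM ?ltW// !mulrA -powRDp//.
  by rewrite (_ : 1 - p + (p - 1) = 0) ?powRr0 ?mul1r//; ring.
rewrite ge0_integralZl ?lee_fin ?powR_ge0//; last 2 first.
- by mfun.
- by move=> s _; rewrite lee_fin mulr_ge0 ?powR_ge0 ?expR_ge0.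
rewrite h -!EFinM; congr EFin; rewrite mulrA -[r^-1]powR_inv1 ?ltW// -powRDp// mulrC.
by congr (_ * powR _ _); ring.
Qed.

Lemma hl_inv_exp_pow p r : 0 < p -> 0 < r ->
  (\int[hl]_s (s `^ (- p - 1) * expR (- (r / s)))%:E = (Gam p * r `^ (- p))%:E)%E.
Proof.
move=> p0 r0.
have mg : mfunT (fun s : R => (s `^ (p - 1) * expR (- (r * s)))%:E) by mfun.
have g0 s : (0 <= (s `^ (p - 1) * expR (- (r * s)))%:E)%E by rewrite lee_fin mulr_ge0 ?powR_ge0 ?expR_ge0.
rewrite -(hl_exp_pow p0 r0) -[RHS](ge0_integral_hl_inv mg g0).
have mi : mfunT (fun s : R => expR (- (r / s))) by mfun.
have mV := @measurable_funV R.
apply: ge0_eq_hl.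
- by mfun.
- by mfun.
- by move=> s; rewrite lee_fin mulr_ge0 ?powR_ge0 ?expR_ge0.
- by move=> s; rewrite -EFinM lee_fin !mulr_ge0 ?powR_ge0 ?expR_ge0// invr_ge0 sqr_ge0.
move=> s s0; rewrite -EFinM mulrA; congr (_ * _)%:E.
rewrite -powR_invn ?ltW// -powR_inv1 ?ltW// -powRrM -powRDp//; congr powR; ring.
Qed.

(** Subordination: the kernel |x|^(-n-2 th) as a superposition of Gaussians, obtained from the Gamma
    integral by s -> 1/s. It turns the fractional Laplacian into an integral over the heat
    semigroup. *)
Lemma hl_G th x : 0 <= th -> 0 < sq x -> 0 < nu + th ->
  (\int[hl]_s (s `^ (- 1 - th) * G s x)%:E = (Gam (nu + th) * sq x `^ (- (nu + th)))%:E)%E.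
Proof.
move=> th0 x0 p0; rewrite -hl_inv_exp_pow//; apply: ge0_eq_hl.
- apply/measurable_EFinP; apply: measurable_funM; first exact: measurable_powR.
  exact: measurable_Gt.
- by mfun.
- by move=> s; rewrite lee_fin mulr_ge0 ?powR_ge0 ?G_ge0.
- by move=> s; rewrite lee_fin mulr_ge0 ?powR_ge0 ?expR_ge0.
move=> s s0; rewrite /G mulrA -powRDp//; congr (_ `^ _ * _)%:E; ring.
Qed.

End Gauss.

Ltac munfold ::= cbv beta delta [G].

Section HalfLineFTC.
Context (R : realType).
Notation lam := (@lebesgue_measure R).
Notation hl := (@hl R).

Lemma integral_mrestr d (T : measurableType d) (mu : {measure set T -> \bar R})
    (D : set T) (mD : measurable D) (f : T -> \bar R) : mfunT f ->
  (\int[mrestr mu mD]_x f x = \int[mu]_(x in D) f x)%E.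
Proof.
move=> mf; rewrite [LHS]integralE [RHS]integralE.
rewrite (@ge0_integral_mrestr _ _ _ _ _ mD)//; last exact: measurable_funepos.
rewrite (@ge0_integral_mrestr _ _ _ _ _ mD)//; exact: measurable_funeneg.
Qed.

(** The bounded interval is expressed by a cutoff at [rho] inside an integral over [hl], the form in
    which the fundamental theorem can be combined with Fubini. *)
Lemma hl_FTC (f g : R -> R) (t rho : R) : 0 < t -> 0 <= rho ->
  mfunT g ->
  (forall s : R, 0 < s -> is_derive s 1 f (g s)) ->
  (forall s : R, 0 < s -> {for s, continuous g}) ->
  \int[hl]_r (g (t + r) * \1_(`]-oo, rho]%classic) r) = f (t + rho) - f t.
Proof.
move=> t0 rho0 mg df cg.
have mgt : mfunT (fun r : R => g (t + r)) by mfun.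
rewrite /Rintegral /hl integral_mrestr; last first.
  by mfun.
move: rho0; rewrite le_eqVlt => /orP[/eqP<-|rho0].
  rewrite integral0_eq ?addr0 ?subrr// => r /=; rewrite in_itv/= andbT => r0.
  by rewrite indicE memNset ?mulr0//= in_itv/=; apply/negP; rewrite -ltNge.
rewrite (_ : (\int[lam]_(r in _) _)%E = (\int[lam]_(r in `]0%R, rho]) (g (t + r))%:E)%E); last first.
  rewrite [LHS]integral_mkcond [RHS]integral_mkcond; apply: eq_integral => r _.
  rewrite !patchE indicE; case: ifPn; rewrite ?inE ?notin_setE/= !in_itv/= ?andbT => r0.
    case: (boolP (r \in _)); rewrite ?inE ?notin_setE/= !in_itv/= ?r0 => h.
      by rewrite mem_set ?mulr1//= in_itv/= r0.
    by rewrite memNset ?mulr0//= in_itv/= r0.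
  by rewrite memNset//= in_itv/= => /andP[].
rewrite integral_itv_obnd_cbnd; last exact/measurable_EFinP/measurable_funTS.
have dft (r : R) : 0 <= r -> is_derive r 1 (fun r => f (t + r)) (g (t + r)).
  move=> r0; have tr : 0 < t + r by rewrite ltr_wpDr.
  have := df _ tr => dftr.
  have h1 : is_derive r 1 (fun r : R => t + r) 1.
    by rewrite -[X in is_derive _ _ _ X]add0r; exact: (is_deriveD (is_derive_cst t r 1) (is_derive_id r 1)).
  by have := @is_derive1_comp R f (fun r => t + r) r _ _ dftr h1; rewrite mulr1.
rewrite (@continuous_FTC2 _ _ (fun r => f (t + r)))//.
- by rewrite -EFinB /= addr0.
- apply: continuous_in_subspaceT => r; rewrite inE/= in_itv/= => /andP[r0 _].
  apply: (@continuous_comp _ _ _ (fun x : R => t + x) g).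
    by apply: cvgD; [exact: cvg_cst|exact: cvg_id].
  by apply: cg; rewrite ltr_wpDr.
- have cf (r : R) : 0 <= r -> {for r, continuous (fun r => f (t + r))}.
    by move=> /dft h; apply/differentiable_continuous/derivable1_diffP; apply: ex_derive.
  split.
  + by move=> r; rewrite in_itv/= => /andP[/ltW/dft h _]; apply: ex_derive.
  + exact/cvg_at_right_filter/cf.
  + exact/cvg_at_left_filter/cf/ltW.
- move=> r; rewrite in_itv/= => /andP[/ltW/dft h _].
  by rewrite derive1E; apply: derive_val.
Qed.

End HalfLineFTC.

(** * The polynomial weight and integrable majorants *)

Section Weight.
Context (R : realType) (n : nat).
Notation mu := (leb R n).
Notation hl := (@hl R).
Notation nu := (n%:R / 2 : R).
Implicit Types (x y z : 'rV[R]_n) (t s p q r : R).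

Definition om q x : R := (1 + sq x) `^ (- q).

Lemma sq1_gt0 x : 0 < 1 + sq x.
Proof. by rewrite ltr_wpDr ?sq_ge0. Qed.

Lemma om_gt0 q x : 0 < om q x.
Proof. by rewrite powR_gt0// sq1_gt0. Qed.

Lemma omN q x : om q (- x) = om q x.
Proof. by rewrite /om sqN. Qed.

Lemma omE q x : om q x = ((1 + sq x) `^ q)^-1.
Proof. by rewrite /om powRN. Qed.

Lemma ler_powR_base r s q : 0 <= q -> 0 <= r -> r <= s -> r `^ q <= s `^ q.
Proof.
by move=> q0 r0 rs; apply: ge0_ler_powR; rewrite ?nnegrE//; exact: le_trans rs.
Qed.

(** Peetre's inequality: a translation changes the weight by a factor that depends on the
    translation alone. *)
Lemma om_peetre q x z : 0 <= q -> om q (x + z) <= 2 `^ q * (1 + sq z) `^ q * om q x.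
Proof.
move=> q0; rewrite !omE ler_pdivlMr ?powR_gt0 ?sq1_gt0//.
rewrite mulrC ler_pdivrMr ?powR_gt0 ?sq1_gt0//.
rewrite -!powRM ?mulr_ge0 ?(ltW (sq1_gt0 _))//.
apply: ler_powR_base => //; first exact/ltW/sq1_gt0.
have := sqD_le2 (x + z) (- z); rewrite addrK sqN => h.
have := sq_ge0 z; have := sq_ge0 (x + z) => h1 h2.
have := mulr_ge0 h1 h2; lra.
Qed.

Lemma powR_1D_le r q : 0 <= q -> 0 <= r -> (1 + r) `^ q <= 2 `^ q * (1 + r `^ q).
Proof.
move=> q0 r0; have [r1|r1] := leP r 1.
  apply: (@le_trans _ _ (2 `^ q)); first by apply: ler_powR_base => //; lra.
  by rewrite ler_peMr ?powR_ge0// lerDl powR_ge0.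
apply: (@le_trans _ _ ((2 * r) `^ q)); first by apply: ler_powR_base => //; lra.
by rewrite powRM// ler_wpM2l ?powR_ge0// lerDr.
Qed.

Lemma powR_1D_ge r q : 0 <= q -> 0 <= r -> 1 + r `^ q <= 2 * (1 + r) `^ q.
Proof.
move=> q0 r0.
have h1 : 1 <= (1 + r) `^ q by have := @ler_powR_base 1 (1 + r) q q0 ler01; rewrite powR1; apply; lra.
have h2 : r `^ q <= (1 + r) `^ q by rewrite ler_powR_base//; lra.
lra.
Qed.

Lemma om_le_in_L q x : 0 <= q -> om q x <= 2 / (1 + sq x `^ q).
Proof.
move=> q0; have p0 : 0 < 1 + sq x `^ q by rewrite ltr_wpDr ?powR_ge0.
rewrite omE ler_pdivlMr// mulrC ler_pdivrMr ?powR_gt0 ?sq1_gt0//.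
exact/powR_1D_ge/sq_ge0.
Qed.

(* For q = n/2 + alpha/2, [om q] is the weight of [in_L] up to constants. *)
Lemma G_le_om q t x : 0 < q -> 0 < t ->
  G t x <= 2 `^ q * (t `^ (- nu) + q `^ q * t `^ (q - nu)) * om q x.
Proof.
move=> q0 t0; rewrite omE ler_pdivlMr ?powR_gt0 ?sq1_gt0//.
have h := powR_1D_le (ltW q0) (sq_ge0 x).
apply: (@le_trans _ _ (G t x * (2 `^ q * (1 + sq x `^ q)))).
  by rewrite ler_wpM2l ?G_ge0.
rewrite mulrCA ler_wpM2l ?powR_ge0// mulrDr mulr1; apply: lerD.
  rewrite /G ler_piMr ?powR_ge0// -expR0 ler_expR oppr_le0 divr_ge0 ?sq_ge0// ltW//.
have -> : G t x * sq x `^ q = ((sq x / t) `^ q * expR (- (sq x / t))) * t `^ (q - nu).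
  have E : (sq x / t) `^ q = sq x `^ q * t `^ (- q).
    by rewrite powRM ?sq_ge0 ?invr_ge0 ?(ltW t0)// -(powR_inv1 (ltW t0)) -powRrM mulN1r.
  have h' : t `^ (- q) * t `^ q = 1 by rewrite -powRDp// addNr powRr0.
  by rewrite E /G (powRDp q)// -[LHS]mulr1 -h'; ring.
by rewrite ler_wpM2r ?powR_ge0// powR_expR_le ?divr_ge0 ?sq_ge0// ltW.
Qed.

Lemma measurable_om q : mfunT (om q).
Proof.
apply: (measurableT_comp (@measurable_powR R (- q))).
Proof. by mfun. Qed.

(** The Gaussian exp(-phi |x|^2) has mass [gmass] phi^(-n/2), so a superposition of Gaussians is
    integrated by one integral over the half line. This takes the place of polar coordinates. *)
Lemma tonelli_gauss (m phi : R -> R) : mfunT m -> mfunT phi ->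
  (forall s, 0 <= m s) -> (forall s, 0 < s -> 0 < phi s) ->
  (\int[mu]_x (\int[hl]_s (m s * expR (- (sq x * phi s)))%:E) =
   \int[hl]_s (gmass R n * (m s * phi s `^ (- nu)))%:E)%E.
Proof.
move=> mm mphi m0 phi0.
pose f := fun z : 'rV[R]_n * (measurableTypeR R) => (m z.2 * expR (- (sq z.1 * phi z.2)))%:E.
have mf : mfunT f by mfun.
have f0 (z : 'rV[R]_n * (measurableTypeR R)) : (0 <= f z)%E by rewrite lee_fin mulr_ge0 ?m0 ?expR_ge0.
rewrite (@fubini_tonelli _ _ _ _ _ mu hl f mf f0); apply: ge0_eq_hl.
- exact: measurable_fun_fubini_tonelli_G.
- by mfun.
- by move=> s; exact: integral_ge0.
- by move=> s; rewrite lee_fin !mulr_ge0 ?powR_ge0 ?m0// ltW// gmass_gt0.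
move=> s s0; have p0 := phi0 s s0.
transitivity (\int[mu]_x ((m s)%:E * (expR (- (sq (x - 0) / (phi s)^-1)))%:E))%E.
  by apply: eq_integral => x _; rewrite /f/= -EFinM invrK subr0.
rewrite ge0_integralZl ?lee_fin//; last first.
  by mfun.
rewrite integral_exp_sq_scale ?invr_gt0// -EFinM -powR_inv1 ?ltW// -powRrM mulN1r.
by congr EFin; ring.
Qed.

Lemma ge0_L1_scaled d (T : measurableType d) (m : {measure set T -> \bar R}) (c : R) (h : T -> R) :
  0 < c -> mfunT h -> (forall w : T, 0 <= h w) ->
  (\int[m]_w (c * h w)%:E < +oo)%E -> L1 m h.
Proof.
move=> c0 mh h0 fin.
have L : L1 m (fun w => c * h w).
  apply/ge0_L1_EFin => //; first exact: measurable_funM.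
  by move=> w; rewrite mulr_ge0// ltW.
have := L1Z c^-1 L; congr (L1 m _); apply/funext => w.
by rewrite mulrA mulVf ?mul1r// gt_eqF.
Qed.

(** (1 + |x|^2)^(-q) is a Gamma integral of exp(-s (1 + |x|^2)). Integrating in x first leaves s^(q
    - n/2 - 1) exp(-s), which converges at 0 because q > n/2. *)
Lemma L1_om q : nu < q -> L1 mu (om q).
Proof.
move=> q1; have q0 : 0 < q by rewrite (le_lt_trans _ q1)// divr_ge0.
apply: (@ge0_L1_scaled _ _ _ (Gam q)); [exact: Gam_gt0|exact: measurable_om|by move=> x; exact/ltW/om_gt0|].
rewrite (_ : (\int[mu]_x _)%E = (\int[mu]_x (\int[hl]_s (s `^ (q - 1) * expR (- s) * expR (- (sq x * s)))%:E))%E); last first.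
  apply: eq_integral => x _; rewrite -[LHS](hl_exp_pow q0 (sq1_gt0 x)); apply: eq_integral => s _.
  by rewrite -mulrA -expRD; congr (_ * expR _)%:E; ring.
rewrite (@tonelli_gauss (fun s => s `^ (q - 1) * expR (- s)) id)//; last 2 first.
- by mfun.
- by move=> s; rewrite mulr_ge0 ?powR_ge0 ?expR_ge0.
have L := L1Z (gmass R n) (@hl_gamma R (q - nu) (etrans (subr_gt0 _ _) q1)).
rewrite (_ : (\int[hl]_s _)%E = (\int[hl]_s (gmass R n * (s `^ (q - nu - 1) * expR (- s)))%:E)%E).
  by rewrite (L1_EFin L) ltry.
have mg r : mfunT (fun s : R => s `^ r * expR (- s)) by mfun.
apply: ge0_eq_hl.
- by mfun.
- by mfun.
- by move=> s; rewrite lee_fin !mulr_ge0 ?powR_ge0 ?expR_ge0// ltW// gmass_gt0.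
- by move=> s; rewrite lee_fin !mulr_ge0 ?powR_ge0 ?expR_ge0// ltW// gmass_gt0.
move=> s s0; rewrite (_ : q - nu - 1 = q - 1 + - nu) ?(powRDp _ (- nu))//; last by ring.
by congr EFin; ring.
Qed.

Definition riesz_gauss (d : R) x : R := sq x `^ (- (nu - d)) * expR (- sq x).

Lemma riesz_gauss_ge0 d x : 0 <= riesz_gauss d x.
Proof. by rewrite mulr_ge0 ?powR_ge0 ?expR_ge0. Qed.

(** The same device with Gaussians of parameter 1 + s: the remaining integrand s^(n/2 - d - 1) (1 +
    s)^(-n/2) converges at 0 because d < n/2 and at infinity because d > 0. *)
Lemma L1_riesz_gauss (d : R) : 0 < d -> d < nu -> L1 mu (riesz_gauss d).
Proof.
move=> d0 d1; have q0 : 0 < nu - d by rewrite subr_gt0.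
have m1 : mfunT (riesz_gauss d).
  apply: measurable_funM; first exact: (measurableT_comp (@measurable_powR R _) (@measurable_sq R n)).
  by mfun.
apply: (@ge0_L1_scaled _ _ _ (Gam (nu - d))) => //; first exact: Gam_gt0.
  by move=> x; exact: riesz_gauss_ge0.
apply: (@le_lt_trans _ _ (\int[mu]_x (\int[hl]_s (s `^ (nu - d - 1) * expR (- (sq x * (1 + s))))%:E))%E).
  apply: ge0_le_integral => //.
  - by move=> x _; rewrite lee_fin mulr_ge0 ?riesz_gauss_ge0// ltW// Gam_gt0.
  - by mfun.
  - pose f := fun z : 'rV[R]_n * (measurableTypeR R) => (z.2 `^ (nu - d - 1) * expR (- (sq z.1 * (1 + z.2))))%:E.
    apply: (@measurable_fun_fubini_tonelli_F _ _ _ _ R hl f); last first.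
      by move=> z; rewrite lee_fin mulr_ge0 ?powR_ge0 ?expR_ge0.
    by mfun.
  move=> x _; have [x0|] := ltP 0 (sq x); last first.
    move=> x0; have -> : sq x = 0 by apply/eqP; rewrite eq_le x0 sq_ge0.
    rewrite /riesz_gauss (_ : sq x = 0); last by apply/eqP; rewrite eq_le x0 sq_ge0.
    rewrite powR0 ?oppr_eq0 ?gt_eqF// mul0r mulr0.
    by apply: integral_ge0 => s _; rewrite lee_fin mulr_ge0 ?powR_ge0 ?expR_ge0.
  rewrite /riesz_gauss mulrA EFinM -hl_exp_pow// -ge0_integralZr ?lee_fin ?expR_ge0//; last 2 first.
  - by mfun.
  - by move=> s _; rewrite lee_fin mulr_ge0 ?powR_ge0 ?expR_ge0.
  rewrite le_eqVlt; apply/orP; left; apply/eqP; apply: eq_integral => s _.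
  by rewrite -EFinM -mulrA -expRD; congr (_ * expR _)%:E; ring.
rewrite (@tonelli_gauss (fun s => s `^ (nu - d - 1)) (fun s => 1 + s))//; last 3 first.
- by mfun.
- by move=> s; rewrite powR_ge0.
- by move=> s s0; rewrite ltr_wpDl.
have mg : mfunT (fun s : R => s `^ (nu - d - 1) * (1 + s) `^ (- nu)) by mfun.
have L : L1 hl (fun s : R => s `^ (nu - d - 1) * (1 + s) `^ (- nu)).
  apply: (@hl_L1_crit _ _ (nu - d) d 1) => //.
  - move=> s /andP[s0 s1]; rewrite ger0_norm ?mulr_ge0 ?powR_ge0// mul1r ler_piMr ?powR_ge0//.
    rewrite powRN invf_le1 ?powR_gt0 ?ltr_wpDl//.
    have := @ler_powR_base 1 (1 + s) nu _ ler01; rewrite powR1; apply; last lra.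
    by rewrite divr_ge0.
  - move=> s s1; have s0 : 0 < s by lra.
    rewrite ger0_norm ?mulr_ge0 ?powR_ge0// mul1r.
    have -> : - d - 1 = nu - d - 1 + - nu by ring.
    rewrite (powRDp (nu - d - 1))// ler_wpM2l ?powR_ge0// !powRN lef_pV2 ?posrE ?powR_gt0//; last lra.
    by apply: ler_powR_base; [rewrite divr_ge0|lra|lra].
by rewrite (L1_EFin (L1Z _ L)) ltry.
Qed.

(* The two-sided bound of the Riesz-type kernel |z|^(-2q), q = nu + th, by an
   integrable function once a factor |z|^(2(th + d)) is gained near the origin. *)
Definition kmaj (th d : R) x : R := expR 1 * riesz_gauss d x + 2 `^ (nu + th) * om (nu + th) x.

Lemma L1_kmaj th d : 0 < th -> 0 < d -> d < nu -> L1 mu (kmaj th d).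
Proof.
move=> th0 d0 d1; apply: L1D; apply: L1Z; first exact: L1_riesz_gauss.
by apply: L1_om; rewrite ltrDl.
Qed.

Lemma kmaj_near th d x : 0 < th -> 0 < d -> sq x <= 1 -> sq x `^ (th + d) * sq x `^ (- (nu + th)) <= kmaj th d x.
Proof.
move=> th0 d0 x1; have [x0|x0] := ltP 0 (sq x); last first.
  have -> : sq x = 0 by apply/eqP; rewrite eq_le x0 sq_ge0.
  rewrite powR0 ?mul0r ?gt_eqF ?addr_gt0// /kmaj addr_ge0 ?mulr_ge0 ?expR_ge0 ?riesz_gauss_ge0 ?powR_ge0//.
rewrite -powRDp// (_ : th + d + _ = - (nu - d)); last by ring.
rewrite /kmaj -[leLHS]addr0 lerD ?mulr_ge0 ?powR_ge0//.
by rewrite /riesz_gauss mulrCA ler_peMr ?powR_ge0// -expRD -[leLHS]expR0 ler_expR subr_ge0.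
Qed.

Lemma kmaj_far th d x : 0 <= nu + th -> 1 <= sq x -> sq x `^ (- (nu + th)) <= kmaj th d x.
Proof.
move=> q0 x1; rewrite /kmaj -[leLHS]add0r lerD ?(mulr_ge0 (expR_ge0 _) (riesz_gauss_ge0 _ _))//.
have x0 : 0 < sq x by lra.
rewrite omE powRN ler_pdivlMr ?powR_gt0 ?sq1_gt0//.
rewrite mulrC ler_pdivrMr ?powR_gt0// -powRM ?(ltW x0)//.
by apply: ler_powR_base => //; lra.
Qed.

End Weight.

Ltac munfold ::= cbv beta delta [G om].

(** * Calculus on row vectors and differentiation under the integral *)

Section RowCalculus.
Context (R : realType) (n : nat).
Notation mu := (leb R n).
Implicit Types (x y z : 'rV[R]_n) (f g h : 'rV[R]_n -> R) (i : 'I_n).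

Definition ei i : 'rV[R]_n := delta_mx ord0 i.

Lemma is_derive_line f x v (r d : R) :
  is_derive (r *: v + x) v f d -> is_derive r 1 (fun s : R => f (s *: v + x)) d.
Proof.
move=> [df <-].
have E : (fun h : R => h^-1 *: ((f \o shift (r *: v + x)) (h *: v) - f (r *: v + x))) =
   (fun h : R => h^-1 *: (((fun s : R => f (s *: v + x)) \o shift r) (h *: (1 : R)) - f (r *: v + x))).
  apply/funext => h /=; congr (_ *: (f _ - _)).
  by rewrite scaler1 scalerDl addrA.
by split; rewrite /derivable /derive -?E.
Qed.

Lemma is_derive_line0 f x v (d : R) :
  is_derive (0 : R) 1 (fun s : R => f (s *: v + x)) d -> is_derive x v f d.
Proof.
move=> [df <-].
have E : (fun h : R => h^-1 *: ((f \o shift x) (h *: v) - f x)) =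
   (fun h : R => h^-1 *: (((fun s : R => f (s *: v + x)) \o shift 0) (h *: (1 : R)) - f (0 *: v + x))).
  by apply/funext => h /=; rewrite scaler1 addr0 scale0r add0r.
by split; rewrite /derivable /derive ?E.
Qed.

Lemma partial_is_derive f i x : derivable f x (ei i) -> is_derive x (ei i) f (partial i f x).
Proof. exact: derivableP. Qed.

Lemma is_derive_partial f i x d : is_derive x (ei i) f d -> derivable f x (ei i) /\ partial i f x = d.
Proof. by move=> [h1 h2]; split. Qed.

Definition D1 f := forall i x, derivable f x (ei i).

Lemma row_mvt1 f i x (r : R) : D1 f ->
  exists2 c : R, 0 <= c <= 1 & f (r *: ei i + x) - f x = r * partial i f ((c * r) *: ei i + x).
Proof.
move=> df; pose F s := f ((s * r) *: ei i + x).
have dF (s : R) : is_derive s 1 F (r * partial i f ((s * r) *: ei i + x)).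
  have h := is_derive_line (partial_is_derive (df i ((s * r) *: ei i + x))).
  have h2 : is_derive s 1 (fun s : R => s * r) r.
    have := is_deriveM (is_derive_id s 1) (is_derive_cst r s 1).
    by rewrite /GRing.scale/= mulr0 add0r mulr1.
  have := @is_derive1_comp R (fun s => f (s *: ei i + x)) (fun s => s * r) s _ _ h h2.
  by rewrite mulrC.
have cF : {within `[(0:R), 1], continuous F} by apply: derivable_within_continuous => s _; apply: ex_derive.
have [c c01] := MVT ltr01 (fun s _ => dF s) cF.
rewrite /F mul1r mul0r scale0r add0r subr0 mulr1 => ->.
by exists c => //; move: c01; rewrite in_itv/= => /andP[/ltW-> /ltW->].
Qed.

(** Telescoping over the coordinates reduces to the mean value theorem in one variable, which is why
    each coordinate has an intermediate point of its own. *)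
Lemma row_mvt f x z : D1 f ->
  exists2 xi : 'I_n -> 'rV[R]_n, (forall i j, `|xi i ord0 j - x ord0 j| <= `|z ord0 j|) &
   f (x + z) - f x = \sum_i z ord0 i * partial i f (xi i).
Proof.
move=> df; pose zk (m : nat) : 'rV[R]_n := \row_j (if (j < m)%N then z ord0 j else 0).
have zS i : zk i.+1 = z ord0 i *: ei i + zk i.
  apply/rowP => j; rewrite !mxE eqxx/= ltnS leq_eqVlt.
  have [->|ji] := eqVneq j i; first by rewrite eqxx ltnn mulr1 addr0.
  by rewrite -val_eqE/= in ji; rewrite (negbTE ji) mulr0 add0r.
have st i : exists xi : 'rV[R]_n, (forall j, `|xi ord0 j - x ord0 j| <= `|z ord0 j|) /\
   f (zk i.+1 + x) - f (zk i + x) = z ord0 i * partial i f xi.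
  have [c /andP[c0 c1] E] := @row_mvt1 f i (zk i + x) (z ord0 i) df.
  exists ((c * z ord0 i) *: ei i + (zk i + x)); rewrite zS -addrA E; split => // j.
  rewrite !mxE eqxx/= addrA addrK.
  have [->|ji] := eqVneq j i.
    rewrite ltnn addr0 mulr1 normrM ler_piMl// ger0_norm//.
  by rewrite mulr0 add0r; case: ifP; rewrite ?normr0.
have [xi xiP] := choice st; exists xi; first by move=> i; have [] := xiP i.
rewrite (eq_bigr (fun i : 'I_n => f (zk i.+1 + x) - f (zk i + x))); last first.
  by move=> i _; have [_ ->] := xiP i.
rewrite -(big_mkord xpredT (fun i : nat => f (zk i.+1 + x) - f (zk i + x))) telescope_sumr//.
congr (f _ - f _).
  by rewrite addrC; congr (_ + _); apply/rowP => j; rewrite mxE ltn_ord.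
by rewrite -[LHS]add0r; congr (_ + _); apply/rowP => j; rewrite !mxE ltn0.
Qed.

Lemma seq_continuous_row f x :
  (forall y_ : nat -> 'rV[R]_n, y_ m @[m --> \oo] --> x -> f (y_ m) @[m --> \oo] --> f x) ->
  {for x, continuous f}.
Proof.
move=> h A /nbhs_ballP[e /= e0 eA]; apply: contrapT => nh.
have : forall m : nat, exists y, (forall i, `|x ord0 i - y ord0 i| < m.+1%:R^-1) /\ ~ `|f x - f y| < e.
  move=> m; apply: contrapT => hm; apply: nh; apply/(@nbhs_rowP R n).
  exists (m.+1%:R^-1); first by rewrite invr_gt0.
  by move=> y xy; apply: eA; apply: contrapT => hy; apply: hm; exists y.
move=> /choice[y yP].
have : y m @[m --> \oo] --> x.
  apply: cvg_row => i; apply/cvgrPdist_lt => d d0; near=> m.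
  apply: (lt_trans (proj1 (yP m) i)); near: m; exact: (@near_infty_natSinv_lt R (PosNum d0)).
move=> /h/cvgrPdist_lt/(_ _ e0)[N _ /(_ N (leqnn N))/=].
by have [_] := yP N.
Unshelve. all: by end_near. Qed.

Lemma compact_sq (rho : R) : compact [set x : 'rV[R]_n | sq x <= rho].
Proof.
apply: bounded_closed_compact; last first.
  have -> : [set x : 'rV[R]_n | sq x <= rho] = @sq R n @^-1` [set r | r <= rho] by [].
  by apply: closed_comp => [x _|]; [exact: continuous_sq|exact: closed_le].
exists (1 + `|rho|); split => // M' /ltW M1 x /= xr; apply: le_trans M1.
have c1 : 0 <= 1 + `|rho| by rewrite addr_ge0.
rewrite [leLHS]mx_normE -[leRHS]/((NngNum c1)%:num) num_le.
apply/bigmax_leP; split => [|[i j] _]; rewrite -num_le//= (ord1 i).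
have := le_trans (coord_le_sq x j) xr.
rewrite -(real_normK (num_real _)) => h; have h2 := ler_norm rho.
have h3 := normr_ge0 (x ord0 j); have h4 := normr_ge0 rho.
rewrite leNgt; apply/negP => h5; nra.
Qed.

Lemma continuous_bounded_sq f (rho : R) : continuous f ->
  exists2 M : R, 0 <= M & forall x, sq x <= rho -> `|f x| <= M.
Proof.
move=> cf; have : compact (f @` [set x : 'rV[R]_n | sq x <= rho]).
  by apply: continuous_compact; [exact: continuous_subspaceT|exact: compact_sq].
move=> /compact_bounded[M [_ hM]]; exists (`|M| + 1); first by rewrite addr_ge0.
move=> x xr; apply: hM; first by rewrite (le_lt_trans (ler_norm M))// ltrDl.
by exists x.
Qed.

Lemma RI_shift (a : 'rV[R]_n) f : mfunT f ->
  \int[mu]_x f (x + a) = \int[mu]_x f x.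
Proof.
move=> mf; rewrite /Rintegral; congr fine.
have mE : mfunT (EFin \o f) by mfun.
rewrite [LHS]integralE [RHS]integralE.
congr (_ - _)%E.
  transitivity (\int[mu]_x (EFin \o f)^\+%E (x + a)%R)%E; first by apply: eq_integral => x _; rewrite !funeposE.
  apply: (@ge0_integral_shift R n a (EFin \o f)^\+%E); first exact: measurable_funepos.
  by move=> x; exact: funepos_ge0.
transitivity (\int[mu]_x (EFin \o f)^\-%E (x + a)%R)%E; first by apply: eq_integral => x _; rewrite !funenegE.
apply: (@ge0_integral_shift R n a (EFin \o f)^\-%E); first exact: measurable_funeneg.
by move=> x; exact: funeneg_ge0.
Qed.

Lemma RI_reflect (a : 'rV[R]_n) f : mfunT f ->
  \int[mu]_x f (a - x) = \int[mu]_x f x.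
Proof.
move=> mf; rewrite /Rintegral; congr fine.
have mE : mfunT (EFin \o f) by mfun.
rewrite [LHS]integralE [RHS]integralE.
congr (_ - _)%E.
  transitivity (\int[mu]_x (EFin \o f)^\+%E (a - x)%R)%E; first by apply: eq_integral => x _; rewrite !funeposE.
  apply: (@ge0_integral_reflect R n a (EFin \o f)^\+%E); first exact: measurable_funepos.
  by move=> x; exact: funepos_ge0.
transitivity (\int[mu]_x (EFin \o f)^\-%E (a - x)%R)%E; first by apply: eq_integral => x _; rewrite !funenegE.
apply: (@ge0_integral_reflect R n a (EFin \o f)^\-%E); first exact: measurable_funeneg.
by move=> x; exact: funeneg_ge0.
Qed.

Lemma measurable_shift (a : 'rV[R]_n) : mfunT (fun x => x + a).
Proof. by mfun. Qed.

Lemma L1_shift (a : 'rV[R]_n) f : L1 mu f -> L1 mu (fun x => f (x + a)).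
Proof.
move=> Lf; have mf := L1_meas Lf; apply: L1P.
  by mfun.
rewrite (@ge0_integral_shift R n a (fun x => `|f x|%:E))//; first exact: L1_lty.
Proof. by mfun. Qed.

Lemma L1_reflect (a : 'rV[R]_n) f : L1 mu f -> L1 mu (fun x => f (a - x)).
Proof.
move=> Lf; have mf := L1_meas Lf; apply: L1P.
  by mfun.
rewrite (@ge0_integral_reflect R n a (fun x => `|f x|%:E))//; first exact: L1_lty.
Proof. by mfun. Qed.

Lemma L1_exp_sq : L1 mu (fun x => expR (- sq x)).
Proof.
apply/ge0_L1_EFin.
- by mfun.
- by move=> x; exact: expR_ge0.
- by rewrite integral_exp_sq ltry.
Qed.

Lemma L1_bounded_supp f (rho M : R) : mfunT f ->
  (forall x, sq x <= rho -> `|f x| <= M) -> (forall x, rho < sq x -> f x = 0) -> L1 mu f.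
Proof.
move=> mf fM f0; apply: (@L1_le _ _ _ mu (fun x => (`|M| * expR rho) * expR (- sq x))) => //.
  move=> x; have [xr|xr] := leP (sq x) rho; last first.
    by rewrite f0// normr0 !mulr_ge0 ?expR_ge0.
  rewrite -mulrA -expRD (le_trans (fM x xr))// (le_trans (ler_norm M))//.
  by rewrite ler_peMr// -expR0 ler_expR subr_ge0.
by apply: L1Z; exact: L1_exp_sq.
Qed.

Lemma cvg_natSinv : (m.+1%:R^-1 : R) @[m --> \oo] --> (0 : R).
Proof.
apply/cvgrPdist_lt => d d0; near=> m; rewrite sub0r normrN ger0_norm//.
by near: m; exact: (@near_infty_natSinv_lt R (PosNum d0)).
Unshelve. all: by end_near. Qed.

Lemma D1_cvg_quot h i x : derivable h x (ei i) ->
  (m.+1%:R * (h ((m.+1%:R^-1) *: ei i + x) - h x)) @[m --> \oo] --> partial i h x.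
Proof.
move=> dh.
have dh' : (r^-1 *: (h (r *: ei i + x) - h x)) @[r --> (0 : R)^'] --> partial i h x by exact: dh.
have := (@cvgr_dnbhsP R (fun r : R => r^-1 *: (h (r *: ei i + x) - h x)) 0 (partial i h x)).1 dh'.
move=> /(_ (fun m => m.+1%:R^-1)) H.
have : (m.+1%:R^-1)^-1 *: (h ((m.+1%:R^-1) *: ei i + x) - h x) @[m --> \oo] --> partial i h x.
  by apply: H; split; [move=> m; rewrite invr_eq0|exact: cvg_natSinv].
by under eq_fun do rewrite invrK.
Qed.

Lemma sq_ei i : sq (ei i) = 1.
Proof.
rewrite /sq (bigD1 i)//= big1 ?addr0; first by rewrite mxE !eqxx expr1n.
by move=> j ji; rewrite mxE (negbTE ji) andbF expr0n.
Qed.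

(** Translation invariance gives every difference quotient in direction i the integral 0. The
    quotients converge dominatedly, since they are values of the derivative and live in a fixed
    ball. *)
Lemma integral_partial_eq0 h i (rho : R) : D1 h -> continuous h -> continuous (partial i h) ->
  (forall x, rho < sq x -> h x = 0) -> \int[mu]_x partial i h x = 0.
Proof.
move=> dh ch cdh h0.
(* A shift of length at most 1 keeps the support inside |x|^2 <= [rho2], and the mean value points
   of that ball inside |x|^2 <= 2 + 2 [rho2]. *)
pose rho2 := 2 * `|rho| + 2.
have [M M0 hM] := continuous_bounded_sq (2 + 2 * rho2) cdh.
pose q m x := m.+1%:R * (h ((m.+1%:R^-1) *: ei i + x) - h x).
have mh := continuous_measurable_row ch.
have mq m : mfunT (q m).
  apply: measurable_funM => //; apply: measurable_funB => //.
  by mfun.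
have m1 (m : nat) : m.+1%:R^-1 <= 1 :> R by rewrite invf_le1 ?ler1n.
have qM m x : `|q m x| <= (M * expR rho2) * expR (- sq x).
  have [xr|xr] := leP (sq x) rho2.
    apply: (@le_trans _ _ M); last by rewrite -mulrA -expRD ler_peMr// -expR0 ler_expR subr_ge0.
    rewrite /q; have [c /andP[c0 c1] ->] := @row_mvt1 h i x m.+1%:R^-1 dh.
    rewrite mulrA mulfV ?mul1r//; apply: hM.
    apply: (le_trans (sqD_le2 _ _)); apply: lerD; last by rewrite ler_pM2l.
    have := m1 m; have : 0 <= m.+1%:R^-1 :> R by [].
    rewrite sqZ sq_ei mulr1; move: (m.+1%:R^-1) => r r0 r1.
    have : c * r <= 1 by nra.
    have : 0 <= c * r by nra.
    move: (c * r) => w; nra.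
  suff -> : q m x = 0 by rewrite normr0 !mulr_ge0 ?expR_ge0.
  rewrite /q !h0 ?subrr ?mulr0//.
    rewrite (le_lt_trans (ler_norm rho))// (le_lt_trans _ xr)// /rho2.
    by have := normr_ge0 rho; lra.
  have := sqD_le2 (m.+1%:R^-1 *: ei i + x) (- (m.+1%:R^-1 *: ei i)).
  rewrite addrAC subrr add0r sqN sqZ sq_ei mulr1 => h1.
  have h2 : (m.+1%:R^-1 : R) ^+ 2 <= 1 by rewrite exprn_ile1// m1.
  have h3 := ler_norm rho; have h4 := normr_ge0 rho; move: xr h1 h2; rewrite /rho2.
  move: (m.+1%:R^-1 ^+ 2) (sq x) (sq _) (`|rho|) h3 h4 => r1 r2 r3 r4; lra.
have [_ cq] := RI_dct mq (fun x => D1_cvg_quot (dh i x)) (L1Z (M * expR rho2) L1_exp_sq) qM.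
have Lh : L1 mu h.
  have [Mh _ hMh] := continuous_bounded_sq rho ch.
  exact: L1_bounded_supp mh hMh h0.
have q0 m : \int[mu]_x q m x = 0.
  rewrite /q RIZ; last first.
    apply: L1B => //; have := L1_shift (m.+1%:R^-1 *: ei i) Lh.
    by under eq_fun do rewrite addrC.
  rewrite RIB//; last first.
    by have := L1_shift (m.+1%:R^-1 *: ei i) Lh; under eq_fun do rewrite addrC.
  have := RI_shift (m.+1%:R^-1 *: ei i) mh.
  under eq_Rintegral do rewrite addrC; move=> ->.
  by rewrite subrr mulr0.
rewrite -(cvg_lim (@Rhausdorff R) cq) (_ : (fun m => _) = fun=> 0) ?lim_cst//.
by apply/funext.
Qed.

End RowCalculus.

Section UnderIntegral.
Context (R : realType) (n : nat) d (T : measurableType d) (m : {measure set T -> \bar R}).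
Implicit Types (x y z : 'rV[R]_n) (i : 'I_n).

Lemma RI_derive1 (f df : R -> T -> R) (a e : R) (g : T -> R) : 0 < e ->
  (forall s t, `|s - a| < e -> is_derive s 1 (f ^~ t) (df s t)) ->
  (forall s, `|s - a| < e -> L1 m (f s)) -> L1 m g ->
  (forall s t, `|s - a| < e -> `|df s t| <= g t) ->
  is_derive a 1 (fun s => \int[m]_t f s t) (\int[m]_t df a t).
Proof.
move=> e0 fdf Lf Lg dfg.
have I s : `]a - e, a + e[%classic s -> `|s - a| < e by rewrite /= in_itv/= ltr_distl.
have Ia : `](a - e), (a + e)[%classic a by rewrite /= in_itv/= ltrBlDr ltrDl e0.
have d1 s t : `|s - a| < e -> partial1of2 f s t = df s t.
  by move=> h; rewrite partial1of2E; exact: (@derive_val _ _ _ _ _ _ _ (fdf s t h)).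
have H1 : forall s t, `]a - e, a + e[%classic s -> setT t -> derivable (f ^~ t) s 1.
  by move=> s t /I h _; apply: (@ex_derive _ _ _ _ _ _ _ (fdf s t h)).
have H2 t : 0 <= g t by apply: le_trans (dfg a t _); rewrite ?normr_ge0// subrr normr0.
have H3 : forall s t, `]a - e, a + e[%classic s -> setT t -> `|partial1of2 f s t| <= g t.
  by move=> s t /I h _; rewrite d1//; exact: dfg.
have H0 s : `]a - e, a + e[%classic s -> m.-integrable setT (EFin \o f s) by move=> /I; exact: Lf.
split; first exact: (derivable_under_integral measurableT Ia H0 H1 H2 Lg H3).
rewrite -derive1E (differentiation_under_integral measurableT Ia H0 H1 H2 Lg H3).
by apply: eq_Rintegral => t _; rewrite d1// subrr normr0.
Qed.

(** One integrable majorant per ball of parameters: enough for continuity and partial derivatives to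
    pass under the integral, which are local matters. *)
Definition locdom (F : 'rV[R]_n -> T -> R) :=
  forall rho : R, exists2 g : T -> R, L1 m g & forall y t, sq y <= rho -> `|F y t| <= g t.

Lemma locdom_L1 F y : locdom F -> mfunT (F y) -> L1 m (F y).
Proof. by move=> /(_ (sq y))[g Lg h] mF; apply: L1_le Lg => // t; apply: h. Qed.

Lemma RI_continuous (F : 'rV[R]_n -> T -> R) : locdom F ->
  (forall y, mfunT (F y)) -> (forall t, continuous (F ^~ t)) ->
  continuous (fun y => \int[m]_t F y t).
Proof.
move=> lF mF cF x; apply: seq_continuous_row => y_ yx.
have [g Lg hg] := lF (sq x + 1).
have cs : sq (y_ k) @[k --> \oo] --> sq x.
  exact: (cvg_comp _ _ yx (@continuous_sq R n x)).
have /cvgrPdist_lt/(_ 1 ltr01)[N _ hN] := cs.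
rewrite -(cvg_shiftn N).
apply: (proj2 (@RI_dct _ _ _ m (fun k => F (y_ (k + N)%N)) (F x) g _ _ Lg _)) => //.
  by move=> t; rewrite (cvg_shiftn N (fun k => F (y_ k) t)); exact: (cvg_comp _ _ yx (cF t x)).
move=> k t; apply: hg; have := hN (k + N)%N (leq_addl _ _).
by rewrite /= distrC ltr_distl => /andP[_ /ltW].
Qed.

Lemma RI_partial i (F dF : 'rV[R]_n -> T -> R) : locdom F -> locdom dF ->
  (forall y, mfunT (F y)) ->
  (forall y t, is_derive y (ei R i) (F ^~ t) (dF y t)) ->
  forall x, is_derive x (ei R i) (fun y => \int[m]_t F y t) (\int[m]_t dF x t).
Proof.
move=> lF ldF mF FdF x; apply: is_derive_line0.
have [g Lg hg] := ldF (2 + 2 * sq x).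
have -> : \int[m]_t dF x t = \int[m]_t dF (0 *: ei R i + x) t by rewrite scale0r add0r.
apply: (@RI_derive1 (fun s => F (s *: ei R i + x)) (fun s => dF (s *: ei R i + x)) 0 1 g) => //.
- by move=> s t _; apply: (@is_derive_line R n (F ^~ t)); apply: FdF.
- by move=> s _; apply: locdom_L1.
- move=> s t; rewrite subr0 => s1; apply: hg; apply: (le_trans (sqD_le2 _ _)).
  rewrite lerD2r sqZ sq_ei mulr1 ler_piMr// -[s ^+ 2]ger0_norm ?sqr_ge0// normrX.
  by rewrite exprn_ile1// ltW.
Qed.

End UnderIntegral.

(** * Classes of differentiable functions *)

Section Smooth.
Context (R : realType) (n : nat).
Notation mu := (leb R n).
Implicit Types (x y z c : 'rV[R]_n) (f g h : 'rV[R]_n -> R) (i : 'I_n) (m : nat) (r : R).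

Fixpoint smooth m g : Prop := continuous g /\
  if m is m'.+1 then D1 g /\ forall i, smooth m' (partial i g) else True.

(** The kernels that may be convolved with a function of the weighted space and differentiated under
    the integral. The free centre [c] lets translated test functions belong to the same class. *)
Fixpoint dec c m r g : Prop := [/\ continuous g,
    exists2 C : R, 0 <= C & forall x, `|g x| <= C * om r (x - c) &
  if m is m'.+1 then D1 g /\ forall i, dec c m' r (partial i g) else True].

Lemma smooth_cont m g : smooth m g -> continuous g.
Proof. by case: m => [|m] []. Qed.

Lemma dec_cont c m r g : dec c m r g -> continuous g.
Proof. by case: m => [|m] []. Qed.

Lemma dec_bound c m r g : dec c m r g -> exists2 C : R, 0 <= C & forall x, `|g x| <= C * om r (x - c).
Proof. by case: m => [|m] []. Qed.

Lemma dec_smooth c m r g : dec c m r g -> smooth m g.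
Proof.
elim: m g => [|m IH] g; first by move=> [].
by move=> [cg _ [dg h]]; split=> //; split => // i; apply/IH/h.
Qed.

Lemma smoothS m g : smooth m.+1 g -> smooth m g.
Proof.
elim: m g => [|m IH] g; first by move=> [].
by move=> [cg [dg h]]; split=> //; split=> // i; apply/IH/h.
Qed.

Lemma decS c m r g : dec c m.+1 r g -> dec c m r g.
Proof.
elim: m g => [|m IH] g; first by move=> [].
by move=> [cg b [dg h]]; split=> //; split=> // i; apply/IH/h.
Qed.

Lemma om_le r r' x : r <= r' -> om r' x <= om r x.
Proof.
by move=> rr; rewrite /om ler_powR ?lerN2// lerDl sq_ge0.
Qed.

Lemma dec_le c m r r' g : r <= r' -> dec c m r' g -> dec c m r g.
Proof.
move=> rr; elim: m g => [|m IH] g [cg [C C0 hC] h]; split => //.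
- by exists C => // x; apply: (le_trans (hC x)); rewrite ler_wpM2l// om_le.
- by exists C => // x; apply: (le_trans (hC x)); rewrite ler_wpM2l// om_le.
- by case: h => dg h; split => // i; apply/IH/h.
Qed.

Lemma partialD i f g : D1 f -> D1 g ->
  partial i (fun x => f x + g x) = fun x => partial i f x + partial i g x.
Proof. by move=> df dg; apply/funext => x; rewrite /partial deriveD; [|exact: df|exact: dg]. Qed.

Lemma partialZ i (a : R) f : D1 f -> partial i (fun x => a * f x) = fun x => a * partial i f x.
Proof. by move=> df; apply/funext => x; rewrite /partial (deriveZ a (df i x)). Qed.

Lemma partialM i f g : D1 f -> D1 g ->
  partial i (fun x => f x * g x) = fun x => partial i f x * g x + f x * partial i g x.
Proof.
move=> df dg; apply/funext => x; rewrite /partial deriveM; [|exact: df|exact: dg].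
by rewrite addrC /GRing.scale/= [g x * _]mulrC.
Qed.

Lemma D1D f g : D1 f -> D1 g -> D1 (fun x => f x + g x).
Proof. by move=> df dg i x; apply: derivableD; [exact: df|exact: dg]. Qed.

Lemma D1Z (a : R) f : D1 f -> D1 (fun x => a * f x).
Proof. by move=> df i x; apply: derivableZ; exact: df. Qed.

Lemma D1M f g : D1 f -> D1 g -> D1 (fun x => f x * g x).
Proof. by move=> df dg i x; apply: derivableM; [exact: df|exact: dg]. Qed.

Lemma continuous_cstf (a : R) : continuous ((fun=> a) : 'rV[R]_n -> R).
Proof. by move=> x; exact: cst_continuous. Qed.

Lemma continuousDf f g : continuous f -> continuous g -> continuous (fun x => f x + g x).
Proof. by move=> cf cg x; exact: (continuousD (cf x) (cg x)). Qed.

Lemma continuousMf f g : continuous f -> continuous g -> continuous (fun x => f x * g x).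
Proof. by move=> cf cg x; exact: (continuousM (cf x) (cg x)). Qed.

Lemma continuousZf (a : R) f : continuous f -> continuous (fun x => a * f x).
Proof. by move=> cf; apply: (@continuousMf (fun=> a)) => //; exact: continuous_cstf. Qed.

Lemma smoothD m f g : smooth m f -> smooth m g -> smooth m (fun x => f x + g x).
Proof.
elim: m f g => [|m IH] f g [cf hf] [cg hg]; split => //; try exact: continuousDf.
case: hf hg => [df hf] [dg hg]; split; first exact: D1D.
by move=> i; rewrite partialD//; apply: IH; [exact: hf|exact: hg].
Qed.

Lemma smoothZ (a : R) m f : smooth m f -> smooth m (fun x => a * f x).
Proof.
elim: m f => [|m IH] f [cf hf]; split => //; try exact: continuousZf.
case: hf => [df hf]; split; first exact: D1Z.
by move=> i; rewrite partialZ//; apply: IH; exact: hf.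
Qed.

Lemma smooth_cst m (a : R) : smooth m (fun=> a).
Proof.
elim: m a => [|m IH] a; split => //; try exact: continuous_cstf.
split=> [i x|i]; first exact: derivable_cst.
by rewrite (_ : partial i _ = fun=> 0)//; apply/funext => x; rewrite /partial derive_cst.
Qed.

Lemma smooth_sum m (s : seq 'I_n) (f : 'I_n -> 'rV[R]_n -> R) :
  (forall i, smooth m (f i)) -> smooth m (fun x => \sum_(i <- s) f i x).
Proof.
move=> hf; elim: s => [|j s IH].
  by under eq_fun do rewrite big_nil; exact: smooth_cst.
by under eq_fun do rewrite big_cons; apply: smoothD.
Qed.

Lemma smooth_neg_laplacian m f : smooth m.+2 f -> smooth m (neg_laplacian f).
Proof.
move=> [_ [_ h]]; rewrite /neg_laplacian.
under eq_fun do rewrite -mulN1r; apply: smoothZ; rewrite /laplacian.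
by apply: smooth_sum => i; case: (h i) => _ [_]; apply.
Qed.

Lemma smooth_iter_neg_laplacian k m f : smooth (2 * k + m) f -> smooth m (iter k (@neg_laplacian R n) f).
Proof.
elim: k f m => [|k IH] f m //; rewrite mulnS -addnA addnC !addnS addn0 => h.
by rewrite iterS; apply: smooth_neg_laplacian; apply: IH; rewrite addnC addSnnS addSnnS addnC.
Qed.

Lemma decZ (a : R) c m r f : dec c m r f -> dec c m r (fun x => a * f x).
Proof.
elim: m f => [|m IH] f [cf [C C0 hC] hf]; split => //; try exact: continuousZf.
- exists (`|a| * C); first by rewrite mulr_ge0.
  by move=> x; rewrite normrM -mulrA ler_wpM2l.
- exists (`|a| * C); first by rewrite mulr_ge0.
  by move=> x; rewrite normrM -mulrA ler_wpM2l.
case: hf => [df hf]; split; first exact: D1Z.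
by move=> i; rewrite partialZ//; apply: IH; exact: hf.
Qed.

Lemma decD c m r f g : dec c m r f -> dec c m r g -> dec c m r (fun x => f x + g x).
Proof.
have H (f' g' : 'rV[R]_n -> R) : (exists2 C : R, 0 <= C & forall x, `|f' x| <= C * om r (x - c)) ->
   (exists2 C : R, 0 <= C & forall x, `|g' x| <= C * om r (x - c)) ->
   exists2 C : R, 0 <= C & forall x, `|f' x + g' x| <= C * om r (x - c).
  move=> [C C0 hC] [D D0 hD]; exists (C + D); first exact: addr_ge0.
  by move=> x; rewrite mulrDl (le_trans (ler_normD _ _))// lerD.
elim: m f g => [|m IH] f g [cf Hf hf] [cg Hg hg]; split => //; try exact: continuousDf; try exact: H.
case: hf hg => [df hf] [dg hg]; split; first exact: D1D.
by move=> i; rewrite partialD//; apply: IH; [exact: hf|exact: hg].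
Qed.

Lemma omD r s x : om r x * om s x = om (r + s) x.
Proof. by rewrite /om opprD powRDp// sq1_gt0. Qed.

Lemma decM c m r s f g : dec c m r f -> dec c m s g -> dec c m (r + s) (fun x => f x * g x).
Proof.
have H (f' g' : 'rV[R]_n -> R) : (exists2 C : R, 0 <= C & forall x, `|f' x| <= C * om r (x - c)) ->
   (exists2 C : R, 0 <= C & forall x, `|g' x| <= C * om s (x - c)) ->
   exists2 C : R, 0 <= C & forall x, `|f' x * g' x| <= C * om (r + s) (x - c).
  move=> [C C0 hC] [D D0 hD]; exists (C * D); first exact: mulr_ge0.
  by move=> x; rewrite normrM -omD mulrACA ler_pM.
elim: m f g => [|m IH] f g [cf Hf hf] [cg Hg hg]; split => //; try exact: continuousMf; try exact: H.
case: (hf) (hg) => [df hf'] [dg hg']; split; first exact: D1M.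
move=> i; rewrite partialM//; apply: decD; apply: IH => //; try (by apply: decS; split);
  [exact: hf'|exact: hg'].
Qed.

Lemma is_derive_coord c i j x : is_derive x (ei R i) (fun x => x ord0 j - c ord0 j) (i == j)%:R.
Proof.
apply: is_derive_line0.
have -> : (fun s : R => (s *: ei R i + x) ord0 j - c ord0 j) =
   (fun s => s * (i == j)%:R + (x ord0 j - c ord0 j)).
  by apply/funext => s; rewrite !mxE eqxx/= eq_sym addrA.
have := is_deriveD (is_deriveM (is_derive_id (0 : R) 1) (is_derive_cst ((i == j)%:R : R) (0 : R) 1))
  (is_derive_cst (x ord0 j - c ord0 j) (0:R) 1).
by rewrite /GRing.scale/= mulr0 add0r mulr1 addr0.
Qed.

Lemma dec_cst c m r (a : R) : r <= 0 -> dec c m r (fun=> a).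
Proof.
move=> r0.
have H (b : R) : exists2 C : R, 0 <= C & forall x : 'rV[R]_n, `|b| <= C * om r (x - c).
  exists `|b| => // x; rewrite ler_peMr// -(powRr0 (1 + sq (x - c))) /om ler_powR ?oppr_ge0//.
  by rewrite lerDl sq_ge0.
elim: m a => [|m IH] a; split => //; try exact: continuous_cstf.
split=> [i x|i]; first exact: derivable_cst.
by rewrite (_ : partial i _ = fun=> 0)//; apply/funext => x; rewrite /partial derive_cst.
Qed.

Lemma continuous_row_sub c : continuous (fun x => x - c).
Proof.
move=> x; apply: (@cvg_row R n _ (nbhs x) (nbhs_filter x) (fun y => y - c)) => i.
under eq_fun do rewrite mxE; rewrite mxE.
apply: (@cvgD _ _ _ _ _ (fun y : 'rV[R]_n => y ord0 i) (fun=> (- c) ord0 i)).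
  exact: coord_continuous.
exact: cvg_cst.
Qed.

Lemma dec_coord c m j : dec c m (- (1 / 2)) (fun x => x ord0 j - c ord0 j).
Proof.
have ct : continuous (fun x : 'rV[R]_n => x ord0 j - c ord0 j).
  apply: (@continuousDf (fun x => x ord0 j)) => x; first exact: coord_continuous.
  exact: continuous_cstf.
have H : exists2 C : R, 0 <= C & forall x : 'rV[R]_n,
    `|x ord0 j - c ord0 j| <= C * om (- (1 / 2)) (x - c).
  exists 1 => // x; rewrite mul1r /om opprK div1r powR12_sqrt; last exact/ltW/sq1_gt0.
  rewrite -sqrtr_sqr ler_wsqrtr//; have := coord_le_sq (x - c) j.
  by rewrite !mxE => /le_trans; apply; rewrite lerDr.
case: m => [|m]; split => //; split => [i x|i].
  by case: (is_derive_coord c i j x).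
rewrite (_ : partial i _ = fun=> (i == j)%:R); last first.
  by apply/funext => x; case: (is_derive_partial (is_derive_coord c i j x)).
by apply: dec_cst; rewrite oppr_le0.
Qed.

Lemma is_derive_radial (c : 'rV[R]_n) i x (g g' : R -> R) :
  is_derive (sq (x - c)) 1 g (g' (sq (x - c))) ->
  is_derive x (ei R i) (fun x => g (sq (x - c))) (2 * (x ord0 i - c ord0 i) * g' (sq (x - c))).
Proof.
move=> hg; apply: is_derive_line0.
have E s : sq (s *: ei R i + x - c) = s * s + (s * (2 * (x ord0 i - c ord0 i)) + sq (x - c)).
  rewrite /sq [in LHS](bigD1 i)//= [in RHS](bigD1 i)//= !mxE !eqxx/= mulr1.
  rewrite (eq_bigr (fun j => (x - c) ord0 j ^+ 2)); first by ring.
  by move=> j ji; rewrite !mxE (negbTE ji) andbF mulr0 add0r.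
have -> : (fun s : R => g (sq (s *: ei R i + x - c))) =
  (fun s => g (s * s + (s * (2 * (x ord0 i - c ord0 i)) + sq (x - c)))).
  by apply/funext => s; rewrite E.
have h2 : is_derive (0 : R) 1 (fun s : R => s * s + (s * (2 * (x ord0 i - c ord0 i)) + sq (x - c)))
    (2 * (x ord0 i - c ord0 i)).
  have := is_deriveD (is_deriveM (is_derive_id (0:R) 1) (is_derive_id (0 : R) 1))
   (is_deriveD (is_deriveM (is_derive_id (0 : R) 1) (is_derive_cst (2 * (x ord0 i - c ord0 i)) (0 : R) 1))
  (is_derive_cst (sq (x - c)) (0:R) 1)).
  by rewrite /GRing.scale/= !mulr0 mul0r !add0r addr0 mulr1.
have hg' : is_derive (0 * 0 + (0 * (2 * (x ord0 i - c ord0 i)) + sq (x - c))) 1 g (g' (sq (x - c))).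
  by rewrite !mul0r !add0r.
have := @is_derive1_comp R g _ 0 _ _ hg' h2.
by rewrite [g' _ * _]mulrC.
Qed.

(** A partial derivative of g(|x - c|^2) is 2 (x_i - c_i) g'(|x - c|^2): the coordinate costs 1/2 in
    the exponent while g' gains 1, so the decay does not worsen and the induction closes. [g j] is
    the j-th derivative of the profile. *)
Lemma dec_radial c (N : nat) r (g : nat -> R -> R) :
  (forall (j : nat) (s : R), (j < N)%N -> 0 <= s -> is_derive s 1 (g j) (g j.+1 s)) ->
  (forall j : nat, (j <= N)%N -> continuous (g j)) ->
  (forall j : nat, (j <= N)%N -> exists2 C : R, 0 <= C &
     forall s : R, 0 <= s -> `|g j s| <= C * (1 + s) `^ (- (r + j%:R))) ->
  forall m j, (m + j <= N)%N -> dec c m (r + j%:R) (fun x => g j (sq (x - c))).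
Proof.
move=> dg cg bg.
have H0 j : (j <= N)%N -> continuous (fun x : 'rV[R]_n => g j (sq (x - c))).
  move=> jN x; apply: (@continuous_comp _ _ _ (fun x => sq (x - c)) (g j)); last exact: cg.
  apply: (@continuous_comp _ _ _ (fun x => x - c) (@sq R n)); last exact: continuous_sq.
  exact: continuous_row_sub.
have H1 j : (j <= N)%N -> exists2 C : R, 0 <= C &
   forall x : 'rV[R]_n, `|g j (sq (x - c))| <= C * om (r + j%:R) (x - c).
  by move=> jN; have [C C0 hC] := bg j jN; exists C => // x; apply: hC; exact: sq_ge0.
elim => [|m IH] j mj; split; try (by apply: H0; exact: leq_trans (leq_addl _ _) mj);
  try (by apply: H1; exact: leq_trans (leq_addl _ _) mj); try exact: I.
have dd i x := @is_derive_radial c i x (g j) (g j.+1)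
  (dg j (sq (x - c)) (leq_trans (leq_addl m j.+1) (eq_ind _ (fun k => (k <= N)%N) mj _ (addSnnS m j))) (sq_ge0 _)).
split=> [i x|i]; first by case: (dd i x).
rewrite (_ : partial i _ = fun x => (2 * ((x ord0 i - c ord0 i) * g j.+1 (sq (x - c))))); last first.
  by apply/funext => x; rewrite mulrA; case: (is_derive_partial (dd i x)).
apply: decZ; apply: (@dec_le _ _ _ (- (1 / 2) + (r + j.+1%:R))).
  by rewrite -[j.+1%:R]natr1; lra.
by apply: decM; [exact: dec_coord|apply: IH; rewrite addnS -addSn].
Qed.

Lemma laplacian_radial c x (g : nat -> R -> R) :
  (forall (j : nat) (s : R), (j < 2)%N -> 0 <= s -> is_derive s 1 (g j) (g j.+1 s)) ->
  laplacian (fun x => g 0%N (sq (x - c))) x =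
    4 * sq (x - c) * g 2%N (sq (x - c)) + 2 * n%:R * g 1%N (sq (x - c)).
Proof.
move=> dg; rewrite /laplacian.
rewrite (eq_bigr (fun i => 2 * g 1%N (sq (x - c)) + 4 * (x - c) ord0 i ^+ 2 * g 2%N (sq (x - c)))).
  rewrite big_split/= sumr_const card_ord -mulr_suml -mulr_sumr -/(sq _).
  by rewrite -mulr_natl; ring.
move=> i _.
have -> : partial i (fun x => g 0%N (sq (x - c))) =
    fun x => 2 * (x ord0 i - c ord0 i) * g 1%N (sq (x - c)).
  apply/funext => y; have := @is_derive_radial c i y (g 0%N) (g 1%N) (dg 0%N _ isT (sq_ge0 _)).
  by case/is_derive_partial.
have h1 := @is_derive_radial c i x (g 1%N) (g 2%N) (dg 1%N _ isT (sq_ge0 _)).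
have h2 := is_deriveZ (2 : R) (is_derive_coord c i i x).
have := is_deriveM h2 h1.
case/is_derive_partial => _; rewrite /GRing.scale/= => ->.
by rewrite eqxx !mxE/= /GRing.scale/=; ring.
Qed.

End Smooth.

(** * Hoelder regularity through second differences *)

Section HolderReg.
Context (R : realType) (n : nat).
Notation mu := (leb R n).
Implicit Types (x y z c : 'rV[R]_n) (f g h u : 'rV[R]_n -> R) (i : 'I_n) (m : nat) (r : R).

(** The symmetric second difference, which turns the principal value into an absolutely convergent
    integral: under the assumed regularity it is O(|z|^(alpha + eps)) near z = 0. *)
Definition dd u x z : R := 2 * u x - u (x + z) - u (x - z).

Lemma compact_sq_bounded (K : set 'rV[R]_n) : compact K ->
  exists2 rho : R, 0 <= rho & forall x, K x -> sq x <= rho.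
Proof.
move=> cK; have cs : compact (@sq R n @` K).
  by apply: continuous_compact => //; apply: continuous_subspaceT; exact: continuous_sq.
have [M [_ hM]] := compact_bounded cs.
exists (`|M| + 1); first by rewrite addr_ge0.
move=> x Kx; apply: le_trans (ler_norm _) _; apply: (hM (`|M| + 1)).
  by rewrite (le_lt_trans (ler_norm M))// ltrDl.
by exists x.
Qed.

Lemma enorm_ge0 x : 0 <= enorm x.
Proof. by rewrite enormE sqrtr_ge0. Qed.

Lemma coord_le_enorm x i : `|x ord0 i| <= enorm x.
Proof. by rewrite enormE -sqrtr_sqr ler_wsqrtr// coord_le_sq. Qed.

Lemma sq_coord_le x y (a : R) : 0 <= a -> (forall i, `|x ord0 i| <= a * `|y ord0 i|) ->
  sq x <= a ^+ 2 * sq y.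
Proof.
move=> a0 h; rewrite /sq mulr_sumr ler_sum// => i _.
by rewrite -exprMn -[leLHS]ger0_norm ?sqr_ge0// -[leRHS]ger0_norm ?sqr_ge0// !normrX ler_pXn2r ?nnegrE//
  normrM (ger0_norm a0).
Qed.

Lemma C1_holder_loc h (g : R) : 0 <= g <= 1 -> D1 h ->
  (forall i, continuous (partial i h)) -> holder_loc g h.
Proof.
move=> /andP[g0 g1] dh ch K /compact_sq_bounded[rho rho0 hK].
have [M M0 hM] : exists2 M : R, 0 <= M & forall i x, sq x <= 10 * rho -> `|partial i h x| <= M.
  have /choice[M hM] : forall i, exists M : R, 0 <= M /\ forall x, sq x <= 10 * rho -> `|partial i h x| <= M.
    by move=> i; have [M M0 hM] := continuous_bounded_sq (10 * rho) (ch i); exists M.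
  exists (\sum_i M i); first by apply: sumr_ge0 => i _; case: (hM i).
  move=> i x xr; apply: le_trans ((proj2 (hM i)) x xr) _.
  by rewrite (bigD1 i)//= lerDl sumr_ge0// => j _; case: (hM j).
exists (n%:R * M * (1 + Num.sqrt (4 * rho))) => x y Kx Ky.
have := row_mvt y (x - y) dh; rewrite [y + _]addrC subrK => -[xi hxi ->].
have zr : sq (x - y) <= 4 * rho.
  apply: le_trans (sqD_le2 _ _) _; rewrite sqN; have := hK x Kx; have := hK y Ky; lra.
have b i : `|partial i h (xi i)| <= M.
  apply: hM; rewrite -[xi i](subrK y).
  apply: le_trans (sqD_le2 _ _) _.
  have : sq (xi i - y) <= 1 ^+ 2 * sq (x - y).
    by apply: sq_coord_le => // j; rewrite mul1r; have := hxi i j; rewrite !mxE.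
  have := hK y Ky; rewrite expr1n; move: (sq _) (sq y) (sq _) zr => s1 s2 s3; lra.
apply: le_trans (ler_norm_sum _ _ _) _.
apply: (@le_trans _ _ (\sum_(i < n) enorm (x - y) * M)).
  by apply: ler_sum => i _; rewrite normrM ler_pM// coord_le_enorm.
rewrite sumr_const card_ord -[leLHS]mulr_natl -!mulrA ler_wpM2l// [enorm _ * M]mulrC ler_wpM2l//.
have e0 := enorm_ge0 (x - y); have s0 : 0 <= Num.sqrt (4 * rho) by rewrite sqrtr_ge0.
have [e1|e1] := leP (enorm (x - y)) 1.
  apply: (@le_trans _ _ (enorm (x - y) `^ g)); last by rewrite ler_peMl ?powR_ge0// lerDl.
  move: e0; rewrite le_eqVlt => /predU1P[<-|e0]; first exact: powR_ge0.
  rewrite -{1}(powRr1 (ltW e0)); rewrite -[leLHS]ger0_norm ?powR_ge0//.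
  rewrite ger0_norm ?powR_ge0// /powR gt_eqF// ler_expR.
  by rewrite ler_wnM2r// ln_le0.
apply: (@le_trans _ _ (1 + Num.sqrt (4 * rho))).
  by rewrite enormE (le_trans (ler_wsqrtr zr))// lerDr.
rewrite ler_peMr ?addr_ge0// -(powRr0 (enorm (x - y))) ler_powR//; exact: ltW.
Qed.

Lemma dd_holder0 g (gam : R) : holder_loc gam g ->
  forall rho : R, exists2 C : R, 0 <= C & forall x z, sq x <= rho -> sq z <= 1 ->
    `|dd g x z| <= C * sq z `^ (gam / 2).
Proof.
move=> hg rho; have [C hC] := hg _ (@compact_sq R n (2 * `|rho| + 2)).
exists (2 * `|C|); first by rewrite mulr_ge0.
move=> x z xr z1.
have x1 : sq x <= 2 * `|rho| + 2 by have := ler_norm rho; have := normr_ge0 rho; lra.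
have xz w : sq w <= 1 -> sq (x + w) <= 2 * `|rho| + 2.
  by move=> w1; apply: le_trans (sqD_le2 _ _) _; have := ler_norm rho; lra.
have b w : sq w <= 1 -> `|g x - g (x + w)| <= `|C| * sq w `^ (gam / 2).
  move=> w1; apply: le_trans (hC _ _ x1 (xz w w1)) _.
  by rewrite enorm_powR opprD addrA subrr add0r sqN ler_wpM2r ?powR_ge0// ler_norm.
have -> : dd g x z = (g x - g (x + z)) + (g x - g (x + - z)) by rewrite /dd; ring.
apply: le_trans (ler_normD _ _) _; have := b z z1; have := b (- z).
by rewrite sqN => /(_ z1); lra.
Qed.

(** The mean value theorem applied to x + z and to x - z leaves z times a difference of first
    derivatives at points within 2|z| of each other; the Hoelder exponent comes on top of the factor
    |z|. *)
Lemma dd_holder1 g (gam : R) : 0 <= gam -> D1 g -> (forall i, holder_loc gam (partial i g)) ->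
  forall rho : R, exists2 C : R, 0 <= C & forall x z, sq x <= rho -> sq z <= 1 ->
    `|dd g x z| <= C * sq z `^ ((1 + gam) / 2).
Proof.
move=> gam0 dg hg rho.
have /choice[Ci hCi] : forall i, exists C : R, forall x y, sq x <= 2 * `|rho| + 2 -> sq y <= 2 * `|rho| + 2 ->
    `|partial i g x - partial i g y| <= C * enorm (x - y) `^ gam.
  by move=> i; have [C hC] := hg i _ (@compact_sq R n (2 * `|rho| + 2)); exists C.
pose C := \sum_i `|Ci i|.
have C0 : 0 <= C by apply: sumr_ge0.
exists (n%:R * (C * 2 `^ gam)); first by rewrite !mulr_ge0 ?powR_ge0.
move=> x z xr z1.
have [xi hxi e1] := row_mvt x z dg; have [et het e2] := row_mvt x (- z) dg.
have -> : dd g x z = - \sum_i z ord0 i * (partial i g (xi i) - partial i g (et i)).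
  rewrite (_ : dd g x z = - ((g (x + z) - g x) + (g (x - z) - g x))); last by rewrite /dd; ring.
  rewrite e1 e2 -big_split/=; congr (- _); apply: eq_bigr => i _; rewrite mxE; ring.
rewrite normrN; apply: le_trans (ler_norm_sum _ _ _) _.
have near1 (w : 'rV[R]_n) : sq (w - x) <= sq z -> sq w <= 2 * `|rho| + 2.
  move=> wz; rewrite -[w](subrK x); apply: le_trans (sqD_le2 _ _) _.
  have := ler_norm rho; move: wz; move: (sq (w - x)) (sq z) z1 => s1 s2; lra.
have h1 i : sq (xi i - x) <= sq z.
  by have := @sq_coord_le (xi i - x) z 1 ler01; rewrite expr1n mul1r; apply => j; rewrite mul1r !mxE hxi.
have h2 i : sq (et i - x) <= sq z.
  have := @sq_coord_le (et i - x) z 1 ler01; rewrite expr1n mul1r; apply => j.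
  by have := het i j; rewrite mul1r !mxE normrN.
have b i : `|partial i g (xi i) - partial i g (et i)| <= C * (2 `^ gam * sq z `^ (gam / 2)).
  apply: le_trans (hCi i _ _ (near1 _ (h1 i)) (near1 _ (h2 i))) _.
  apply: (@le_trans _ _ (C * enorm (xi i - et i) `^ gam)).
    rewrite ler_wpM2r ?powR_ge0// (le_trans (ler_norm _))// /C (bigD1 i)//= lerDl.
    by rewrite sumr_ge0.
  rewrite ler_wpM2l// -[sq z `^ _]enorm_powR -powRM// ?enorm_ge0//.
  apply: ler_powR_base => //; first exact: enorm_ge0.
  rewrite !enormE (_ : 2 * Num.sqrt (sq z) = Num.sqrt (2 ^+ 2 * sq z)); last first.
    by rewrite sqrtrM ?sqr_ge0// sqrtr_sqr ger0_norm.
  rewrite ler_wsqrtr//; apply: sq_coord_le => // j.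
  rewrite !mxE (_ : xi i ord0 j - et i ord0 j = (xi i ord0 j - x ord0 j) - (et i ord0 j - x ord0 j)); last by ring.
  apply: le_trans (ler_normB _ _) _; have := hxi i j; have := het i j; rewrite mxE normrN.
  lra.
apply: (@le_trans _ _ (\sum_(i < n) sq z `^ (1 / 2) * (C * (2 `^ gam * sq z `^ (gam / 2))))).
  apply: ler_sum => i _; rewrite normrM ler_pM// -[sq z `^ _](enorm_powR z 1).
  by rewrite powRr1 ?enorm_ge0// coord_le_enorm.
rewrite sumr_const card_ord -[leLHS]mulr_natl -!mulrA ler_wpM2l//.
rewrite mulrC -!mulrA ler_wpM2l// ler_wpM2l ?powR_ge0//.
have := sq_ge0 z; rewrite le_eqVlt => /predU1P[<-|z0].
  by rewrite (@powR0 _ (1 / 2)) ?mulr0 ?powR_ge0//; lra.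
by rewrite mulrDl powRDp// mulrC.
Qed.

(* e is half the Hoelder exponent: |z| ^ (2 e) = sq z `^ e *)
Fixpoint Reg (e : R) m g : Prop := [/\ continuous g,
  forall rho : R, exists2 C : R, 0 <= C & forall x z, sq x <= rho -> sq z <= 1 ->
    `|dd g x z| <= C * sq z `^ e &
  if m is m'.+1 then D1 g /\ forall i, Reg e m' (partial i g) else True].

Lemma Reg_cont e m g : Reg e m g -> continuous g.
Proof. by case: m => [|m] []. Qed.

Lemma Reg_dd e m g : Reg e m g -> forall rho : R, exists2 C : R, 0 <= C &
  forall x z, sq x <= rho -> sq z <= 1 -> `|dd g x z| <= C * sq z `^ e.
Proof. by case: m => [|m] []. Qed.

Lemma Reg_smooth e m g : Reg e m g -> smooth m g.
Proof.
elim: m g => [|m IH] g; first by move=> [].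
by move=> [cg _ [dg h]]; split=> //; split => // i; apply/IH/h.
Qed.

Lemma CkHolder_D1 m (gam : R) g : CkHolder_loc m.+1 gam g -> D1 g.
Proof. by move=> [h _ _] i x; exact: (h [::]). Qed.

Lemma CkHolder_partial m (gam : R) g i : CkHolder_loc m.+1 gam g -> CkHolder_loc m gam (partial i g).
Proof.
move=> [h1 h2 h3].
have E s : partials s (partial i g) = partials (rcons s i) g by rewrite /partials -cats1 foldr_cat.
by split=> s sm; rewrite E; [apply: h1|apply: h2|apply: h3]; rewrite size_rcons ?sm.
Qed.

Lemma CkHolder_S m (gam : R) g : 0 <= gam <= 1 -> CkHolder_loc m.+1 gam g -> CkHolder_loc m gam g.
Proof.
move=> gam01 [h1 h2 h3]; split.
- by move=> s sm; apply: h1; exact: leqW.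
- by move=> s sm; apply: h2; exact: leqW.
move=> s sm; apply: C1_holder_loc => //.
  by move=> i x; apply: h1; rewrite sm.
by move=> i; apply: (h2 (i :: s)); rewrite /= sm.
Qed.

(** [a] plays the part of the integer part of alpha: for a = 0 Hoelder increments of the function
    bound its second differences, for a = 1 Hoelder increments of its gradient. Functions with
    derivatives to spare reduce to this by [CkHolder_S]. *)
Lemma CkHolder_Reg (a : nat) m (gam : R) g : 0 <= gam <= 1 -> (a <= 1)%N ->
  CkHolder_loc (m + a) gam g -> Reg ((a%:R + gam) / 2) m g.
Proof.
move=> gam01 a1.
have H0 m' g' : CkHolder_loc (m' + a) gam g' -> Reg ((a%:R + gam) / 2) 0 g'.
  elim: m' g' => [|m' IH] g' hg; last by apply: IH; exact: CkHolder_S.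
  split => //; first by case: hg => _ /(_ [::] isT).
  case: a a1 hg => [|[|//]] _ hg.
    by rewrite add0r; apply: dd_holder0; case: hg => _ _ /(_ [::] erefl).
  apply: dd_holder1; [by case/andP: gam01|exact: CkHolder_D1 hg|].
  by move=> i; case: hg => _ _ /(_ [:: i] erefl).
elim: m g => [|m IH] g hg; first exact: (H0 0%N).
have [c b _] := H0 _ _ hg; split => //; split; first exact: CkHolder_D1 hg.
by move=> i; apply: IH; exact: CkHolder_partial.
Qed.

End HolderReg.

Ltac munfold ::= cbv beta delta [G om dd].

(** * Integrals of second differences against singular kernels *)

Section Potentials.
Context (R : realType) (n : nat).
Notation mu := (leb R n).
Notation nu := (n%:R / 2 : R).
Implicit Types (x y z c : 'rV[R]_n) (f g h u : 'rV[R]_n -> R) (i : 'I_n) (m : nat) (r : R).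

Lemma is_derive_val (V : normedModType R) (f : V -> R) (x v : V) d d' :
  is_derive x v f d -> d = d' -> is_derive x v f d'.
Proof. by move=> h <-. Qed.

Lemma is_derive_shift f x a v (d : R) : is_derive (x + a) v f d -> is_derive x v (fun y => f (y + a)) d.
Proof.
move=> [df <-].
have E : (fun h : R => h^-1 *: ((f \o shift (x + a)) (h *: v) - f (x + a))) =
   (fun h : R => h^-1 *: (((fun y => f (y + a)) \o shift x) (h *: v) - f (x + a))).
  by apply/funext => h /=; rewrite addrA.
by split; rewrite /derivable /derive -?E.
Qed.

Lemma continuous_rowshift f a : continuous f -> continuous (fun x => f (x + a)).
Proof.
move=> cf x; apply: (@continuous_comp _ _ _ (fun x => x + a) f); last exact: cf.
by rewrite -[a]opprK; exact: continuous_row_sub.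
Qed.

Lemma measurable_dd g x : mfunT g -> mfunT (dd g x).
Proof.
move=> mg; apply: measurable_funB; first apply: measurable_funB => //.
  by mfun.
Proof. by mfun. Qed.

Lemma dd0 g x : dd g x 0 = 0.
Proof. by rewrite /dd subr0 addr0; ring. Qed.

Lemma continuous_dd g z : continuous g -> continuous (fun x => dd g x z).
Proof.
move=> cg; rewrite /dd.
have -> : (fun x => 2 * g x - g (x + z) - g (x - z)) =
  (fun x => (2 * g x + (-1) * g (x + z)) + (-1) * g (x - z)) by apply/funext => x; ring.
by apply: continuousDf; [apply: continuousDf|]; apply: continuousZf => //; exact: continuous_rowshift.
Qed.

Lemma is_derive_dd g z i x : D1 g -> is_derive x (ei R i) (fun y => dd g y z) (dd (partial i g) x z).
Proof.
move=> dg.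
have h1 := partial_is_derive (dg i x).
have h2 := is_derive_shift (partial_is_derive (dg i (x + z))).
have h3 := is_derive_shift (partial_is_derive (dg i (x + - z))).
exact: (is_derive_val (is_deriveB (is_deriveB (is_deriveZ (2 : R) h1) h2) h3)).
Qed.

Section Kernel.
Context (th d : R) (th0 : 0 < th) (d0 : 0 < d) (dn : d < nu).
Notation q := (nu + th).

(** The kernel |z|^(-n-alpha) for alpha = 2 [th]; the convention for powers gives it the value 0 at
    the origin. *)
Definition rker z : R := sq z `^ (- q).

Lemma q_gt0 : 0 < q.
Proof. by rewrite ltr_wpDl// divr_ge0. Qed.

Lemma measurable_rker : mfunT rker.
Proof.
apply: (measurableT_comp (measurable_powR _)); exact: measurable_sq.
Qed.

Lemma rker_ge0 z : 0 <= rker z.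
Proof. exact: powR_ge0. Qed.

Lemma rkerN z : rker (- z) = rker z.
Proof. by rewrite /rker sqN. Qed.

Lemma kmaj_ge0 z : 0 <= kmaj th d z.
Proof. by rewrite /kmaj addr_ge0 ?mulr_ge0 ?expR_ge0 ?riesz_gauss_ge0 ?powR_ge0// ltW// om_gt0. Qed.

Lemma near_bound g x z (C Cj : R) (j : 'rV[R]_n -> R) : 0 <= C -> 0 <= Cj ->
  (z != 0 -> sq z <= 1 -> `|j z| <= Cj * rker z) -> (1 < sq z -> j z = 0) ->
  (sq z <= 1 -> `|dd g x z| <= C * sq z `^ (th + d)) -> `|dd g x z * j z| <= C * Cj * kmaj th d z.
Proof.
move=> C0 Cj0 hj hj0 hg.
have k0 := kmaj_ge0 z.
have [z1|z1] := ltP 1 (sq z); first by rewrite hj0// mulr0 normr0 !mulr_ge0.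
have [->|z0] := eqVneq z 0; first by rewrite dd0 mul0r normr0 !mulr_ge0 ?kmaj_ge0.
rewrite normrM; apply: (@le_trans _ _ ((C * sq z `^ (th + d)) * (Cj * rker z))).
  by apply: ler_pM => //; [exact: hg|exact: hj].
by rewrite mulrACA ler_wpM2l ?mulr_ge0// kmaj_near.
Qed.

(** Differentiation in x commutes with second differences, so every derivative falls on [g] and the
    singular kernel [j] is never differentiated. *)
Lemma smooth_near (j : 'rV[R]_n -> R) (Cj : R) : mfunT j -> 0 <= Cj ->
  (forall z, z != 0 -> sq z <= 1 -> `|j z| <= Cj * rker z) -> (forall z, 1 < sq z -> j z = 0) ->
  forall m g, Reg (th + d) m g -> smooth m (fun x => \int[mu]_z (dd g x z * j z)).
Proof.
move=> mj Cj0 hj hj0.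
have LD m g : Reg (th + d) m g -> locdom mu (fun x z => dd g x z * j z).
  move=> /Reg_dd hg rho; have [C C0 hC] := hg rho.
  exists (fun z => C * Cj * kmaj th d z); first exact/L1Z/L1_kmaj.
  by move=> x z xr; apply: near_bound => //; [exact: hj|exact: hj0|exact: hC].
have M m g x : Reg (th + d) m g -> mfunT (fun z => dd g x z * j z).
  move=> /Reg_cont cg; apply: measurable_funM => //.
  by mfun.
have CT m g : Reg (th + d) m g -> continuous (fun x => \int[mu]_z (dd g x z * j z)).
  move=> hg; apply: RI_continuous; [exact: LD hg|by move=> y; exact: M hg|].
  move=> z; apply: (@continuousMf R n (fun x => dd g x z) (fun=> j z)); last exact: continuous_cstf.
  exact: continuous_dd (Reg_cont hg).
elim=> [|m IH] g hg; split => //; try exact: CT hg.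
case: (hg) => cg _ [dg rg].
have P i x : is_derive x (ei R i) (fun x => \int[mu]_z (dd g x z * j z)) (\int[mu]_z (dd (partial i g) x z * j z)).
  apply: (@RI_partial _ _ _ _ _ i (fun x z => dd g x z * j z) (fun x z => dd (partial i g) x z * j z)).
  - exact: LD hg.
  - exact: LD (rg i).
  - by move=> y; exact: M hg.
  move=> y z; apply: (is_derive_val (is_deriveM (is_derive_dd z i y dg) (is_derive_cst (j z) y (ei R i)))).
  by rewrite /GRing.scale/= mulr0 add0r mulrC.
split=> [i x|i]; first by case: (P i x).
rewrite (_ : partial i _ = fun x => \int[mu]_z (dd (partial i g) x z * j z)); first by apply: IH; exact: rg.
by apply/funext => x; case: (is_derive_partial (P i x)).
Qed.

Lemma om_shift x z : om q z <= 2 `^ q * (1 + sq x) `^ q * om q (x + z).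
Proof.
have := om_peetre (x + z) (- x) (ltW q_gt0).
by rewrite addrAC subrr add0r sqN.
Qed.

(** Here the derivatives fall on the smooth kernel [k], so integrability of [u] against the weight
    is enough; [om_shift] makes the domination uniform for x in a ball. *)
Lemma smooth_conv u : mfunT u -> L1 mu (fun y => u y * om q y) ->
  forall m k, dec 0 m q k -> smooth m (fun x => \int[mu]_y (u y * k (x - y))).
Proof.
move=> mU Lu.
have LD m k : dec 0 m q k -> locdom mu (fun x y => u y * k (x - y)).
  move=> /dec_bound[C C0 hC] rho.
  exists (fun y => C * (2 `^ q * (1 + rho) `^ q) * `|u y * om q y|); first exact/L1Z/L1_norm.
  move=> x y xr; rewrite !normrM mulrCA ler_wpM2l//.
  apply: (le_trans (hC _)); rewrite subr0 -!mulrA ler_wpM2l// mulrA.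
  rewrite (ger0_norm (ltW (om_gt0 q y))).
  have := om_shift (- x) (x - y); rewrite addrA addNr add0r omN sqN => /le_trans; apply.
  rewrite ler_wpM2r ?(ltW (om_gt0 _ _))// ler_wpM2l ?powR_ge0//.
  by apply: ler_powR_base; rewrite ?(ltW q_gt0) ?addr_ge0 ?sq_ge0 ?lerD2l.
have M m k x : dec 0 m q k -> mfunT (fun y => u y * k (x - y)).
  move=> /dec_cont ck; apply: measurable_funM => //.
  by mfun.
have CT m k : dec 0 m q k -> continuous (fun x => \int[mu]_y (u y * k (x - y))).
  move=> hk; apply: RI_continuous; [exact: LD hk|by move=> y; exact: M hk|].
  move=> y; apply: continuousZf; apply: continuous_rowshift; exact: dec_cont hk.
elim=> [|m IH] k hk; split => //; try exact: CT hk.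
case: (hk) => ck _ [dk rk].
have P i x : is_derive x (ei R i) (fun x => \int[mu]_y (u y * k (x - y)))
    (\int[mu]_y (u y * partial i k (x - y))).
  apply: (@RI_partial _ _ _ _ _ i (fun x y => u y * k (x - y)) (fun x y => u y * partial i k (x - y))).
  - exact: LD hk.
  - exact: LD (rk i).
  - by move=> y; exact: M hk.
  move=> y z; have h := is_derive_shift (partial_is_derive (dk i (y + - z))).
  exact: (is_derive_val (is_deriveZ (u z) h)).
split=> [i x|i]; first by case: (P i x).
rewrite (_ : partial i _ = fun x => \int[mu]_y (u y * partial i k (x - y))); first by apply: IH; exact: rk.
by apply/funext => x; case: (is_derive_partial (P i x)).
Qed.

Lemma rker_far (e : R) z : 0 < e -> e <= sq z -> rker z <= (1 + e^-1) `^ q * om q z.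
Proof.
move=> e0 ez; have z0 : 0 < sq z by exact: lt_le_trans ez.
rewrite /rker omE powRN ler_pdivlMr ?powR_gt0 ?sq1_gt0// mulrC ler_pdivrMr ?powR_gt0//.
rewrite -powRM ?(ltW z0) ?addr_ge0 ?invr_ge0 ?(ltW e0)//; apply: ler_powR_base.
- exact: ltW q_gt0.
- exact: ltW (sq1_gt0 _).
- rewrite mulrDl mul1r addrC lerD2l mulrC ler_pdivlMr// mul1r//.
Qed.

Section FracLap.
Context (u : 'rV[R]_n -> R).
Hypothesis cu : continuous u.
Hypothesis Lu : L1 mu (fun y => u y * om q y).
Hypothesis ru : Reg (th + d) 0 u.

Lemma measurable_u : mfunT u.
Proof. by mfun. Qed.

Lemma L1_shift_om x : L1 mu (fun z => u (x + z) * om q z).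
Proof.
apply: (@L1_le _ _ _ _ (fun z => 2 `^ q * (1 + sq x) `^ q * `|u (z + x) * om q (z + x)|)).
- by mfun.
- move=> z; rewrite !normrM mulrCA ![x + _]addrC ler_wpM2l//.
  by rewrite !ger0_norm ?(ltW (om_gt0 _ _))// [z + x]addrC; exact: om_shift.
- exact/L1Z/L1_norm/(L1_shift x Lu).
Qed.

Lemma L1_reflect_om x : L1 mu (fun z => u (x - z) * om q z).
Proof.
have := L1_reflect 0 (L1_shift_om x); rewrite (_ : (fun z => _) = (fun z => u (x - z) * om q z))//.
by apply/funext => z; rewrite sub0r omN.
Qed.

Lemma RI_shift_om x : \int[mu]_z `|u (x + z) * om q z| <=
  2 `^ q * (1 + sq x) `^ q * \int[mu]_z `|u z * om q z|.
Proof.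
rewrite -(RI_shift x (L1_meas (L1_norm Lu))) -RIZ; last exact: (L1_shift x (L1_norm Lu)).
apply: RI_le; [exact/L1_norm/L1_shift_om|exact/L1Z/(L1_shift x (L1_norm Lu))|].
move=> z; rewrite !normrM mulrCA ![x + _]addrC ler_wpM2l//.
by rewrite !ger0_norm ?(ltW (om_gt0 _ _))// [z + x]addrC; exact: om_shift.
Qed.

(** The terms are, in order: the region near 0, where the second difference is small; and the far
    region, where u(x) and the two translates of u are each paid for by the weight. *)
Definition ddmaj (C : R) x z : R := C * kmaj th d z +
  (2 `^ q * (2 * `|u x|) * om q z + 2 `^ q * (`|u (x + z) * om q z| + `|u (x - z) * om q z|)).

Lemma L1_om_q : L1 mu (om q).
Proof. by apply: L1_om; rewrite ltrDl. Qed.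

Lemma L1_ddmaj C x : L1 mu (ddmaj C x).
Proof.
apply: L1D; first exact/L1Z/L1_kmaj.
by apply: L1D; apply: L1Z; [exact: L1_om_q|apply: L1D; apply: L1_norm; [exact: L1_shift_om|exact: L1_reflect_om]].
Qed.

Lemma dd_rker_le C x z : 0 <= C -> (sq z <= 1 -> `|dd u x z| <= C * sq z `^ (th + d)) ->
  `|dd u x z * rker z| <= ddmaj C x z.
Proof.
move=> C0 hC; have o0 := ltW (om_gt0 q z).
have m2 : 0 <= 2 `^ q * (2 * `|u x|) * om q z + 2 `^ q * (`|u (x + z) * om q z| + `|u (x - z) * om q z|).
  by rewrite addr_ge0 ?mulr_ge0 ?powR_ge0 ?addr_ge0.
have [z1|z1] := leP (sq z) 1.
  rewrite -[leLHS]addr0 lerD// normrM (ger0_norm (rker_ge0 z)).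
  apply: le_trans (_ : (C * sq z `^ (th + d)) * rker z <= _).
    by rewrite ler_wpM2r ?rker_ge0// hC.
  by rewrite -mulrA ler_wpM2l// kmaj_near.
rewrite -[leLHS]add0r lerD ?mulr_ge0 ?kmaj_ge0// normrM (ger0_norm (rker_ge0 z)).
have k1 : rker z <= 2 `^ q * om q z by have := rker_far ltr01 (ltW z1); rewrite invr1.
apply: le_trans (_ : (2 * `|u x| + `|u (x + z)| + `|u (x - z)|) * (2 `^ q * om q z) <= _); last first.
  by rewrite !normrM (ger0_norm o0) le_eqVlt; apply/orP; left; apply/eqP; ring.
apply: ler_pM => //; first exact: rker_ge0.
rewrite /dd (le_trans (ler_normB _ _))// lerD2r (le_trans (ler_normB _ _))// lerD2r.
by rewrite normrM ger0_norm.
Qed.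

Lemma measurable_ddrker x : mfunT (fun z => dd u x z * rker z).
Proof.
apply: measurable_funM; last exact: measurable_rker.
Proof. by mfun. Qed.

Lemma L1_ddrker x : L1 mu (fun z => dd u x z * rker z).
Proof.
have [C C0 hC] := Reg_dd ru (sq x).
apply: L1_le (L1_ddmaj C x); first exact: measurable_ddrker.
by move=> z; apply: dd_rker_le => // z1; exact: hC.
Qed.

Lemma RI_ddrker_bound (rho : R) : exists2 M : R, 0 <= M & forall x, sq x <= rho ->
  \int[mu]_z `|dd u x z * rker z| <= M.
Proof.
have [C C0 hC] := Reg_dd ru rho; have [Mu Mu0 hMu] := continuous_bounded_sq rho cu.
pose I1 := \int[mu]_z kmaj th d z; pose I2 := \int[mu]_z om q z.
pose I3 := \int[mu]_z `|u z * om q z|.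
have I10 : 0 <= I1 by apply: RI_ge0 => z; exact: kmaj_ge0.
have I20 : 0 <= I2 by apply: RI_ge0 => z; exact/ltW/om_gt0.
have I30 : 0 <= I3 by apply: RI_ge0 => z.
pose B := 2 `^ q * (1 + `|rho|) `^ q * I3.
have B0 : 0 <= B by rewrite !mulr_ge0 ?powR_ge0.
exists (C * I1 + (2 `^ q * (2 * Mu) * I2 + 2 `^ q * (B + B))).
  by rewrite !(addr_ge0, mulr_ge0) ?powR_ge0.
move=> x xr.
have L1a := L1_norm (L1_shift_om x); have L1b := L1_norm (L1_reflect_om x).
apply: (@le_trans _ _ (\int[mu]_z ddmaj C x z)).
  apply: RI_le; [exact/L1_norm/L1_ddrker|exact: L1_ddmaj|].
  by move=> z; apply: dd_rker_le => // z1; exact: hC.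
have sB : \int[mu]_z `|u (x + z) * om q z| <= B.
  apply: (le_trans (RI_shift_om x)); rewrite /B ler_wpM2r// ler_wpM2l ?powR_ge0//.
  apply: ler_powR_base; [exact: ltW q_gt0|exact: ltW (sq1_gt0 _)|].
  by rewrite lerD2l (le_trans xr)// ler_norm.
rewrite /ddmaj RID; [|exact/L1Z/L1_kmaj|by apply: L1D; apply: L1Z; [exact: L1_om_q|exact: L1D]].
rewrite RID; [|by apply: L1Z; exact: L1_om_q|by apply: L1Z; exact: L1D].
rewrite RIZ; last exact: L1_kmaj.
rewrite RIZ; last exact: L1_om_q.
rewrite RIZ; last exact: (L1D L1a L1b).
rewrite (RID L1a L1b).
rewrite lerD2l lerD//.
  by rewrite ler_wpM2r// ler_wpM2l ?powR_ge0// ler_wpM2l// hMu.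
rewrite ler_wpM2l ?powR_ge0// lerD//.
apply: le_trans sB; rewrite -(RI_reflect 0 (L1_meas L1a)) le_eqVlt; apply/orP; left; apply/eqP.
by apply: eq_Rintegral => z _; rewrite sub0r omN.
Qed.

End FracLap.
End Kernel.

End Potentials.

Ltac munfold ::= cbv beta delta [G om dd rker].

(** * The fractional Laplacian as an absolutely convergent integral *)

Section FracLaplacianFormula.
Context (R : realType) (n : nat).
Notation mu := (leb R n).
Notation nu := (n%:R / 2 : R).
Implicit Types (x y z c : 'rV[R]_n) (f g h u : 'rV[R]_n -> R) (i : 'I_n) (m : nat) (r : R).

Lemma Rn_integral_leb (D : set 'rV[R]_n) f : measurable D -> mfunT f ->
  Rn_integral D f = \int[mu]_y (f y * \1_D y).
Proof.
move=> mD mf; have mg : mfunT (fun y => f y * \1_D y).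
  by mfun.
rewrite /Rn_integral /Rintegral integral_mkcond; congr fine.
rewrite (_ : _ \_ _ = fun t => (f (row_of_tuple t) * \1_D (row_of_tuple t))%:E); last first.
  apply/funext => t; rewrite patchE indicE.
  rewrite (_ : (t \in @row_of_tuple R n @^-1` D) = (row_of_tuple t \in D)); last first.
    by apply/idP/idP; rewrite !inE.
  by case: ifPn => _; rewrite ?mulr1 ?mulr0.
rewrite [LHS]integralE [RHS]integralE; congr (_ - _)%E; rewrite ge0_integral_leb.
- by apply: eq_integral => t _; rewrite !funeposE.
- by apply: measurable_funepos; exact/measurable_EFinP.
- by move=> x; exact: funepos_ge0.
- by apply: eq_integral => t _; rewrite !funenegE.
- by apply: measurable_funeneg; exact/measurable_EFinP.
- by move=> x; exact: funeneg_ge0.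
Qed.

Lemma in_L_om (al : R) u : 0 <= al -> mfunT u -> in_L al u ->
  L1 mu (fun y => u y * om (nu + al / 2) y).
Proof.
move=> al0 mU /integrableP[_ hL].
have q0 : 0 <= nu + al / 2 by rewrite addr_ge0 ?divr_ge0.
have E y : enorm y `^ (n%:R + al) = sq y `^ (nu + al / 2) by rewrite enorm_powR mulrDl.
have mh : mfunT (fun y => `|u y| / (1 + enorm y `^ (n%:R + al))).
  apply: measurable_funM; first exact: measurableT_comp.
  under eq_fun do rewrite E.
  apply: (measurableT_comp (@measurable_funV R)); apply: measurable_funD => //.
  by mfun.
have Lh : L1 mu (fun y => `|u y| / (1 + enorm y `^ (n%:R + al))).
  apply: L1P => //; rewrite ge0_integral_leb//; last first.
    by apply/measurable_EFinP; exact: measurableT_comp.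
apply: (L1_le _ _ (L1Z 2 Lh)).
  by mfun.
move=> y; rewrite normrM (ger0_norm (ltW (om_gt0 _ _))) mulrCA ler_wpM2l//.
by rewrite E; exact: om_le_in_L.
Qed.

Section Formula.
Context (th d : R) (th0 : 0 < th) (d0 : 0 < d) (dn : d < nu).
Notation q := (nu + th).
Notation K := (@rker R n th).
Context (u : 'rV[R]_n -> R).
Hypothesis cu : continuous u.
Hypothesis Lu : L1 mu (fun y => u y * om q y).
Hypothesis ru : Reg (th + d) 0 u.

Lemma enorm_geE (e : R) y : 0 < e -> (e <= enorm y) = (e ^+ 2 <= sq y).
Proof.
by move=> e0; rewrite enormE -{1}(ger0_norm (ltW e0)) -sqrtr_sqr ler_sqrt// sq_ge0.
Qed.

Lemma measurable_enorm_ge (e : R) (a : 'rV[R]_n) : 0 < e ->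
  measurable [set y : 'rV[R]_n | e <= enorm (y - a)].
Proof.
move=> e0; rewrite (_ : [set y | _] = (fun y => sq (y - a)) @^-1` `[e ^+ 2, +oo[%classic); last first.
  by apply/seteqP; split => y /=; rewrite in_itv/= andbT enorm_geE.
rewrite -[X in measurable X]setTI; apply: (measurableT_comp (@measurable_sq R n) (measurable_shift (- a))) => //.
Qed.

(** Truncation region and kernel are even in z = y - x, so averaging over z and -z replaces the
    first difference of u by half its second difference. *)
Lemma frac_integral (e : R) x : 0 < e ->
  Rn_integral [set y | e <= enorm (y - x)]
    (fun y => (u x - u y) / enorm (x - y) `^ (n%:R + 2 * th)) =
  1 / 2 * \int[mu]_z (dd u x z * K z * \1_[set z | e <= enorm z] z).
Proof.
move=> e0; set D := [set z | e <= enorm z].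
have mU := measurable_u cu.
have mD : measurable D.
  have := measurable_enorm_ge 0 e0.
  by rewrite (_ : [set y | _] = D)//; apply/seteqP; split => y /=; rewrite subr0.
have mI : mfunT (\1_D : 'rV[R]_n -> R) by mfun.
pose phi z := (u x - u (x + z)) * K z * \1_D z.
have mux : mfunT (fun z => u (x + z)) by mfun.
have mphi : mfunT phi by mfun.
have Lphi : L1 mu phi.
  have Lo : L1 mu (fun z => (1 + (e ^+ 2)^-1) `^ q * (`|u x| * om q z + `|u (x + z) * om q z|)).
    apply: L1Z; apply: L1D; first by apply: L1Z; exact: L1_om_q.
    by apply: L1_norm; exact: L1_shift_om.
  apply: L1_le Lo => // z; rewrite /phi indicE.
  have [zD|zD] := boolP (z \in D); last first.
    rewrite mulr0 normr0 mulr_ge0 ?powR_ge0// addr_ge0// mulr_ge0// ltW// om_gt0//.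
  move: zD; rewrite inE /D/= enorm_geE// => zD.
  rewrite mulr1 normrM (ger0_norm (rker_ge0 _ _)).
  apply: le_trans (_ : (`|u x| + `|u (x + z)|) * ((1 + (e ^+ 2)^-1) `^ q * om q z) <= _).
    by apply: ler_pM => //; [exact: rker_ge0|exact: ler_normB|apply: rker_far => //; exact: exprn_gt0].
  rewrite normrM (ger0_norm (ltW (om_gt0 q z))).
  by rewrite le_eqVlt; apply/orP; left; apply/eqP; ring.
have E y : enorm (x - y) `^ (n%:R + 2 * th) = sq (x - y) `^ q by rewrite enorm_powR; congr (_ `^ _); field.
rewrite Rn_integral_leb; first last.
- under eq_fun do rewrite E; apply: measurable_funM; first exact: measurable_funB.
  by mfun.
- exact: measurable_enorm_ge.
have -> : \int[mu]_y ((u x - u y) / enorm (x - y) `^ (n%:R + 2 * th) * \1_[set y | e <= enorm (y - x)] y)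
   = \int[mu]_z phi z.
  rewrite -[RHS](RI_shift (- x) mphi); apply: eq_Rintegral => y _.
  rewrite /phi E [x + (y - x)]addrC subrK /K /rker -[in RHS]sqN opprB powRN.
  by congr (_ * _); rewrite !indicE; congr (nat_of_bool _)%:R; apply/idP/idP; rewrite !inE.
have h : \int[mu]_z phi (0 - z) = \int[mu]_z phi z by exact: RI_reflect.
have Lr := L1_reflect 0 Lphi.
have : \int[mu]_z (phi z + phi (0 - z)) = \int[mu]_z (dd u x z * K z * \1_D z).
  apply: eq_Rintegral => z _; rewrite /phi sub0r rkerN.
  have -> : \1_D (- z) = \1_D z :> R.
    by rewrite !indicE; congr (nat_of_bool _)%:R; apply/idP/idP; rewrite !inE /D/= !enormE sqN.
  by rewrite /dd; ring.
rewrite (RID Lphi Lr) h => <-; by field.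
Qed.

(** Second difference times kernel is integrable over the whole space, so the truncated integrals
    converge dominatedly along every sequence of radii decreasing to 0. *)
Lemma frac_laplacian_dd (al : R) x : al = 2 * th ->
  frac_laplacian al u x = frac_const n al * (1 / 2 * \int[mu]_z (dd u x z * K z)).
Proof.
move=> ->; rewrite /frac_laplacian; congr (_ * _).
apply/cvg_lim => //.
apply/cvg_at_rightP => e_ [e0 ecvg].
under eq_fun do rewrite frac_integral ?e0//.
apply: cvgMr.
have mdd := measurable_ddrker th cu x.
apply: (proj2 (@RI_dct _ _ _ mu (fun m z => dd u x z * K z * \1_[set z | e_ m <= enorm z] z)
   (fun z => dd u x z * K z) (fun z => `|dd u x z * K z|) _ _ _ _)).
- move=> m; apply: measurable_funM => //; apply: measurable_indic.
  have := measurable_enorm_ge 0 (e0 m).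
  by rewrite (_ : [set y | _] = [set z | e_ m <= enorm z])//; apply/seteqP; split => y /=; rewrite subr0.
- move=> z; have [->|z0] := eqVneq z 0.
    under eq_fun do rewrite dd0 !mul0r; rewrite dd0 mul0r; exact: cvg_cst.
  have ez : 0 < enorm z by rewrite enormE sqrtr_gt0 lt0r sq_eq0 z0 sq_ge0.
  apply: cvg_near_cst; move/cvgrPdist_lt: ecvg => /(_ _ ez); apply: filterS => m.
  rewrite sub0r normrN (gtr0_norm (e0 m)) => /ltW em.
  by rewrite indicE mem_set// mulr1.
- by apply: L1_norm; exact: (L1_ddrker th0 d0 dn cu Lu ru x).
- by move=> m z; rewrite normrM ler_piMr// indicE; case: (_ \in _); rewrite ?normr1 ?normr0.
Qed.

(* The kernel is split as a part supported near 0, which only sees local regularity, and a smooth part. *)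
Lemma frac_laplacian_smooth (al : R) m k : al = 2 * th -> Reg (th + d) m u ->
  dec 0 m q k -> (forall z, k (- z) = k z) -> (forall z, 1 <= sq z -> k z = K z) ->
  smooth m (frac_laplacian al u).
Proof.
move=> hal rum hk kN kK.
have ck := dec_cont hk; have mk := continuous_measurable_row ck.
have [Ck Ck0 hCk] := dec_bound hk.
pose j z := K z - k z.
have mj : mfunT j by mfun.
have hj z : z != 0 -> sq z <= 1 -> `|j z| <= (1 + Ck) * K z.
  move=> z0 z1; have sz : 0 < sq z by rewrite lt0r sq_eq0 z0 sq_ge0.
  have k1 : 1 <= K z.
    rewrite /K /rker powRN -[leLHS]invr1 lef_pV2 ?posrE ?powR_gt0//.
    apply: (@le_trans _ _ (1 `^ q)); last by rewrite powR1.
    by apply: ler_powR_base; rewrite ?sq_ge0// (ltW (q_gt0 n th0)).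
  have kb : `|k z| <= Ck.
    apply: (le_trans (hCk z)); rewrite ler_piMr// subr0.
    by apply: le_trans (om_le (r := 0) _ (ltW (q_gt0 _ th0))) _; rewrite /om oppr0 powRr0.
  rewrite /j (le_trans (ler_normB _ _))// (ger0_norm (rker_ge0 _ _)) mulrDl mul1r lerD2l.
  by apply: (le_trans kb); rewrite ler_peMr.
have hj0 z : 1 < sq z -> j z = 0 by move=> z1; rewrite /j kK ?subrr ?ltW.
have Ck1 : 0 <= 1 + Ck by rewrite addr_ge0.
have sN := smooth_near th0 d0 dn mj Ck1 hj hj0 rum.
have sC := smooth_conv th0 (measurable_u cu) Lu hk.
have Lk : L1 mu k.
  apply: (L1_le _ _ (L1Z Ck (L1_om_q n th0))) => // z.
  by have := hCk z; rewrite subr0.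
have Lj x : L1 mu (fun z => dd u x z * j z).
  have [C C0 hC] := Reg_dd ru (sq x).
  apply: L1_le (L1Z (C * (1 + Ck)) (L1_kmaj th0 d0 dn)).
    by mfun.
  move=> z; apply: near_bound => //; [exact: hj|exact: hj0|by move=> z1; apply: hC].
have Ldom (w : 'rV[R]_n -> R) : mfunT w -> L1 mu (fun z => w z * om q z) -> L1 mu (fun z => w z * k z).
  move=> mw Lw; apply: (L1_le _ _ (L1Z Ck (L1_norm Lw))); first exact: measurable_funM.
  move=> z; rewrite !normrM mulrCA ler_wpM2l// (ger0_norm (ltW (om_gt0 _ _))).
  by have := hCk z; rewrite subr0.
have L2 x : L1 mu (fun z => u (x + z) * k z).
  apply: Ldom; last exact: L1_shift_om.
  by mfun.
have L3 x : L1 mu (fun z => u (x - z) * k z).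
  apply: Ldom; last exact: L1_reflect_om.
  by mfun.
pose c1 := \int[mu]_z k z.
(* The smooth part [k] of the kernel is integrable, so against it the second difference can be taken
   apart: a multiple of u(x) minus the convolution of u with [k]. *)
rewrite (_ : frac_laplacian al u = fun x => frac_const n al *
  (1 / 2 * \int[mu]_z (dd u x z * j z) + (c1 * u x + (-1) * \int[mu]_y (u y * k (x - y))))).
  apply: smoothZ; apply: smoothD; first exact: smoothZ.
  by apply: smoothD; apply: smoothZ => //; exact: Reg_smooth rum.
apply/funext => x; rewrite frac_laplacian_dd//; congr (_ * _).
have e2 : \int[mu]_z (u (x + z) * k z) = \int[mu]_y (u y * k (x - y)).
  rewrite -(RI_shift (- x) (L1_meas (L2 x))); apply: eq_Rintegral => y _.
  by rewrite [x + _]addrC subrK -kN opprB.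
have e3 : \int[mu]_z (u (x - z) * k z) = \int[mu]_y (u y * k (x - y)).
  rewrite -(RI_reflect x (L1_meas (L3 x))); apply: eq_Rintegral => y _.
  by rewrite opprB addrC subrK.
have -> : \int[mu]_z (dd u x z * K z) = \int[mu]_z (dd u x z * j z +
    ((2 * u x * k z - u (x + z) * k z) - u (x - z) * k z)).
  by apply: eq_Rintegral => z _; rewrite /j /dd; ring.
have L1k := L1Z (2 * u x) Lk.
rewrite (RID (Lj x) (L1B (L1B L1k (L2 x)) (L3 x))) (RIB (L1B L1k (L2 x)) (L3 x)) (RIB L1k (L2 x)).
by rewrite (RIZ _ Lk) e2 e3 -/c1; field.
Qed.

End Formula.
End FracLaplacianFormula.

(** * Iterated Laplacians of radial functions *)

Section Jets.
Context (R : realType).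
Implicit Types (p : {poly R}) (s t : R) (g : nat -> R -> R) (c : nat -> {poly R}).

Lemma is_derive1_quot (f : R -> R) (a d : R) : is_derive a 1 f d <->
  forall e : R, 0 < e -> exists2 r : R, 0 < r &
    forall h, h != 0 -> `|h| < r -> `|d - h^-1 * (f (h + a) - f a)| < e.
Proof.
split=> [[df dE] e e0|H].
  have : h^-1 *: (f (h *: 1 + a) - f a) @[h --> 0^'] --> d by rewrite -dE; exact: df.
  move/cvgrPdist_lt => /(_ _ e0)[r /= r0 hr]; exists r => // h h0 hlt.
  by have := hr h; rewrite /= sub0r normrN /GRing.scale/= mulr1; apply.
have cv : h^-1 *: (f (h *: 1 + a) - f a) @[h --> 0^'] --> d.
  apply/cvgrPdist_lt => e e0; have [r r0 hr] := H e e0.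
  exists r => //= h; rewrite /= sub0r normrN => hlt h0.
  by have := hr h h0 hlt; rewrite /GRing.scale/= mulr1.
split; first by apply/cvg_ex; exists d.
by apply/cvg_lim.
Qed.

Lemma is_derive_glue (f1 f2 f1' f2' : R -> R) (a : R) :
  (forall s, s <= a -> is_derive s 1 f1 (f1' s)) -> (forall s, a <= s -> is_derive s 1 f2 (f2' s)) ->
  f1 a = f2 a -> f1' a = f2' a ->
  forall s, is_derive s 1 (fun s => if s < a then f1 s else f2 s) (if s < a then f1' s else f2' s).
Proof.
move=> d1 d2 e e' s; apply/is_derive1_quot => eps eps0.
have [sa|sa|sa] := ltgtP s a.
- have [r r0 hr] := proj1 (is_derive1_quot _ _ _) (d1 s (ltW sa)) _ eps0.
  exists (Num.min r (a - s)); first by rewrite lt_min r0 subr_gt0.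
  move=> h h0; rewrite lt_min => /andP[hr1 hr2].
  have -> : h + s < a by move: (ler_norm h); lra.
  exact: hr.
- have [r r0 hr] := proj1 (is_derive1_quot _ _ _) (d2 s (ltW sa)) _ eps0.
  exists (Num.min r (s - a)); first by rewrite lt_min r0 subr_gt0.
  move=> h h0; rewrite lt_min => /andP[hr1 hr2].
  have -> : (h + s < a) = false by apply/negbTE; rewrite -leNgt; move: (ler_norm (- h)); rewrite normrN; lra.
  exact: hr.
- have a1 : s <= a by rewrite sa.
  have a2 : a <= s by rewrite sa.
  have [r r0 hr] := proj1 (is_derive1_quot _ _ _) (d1 s a1) _ eps0.
  have [r' r'0 hr'] := proj1 (is_derive1_quot _ _ _) (d2 s a2) _ eps0.
  exists (Num.min r r'); first by rewrite lt_min r0.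
  move=> h h0; rewrite lt_min => /andP[hr1 hr2].
  case: ifPn => _; last exact: hr'.
  by rewrite sa -e -e' -sa; exact: hr.
Qed.

Lemma poly_bound p : exists2 C : R, 0 <= C & forall s, 0 <= s -> `|p.[s]| <= C * (1 + s) ^+ size p.
Proof.
exists (\sum_(i < size p) `|p`_i|); first exact: sumr_ge0.
move=> s s0; rewrite horner_coef mulr_suml; apply: le_trans (ler_norm_sum _ _ _) _.
apply: ler_sum => i _; rewrite normrM ler_wpM2l// normrX (ger0_norm s0).
apply: (@le_trans _ _ ((1 + s) ^+ i)); first by rewrite lerXn2r ?nnegrE ?addr_ge0// lerDr.
by rewrite ler_weXn2l ?lerDl// ltnW.
Qed.

Lemma pow_exp_bound (N : nat) (a : R) : 0 < a ->
  exists2 C : R, 0 <= C & forall s, 0 <= s -> (1 + s) ^+ N * expR (- (a * s)) <= C.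
Proof.
move=> a0; exists (expR a * a ^- N * N%:R `^ N%:R).
  by rewrite !mulr_ge0 ?expR_ge0 ?powR_ge0// invr_ge0 exprn_ge0// ltW.
move=> s s0.
have := @powR_expR_le R N%:R (a * (1 + s)) (ler0n _ _).
rewrite mulr_ge0 ?(ltW a0) ?addr_ge0// => /(_ isT) h.
rewrite powR_mulrn in h; last by rewrite mulr_ge0 ?(ltW a0) ?addr_ge0.
rewrite exprMn in h.
rewrite -mulrA (_ : _ * expR _ = expR a * a ^- N * (a ^+ N * (1 + s) ^+ N * expR (- (a * (1 + s))))).
  by rewrite -mulrA !ler_wpM2l ?expR_ge0// ?invr_ge0 ?exprn_ge0 ?(ltW a0)// .
rewrite (_ : expR a * _ * _ = (a ^- N * a ^+ N) * ((1 + s) ^+ N * (expR a * expR (- (a * (1 + s)))))); last by ring.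
rewrite mulVf ?mul1r ?expf_neq0 ?gt_eqF// -expRD; congr (_ * expR _); ring.
Qed.

(** [g i] is meant to be the i-th derivative of a radial profile. Iterated Laplacians have this form
    with polynomial coefficients that do not depend on the profile, so bounds and limits of profiles
    carry over to them. *)
Definition ev (N : nat) c g s : R := \sum_(i < N) (c i).[s] * g i s.

Definition jD c (i : nat) : {poly R} := (c i)^`() + (if i is i'.+1 then c i' else 0).

Lemma is_derive_ev N c g s : c N = 0 ->
  (forall i, (i < N)%N -> is_derive s 1 (g i) (g i.+1 s)) ->
  is_derive s 1 (ev N c g) (ev N.+1 (jD c) g s).
Proof.
move=> cN dg.
have -> : ev N.+1 (jD c) g s = \sum_(i < N) ((c i).[s] * g i.+1 s + (c i)^`().[s] * g i s).
  rewrite /ev big_split/= addrC.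
  have -> : \sum_(i < N) (c i)^`().[s] * g i s = \sum_(i < N.+1) (c i)^`().[s] * g i s.
    by rewrite big_ord_recr/= cN deriv0 horner0 mul0r addr0.
  have -> : \sum_(i < N) (c i).[s] * g i.+1 s =
     \sum_(i < N.+1) (if (i : nat) is i'.+1 then c i' else 0).[s] * g i s.
    by rewrite big_ord_recl/= horner0 mul0r add0r.
  by rewrite -big_split/=; apply: eq_bigr => i _; rewrite /jD hornerD mulrDl.
rewrite /ev; elim: N {cN} dg => [|N IH] dg.
  rewrite big_ord0 (_ : (fun s => _) = fun=> 0); first exact: is_derive_cst.
  by apply/funext => r; rewrite big_ord0.
rewrite big_ord_recr/= (_ : (fun s => _) = (fun s => \sum_(i < N) (c i).[s] * g i s + (c N).[s] * g N s)).
  have h1 := IH (fun i iN => dg i (leqW iN)).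
  have h2 := is_deriveM (is_derive_poly (c N) s) (dg N (leqnn _)).
  apply: (is_derive_val (is_deriveD h1 h2)).
  by rewrite /GRing.scale/=; congr (_ + _); rewrite [g N s * _]mulrC.
by apply/funext => r; rewrite big_ord_recr.
Qed.

(** The radial Laplacian 4 s g'' + 2 n g' in the variable s = |x|^2, transcribed to coefficients. *)
Definition jL (n : nat) c (i : nat) : {poly R} := 4%:P * 'X * jD (jD c) i + (2 * n%:R)%:P * jD c i.

Definition jlap (n k : nat) : nat -> {poly R} := iter k (jL n) (fun i => if i is 0%N then 1 else 0).

Lemma jD_supp c N : (forall i, (N < i)%N -> c i = 0) -> forall i, (N.+1 < i)%N -> jD c i = 0.
Proof.
move=> h [|i]// Ni; rewrite /jD !h ?deriv0 ?addr0//; exact: ltnW.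
Qed.

Lemma jlap_supp n k i : (2 * k < i)%N -> jlap n k i = 0.
Proof.
elim: k i => [|k IH] i; first by case: i.
rewrite mulnS => ki; rewrite /jlap iterS -/(jlap n k) /jL.
rewrite (jD_supp (jD_supp IH)) ?(jD_supp IH) ?mulr0 ?addr0//; first exact: ltnW.
Qed.

Lemma iter_laplacian_radial n k (x0 : 'rV[R]_n) g :
  (forall i s, (i < 2 * k)%N -> 0 <= s -> is_derive s 1 (g i) (g i.+1 s)) ->
  iter k (@neg_laplacian R n) (fun x => g 0%N (sq (x - x0))) =
  fun x => (-1) ^+ k * ev (2 * k).+1 (jlap n k) g (sq (x - x0)).
Proof.
elim: k => [|k IH] dg.
  by apply/funext => x; rewrite /= /ev big_ord1 /= hornerC !mul1r.
have ik2 i : (i < 2 * k)%N -> (i < 2 * k.+1)%N by move=> ik; rewrite mulnS (leq_trans ik)// leq_addl.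
rewrite iterS (IH (fun i s ik => dg i s (ik2 i ik))).
apply/funext => x; rewrite /neg_laplacian.
(* [laplacian_radial] asks for a profile with two derivatives; each application of [jD] lengthens
   the combination by one term of the jet. *)
pose G (j : nat) := if j is 0%N then ev (2 * k).+1 (jlap n k) g else
  if j is 1%N then ev (2 * k).+2 (jD (jlap n k)) g else ev (2 * k).+3 (jD (jD (jlap n k))) g.
have dG (j : nat) s : (j < 2)%N -> 0 <= s -> is_derive s 1 (G j) (G j.+1 s).
  have S := @jlap_supp n k.
  case: j => [|[|//]] _ s0; apply: is_derive_ev => [|i ik].
  - exact: jlap_supp.
  - by apply: dg => //; rewrite mulnS; apply: leq_trans ik _; rewrite add2n ltnW.
  - by apply: (jD_supp S).
  - by apply: dg => //; rewrite mulnS.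
have -> : laplacian (fun x => (-1) ^+ k * ev (2 * k).+1 (jlap n k) g (sq (x - x0))) x =
   (-1) ^+ k * laplacian (fun x => G 0%N (sq (x - x0))) x.
  have d0 : D1 (fun x : 'rV[R]_n => G 0%N (sq (x - x0))).
    by move=> i y; case: (@is_derive_radial R n x0 i y (G 0%N) (G 1%N) (dG 0%N _ isT (sq_ge0 _))).
  have p0 i : partial i (fun x : 'rV[R]_n => G 0%N (sq (x - x0))) = fun x => 2 * (x ord0 i - x0 ord0 i) * G 1%N (sq (x - x0)).
    apply/funext => y; have := @is_derive_radial R n x0 i y (G 0%N) (G 1%N) (dG 0%N _ isT (sq_ge0 _)).
    by case/is_derive_partial.
  rewrite /laplacian mulr_sumr; apply: eq_bigr => i _.
  rewrite (partialZ _ _ d0) p0.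
  have h1 := @is_derive_radial R n x0 i x (G 1%N) (G 2%N) (dG 1%N _ isT (sq_ge0 _)).
  have h := is_deriveM (is_deriveZ (2 : R) (is_derive_coord x0 i i x)) h1.
  have [_ ->] := is_derive_partial (is_deriveZ ((-1) ^+ k : R) h).
  by have [_ ->] := is_derive_partial h.
rewrite (laplacian_radial x0 x dG) exprS -mulrN -!mulrA mulN1r -mulrN; congr (_ * _).
have E N M c : (N <= M)%N -> (forall i, (N <= i)%N -> c i = 0) -> forall s, ev N c g s = ev M c g s.
  move=> NM h s; rewrite /ev (big_ord_widen _ (fun i => (c i).[s] * g i s) NM).
  rewrite big_mkcond/=; apply: eq_bigr => i _; case: ltnP => // iN.
  by rewrite h// horner0 mul0r.
congr (- _).
rewrite /G mulnS add2n (E (2 * k).+2 (2 * k).+3 (jD (jlap n k)) (leqnSn _)); last first.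
  by move=> i ki; apply: (jD_supp (@jlap_supp n k)).
rewrite /ev !mulr_sumr -big_split/=; apply: eq_bigr => i _.
rewrite /jL !(hornerD, hornerM, hornerC, hornerX); ring.
Qed.

(** The polynomial coefficients are absorbed by lowering the exponential rate from a to b. *)
Lemma ev_bound N c (a b : R) : 0 < b -> b < a ->
  exists2 C : R, 0 <= C & forall (g : nat -> R -> R) (A s : R), 0 <= s ->
    (forall i, (i < N)%N -> `|g i s| <= A * expR (- (a * s))) -> `|ev N c g s| <= C * A * expR (- (b * s)).
Proof.
move=> b0 ba.
have /choice[C hC] : forall i : nat, exists C : R, 0 <= C /\ forall s, 0 <= s ->
    `|(c i).[s]| * expR (- ((a - b) * s)) <= C.
  move=> i; have [C1 C10 h1] := poly_bound (c i).
  have [C2 C20 h2] := @pow_exp_bound (size (c i)) (a - b) ltac:(lra).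
  exists (C1 * C2); split => [|s s0]; first exact: mulr_ge0.
  apply: le_trans (_ : (C1 * (1 + s) ^+ size (c i)) * expR (- ((a - b) * s)) <= _).
    by rewrite ler_wpM2r ?expR_ge0// h1.
  by rewrite -mulrA ler_wpM2l// h2.
exists (\sum_(i < N) C i); first by apply: sumr_ge0 => i _; case: (hC i).
move=> g A s s0 hg; rewrite /ev -mulrA mulr_suml.
apply: le_trans (ler_norm_sum _ _ _) _; apply: ler_sum => i _; rewrite normrM.
apply: le_trans (_ : `|(c i).[s]| * (A * expR (- (a * s))) <= _); first by rewrite ler_wpM2l// hg.
have A0 : 0 <= A by have := hg i (ltn_ord i) => /(le_trans (normr_ge0 _)); rewrite pmulr_lge0// expR_gt0.
rewrite (_ : - (a * s) = - ((a - b) * s) + - (b * s)) ?expRD; last by ring.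
rewrite (_ : `|(c i).[s]| * (A * _) = `|(c i).[s]| * expR (- ((a - b) * s)) * (A * expR (- (b * s)))); last by ring.
by rewrite ler_wpM2r ?mulr_ge0 ?expR_ge0//; case: (hC i) => _; apply.
Qed.

End Jets.

Section SmoothKernel.
Context (R : realType) (n : nat).

(* Taylor polynomial of s^(-q) at 1, used to extend the kernel smoothly to s < 1. *)
Lemma smooth_kernel (q : R) (m : nat) : 0 <= q -> exists k : 'rV[R]_n -> R,
  [/\ dec 0 m q k, forall z, k (- z) = k z & forall z, 1 <= sq z -> k z = sq z `^ (- q)].
Proof.
move=> q0; pose a (j : nat) : R := \prod_(i < j) (- (q + i%:R)).
have aS j : a j.+1 = a j * (- (q + j%:R)) by rewrite /a big_ord_recr.
(* The degree m + 1 makes the derivatives of both branches agree at 1 up to order m + 1, which is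
   what differentiability of [g j] for j <= m requires. *)
pose p : {poly R} := \poly_(i < m.+2) (a i / i`!%:R).
pose P j : {poly R} := (p^`(j)) \Po ('X - 1%:P).
have PS j : (P j)^`() = P j.+1 by rewrite /P deriv_comp derivB derivX derivC subr0 mulr1 -derivnS.
have P1 j : (j < m.+2)%N -> (P j).[1] = a j.
  move=> jm; rewrite /P horner_comp !hornerE subrr horner_coef0 coef_derivn addn0 ffactnn.
  by rewrite /p coef_poly jm -[LHS]mulr_natr mulfVK// pnatr_eq0 -lt0n fact_gt0.
pose f2 (j : nat) (s : R) := a j * s `^ (- q - j%:R).
pose g (j : nat) (s : R) := if s < 1 then (P j).[s] else f2 j s.
have d2 (j : nat) (s : R) : 1 <= s -> is_derive s 1 (f2 j) (f2 j.+1 s).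
  move=> s1; have s0 : 0 < s by exact: lt_le_trans s1.
  apply: (is_derive_val (is_deriveZ (a j) (is_derive1_powR (- q - j%:R) s0))).
  rewrite /GRing.scale/= /f2 aS mulrA (_ : - q - j%:R = - (q + j%:R)); last by ring.
  by congr (_ * _ `^ _); rewrite -natr1; ring.
have dg (j : nat) (s : R) : (j <= m)%N -> is_derive s 1 (g j) (g j.+1 s).
  move=> jm; apply: (@is_derive_glue R (horner (P j)) (f2 j) (horner (P j.+1)) (f2 j.+1)).
  - by move=> r _; apply: (is_derive_val (is_derive_poly (P j) r)); rewrite PS.
  - by rewrite P1 ?ltnS ?leqW// /f2 powR1 mulr1.
  - by rewrite P1 ?ltnS// /f2 powR1 mulr1.
exists (fun z => g 0%N (sq (z - 0))); split; last 2 first.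
- by move=> z; rewrite !subr0 sqN.
- by move=> z z1; rewrite subr0 /g ltNge z1/= /f2 /a big_ord0 mul1r subr0.
have := @dec_radial R n 0 m q g _ _ _ m 0%N; rewrite addr0 addn0; apply => //.
- by move=> j s jm _; apply: dg; exact: ltnW.
- move=> j jm s; apply: differentiable_continuous; apply/derivable1_diffP.
  by case: (dg j s jm).
move=> j jm; have [C C0 hC] := poly_bound (P j).
have qj0 : 0 <= q + j%:R by rewrite addr_ge0.
exists ((C * 2 ^+ size (P j) + `|a j|) * 2 `^ (q + j%:R)).
  by rewrite mulr_ge0 ?powR_ge0// addr_ge0// mulr_ge0// exprn_ge0.
move=> s s0; have s1 : 0 < 1 + s by rewrite ltr_wpDr.
rewrite powRN ler_pdivlMr ?powR_gt0//.
rewrite /g; case: ltP => s1'.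
  apply: ler_pM => //; first exact: powR_ge0.
    apply: (le_trans (hC s s0)); rewrite -[leLHS]addr0 lerD// ler_wpM2l//.
    by rewrite lerXn2r ?nnegrE ?(ltW s1)//; lra.
  by apply: ler_powR_base => //; [exact: ltW|lra].
have sp : 0 < s by lra.
rewrite /f2 normrM (ger0_norm (powR_ge0 _ _)) (_ : - q - j%:R = - (q + j%:R)); last by ring.
rewrite powRN -!mulrA; apply: ler_pM => //.
- by rewrite mulr_ge0 ?invr_ge0 ?powR_ge0.
- by rewrite lerDr mulr_ge0// exprn_ge0.
rewrite mulrC ler_pdivrMr ?powR_gt0// -powRM ?(ltW sp)//.
by apply: ler_powR_base => //; [exact: ltW|lra].
Qed.

End SmoothKernel.

(** * Compactly supported approximations of the Gaussian *)

Section TestFunctions.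
Context (R : realType).
Implicit Types (tau s x : R) (M i : nat).

Definition tgc tau M i : R := (- tau) ^+ i * ((M ^_ i)%:R / M%:R ^+ i).

(* i-th derivative of (1 - tau s / M)_+ ^ M, a compactly supported approximation of exp (- tau s) *)
Definition tg tau M i s : R :=
  if s < M%:R / tau then tgc tau M i * (1 - tau / M%:R * s) ^+ (M - i) else 0.

(** The condition i + 1 < M keeps the exponent M - i - 1 positive, so the function and its
    derivative both vanish at the cut and glue with 0. *)
Lemma is_derive_tg tau M i s : 0 < tau -> (i.+1 < M)%N ->
  is_derive s 1 (tg tau M i) (tg tau M i.+1 s).
Proof.
move=> tau0 iM; have M0 : 0 < M%:R :> R by rewrite ltr0n (leq_trans _ iM).
have MN : M%:R != 0 :> R by rewrite gt_eqF.
pose p : {poly R} := (1 - (tau / M%:R) *: 'X) ^+ (M - i).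
have pE r : p.[r] = (1 - tau / M%:R * r) ^+ (M - i) by rewrite /p !hornerE.
have z : 1 - tau / M%:R * (M%:R / tau) = 0 by field; rewrite MN gt_eqF.
apply: (@is_derive_glue R (fun r => tgc tau M i * (1 - tau / M%:R * r) ^+ (M - i)) (fun=> 0)
  (fun r => tgc tau M i.+1 * (1 - tau / M%:R * r) ^+ (M - i.+1)) (fun=> 0)).
- move=> r _; under eq_fun do rewrite -pE.
  apply: (is_derive_val (is_deriveZ (tgc tau M i) (is_derive_poly p r))).
  rewrite /GRing.scale/= /p deriv_exp hornerMn hornerM derivB derivC derivZ derivX sub0r.
  rewrite alg_polyC hornerN hornerC horner_exp -polyC1 !(hornerD, hornerN, hornerZ, hornerC, hornerX).
  rewrite -subnS /tgc ffactnSr natrM -[_ *+ (M - i)]mulr_natr.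
  move: ((M - i)%:R : R) => Mi.
  rewrite !exprS; field; rewrite MN/= expf_neq0//.
- by rewrite z expr0n subn_eq0 leqNgt (ltnW iM)/= mulr0.
- by rewrite z expr0n subn_eq0 leqNgt iM/= mulr0.
Qed.

Lemma ffact_le M i : (M ^_ i <= M ^ i)%N.
Proof. by elim: i => // i IH; rewrite ffactnSr expnSr leq_mul// leq_subr. Qed.

Lemma tgc_le tau M i : 0 < tau -> `|tgc tau M i| <= tau ^+ i.
Proof.
move=> tau0; rewrite /tgc normrM normrX normrN (gtr0_norm tau0) ler_piMr ?exprn_ge0 ?(ltW tau0)//.
rewrite ger0_norm ?divr_ge0 ?exprn_ge0//; case: M => [|M].
  by case: i => [|i]; rewrite ?ffactn0 ?expr0 ?divr1// ffact0n mul0r.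
by rewrite ler_pdivrMr ?exprn_gt0// mul1r -natrX ler_nat ffact_le.
Qed.

(** From 1 - y <= exp(-y). The remaining power M - i is at least M/2, which leaves half the rate
    tau, with a constant independent of M. *)
Lemma tg_bound tau M i s : 0 < tau -> (2 * i <= M)%N -> 0 <= s ->
  `|tg tau M i s| <= tau ^+ i * expR (- (tau / 2 * s)).
Proof.
move=> tau0 iM s0; rewrite /tg; case: ltP => [sM|_]; last first.
  by rewrite normr0 mulr_ge0 ?expR_ge0// exprn_ge0// ltW.
have M0 : 0 < M%:R :> R by rewrite -(pmulr_lgt0 _ (_ : 0 < tau^-1)) ?invr_gt0// (le_lt_trans s0).
have y0 : 0 <= 1 - tau / M%:R * s by rewrite subr_ge0 mulrAC ler_pdivrMr// mul1r mulrC -ler_pdivlMr// ltW.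
rewrite normrM ler_pM//; first exact: tgc_le.
rewrite ger0_norm ?exprn_ge0//.
apply: (@le_trans _ _ (expR (- (tau / M%:R * s)) ^+ (M - i))).
  by rewrite lerXn2r ?nnegrE ?expR_ge0// expR_ge1Dx.
rewrite -expRM_natr ler_expR mulNr lerN2 [leRHS]mulrAC ler_wpM2r//.
rewrite -!mulrA ler_wpM2l ?(ltW tau0)// mulrC ler_pdivlMr// natrB; last first.
  by apply: leq_trans iM; rewrite leq_pmull.
have : (2 * i)%:R <= M%:R :> R by rewrite ler_nat.
by rewrite natrM; lra.
Qed.

Lemma tg_supp tau M i s : M%:R / tau <= s -> tg tau M i s = 0.
Proof. by move=> h; rewrite /tg ltNge h. Qed.

Lemma cvg_natV : (m%:R^-1 : R) @[m --> \oo] --> (0 : R).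
Proof. by rewrite -(cvg_shiftS (fun m => m%:R^-1 : R)); exact: cvg_natSinv. Qed.

Lemma cvg_tgc tau i : tgc tau M i @[M --> \oo] --> (- tau) ^+ i.
Proof.
rewrite -[X in _ --> X]mulr1; apply: cvgMr; elim: i => [|i IH].
  by under eq_fun do rewrite ffactn0 expr0 divr1; exact: cvg_cst.
have h : ((M ^_ i)%:R / M%:R ^+ i) * (1 - i%:R * M%:R^-1) @[M --> \oo] --> (1 : R).
  rewrite -[X in _ --> X]mulr1; apply: cvgM => //.
  rewrite -[X in _ --> X]subr0; apply: cvgB; first exact: cvg_cst.
  rewrite -(mulr0 i%:R); apply: cvgMr; exact: cvg_natV.
apply: cvg_trans h; apply: near_eq_cvg; near=> M.
have iM : (i < M)%N by near: M; exact: nbhs_infty_gt.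
have M0 : M%:R != 0 :> R by rewrite pnatr_eq0 -lt0n (leq_trans _ iM).
rewrite ffactnSr natrM natrB ?(ltnW iM)// exprSr; field.
by rewrite M0 expf_neq0.
Unshelve. all: by end_near. Qed.

(** Squeezed between exp(-x/(1 - x/M)) and exp(-x (1 - i/M)); both bounds come from 1 + y <= exp
    y. *)
Lemma cvg_exp_lim x i : 0 <= x -> (1 - x / M%:R) ^+ (M - i) @[M --> \oo] --> expR (- x).
Proof.
move=> x0.
have h1 : expR (- (x * (1 - i%:R * M%:R^-1))) @[M --> \oo] --> expR (- x).
  apply: (cvg_comp _ expR); last exact: continuous_expR.
  apply: cvgN; rewrite -[X in _ --> X]mulr1; apply: cvgMr.
  rewrite -[X in _ --> X]subr0; apply: cvgB; first exact: cvg_cst.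
  rewrite -(mulr0 i%:R); apply: cvgMr; exact: cvg_natV.
have h2 : expR (- (x * (1 - x * M%:R^-1)^-1)) @[M --> \oo] --> expR (- x).
  apply: (cvg_comp _ expR); last exact: continuous_expR.
  apply: cvgN; rewrite -[X in _ --> X]mulr1; apply: cvgMr.
  rewrite -[X in _ --> X]invr1; apply: cvgV; first exact: oner_neq0.
  rewrite -[X in _ --> X]subr0; apply: cvgB; first exact: cvg_cst.
  rewrite -(mulr0 x); apply: cvgMr; exact: cvg_natV.
apply: squeeze_cvgr h2 h1; near=> M.
have iM : (i < M)%N by near: M; exact: nbhs_infty_gt.
have xM : x < M%:R by near: M; exact: nbhs_infty_gtr.
have M0 : 0 < M%:R :> R by exact: le_lt_trans xM.
have y0 : 0 < 1 - x / M%:R by rewrite subr_gt0 ltr_pdivrMr// mul1r.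
apply/andP; split; last first.
  apply: (@le_trans _ _ (expR (- (x / M%:R)) ^+ (M - i))).
    by rewrite lerXn2r ?nnegrE ?expR_ge0 ?(ltW y0)// expR_ge1Dx.
  rewrite -expRM_natr natrB ?(ltnW iM)// ler_expR le_eqVlt; apply/orP; left; apply/eqP.
  by field; rewrite gt_eqF.
apply: (@le_trans _ _ ((1 - x / M%:R) ^+ M)); last first.
  by rewrite ler_wiXn2l ?leq_subr ?(ltW y0)// gerBl divr_ge0// ltW.
rewrite -[leRHS]invrK -exprVn expRN lef_pV2 ?posrE ?expR_gt0 ?exprn_gt0 ?invr_gt0//.
apply: (@le_trans _ _ (expR (x / M%:R / (1 - x / M%:R)) ^+ M)).
  rewrite lerXn2r ?nnegrE ?expR_ge0 ?invr_ge0 ?(ltW y0)//.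
  apply: le_trans (expR_ge1Dx _); rewrite le_eqVlt; apply/orP; left; apply/eqP.
  by field; rewrite ?gt_eqF// ?subr_gt0// andbT.
rewrite -expRM_natr ler_expR le_eqVlt; apply/orP; left; apply/eqP.
by field; rewrite ?gt_eqF// ?subr_gt0// andbT.
Unshelve. all: by end_near. Qed.

Lemma cvg_tg tau i s : 0 < tau -> 0 <= s -> tg tau M i s @[M --> \oo] --> (- tau) ^+ i * expR (- (tau * s)).
Proof.
move=> tau0 s0.
have h : tgc tau M i * (1 - (tau * s) / M%:R) ^+ (M - i) @[M --> \oo] --> (- tau) ^+ i * expR (- (tau * s)).
  by apply: cvgM; [exact: cvg_tgc|apply: cvg_exp_lim; rewrite mulr_ge0// ltW].
apply: cvg_trans h; apply: near_eq_cvg; near=> M.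
have xM : tau * s < M%:R by near: M; exact: nbhs_infty_gtr.
by rewrite /tg ltr_pdivlMr// [s * tau]mulrC xM [tau / _ * s]mulrAC.
Unshelve. all: by end_near. Qed.

End TestFunctions.

(** * Integration by parts and duality *)

Section Green.
Context (R : realType) (n : nat).
Notation mu := (leb R n).
Notation nu := (n%:R / 2 : R).
Implicit Types (x y z c : 'rV[R]_n) (f g h u phi psi : 'rV[R]_n -> R) (i : 'I_n) (m : nat) (r : R).

Lemma smooth_D1 m f : smooth m.+1 f -> D1 f.
Proof. by move=> [_ []]. Qed.

Lemma smooth_partial m f i : smooth m.+1 f -> smooth m (partial i f).
Proof. by move=> [_ [_]]; apply. Qed.

Lemma partial_supp f i (rho : R) : (forall x, rho < sq x -> f x = 0) ->
  forall x, rho < sq x -> partial i f x = 0.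
Proof.
move=> f0 x xr; rewrite /partial (@near_eq_derive _ _ _ f (fun=> 0)) ?derive_cst//.
have : nbhs x (@sq R n @^-1` [set r | rho < r]).
  apply: open_nbhs_nbhs; split => //; apply: open_comp; last exact: open_gt.
  by move=> y _; exact: continuous_sq.
by apply: filterS => y; exact: f0.
Qed.

Lemma neg_laplacian_supp f (rho : R) : (forall x, rho < sq x -> f x = 0) ->
  forall x, rho < sq x -> neg_laplacian f x = 0.
Proof.
move=> f0 x xr; rewrite /neg_laplacian /laplacian big1 ?oppr0// => i _.
exact: (partial_supp i (partial_supp i f0) xr).
Qed.

Lemma L1_cont_supp f (rho : R) : continuous f -> (forall x, rho < sq x -> f x = 0) -> L1 mu f.
Proof.
move=> cf f0; have [M _ hM] := continuous_bounded_sq rho cf.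
exact: L1_bounded_supp (continuous_measurable_row cf) hM f0.
Qed.

(** Each partial derivative of f_i phi - f phi_i, taken in direction i, has integral 0 by
    [integral_partial_eq0]; their sum is the difference of the two integrands up to sign. *)
Lemma green1 f phi (rho : R) : smooth 2 f -> smooth 2 phi -> (forall x, rho < sq x -> phi x = 0) ->
  \int[mu]_x (neg_laplacian f x * phi x) = \int[mu]_x (f x * neg_laplacian phi x).
Proof.
move=> sf sp p0.
have cf := smooth_cont sf; have cp := smooth_cont sp.
have df := smooth_D1 sf; have dp := smooth_D1 sp.
have sf1 i := smooth_partial i sf; have sp1 i := smooth_partial i sp.
have c1 i := smooth_cont (sf1 i); have c2 i := smooth_cont (sp1 i).
have d1 i := smooth_D1 (sf1 i); have d2 i := smooth_D1 (sp1 i).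
have c11 i := smooth_cont (smooth_partial i (sf1 i)).
have c22 i := smooth_cont (smooth_partial i (sp1 i)).
pose h i x := partial i f x * phi x + (-1) * (f x * partial i phi x).
have h0 i x : rho < sq x -> h i x = 0 by move=> xr; rewrite /h p0// (partial_supp i p0 xr) !mulr0 addr0.
have d1p i := D1M (d1 i) dp; have d2p i := D1M df (d2 i).
have dh i : D1 (h i) := D1D (d1p i) (@D1Z R n (-1) _ (d2p i)).
have ph i : partial i (h i) = fun x => partial i (partial i f) x * phi x + (-1) * (f x * partial i (partial i phi) x).
  rewrite /h (partialD i (d1p i) (@D1Z R n (-1) _ (d2p i))) (partialZ i _ (d2p i)).
  rewrite (partialM i (d1 i) dp) (partialM i df (d2 i)).
  apply/funext => x; move: (partial i f x * partial i phi x) (partial i (partial i f) x * phi x).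
  by move: (f x * partial i (partial i phi) x) => a b c; ring.
have cc i : continuous (fun x => partial i (partial i f) x * phi x + (-1) * (f x * partial i (partial i phi) x)).
  by apply: continuousDf; [exact: continuousMf|apply: continuousZf; exact: continuousMf].
have E i : \int[mu]_x (partial i (partial i f) x * phi x + (-1) * (f x * partial i (partial i phi) x)) = 0.
  have hc : continuous (h i) := continuousDf (continuousMf (c1 i) cp) (@continuousZf R n (-1) _ (continuousMf cf (c2 i))).
  have hp : continuous (partial i (h i)) by rewrite ph; exact: cc.
  by have := @integral_partial_eq0 R n (h i) i rho (dh i) hc hp (h0 i); rewrite ph.
have La : L1 mu (fun x => neg_laplacian f x * phi x).
  apply: (@L1_cont_supp _ rho (continuousMf (smooth_cont (@smooth_neg_laplacian R n 0 f sf)) cp)).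
  by move=> x xr; rewrite p0// mulr0.
have Lb : L1 mu (fun x => f x * neg_laplacian phi x).
  apply: (@L1_cont_supp _ rho (continuousMf cf (smooth_cont (@smooth_neg_laplacian R n 0 phi sp)))).
  by move=> x xr; rewrite (neg_laplacian_supp p0)// mulr0.
apply/eqP; rewrite -subr_eq0 -(RIB La Lb).
have -> : \int[mu]_x (neg_laplacian f x * phi x - f x * neg_laplacian phi x) =
   \int[mu]_x (\sum_i ((-1) * (partial i (partial i f) x * phi x + (-1) * (f x * partial i (partial i phi) x)))).
  apply: eq_Rintegral => x _; rewrite /neg_laplacian /laplacian mulNr mulrN opprK mulr_suml mulr_sumr.
  rewrite -sumrN -big_split/=; apply: eq_bigr => i _.
  by move: (partial i (partial i f) x * phi x) (f x * partial i (partial i phi) x) => a b; ring.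
have Lc i : L1 mu (fun x => partial i (partial i f) x * phi x + (-1) * (f x * partial i (partial i phi) x)).
  apply: (@L1_cont_supp _ rho (cc i)) => x xr.
  by rewrite p0// (partial_supp i (partial_supp i p0) xr) !mulr0 addr0.
rewrite (RI_sum _ (fun i => L1Z (-1) (Lc i))).
by rewrite big1// => i _; rewrite (RIZ _ (Lc i)) E mulr0.
Qed.

Lemma green k f phi (rho : R) : smooth (2 * k) f -> smooth (2 * k) phi -> (forall x, rho < sq x -> phi x = 0) ->
  \int[mu]_x (iter k (@neg_laplacian R n) f x * phi x) = \int[mu]_x (f x * iter k (@neg_laplacian R n) phi x).
Proof.
elim: k f phi => [//|k IH] f phi sf sp p0.
have sm (g : 'rV[R]_n -> R) : smooth (2 * k.+1) g -> smooth (2 * k + 2) g by rewrite mulnS addnC.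
have sN : smooth (2 * k) (neg_laplacian phi) by apply: smooth_neg_laplacian; have := sm _ sp; rewrite addn2.
have s2 : smooth 2 phi.
  have smo (a b : nat) (g : 'rV[R]_n -> R) : (a <= b)%N -> smooth b g -> smooth a g.
    by elim: b => [|b IHb]; [case: a|rewrite leq_eqVlt => /predU1P[->//|/IHb h /smoothS/h]].
  by apply: smo sp; rewrite mulnS leq_addr.
have sf2 : smooth (2 * k) f by have := sm _ sf; rewrite addn2 => /smoothS/smoothS.
have s2' : smooth 2 (iter k (@neg_laplacian R n) f) := smooth_iter_neg_laplacian (sm _ sf).
have e1 := green1 s2' s2 p0.
have e2 := IH f _ sf2 sN (neg_laplacian_supp p0).
by rewrite iterS iterSr e1 e2.
Qed.

End Green.

Section TestBound.
Context (R : realType) (n : nat).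
Notation mu := (leb R n).
Notation nu := (n%:R / 2 : R).
Implicit Types (x y z c : 'rV[R]_n) (u psi : 'rV[R]_n -> R) (r : R).
Context (th d : R) (th0 : 0 < th) (d0 : 0 < d) (dn : d < nu) (thd : th + d <= 1).
Notation q := (nu + th).
Notation K := (@rker R n th).

(* What is used of a rapidly decreasing test function centred at c *)
Definition test_bound (A b : R) c psi : Prop := [/\ continuous psi,
  forall x, `|psi x| <= A * expR (- (b * sq (x - c))) &
  forall x z, sq z <= 1 -> `|dd psi x z| <= A * sq z * expR (- (b * sq (x - c)))].

(** A majorant of second difference times kernel, built so that its integral in z is a constant
    times the weight at x - c, with the same constant for all centres ([RI_tmaj]). *)
Definition tmaj (b : R) c x z : R := om q (x - c) *
  (kmaj th d z + (expR (- (b / 2 * sq (x - c + z))) + expR (- (b / 2 * sq (x - c - z))))).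

Lemma pow_exp_le (a p : R) : 0 < a -> 0 <= p -> exists2 C : R, 0 <= C & forall s : R, 0 <= s ->
  (1 + s) `^ p * expR (- (a * s)) <= C.
Proof.
move=> a0 p0; exists (expR a * a `^ (- p) * p `^ p); first by rewrite !mulr_ge0 ?expR_ge0 ?powR_ge0.
move=> s s0; have s1 : 0 <= 1 + s by rewrite addr_ge0.
have := @powR_expR_le R p (a * (1 + s)) p0; rewrite mulr_ge0 ?(ltW a0)// => /(_ isT).
rewrite powRM ?(ltW a0)// => h.
rewrite (_ : - (a * s) = a + - (a * (1 + s))) ?expRD; last by ring.
rewrite mulrCA -mulrA ler_wpM2l ?expR_ge0// powRN ler_pdivlMl ?powR_gt0//.
by rewrite mulrA.
Qed.

Lemma exp_le_om (b : R) : 0 < b -> exists2 C : R, 0 <= C & forall x, expR (- (b * sq x)) <= C * om q x.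
Proof.
move=> b0; have q0 := q_gt0 n th0.
have [C C0 hC] := pow_exp_le b0 (ltW q0); exists C => // x.
by rewrite omE ler_pdivlMr ?powR_gt0 ?sq1_gt0// mulrC hC// sq_ge0.
Qed.

(** For |z| <= 1 the factor |z|^2 is at most |z|^(2 (th + d)), since th + d <= 1. For |z| > 1 the
    three values of [psi] are bounded separately; the shifted ones give up half of their exponential
    rate, and Peetre's inequality moves the weight to x - c. *)
Lemma test_bound_le (b : R) : 0 < b -> exists2 C : R, 0 <= C & forall (A : R) c psi, test_bound A b c psi ->
  forall x z, `|dd psi x z * K z| <= C * A * tmaj b c x z.
Proof.
move=> b0; have q0 := q_gt0 n th0.
have [C1 C10 h1] := exp_le_om b0.
have [C2 C20 h2] : exists2 C : R, 0 <= C & forall s : R, 0 <= s ->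
    (1 + s) `^ q * expR (- (b / 2 * s)) <= C.
  by apply: pow_exp_le; [rewrite divr_gt0|exact: ltW].
pose C3 := 2 `^ q * 2 `^ q * C2.
have C30 : 0 <= C3 by rewrite !mulr_ge0 ?powR_ge0.
exists (2 * C1 + C3); first by rewrite addr_ge0 ?mulr_ge0.
move=> A c psi [_ hA hdd] x z.
have A0 : 0 <= A by have := le_trans (normr_ge0 _) (hA x); rewrite pmulr_lge0 ?expR_gt0.
have k0 := @kmaj_ge0 R n th d z; have o0 := om_gt0 q (x - c).
rewrite normrM (ger0_norm (rker_ge0 _ _)) /tmaj.
set e1 := expR (- (b / 2 * sq (x - c + z))); set e2 := expR (- (b / 2 * sq (x - c - z))).
have e10 : 0 <= e1 by exact: expR_ge0.
have e20 : 0 <= e2 by exact: expR_ge0.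
have hb := h1 (x - c).
have [z1|z1] := leP (sq z) 1.
  apply: (@le_trans _ _ (A * (C1 * om q (x - c)) * kmaj th d z)).
    apply: (@le_trans _ _ (A * expR (- (b * sq (x - c))) * (sq z * K z))).
      by rewrite mulrA ler_wpM2r ?rker_ge0// (le_trans (hdd x z z1))// mulrAC.
    apply: ler_pM; rewrite ?mulr_ge0 ?expR_ge0 ?sq_ge0 ?rker_ge0//; first by rewrite ler_wpM2l.
    apply: le_trans (kmaj_near th0 d0 z1); rewrite ler_wpM2r ?rker_ge0//.
    have := sq_ge0 z; rewrite le_eqVlt => /predU1P[<-|sz]; first exact: powR_ge0.
    by rewrite -{1}(powRr1 (ltW sz)) /powR gt_eqF// ler_expR ler_wnM2r// ln_le0.
  rewrite (_ : A * _ * _ = (C1 * A) * (om q (x - c) * kmaj th d z)); last by ring.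
  apply: ler_pM; rewrite ?mulr_ge0 ?(ltW o0)//.
    by rewrite ler_wpM2r//; lra.
  by rewrite ler_wpM2l ?(ltW o0)// lerDl addr_ge0.
have Kz : K z <= 2 `^ q * om q z by have := rker_far th0 ltr01 (ltW z1); rewrite invr1.
have kz : K z <= kmaj th d z by apply: kmaj_far; [exact: ltW|exact: ltW].
have far (w : 'rV[R]_n) : om q w = om q z ->
    `|psi (x + w)| * K z <= C3 * A * (om q (x - c) * expR (- (b / 2 * sq (x - c + w)))).
  move=> wz; apply: (@le_trans _ _ ((A * expR (- (b * sq (x - c + w)))) *
     (2 `^ q * (2 `^ q * (1 + sq (x - c + w)) `^ q * om q (x - c))))).
    apply: ler_pM; rewrite ?rker_ge0//; first by have := hA (x + w); rewrite addrAC.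
    apply: (le_trans Kz); rewrite ler_wpM2l ?powR_ge0// -wz.
    have := @om_peetre R n q (c - x) (x - c + w) (ltW q0).
    by rewrite addrA subrKA subrr add0r -[c - x]opprB omN.
  rewrite (_ : b * sq _ = b / 2 * sq (x - c + w) + b / 2 * sq (x - c + w)); last by field.
  rewrite opprD expRD /C3.
  rewrite (_ : A * _ * _ = (2 `^ q * 2 `^ q * ((1 + sq (x - c + w)) `^ q * expR (- (b / 2 * sq (x - c + w))))) *
     (A * (om q (x - c) * expR (- (b / 2 * sq (x - c + w)))))); last by ring.
  rewrite -[leRHS]mulrA ler_wpM2r ?mulr_ge0 ?expR_ge0 ?(ltW o0)//.
  by rewrite ler_wpM2l ?mulr_ge0 ?powR_ge0// h2 ?sq_ge0.
have f1 := far z erefl; have f2 := far (- z) (omN _ _).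
have p0 : 2 * `|psi x| * K z <= 2 * C1 * A * (om q (x - c) * kmaj th d z).
  rewrite (_ : 2 * C1 * A * _ = (2 * (A * (C1 * om q (x - c)))) * kmaj th d z); last by ring.
  apply: ler_pM; rewrite ?mulr_ge0 ?rker_ge0// ler_wpM2l//.
  by apply: (le_trans (hA x)); rewrite ler_wpM2l.
have t1 : `|dd psi x z| <= 2 * `|psi x| + `|psi (x + z)| + `|psi (x + - z)|.
  rewrite /dd (le_trans (ler_normB _ _))// lerD2r (le_trans (ler_normB _ _))// lerD2r.
  by rewrite normrM ger0_norm.
have t2 := ler_wpM2r (rker_ge0 th z) t1.
have : 0 <= C3 * A * (om q (x - c) * kmaj th d z) by rewrite !mulr_ge0 ?(ltW o0).
have : 0 <= 2 * C1 * A * (om q (x - c) * (e1 + e2)) by rewrite !mulr_ge0 ?(ltW o0) ?addr_ge0.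
move: p0 f1 f2 t2; rewrite -/e1 -/e2 !mulrDr !mulrDl; move: (om q (x - c)) => o; lra.
Qed.

Lemma L1_gauss_shift (b : R) c : 0 < b -> L1 mu (fun z => expR (- (b * sq (c + z)))).
Proof.
move=> b0; have [C C0 hC] := exp_le_om b0.
have := L1_shift c (L1Z C (L1_om_q n th0)); apply: L1_le.
  by mfun.
by move=> z; rewrite ger0_norm ?expR_ge0// [c + z]addrC.
Qed.

Lemma L1_gauss_reflect (b : R) c : 0 < b -> L1 mu (fun z => expR (- (b * sq (c - z)))).
Proof.
move=> b0; have := L1_reflect 0 (L1_gauss_shift c b0).
by under eq_fun do rewrite sub0r.
Qed.

Lemma L1_tmaj (b : R) c x : 0 < b -> L1 mu (tmaj b c x).
Proof.
move=> b0; have b2 : 0 < b / 2 by rewrite divr_gt0.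
by apply: L1Z; apply: L1D; [exact: L1_kmaj|apply: L1D; [exact: L1_gauss_shift|exact: L1_gauss_reflect]].
Qed.

Lemma RI_tmaj (b : R) : 0 < b -> exists2 I : R, 0 <= I & forall c x, \int[mu]_z tmaj b c x z = I * om q (x - c).
Proof.
move=> b0; have b2 : 0 < b / 2 by rewrite divr_gt0.
exists (\int[mu]_z kmaj th d z + (\int[mu]_z expR (- (b / 2 * sq z)) + \int[mu]_z expR (- (b / 2 * sq z)))).
  by rewrite !addr_ge0// RI_ge0// => z; rewrite ?expR_ge0// kmaj_ge0.
move=> c x; have L1a := L1_gauss_shift (x - c) b2; have L1b := L1_gauss_reflect (x - c) b2.
have Lk := L1_kmaj th0 d0 dn.
have L0 := L1_gauss_shift 0 b2.
have e0 : \int[mu]_z expR (- (b / 2 * sq (0 + z))) = \int[mu]_z expR (- (b / 2 * sq z)).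
  by apply: eq_Rintegral => z _; rewrite add0r.
have e1 : \int[mu]_z expR (- (b / 2 * sq (x - c + z))) = \int[mu]_z expR (- (b / 2 * sq z)).
  rewrite -e0 -(RI_shift (x - c) (L1_meas L0)); apply: eq_Rintegral => z _.
  by rewrite add0r [z + _]addrC.
have e2 : \int[mu]_z expR (- (b / 2 * sq (x - c - z))) = \int[mu]_z expR (- (b / 2 * sq z)).
  by rewrite -e0 -(RI_reflect (x - c) (L1_meas L0)); apply: eq_Rintegral => z _; rewrite add0r.
rewrite /tmaj (RIZ _ (L1D Lk (L1D L1a L1b))) (RID Lk (L1D L1a L1b)) (RID L1a L1b) e1 e2.
by rewrite mulrC.
Qed.

End TestBound.

Section FubiniFatou.
Context (R : realType).

Lemma fubini_fin (d1 d2 : measure_display) (T1 : measurableType d1) (T2 : measurableType d2)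
   (m1 : {sigma_finite_measure set T1 -> \bar R}) (m2 : {sigma_finite_measure set T2 -> \bar R})
   (f : T1 * T2 -> R) (g : T1 -> R) : mfunT f -> L1 m1 g ->
  (forall x, L1 m2 (fun y => f (x, y))) -> (forall x, \int[m2]_y `|f (x, y)| <= g x) ->
  (\int[m1]_x \int[m2]_y `|f (x, y)|%:E < +oo)%E.
Proof.
move=> mf Lg Lf fg.
have g0 x : 0 <= g x by apply: le_trans (fg x); apply: RI_ge0.
have mE : mfunT (fun p : T1 * T2 => `|f p|%:E) by mfun.
apply: (@le_lt_trans _ _ (\int[m1]_x (g x)%:E)%E); last first.
  by rewrite (L1_EFin Lg) ltry.
apply: ge0_le_integral => //.
- by move=> x _; exact: integral_ge0.
- exact: (@measurable_fun_fubini_tonelli_F _ _ _ _ _ m2 (fun p => `|f p|%:E) mE).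
- by mfun.
- by move=> x _; rewrite (L1_EFin (L1_norm (Lf x))) lee_fin.
Qed.

Lemma cvg_EFin_seq (v : nat -> R) (l : R) : v k @[k --> \oo] --> l -> (v k)%:E @[k --> \oo] --> l%:E.
Proof. by move=> h P /= /nbhs_EFin /h. Qed.

(** For limits that nothing dominates: with nonnegative functions, convergence of the integrals
    already yields integrability of the limit. *)
Lemma fatou_L1 (dd : measure_display) (T : measurableType dd) (m : {measure set T -> \bar R})
    (f_ : nat -> T -> R) (f : T -> R) (l : R) : (forall k, L1 m (f_ k)) ->
  (forall k x, 0 <= f_ k x) -> (forall x, f_ k x @[k --> \oo] --> f x) ->
  \int[m]_x f_ k x @[k --> \oo] --> l -> L1 m f.
Proof.
move=> Lf f0 cf cl.
have mf : mfunT f.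
  apply: (@measurable_fun_cvg _ _ _ _ f_ f) => //; first by move=> k; exact: L1_meas.
have fx0 x : 0 <= f x by apply: (@cvgr_to_ge _ _ _ _ (fun k => f_ k x) (f x) 0 (cf x)); exact: nearW.
apply/(ge0_L1_EFin _ mf fx0).
have := @fatou _ _ _ m setT measurableT (fun k x => (f_ k x)%:E).
have -> : (fun x : T => limn_einf (fun k => (f_ k x)%:E)) = (fun x => (f x)%:E).
  apply/funext => x; have c1 := cvg_EFin_seq (cf x).
  by rewrite (@cvg_limn_einf_sup _ _ _ c1).1.
move=> h; apply: (le_lt_trans (h _ _)).
- by move=> k; apply/measurable_EFinP; exact: L1_meas.
- by move=> k x _; rewrite lee_fin.
have -> : (fun k => \int[m]_x (f_ k x)%:E)%E = (fun k => (\int[m]_x f_ k x)%:E).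
  by apply/funext => k; rewrite L1_EFin.
have c2 := cvg_EFin_seq cl.
by rewrite (@cvg_limn_einf_sup _ _ _ c2).1 ltry.
Qed.

End FubiniFatou.

Section WeakForm.
Context (R : realType) (n : nat).
Notation mu := (leb R n).
Notation nu := (n%:R / 2 : R).
Implicit Types (x y z c : 'rV[R]_n) (u psi : 'rV[R]_n -> R) (r : R).

Section Duality.
Context (th d : R) (th0 : 0 < th) (d0 : 0 < d) (dn : d < nu) (thd : th + d <= 1).
Notation q := (nu + th).
Notation K := (@rker R n th).
Context (u : 'rV[R]_n -> R).
Hypothesis cu : continuous u.
Hypothesis Lu : L1 mu (fun y => u y * om q y).
Hypothesis ru : Reg (th + d) 0 u.

Lemma RI_dd_transpose psi z (rho : R) : continuous psi -> (forall x, rho < sq x -> psi x = 0) ->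
  \int[mu]_x (dd u x z * psi x) = \int[mu]_x (u x * dd psi x z).
Proof.
move=> cp p0.
have L (w : 'rV[R]_n) : L1 mu (fun x => u (x + w) * psi x).
  have h1 : continuous (fun x => u (x + w) * psi x) := continuousMf (@continuous_rowshift R n u w cu) cp.
  by apply: (L1_cont_supp h1 (rho := rho)) => x xr; rewrite p0// mulr0.
have L' w : L1 mu (fun x => u x * psi (x - w)) by have := L1_shift (- w) (L w); under eq_fun do rewrite subrK.
have E w : \int[mu]_x (u (x + w) * psi x) = \int[mu]_x (u x * psi (x - w)).
  by rewrite -(RI_shift (- w) (L1_meas (L w))); apply: eq_Rintegral => x _; rewrite subrK.
have L0 : L1 mu (fun x => 2 * (u x * psi x)) by apply: L1Z; have := L 0; under eq_fun do rewrite addr0.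
have -> : \int[mu]_x (dd u x z * psi x) =
   \int[mu]_x (2 * (u x * psi x) - u (x + z) * psi x - u (x + - z) * psi x).
  by apply: eq_Rintegral => x _; rewrite /dd; ring.
have -> : \int[mu]_x (u x * dd psi x z) =
   \int[mu]_x (2 * (u x * psi x) - u x * psi (x - - z) - u x * psi (x - z)).
  by apply: eq_Rintegral => x _; rewrite /dd opprK; ring.
rewrite (RIB (L1B L0 (L z)) (L (- z))) (RIB L0 (L z)) (RIB (L1B L0 (L' (- z))) (L' z)) (RIB L0 (L' (- z))).
by rewrite (E z) (E (- z)); ring.
Qed.

Lemma L1_u_om c : L1 mu (fun x => u x * om q (x - c)).
Proof.
have q0 := q_gt0 n th0.
apply: (L1_le _ _ (L1Z (2 `^ q * (1 + sq c) `^ q) (L1_norm Lu))).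
  by mfun.
move=> x; rewrite !normrM mulrCA ler_wpM2l// !ger0_norm ?(ltW (om_gt0 _ _))//.
by have := om_peetre x (- c) (ltW q0); rewrite sqN.
Qed.

(** For fixed z the second difference is symmetric under the integral in x, by translation; Fubini
    on both sides transfers this to the kernel. The bounded support of [psi] makes the left double
    integral finite, the fractional Laplacian of u being controlled only locally. *)
Lemma duality (A b : R) c psi (rho : R) : 0 < b -> test_bound A b c psi ->
  (forall x, rho < sq x -> psi x = 0) ->
  \int[mu]_x ((\int[mu]_z (dd u x z * K z)) * psi x) = \int[mu]_x (u x * \int[mu]_z (dd psi x z * K z)).
Proof.
move=> b0 tb p0; have [cp _ _] := tb.
have q0 := q_gt0 n th0.
have mU := measurable_u cu; have mp := continuous_measurable_row cp.
have mK : mfunT (fun p : 'rV[R]_n * 'rV[R]_n => K p.2) by mfun.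
pose f1 (p : 'rV[R]_n * 'rV[R]_n) := dd u p.1 p.2 * K p.2 * psi p.1.
pose f2 (p : 'rV[R]_n * 'rV[R]_n) := u p.1 * (dd psi p.1 p.2 * K p.2).
have mf1 : mfunT f1 by mfun.
have mf2 : mfunT f2 by mfun.
have Ld x := L1_ddrker th0 d0 dn cu Lu ru x.
have [M M0 hM] := RI_ddrker_bound th0 d0 dn cu Lu ru rho.
have Lp := L1_cont_supp cp p0.
have L1f1 x : L1 mu (fun z => f1 (x, z)) by have := L1Z (psi x) (Ld x); under eq_fun do rewrite mulrC.
have fin1 : (\int[mu]_x \int[mu]_z `|f1 (x, z)|%:E < +oo)%E.
  apply: (@fubini_fin R _ _ _ _ mu mu f1 (fun x => M * `|psi x|)) => //; first exact/L1Z/L1_norm.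
  move=> x; rewrite /f1/=; under eq_Rintegral do rewrite normrM mulrC.
  rewrite (RIZ _ (L1_norm (Ld x))) mulrC.
  have [xr|xr] := leP (sq x) rho; first by rewrite ler_wpM2r// hM.
  by rewrite p0// normr0 !mulr0.
have [C C0 hC] := @test_bound_le R n th d th0 d0 thd b b0.
have hb := hC _ _ _ tb.
have [I I0 hI] := RI_tmaj th0 d0 dn b0.
have Lt x := L1_tmaj th0 d0 dn c x b0.
have Lpd x : L1 mu (fun z => dd psi x z * K z).
  apply: (L1_le _ (hb x) (L1Z (C * A) (Lt x))).
  by mfun.
have fin2 : (\int[mu]_x \int[mu]_z `|f2 (x, z)|%:E < +oo)%E.
  apply: (@fubini_fin R _ _ _ _ mu mu f2 (fun x => C * A * I * `|u x * om q (x - c)|)) => //.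
  - by apply/L1Z/L1_norm; exact: L1_u_om.
  - by move=> x; exact: (L1Z (u x) (Lpd x)).
  move=> x; rewrite /f2/=; under eq_Rintegral do rewrite normrM.
  rewrite (RIZ _ (L1_norm (Lpd x))) normrM (ger0_norm (ltW (om_gt0 q (x - c)))) mulrCA ler_wpM2l//.
  apply: (le_trans (RI_le (L1_norm (Lpd x)) (L1Z (C * A) (Lt x)) (hb x))).
  by rewrite (RIZ _ (Lt x)) hI mulrA.
have e1 : \int[mu]_x ((\int[mu]_z (dd u x z * K z)) * psi x) = \int[mu]_x \int[mu]_z f1 (x, z).
  apply: eq_Rintegral => x _; rewrite mulrC -(RIZ _ (Ld x)); apply: eq_Rintegral => z _.
  by rewrite /f1/= mulrC.
have e2 : \int[mu]_x (u x * \int[mu]_z (dd psi x z * K z)) = \int[mu]_x \int[mu]_z f2 (x, z).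
  by apply: eq_Rintegral => x _; rewrite -(RIZ _ (Lpd x)).
rewrite e1 e2 (RI_fubini mf1 fin1) (RI_fubini mf2 fin2); apply: eq_Rintegral => z _.
have t := RI_dd_transpose z cp p0.
have La : L1 mu (fun x => dd u x z * psi x).
  apply: (@L1_cont_supp R n _ rho); first by apply: continuousMf => //; exact: continuous_dd.
  by move=> x xr; rewrite p0// mulr0.
have Lb : L1 mu (fun x => u x * dd psi x z).
  apply: (@L1_cont_supp R n _ (2 * `|rho| + 2 * sq z)); first by apply: continuousMf => //; exact: continuous_dd.
  move=> x xr; have z0 := sq_ge0 z; have r0 := normr_ge0 rho; have rr := ler_norm rho.
  have h w : sq w = sq z -> psi (x + w) = 0.
    move=> wz; apply: p0; have := sqD_le2 (x + w) (- w); rewrite addrK sqN wz; lra.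
  rewrite /dd h// h ?sqN// (p0 x); [ring|lra].
have -> : \int[mu]_x f1 (x, z) = K z * \int[mu]_x (dd u x z * psi x).
  by rewrite -(RIZ _ La); apply: eq_Rintegral => x _; rewrite /f1/=; ring.
by rewrite t -(RIZ _ Lb); apply: eq_Rintegral => x _; rewrite /f2/=; ring.
Qed.

End Duality.
End WeakForm.

Section RadialTest.
Context (R : realType) (n : nat).
Implicit Types (x y z c : 'rV[R]_n).

Definition dotr y z : R := \sum_i y ord0 i * z ord0 i.

Lemma sq_line y z (r : R) : sq (y + r *: z) = sq y + 2 * r * dotr y z + r ^+ 2 * sq z.
Proof.
by rewrite /sq /dotr !mulr_sumr -!big_split/=; apply: eq_bigr => i _; rewrite !mxE; ring.
Qed.

Lemma cauchy_schwarz y z : dotr y z ^+ 2 <= sq y * sq z.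
Proof.
have := sq_ge0 z; rewrite le_eqVlt => /predU1P[z0|z0].
  have -> : z = 0 by apply/eqP; rewrite -sq_eq0 -z0.
  by rewrite /dotr big1 ?expr0n ?mulr_ge0 ?sq_ge0// => i _; rewrite mxE mulr0.
have := sq_ge0 (y + (- (dotr y z / sq z)) *: z); rewrite sq_line => h.
rewrite -ler_pdivrMr// -subr_ge0 (_ : _ - _ = sq y + 2 * - (dotr y z / sq z) * dotr y z + (- (dotr y z / sq z)) ^+ 2 * sq z)//.
by field; rewrite gt_eqF.
Qed.

(** The even function r -> psi(x + r z) + psi(x - r z) has derivative 0 at r = 0, so two mean value
    steps bound the second difference by the second derivative along the line. The rate drops from b
    to b/2 to absorb a polynomial factor, and to b/4 for the shift by r z. *)
Lemma radial_test_bound (b : R) : 0 < b -> exists2 C : R, 0 <= C & forall (E : nat -> R -> R) (A : R) c,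
  continuous (E 0%N) ->
  (forall (j : nat) (s : R), (j < 2)%N -> 0 <= s -> is_derive s 1 (E j) (E j.+1 s)) ->
  (forall (j : nat) (s : R), (j <= 2)%N -> 0 <= s -> `|E j s| <= A * expR (- (b * s))) ->
  test_bound (A * C) (b / 4) c (fun x => E 0%N (sq (x - c))).
Proof.
move=> b0; have b2 : 0 < b / 2 by rewrite divr_gt0.
have [C1 C10 hC1] := @pow_exp_bound R 1 (b / 2) b2.
exists (1 + 8 * C1 * expR (b / 2)); first by rewrite addr_ge0 ?mulr_ge0 ?expR_ge0.
move=> E A c cE dE hE.
have A0 : 0 <= A by have := hE 0%N 0 isT (lexx _); rewrite mulr0 oppr0 expR0 mulr1; apply: le_trans.
have C0 : 0 <= 8 * C1 * expR (b / 2) by rewrite !mulr_ge0 ?expR_ge0.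
split.
- move=> x; apply: (@continuous_comp _ _ _ (fun x => sq (x - c)) (E 0%N)); last exact: cE.
  apply: (@continuous_comp _ _ _ (fun x => x - c) (@sq R n)); last exact: continuous_sq.
  exact: continuous_row_sub.
- move=> x; apply: le_trans (hE 0%N _ isT (sq_ge0 _)) _.
  rewrite -mulrA ler_wpM2l// -[leLHS]mul1r ler_pM ?expR_ge0//; first by rewrite lerDl.
  rewrite ler_expR lerN2 ler_wpM2r ?sq_ge0//; lra.
move=> x z z1; set y := x - c.
pose S (r : R) := sq (y + r *: z).
have S0 r : 0 <= S r by exact: sq_ge0.
have dS (r : R) : is_derive r 1 S (2 * (dotr y z + r * sq z)).
  rewrite (_ : S = fun r => sq y + (r * (2 * dotr y z) + (r * r) * sq z)); last first.
    by apply/funext => t; rewrite /S sq_line; ring.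
  apply: (is_derive_val (is_deriveD (is_derive_cst (sq y) r 1) (is_deriveD
     (is_deriveM (is_derive_id r 1) (is_derive_cst (2 * dotr y z) r 1))
     (is_deriveM (is_deriveM (is_derive_id r 1) (is_derive_id r 1)) (is_derive_cst (sq z) r 1))))).
  by rewrite /GRing.scale/=; ring.
pose S' (r : R) := 2 * (dotr y z + r * sq z).
have dS' (r : R) : is_derive r 1 S' (2 * sq z).
  apply: (is_derive_val (is_deriveZ (2 : R) (is_deriveD (is_derive_cst (dotr y z) r 1)
     (is_deriveM (is_derive_id r 1) (is_derive_cst (sq z) r 1))))).
  by rewrite /GRing.scale/=; ring.
pose k0 (r : R) := E 0%N (S r); pose k1 (r : R) := E 1%N (S r) * S' r.
pose k2 (r : R) := E 2%N (S r) * S' r ^+ 2 + E 1%N (S r) * (2 * sq z).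
have dk0 (r : R) : is_derive r 1 k0 (k1 r).
  exact: (@is_derive1_comp R (E 0%N) S r _ _ (dE 0%N _ isT (S0 r)) (dS r)).
have dk1 (r : R) : is_derive r 1 k1 (k2 r).
  have h := @is_derive1_comp R (E 1%N) S r _ _ (dE 1%N _ isT (S0 r)) (dS r).
  apply: (is_derive_val (is_deriveM h (dS' r))).
  by rewrite /GRing.scale/= /k2 /S'; ring.
have hS' (r : R) : S' r ^+ 2 <= 4 * sq z * S r by rewrite /S' /S sq_line; have := cauchy_schwarz y z; nra.
(* Since |r z| <= 1, |y|^2 <= 2 |y + r z|^2 + 2: decay at the shifted point is decay at [y] with
   half the rate. *)
have bS (r : R) : r ^+ 2 <= 1 -> expR (- (b / 2 * S r)) <= expR (b / 2) * expR (- (b / 4 * sq y)).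
  move=> r1; rewrite -expRD ler_expR.
  have : sq y <= 2 * S r + 2.
    have := sqD_le2 (y + r *: z) (- (r *: z)); rewrite addrK sqN sqZ -/(S r).
    have := sq_ge0 z; have : r ^+ 2 * sq z <= 1 by rewrite mulr_ile1 ?sqr_ge0 ?sq_ge0.
    lra.
  by move: (S r) (sq y) => s1 s2; nra.
have hk2 (r : R) : r ^+ 2 <= 1 -> `|k2 r| <= 4 * sq z * (A * C1 * (expR (b / 2) * expR (- (b / 4 * sq y)))).
  move=> r1; have h1 := hE 1%N (S r) isT (S0 r); have h2 := hE 2%N (S r) isT (S0 r).
  apply: (@le_trans _ _ (4 * sq z * (A * ((1 + S r) ^+ 1 * expR (- (b / 2 * S r)) * expR (- (b / 2 * S r)))))).
    rewrite -[_ ^+ 1 * _ * _]mulrA -expRD (_ : - (b / 2 * S r) + _ = - (b * S r)); last by field.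
    rewrite expr1 /k2; apply: (le_trans (ler_normD _ _)).
    rewrite (normrM (E 2%N _)) (normrM (E 1%N _)) (ger0_norm (sqr_ge0 (S' r))).
    rewrite (@ger0_norm _ (2 * sq z)) ?mulr_ge0 ?sq_ge0//.
    have := ler_pM (normr_ge0 _) (sqr_ge0 _) h2 (hS' r).
    have z0 := sq_ge0 z; have s0 := S0 r; have e0 := expR_ge0 (- (b * S r)).
    move: h1; set e := expR _; move: (`|E 1%N (S r)|) (`|E 2%N _| * _) => a1 a2 h1.
    have Ae : 0 <= A * e * sq z by rewrite !mulr_ge0.
    have : a1 * (2 * sq z) <= A * e * (2 * sq z) by rewrite ler_wpM2r// mulr_ge0.
    rewrite -/e; move=> h3 h4.
    rewrite (_ : 4 * sq z * (A * ((1 + S r) * e)) = A * e * (4 * sq z * S r) + A * e * (2 * sq z) + 2 * (A * e * sq z)); last by ring.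
    lra.
  rewrite ler_wpM2l ?mulr_ge0 ?sq_ge0// -[A * C1 * _]mulrA ler_wpM2l//.
  by apply: ler_pM; rewrite ?mulr_ge0 ?expR_ge0 ?addr_ge0// ?hC1// bS.
set B := 4 * sq z * (A * C1 * (expR (b / 2) * expR (- (b / 4 * sq y)))) in hk2.
pose h0 (r : R) := k0 r + k0 (- r); pose h1 (r : R) := k1 r - k1 (- r).
have dN (g g' : R -> R) : (forall r : R, is_derive r 1 g (g' r)) ->
    forall r : R, is_derive r 1 (fun r => g (- r)) (- g' (- r)).
  move=> dg r; have hN : is_derive r 1 (fun r : R => - r) (-1) by apply: (is_derive_val (is_deriveN (is_derive_id r 1))).
  by apply: (is_derive_val (@is_derive1_comp R g (fun r => - r) r _ _ (dg (- r)) hN)); rewrite mulrN1.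
have dh0 (r : R) : is_derive r 1 h0 (h1 r) by exact: (is_deriveD (dk0 r) (dN _ _ dk0 r)).
have dh1 (r : R) : is_derive r 1 h1 (k2 r + k2 (- r)).
  by apply: (is_derive_val (is_deriveB (dk1 r) (dN _ _ dk1 r))); rewrite opprK.
have cts (g g' : R -> R) (a : R) : (forall r : R, is_derive r 1 g (g' r)) -> {within `[0, a], continuous g}.
  by move=> dg; apply: derivable_within_continuous => s _; have [] := dg s.
have [r1 r101 e1] := MVT ltr01 (fun s _ => dh0 s) (cts _ _ _ dh0).
move: r101; rewrite in_itv/= => /andP[r10 r11].
have [r2 r201 e2] := MVT r10 (fun s _ => dh1 s) (cts _ _ _ dh1).
move: r201; rewrite in_itv/= => /andP[r20 r21].
have -> : dd (fun x => E 0%N (sq (x - c))) x z = - (h0 1 - h0 0).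
  rewrite /dd /h0 /k0 /S oppr0 scale0r addr0 scaleN1r scale1r /y.
  by rewrite (_ : x + z - c = x - c + z) 1?addrAC// (_ : x - z - c = x - c - z) 1?addrAC//; ring.
rewrite e1 subr0 mulr1 normrN.
have -> : h1 r1 = (k2 r2 + k2 (- r2)) * r1.
  have h10 : h1 0 = 0 by rewrite /h1 oppr0 subrr.
  by move: e2; rewrite h10 !subr0.
have r2s : r2 ^+ 2 <= 1 by rewrite exprn_ile1 ?ltW//; apply: lt_trans r11.
have B0 : 0 <= B := le_trans (normr_ge0 _) (hk2 r2 r2s).
apply: (@le_trans _ _ (2 * B)).
  rewrite normrM -[leRHS]mulr1 ler_pM//; last by rewrite gtr0_norm// ltW.
  apply: (le_trans (ler_normD _ _)); have := hk2 r2 r2s; have := hk2 (- r2); rewrite sqrrN => /(_ r2s).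
  lra.
rewrite /B (_ : 2 * _ = A * (8 * C1 * expR (b / 2)) * sq z * expR (- (b / 4 * sq y))); last by ring.
rewrite ler_wpM2r ?expR_ge0// ler_wpM2r ?sq_ge0// ler_wpM2l// lerDr//.
Qed.

End RadialTest.

(** * Testing the equation against a Gaussian *)

Section GaussianTest.
Context (R : realType) (n : nat).
Notation mu := (leb R n).
Notation nu := (n%:R / 2 : R).
Implicit Types (x y z c : 'rV[R]_n) (u psi : 'rV[R]_n -> R) (r : R).
Context (th d : R) (th0 : 0 < th) (d0 : 0 < d) (dn : d < nu) (thd : th + d <= 1).
Notation q := (nu + th).
Notation K := (@rker R n th).

Definition gexp (tau : R) (i : nat) (s : R) : R := (- tau) ^+ i * expR (- (tau * s)).

Lemma is_derive_gexp tau i (s : R) : is_derive s 1 (gexp tau i) (gexp tau i.+1 s).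
Proof.
have h : is_derive s 1 (fun s : R => - tau * s) (- tau).
  by apply: (is_derive_val (is_deriveZ (- tau) (is_derive_id s 1))); rewrite /GRing.scale/= mulr1.
have h2 := @is_derive1_comp R (@expR R) (fun s : R => - tau * s) s _ _ (is_derive_expR (- tau * s)) h.
have h3 := is_deriveZ ((- tau) ^+ i) h2.
rewrite (_ : gexp tau i = (- tau) ^+ i \*: (expR \o (fun s => - tau * s))); last first.
  by apply/funext => r; rewrite /gexp -mulNr.
apply: (is_derive_val h3); rewrite /gexp exprSr /GRing.scale/= mulNr; ring.
Qed.

Lemma Gamma_Gam (p : R) : 0 < p -> Gamma p = Gam p.
Proof.
move=> p0; rewrite /Gamma /Gam /Rintegral integral_mrestr//.
Proof. by mfun. Qed.

(** Positivity is all that is used of the normalizing constant. *)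
Lemma frac_const_gt0 : th < 1 -> 0 < frac_const n (2 * th).
Proof.
move=> th1; rewrite /frac_const.
have a0 : 0 < 2 * th by rewrite mulr_gt0.
have p1 : 0 < (n%:R + 2 * th) / 2 by rewrite divr_gt0// ltr_wpDl.
have p2 : 0 < 1 - 2 * th / 2 by lra.
rewrite !Gamma_Gam//; apply: divr_gt0.
  by apply: mulr_gt0; [exact: powR_gt0|exact: Gam_gt0].
apply: mulr_gt0; first by apply: powR_gt0; exact: pi_gt0.
by apply: divr_gt0; [exact: Gam_gt0|lra].
Qed.

Section Approx.
Context (k : nat) (tau : R) (tau0 : 0 < tau) (c : 'rV[R]_n).

(** The order m + 4 k + 8 places the derivatives of the profile up to order 2 k + 3 within the range
    of [tg_bound], for every m. *)
Definition phiM (m : nat) x : R := tg tau (m + (4 * k + 8)) 0 (sq (x - c)).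
Definition psiM (m : nat) := iter k (@neg_laplacian R n) (phiM m).
Definition phioo x : R := expR (- (tau * sq (x - c))).
Definition psioo := iter k (@neg_laplacian R n) phioo.

Let M m := (m + (4 * k + 8))%N.

Lemma psiME m : psiM m = fun x => (-1) ^+ k * ev (2 * k).+1 (jlap R n k) (tg tau (M m)) (sq (x - c)).
Proof.
apply: (@iter_laplacian_radial R n k c (tg tau (M m))) => i s ik _.
by apply: is_derive_tg => //; rewrite /M; lia.
Qed.

Lemma psiooE : psioo = fun x => (-1) ^+ k * ev (2 * k).+1 (jlap R n k) (gexp tau) (sq (x - c)).
Proof.
rewrite /psioo (_ : phioo = fun x => gexp tau 0 (sq (x - c))); last first.
  by apply/funext => x; rewrite /gexp expr0 mul1r.
by apply: (@iter_laplacian_radial R n k c (gexp tau)) => i s _ _; exact: is_derive_gexp.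
Qed.

Lemma derive_tgM m i (s : R) : (i <= (2 * k).+2)%N -> is_derive s 1 (tg tau (M m) i) (tg tau (M m) i.+1 s).
Proof. by move=> ik; apply: is_derive_tg => //; rewrite /M; lia. Qed.

Lemma tgM_bound m i (s : R) : (i <= (2 * k).+3)%N -> 0 <= s ->
  `|tg tau (M m) i s| <= tau ^+ i * expR (- (tau / 2 * s)).
Proof. by move=> ik; apply: tg_bound => //; rewrite /M; lia. Qed.

Lemma continuous_tg m i : (i <= (2 * k).+2)%N -> continuous (tg tau (M m) i).
Proof.
move=> ik s; apply: differentiable_continuous; apply/derivable1_diffP.
by case: (@derive_tgM m i s ik).
Qed.

Lemma smooth_phiM m : smooth (2 * k) (phiM m).
Proof.
apply: (@dec_smooth R n c (2 * k) (0 + 0%:R)).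
apply: (@dec_radial R n c (2 * k) 0 (tg tau (M m))) => //; last by rewrite addn0.
- by move=> j s jk _; apply: derive_tgM; apply: leq_trans (ltnW jk) _; rewrite !leqW.
- by move=> j jk; apply: continuous_tg; rewrite !leqW.
move=> j jk; have [C C0 hC] := @pow_exp_le R (tau / 2) j%:R ltac:(by rewrite divr_gt0) (ler0n _ _).
exists (tau ^+ j * C); first by rewrite mulr_ge0 ?exprn_ge0// ltW.
move=> s s0; apply: (le_trans (@tgM_bound m j s _ s0)); first by rewrite !leqW.
rewrite add0r powRN -[tau ^+ j * C * _]mulrA ler_wpM2l ?exprn_ge0 ?(ltW tau0)// ler_pdivlMr ?powR_gt0 ?ltr_wpDr//.
by rewrite mulrC hC.
Qed.

Lemma phiM_supp m x : 2 * ((M m)%:R / tau) + 2 * sq c < sq x -> phiM m x = 0.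
Proof.
move=> h; apply: tg_supp; have := sqD_le2 (x - c) c; rewrite subrK.
move: (_ / tau) h => a h; move: (sq (x - c)) (sq c) (sq x) h => s1 s2 s3; lra.
Qed.

Lemma psiM_supp m x : 2 * ((M m)%:R / tau) + 2 * sq c < sq x -> psiM m x = 0.
Proof.
rewrite /psiM; elim: k x => [|j IH] x h; first exact: phiM_supp.
by rewrite iterS; apply: (neg_laplacian_supp IH).
Qed.

(** The rate is tau/2 for the profiles, tau/4 once the polynomial coefficients are absorbed, and
    tau/16 after [radial_test_bound]. One constant [A] serves all m, as the limit requires. *)
Lemma test_bound_psiM : exists2 A : R, 0 <= A & forall m, test_bound A (tau / 16) c (psiM m).
Proof.
have t4 : 0 < tau / 4 by rewrite divr_gt0.
have [C C0 hC] := @radial_test_bound R n (tau / 4) t4.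
have evb j cc : exists D : R, 0 <= D /\ forall m s, 0 <= s -> (j <= (2 * k).+3)%N ->
    `|ev j cc (tg tau (M m)) s| <= D * expR (- (tau / 4 * s)).
  have [D D0 hD] := @ev_bound R j cc (tau / 2) (tau / 4) t4 ltac:(lra).
  exists (D * (1 + tau) ^+ (2 * k).+2); split; first by rewrite mulr_ge0 ?exprn_ge0// addr_ge0// ltW.
  move=> m s s0 jk; apply: hD => // i ij.
  apply: (le_trans (@tgM_bound m i s _ s0)); first exact: leq_trans (ltnW ij) jk.
  rewrite ler_wpM2r ?expR_ge0//; apply: (@le_trans _ _ ((1 + tau) ^+ i)).
    by rewrite lerXn2r ?nnegrE ?addr_ge0 ?(ltW tau0)// lerDr.
  by rewrite ler_weXn2l ?lerDl ?(ltW tau0)// -ltnS (leq_trans ij jk).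
have [D0 [D00 h0]] := evb (2 * k).+1 (jlap R n k).
have [D1 [D10 h1]] := evb (2 * k).+2 (jD (jlap R n k)).
have [D2 [D20 h2]] := evb (2 * k).+3 (jD (jD (jlap R n k))).
pose E (m j : nat) (s : R) : R := (-1) ^+ k * (if j is 0%N then ev (2 * k).+1 (jlap R n k) (tg tau (M m)) s else
  if j is 1%N then ev (2 * k).+2 (jD (jlap R n k)) (tg tau (M m)) s else
  ev (2 * k).+3 (jD (jD (jlap R n k))) (tg tau (M m)) s).
exists ((D0 + D1 + D2) * C); first by rewrite mulr_ge0// !addr_ge0.
have t16 : tau / 4 / 4 = tau / 16 by field.
move=> m; rewrite -t16 psiME; apply: (hC (E m) (D0 + D1 + D2) c).
- move=> s; apply: differentiable_continuous; apply/derivable1_diffP.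
  have : is_derive s 1 (E m 0%N) (E m 1%N s).
    apply: is_deriveZ; apply: is_derive_ev; first exact: jlap_supp.
    by move=> i ik; apply: derive_tgM; apply: leq_trans (ltnW ik) _; rewrite leqW.
  by case.
- move=> [|[|//]] s _ s0; apply: is_deriveZ; apply: is_derive_ev.
  + exact: jlap_supp.
  + by move=> i ik; apply: derive_tgM; apply: leq_trans (ltnW ik) _; rewrite leqW.
  + by apply: (jD_supp (@jlap_supp R n k)).
  + by move=> i ik; apply: derive_tgM; exact: ltnW.
move=> j s j2 s0; rewrite /E normrM normrX normrN1 expr1n mul1r.
have e0 := expR_ge0 (- (tau / 4 * s)).
case: j j2 => [|[|[|//]]] _.
- by apply: (le_trans (h0 m s s0 (leqW (leqnSn _)))); rewrite ler_wpM2r// -addrA lerDl addr_ge0.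
- by apply: (le_trans (h1 m s s0 (leqnSn _))); rewrite ler_wpM2r// addrAC lerDr addr_ge0.
- by apply: (le_trans (h2 m s s0 (leqnn _))); rewrite ler_wpM2r// lerDr addr_ge0.
Qed.

Lemma cvg_tgM i (s : R) : 0 <= s -> tg tau (M m) i s @[m --> \oo] --> gexp tau i s.
Proof.
move=> s0; have h := @cvg_tg R tau i s tau0 s0.
by rewrite (cvg_shiftn (4 * k + 8) (fun m => tg tau m i s)).
Qed.

Lemma cvg_psiM x : psiM m x @[m --> \oo] --> psioo x.
Proof.
under eq_fun do rewrite psiME; rewrite psiooE; apply: cvgMr.
rewrite /ev; elim: (2 * k).+1 => [|N IH].
  by under eq_fun do rewrite big_ord0; rewrite big_ord0; exact: cvg_cst.
under eq_fun do rewrite big_ord_recr/=; rewrite big_ord_recr/=.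
by apply: cvgD => //; apply: cvgMr; apply: cvg_tgM; exact: sq_ge0.
Qed.

Lemma cvg_phiM x : phiM m x @[m --> \oo] --> phioo x.
Proof.
have := @cvg_tgM 0 (sq (x - c)) (sq_ge0 _).
by rewrite /gexp expr0 mul1r.
Qed.

Lemma phiM_le m x : 0 <= phiM m x <= phioo x.
Proof.
rewrite /phiM /phioo -/(M m); set s := sq (x - c); have s0 : 0 <= s by exact: sq_ge0.
rewrite /tg; case: ltP => [sM|_]; last by rewrite lexx expR_ge0.
have M0 : 0 < (M m)%:R :> R by rewrite ltr0n /M; lia.
have y0 : 0 <= 1 - tau / (M m)%:R * s by rewrite subr_ge0 mulrAC ler_pdivrMr// mul1r mulrC -ler_pdivlMr// ltW.
rewrite /tgc ffactn0 !expr0 divr1 !mul1r subn0 exprn_ge0//=.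
apply: (@le_trans _ _ (expR (- (tau / (M m)%:R * s)) ^+ M m)).
  by rewrite lerXn2r ?nnegrE ?expR_ge0// expR_ge1Dx.
rewrite -expRM_natr ler_expR le_eqVlt; apply/orP; left; apply/eqP.
by field; rewrite gt_eqF.
Qed.

Context (u : 'rV[R]_n -> R) (al : R) (hal : al = 2 * th).
Hypothesis cu : continuous u.
Hypothesis Lu : L1 mu (fun y => u y * om q y).
Hypothesis ru : Reg (th + d) (2 * k) u.

Lemma smooth_poly_frac : smooth (2 * k) (frac_laplacian al u).
Proof.
have [kap [h1 h2 h3]] := @smooth_kernel R n q (2 * k) (ltW (q_gt0 n th0)).
have ru0 : Reg (th + d) 0 u by split => //; exact: Reg_dd ru.
exact: (@frac_laplacian_smooth R n th d th0 d0 dn u cu Lu ru0 al (2 * k) kap hal ru h1 h2 h3).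
Qed.

Lemma continuous_poly_frac : continuous (poly_frac_laplacian k al u).
Proof.
have := @smooth_iter_neg_laplacian R n k 0 (frac_laplacian al u).
by rewrite addn0 => /(_ smooth_poly_frac) [].
Qed.

Hypothesis fge0 : forall x, 0 <= poly_frac_laplacian k al u x.

(** The compactly supported identity from [green] and [duality], in the limit m -> oo. The right
    side is dominated through the weight. Nothing dominates the left side at first: f >= 0 and Fatou
    give integrability of f times the Gaussian, and only then does dominated convergence identify
    the limit. *)
Lemma weak_gauss :
  [/\ L1 mu (fun x => poly_frac_laplacian k al u x * phioo x),
     exists2 B : R, 0 <= B & forall x, `|\int[mu]_z (dd psioo x z * K z)| <= B * om q (x - c),
     forall x, L1 mu (fun z => dd psioo x z * K z) &
     \int[mu]_x (poly_frac_laplacian k al u x * phioo x) =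
       frac_const n al / 2 * \int[mu]_x (u x * \int[mu]_z (dd psioo x z * K z))].
Proof.
have ru0 : Reg (th + d) 0 u by split => //; exact: Reg_dd ru.
have t16 : 0 < tau / 16 by rewrite divr_gt0.
have [A A0 hA] := test_bound_psiM.
have [C C0 hC] := @test_bound_le R n th d th0 d0 thd _ t16.
have hb m := hC _ _ _ (hA m).
have [I I0 hI] := @RI_tmaj R n th d th0 d0 dn _ t16.
have Lt x := @L1_tmaj R n th d th0 d0 dn _ c x t16.
set f := poly_frac_laplacian k al u.
have cf : continuous f := continuous_poly_frac.
have mK : mfunT K by mfun.
have inner x : L1 mu (fun z => dd psioo x z * K z) /\
    \int[mu]_z (dd (psiM m) x z * K z) @[m --> \oo] --> \int[mu]_z (dd psioo x z * K z).
  apply: (RI_dct _ _ (L1Z (C * A) (Lt x))) => [m|z|m z]; last exact: hb.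
    apply: measurable_funM => //; apply: measurable_dd.
    by apply: continuous_measurable_row; case: (hA m).
  apply: cvgMl; apply: cvgB; first apply: cvgB; first apply: cvgMr; exact: cvg_psiM.
have bM m x : `|\int[mu]_z (dd (psiM m) x z * K z)| <= C * A * I * om q (x - c).
  have Lm : L1 mu (fun z => dd (psiM m) x z * K z).
    apply: (L1_le _ (hb m x) (L1Z (C * A) (Lt x))).
    apply: measurable_funM => //; apply: measurable_dd.
    by apply: continuous_measurable_row; case: (hA m).
  apply: (le_trans (RI_norm Lm)).
  apply: (le_trans (RI_le (L1_norm Lm) (L1Z (C * A) (Lt x)) (hb m x))).
  by rewrite (RIZ _ (Lt x)) hI mulrA.
have boo x : `|\int[mu]_z (dd psioo x z * K z)| <= C * A * I * om q (x - c).
  have h := cvg_norm (proj2 (inner x)).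
  by apply: (cvgr_to_le (h _)); apply: nearW => m; exact: bM.
have mJ m : mfunT (fun x => \int[mu]_z (dd (psiM m) x z * K z)).
  have mp : mfunT (psiM m) by apply: continuous_measurable_row; case: (hA m).
  pose f2 (p : 'rV[R]_n * 'rV[R]_n) := dd (psiM m) p.1 p.2 * K p.2.
  have mf2 : mfunT f2 by mfun.
  have Lm x : L1 mu (fun z => dd (psiM m) x z * K z).
    apply: (L1_le _ (hb m x) (L1Z (C * A) (Lt x))).
    by mfun.
  have fin : (\int[mu]_x \int[mu]_z `|f2 (x, z)|%:E < +oo)%E.
    apply: (@fubini_fin R _ _ _ _ mu mu f2 (fun x => C * A * I * om q (x - c))) => //.
    - by apply: L1Z; apply: (@L1_shift R n (- c) (om q)); exact: L1_om_q.
    - move=> x; apply: (le_trans (RI_le (L1_norm (Lm x)) (L1Z (C * A) (Lt x)) (hb m x))).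
      by rewrite (RIZ _ (Lt x)) hI mulrA.
  exact: L1_meas (L1_fubini1 mf2 fin).
have Luo := @L1_u_om R n th th0 u cu Lu c.
have [_ cJ] : L1 mu (fun x => u x * \int[mu]_z (dd psioo x z * K z)) /\
   \int[mu]_x (u x * \int[mu]_z (dd (psiM m) x z * K z)) @[m --> \oo] -->
   \int[mu]_x (u x * \int[mu]_z (dd psioo x z * K z)).
  apply: (RI_dct _ _ (L1Z (C * A * I) (L1_norm Luo))) => [m|x|m x].
  - by apply: measurable_funM => //; exact: measurable_u.
  - by apply: cvgMr; case: (inner x).
  - rewrite !normrM (ger0_norm (ltW (om_gt0 q (x - c)))) mulrCA ler_wpM2l//.
have al0 : 0 < frac_const n al by rewrite hal; apply: frac_const_gt0; apply: lt_le_trans thd; rewrite ltrDl.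
have sw := smooth_poly_frac; have cw := smooth_cont sw.
pose rho m : R := 2 * ((M m)%:R / tau) + 2 * sq c.
have Em m : \int[mu]_x (f x * phiM m x) =
    frac_const n al / 2 * \int[mu]_x (u x * \int[mu]_z (dd (psiM m) x z * K z)).
  rewrite -(@duality R n th d th0 d0 dn thd u cu Lu ru0 A (tau / 16) c (psiM m) (rho m) t16 (hA m) (@psiM_supp m)).
  rewrite /f /poly_frac_laplacian (@green R n k _ _ (rho m) sw (smooth_phiM m) (@phiM_supp m)) -/(psiM m).
  have Lw : L1 mu (fun x => frac_laplacian al u x * psiM m x).
    apply: (@L1_cont_supp R n _ (rho m)).
      by apply: continuousMf => //; case: (hA m).
    by move=> x xr; rewrite (psiM_supp xr) mulr0.
  have -> : \int[mu]_x ((\int[mu]_z (dd u x z * K z)) * psiM m x) =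
      \int[mu]_x (2 / frac_const n al * (frac_laplacian al u x * psiM m x)).
    apply: eq_Rintegral => x _.
    rewrite (@frac_laplacian_dd R n th d th0 d0 dn u cu Lu ru0 al x hal).
    by field; rewrite gt_eqF.
  by rewrite (RIZ _ Lw) mulrA mulrC; field; rewrite gt_eqF.
have Lf m : L1 mu (fun x => f x * phiM m x).
  apply: (@L1_cont_supp R n _ (rho m)).
    by apply: continuousMf => //; exact: smooth_cont (smooth_phiM m).
  by move=> x xr; rewrite (phiM_supp xr) mulr0.
have cE : \int[mu]_x (f x * phiM m x) @[m --> \oo] -->
    frac_const n al / 2 * \int[mu]_x (u x * \int[mu]_z (dd psioo x z * K z)).
  by under eq_fun do rewrite Em; apply: cvgMr.
have cfp x : f x * phiM m x @[m --> \oo] --> f x * phioo x by apply: cvgMr; exact: cvg_phiM.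
have Lfo : L1 mu (fun x => f x * phioo x).
  apply: (fatou_L1 Lf _ cfp cE) => m x; apply: mulr_ge0; first exact: fge0.
  by case/andP: (phiM_le m x).
split => //.
- by exists (C * A * I) => //; rewrite !mulr_ge0.
- by move=> x; case: (inner x).
have dom m x : `|f x * phiM m x| <= f x * phioo x.
  case/andP: (phiM_le m x) => p0 p1.
  by rewrite ger0_norm ?mulr_ge0 ?fge0// ler_wpM2l ?fge0.
have [_ c2] := RI_dct (fun m => L1_meas (Lf m)) cfp Lfo dom.
exact: (cvg_unique (@Rhausdorff R) c2 cE).
Qed.

End Approx.
End GaussianTest.

(** * Time derivatives of the Gaussian *)

Section HeatDerivatives.
Context (R : realType) (n : nat).
Notation mu := (leb R n).
Notation hl := (@hl R).
Notation nu := (n%:R / 2 : R).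
Implicit Types (x y z c : 'rV[R]_n) (t s r : R) (p : {poly R}).

(** On functions p(s) exp(-s) of s = |x|^2/t, [eD] acts as d/ds and [eB] as t/4 times the Laplacian
    in x. *)
Definition eD p : {poly R} := p^`() - p.
Definition eB p : {poly R} := 'X * eD (eD p) + nu%:P * eD p.
Definition hP (k : nat) : {poly R} := iter k (fun p => - eB p) 1.

(* (- d/dt)^k of the Gaussian t ^ (- n/2) exp (- |x|^2 / t) *)
Definition Hk (k : nat) t x : R :=
  t `^ (- nu - k%:R) * (hP k).[sq x / t] * expR (- (sq x / t)).

Lemma Hk0 t x : Hk 0 t x = G t x.
Proof. by rewrite /Hk /hP /= hornerC mulr1 subr0. Qed.

(** The heat equation in the self-similar variable |x|^2/t: [hP] is built from the Laplacian, and
    this identity lets it also compute the time derivative. Applying [eB] to the identity gives the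
    induction step. *)
Lemma hP_eq k : 'X * eD (eD (hP k)) + (nu%:P + 'X) * eD (hP k) + (nu + k%:R)%:P * hP k = 0.
Proof.
elim: k => [|k IH].
  have e1 : eD 1 = -1 by rewrite /eD -polyC1 derivC sub0r.
  have e2 : eD (-1) = 1 by rewrite /eD derivN -polyC1 derivC oppr0 sub0r opprK.
  by rewrite /hP /= e1 e2 addr0; ring.
have -> : hP k.+1 = - eB (hP k) by [].
set p := hP k in IH *.
have h : eB ('X * eD (eD p) + (nu%:P + 'X) * eD p + (nu + k%:R)%:P * p) = 0.
  by rewrite IH /eB /eD deriv0 subr0 deriv0 subr0 !mulr0 addr0.
rewrite -[RHS]oppr0 -[in RHS]h /eB /eD -natr1.
rewrite !(derivD, derivB, derivN, derivM, derivC, derivX) !polyCD.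
move: p^`() => p1 in h *; ring.
Qed.

Lemma hP_evalB k r : (hP k.+1).[r] = - (r * (eD (eD (hP k))).[r] + nu * (eD (hP k)).[r]).
Proof.
rewrite /hP iterS -/(hP k) /eB; move: (eD (eD (hP k))) (eD (hP k)) => q2 q1.
by rewrite hornerN hornerD !hornerM hornerX hornerC.
Qed.

Lemma hP_eval k r : (hP k.+1).[r] = r * (eD (hP k)).[r] + (nu + k%:R) * (hP k).[r].
Proof.
rewrite hP_evalB; move: (hP_eq k); move: (eD (hP k)) => q1; move: (eD q1) => q2 /(congr1 (fun p => p.[r])).
rewrite /= horner0 !(hornerD, hornerM, hornerX, hornerC).
move: (nu) (k%:R : R) => a b; lra.
Qed.

Lemma is_derive_pexp p s : is_derive s 1 (fun s => p.[s] * expR (- s)) ((eD p).[s] * expR (- s)).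
Proof.
have hN : is_derive s 1 (fun s : R => - s) (-1) by apply: (is_derive_val (is_deriveN (is_derive_id s 1))).
have h2 := @is_derive1_comp R (@expR R) (fun s : R => - s) s _ _ (is_derive_expR (- s)) hN.
apply: (is_derive_val (is_deriveM (is_derive_poly p s) h2)).
by rewrite /GRing.scale/= /eD hornerD hornerN; ring.
Qed.

Lemma is_derive_invV (s t : R) : 0 < t -> is_derive t 1 (fun t => s / t) (- (s / t ^+ 2)).
Proof.
move=> t0; have tN : t != 0 by rewrite gt_eqF.
have dV : is_derive t 1 (fun t : R => t^-1) (- t ^- 2).
  split; first by apply: derivableV => //; exact: derivable_id.
  by rewrite deriveV ?derive_id// /GRing.scale/= mulr1.
apply: (is_derive_val (is_deriveZ s dV)).
by rewrite /GRing.scale/= mulrN.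
Qed.

Lemma is_derive_Hk k t x : 0 < t -> is_derive t 1 (fun t => Hk k t x) (- Hk k.+1 t x).
Proof.
move=> t0; have tN : t != 0 by rewrite gt_eqF.
set s := sq x.
have h1 := is_derive1_powR (- nu - k%:R) t0.
have h2 := @is_derive1_comp R (fun s => (hP k).[s] * expR (- s)) (fun t => s / t) t _ _
   (is_derive_pexp (hP k) (s / t)) (is_derive_invV s t0).
have h3 := is_deriveM h1 h2.
rewrite (_ : (fun t => Hk k t x) = ((@powR R ^~ (- nu - k%:R)) * ((fun s => (hP k).[s] * expR (- s)) \o (fun t => s / t)))); last first.
  by apply/funext => r; rewrite /Hk -mulrA.
apply: (is_derive_val h3); rewrite /GRing.scale/= /Hk -/s.
rewrite hP_eval.
have -> : t `^ (- nu - k%:R - 1) = t `^ (- nu - k%:R) * t^-1 by rewrite powRDp// powR_inv1// ltW.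
have -> : t `^ (- nu - k.+1%:R) = t `^ (- nu - k%:R) * t^-1.
  by rewrite -[k.+1%:R]natr1 opprD addrA powRDp// powR_inv1// ltW.
by field.
Qed.

Lemma laplacian_Hk k t x0 (b : R) : 0 < t ->
  neg_laplacian (fun x => b * Hk k t (x - x0)) = fun x => b * 4 * Hk k.+1 t (x - x0).
Proof.
move=> t0; have tN : t != 0 by rewrite gt_eqF.
pose a := t `^ (- nu - k%:R).
pose g (j : nat) (s : R) : R := b * a * t^-1 ^+ j * ((iter j eD (hP k)).[s / t] * expR (- (s / t))).
have dg j s : is_derive s 1 (g j) (g j.+1 s).
  have h : is_derive s 1 (fun s => s / t) t^-1.
    have := is_deriveM (is_derive_id s 1) (is_derive_cst t^-1 s 1) => h; apply: (is_derive_val h).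
    by rewrite /GRing.scale/= mulr0 add0r mulr1.
  have h2 := @is_derive1_comp R (fun s => (iter j eD (hP k)).[s] * expR (- s)) (fun s => s / t) s _ _
   (is_derive_pexp (iter j eD (hP k)) (s / t)) h.
  apply: (is_derive_val (is_deriveZ (b * a * t^-1 ^+ j) h2)).
  by rewrite /GRing.scale/= /g iterS exprS; ring.
apply/funext => x; rewrite /neg_laplacian.
have -> : (fun x => b * Hk k t (x - x0)) = (fun x => g 0%N (sq (x - x0))).
  by apply/funext => y; rewrite /g expr0 mulr1 /Hk -/a !mulrA.
rewrite (laplacian_radial x0 x (fun j s _ _ => dg j s)) /g /= /Hk.
set s := sq (x - x0).
have -> : t `^ (- nu - k.+1%:R) = a * t^-1 by rewrite -[k.+1%:R]natr1 opprD addrA powRDp// powR_inv1// ltW.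
by rewrite hP_evalB expr1; field.
Qed.

Lemma iter_laplacian_G k t x0 (b : R) : 0 < t ->
  iter k (@neg_laplacian R n) (fun x => b * G t (x - x0)) = fun x => b * 4 ^+ k * Hk k t (x - x0).
Proof.
move=> t0; elim: k => [|k IH]; first by apply/funext => x; rewrite /= expr0 mulr1 Hk0.
by rewrite iterS IH laplacian_Hk// exprSr mulrA.
Qed.

(** Half of the Gaussian exponent absorbs the polynomial; the other half is a Gaussian at time 2
    t. *)
Lemma Hk_bound k : exists2 C : R, 0 <= C & forall t x, 0 < t -> `|Hk k t x| <= C * t ^- k * G (2 * t) x.
Proof.
have [C1 C10 h1] := poly_bound (hP k).
have [C2 C20 h2] := @pow_exp_bound R (size (hP k)) (1 / 2) ltac:(lra).
exists (C1 * C2 * 2 `^ nu); first by rewrite !mulr_ge0 ?powR_ge0.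
move=> t x t0; have s0 : 0 <= sq x / t by rewrite divr_ge0 ?sq_ge0// ltW.
rewrite /Hk /G powRM ?(ltW t0)// !normrM (ger0_norm (powR_ge0 _ _)) (ger0_norm (expR_ge0 _)).
have -> : t `^ (- nu - k%:R) = t `^ (- nu) * t ^- k by rewrite powRDp// (powRN t k%:R) powR_mulrn// ltW.
have -> : C1 * C2 * 2 `^ nu * t ^- k * (2 `^ (- nu) * t `^ (- nu) * expR (- (sq x / (2 * t)))) =
   t `^ (- nu) * t ^- k * (C1 * C2 * expR (- (sq x / (2 * t)))) * (2 `^ nu * 2 `^ (- nu)) by ring.
rewrite -powRDp// subrr powRr0 mulr1 [t `^ (- nu)]powRN -!mulrA ler_wpM2l ?invr_ge0 ?powR_ge0//.
rewrite ler_wpM2l ?invr_ge0 ?exprn_ge0 ?(ltW t0)//.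
apply: (@le_trans _ _ ((C1 * (1 + sq x / t) ^+ size (hP k)) * expR (- (sq x / t)))).
  by rewrite ler_wpM2r ?expR_ge0// h1.
have -> : expR (- (sq x / t)) = expR (- (1 / 2 * (sq x / t))) * expR (- (sq x / (2 * t))).
  by rewrite -expRD; congr expR; field; rewrite gt_eqF.
set e1 := expR (- (1 / 2 * _)); set e2 := expR (- (sq x / (2 * t))).
rewrite (_ : C1 * _ * (e1 * e2) = C1 * ((1 + sq x / t) ^+ size (hP k) * e1) * e2); last by ring.
by rewrite [leRHS]mulrA ler_wpM2r ?expR_ge0// ler_wpM2l// h2.
Qed.

Lemma measurable_Hk k (d : measure_display) (T : measurableType d) (f : T -> R) (g : T -> 'rV[R]_n) :
  mfunT f -> mfunT g -> mfunT (fun w : T => Hk k (f w) (g w)).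
Proof.
move=> mf mg; have mh : mfunT (horner (hP k)).
  by apply: continuous_measurable_fun; exact: continuous_horner.
by rewrite /Hk; mfun.
Qed.

Lemma Hk_om k (q : R) t1 t2 : 0 < q -> 0 < t1 -> exists2 C : R, 0 <= C &
  forall t x, t1 <= t <= t2 -> `|Hk k t x| <= C * om q x.
Proof.
move=> q0 t10; have [C C0 hC] := Hk_bound k.
pose B (t : R) := 2 `^ q * (t `^ (- nu) + q `^ q * t `^ (q - nu)).
exists (C * t1 ^- k * (2 `^ q * ((2 * t1) `^ (- nu) + q `^ q * ((2 * t2) `^ q * (2 * t1) `^ (- nu))))).
  by rewrite !(mulr_ge0, addr_ge0) ?powR_ge0// invr_ge0 exprn_ge0// ltW.
move=> t x /andP[tt1 tt2]; have t0 : 0 < t by exact: lt_le_trans tt1.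
apply: (le_trans (hC t x t0)).
have t2p : 0 < 2 * t by rewrite mulr_gt0.
have a1 : (2 * t) `^ (- nu) <= (2 * t1) `^ (- nu).
  rewrite !powRN lef_pV2 ?posrE ?powR_gt0 ?mulr_gt0//.
  by apply: ler_powR_base; rewrite ?divr_ge0 ?mulr_ge0 ?(ltW t10)// ler_pM2l.
apply: (@le_trans _ _ (C * t1 ^- k * (2 `^ q * ((2 * t) `^ (- nu) + q `^ q * (2 * t) `^ (q - nu)) * om q x))).
  apply: ler_pM; rewrite ?G_ge0 ?mulr_ge0 ?invr_ge0 ?exprn_ge0 ?(ltW t0)//; last exact: G_le_om.
  rewrite ler_wpM2l// lef_pV2 ?posrE ?exprn_gt0// lerXn2r ?nnegrE ?(ltW t0) ?(ltW t10)//.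
rewrite -!mulrA ler_wpM2l// ler_wpM2l ?invr_ge0 ?exprn_ge0 ?(ltW t10)// ler_wpM2l ?powR_ge0//.
rewrite ler_wpM2r ?(ltW (om_gt0 _ _))// lerD// ler_wpM2l ?powR_ge0// powRDp//.
apply: ler_pM; rewrite ?powR_ge0//; apply: ler_powR_base; rewrite ?(ltW q0) ?(ltW t2p)//.
by rewrite ler_pM2l.
Qed.

Lemma L1_Hk k t c : 0 < t -> L1 mu (fun x => Hk k t (c - x)).
Proof.
move=> t0; have nu1 : 0 < nu + 1 by rewrite ltr_wpDl// divr_ge0.
have [C C0 hC] := @Hk_om k (nu + 1) t t nu1 t0.
apply: (L1_reflect c (f := Hk k t)).
apply: (L1_le _ _ (L1Z C (@L1_om R n (nu + 1) _))) => [|x|]; last by rewrite ltrDl.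
  exact: (measurable_Hk k (f := fun=> t) (g := id)).
by apply: hC; rewrite lexx.
Qed.

(** The semigroup property differentiated in t: under the integral on one side, explicitly on the
    other. *)
Lemma Hk_semigroup k s t x : 0 < s -> 0 < t ->
  \int[mu]_z (G s z * Hk k t (x - z)) = gmass R n * Hk k (s + t) x.
Proof.
move=> s0; elim: k t => [|k IH] t t0.
  under eq_Rintegral do rewrite Hk0.
  by rewrite Hk0 /Rintegral G_semigroup.
have LG j r : 0 < r -> L1 mu (fun z => G s z * Hk j r (x - z)).
  move=> r0; have := L1Z (s `^ (- nu)) (L1_norm (L1_Hk j x r0)); apply: L1_le.
    apply: measurable_funM; [exact: measurable_G|exact: L1_meas (L1_Hk j x r0)].
  move=> z; rewrite normrM ler_wpM2r// ger0_norm ?G_ge0// /G ler_piMr ?powR_ge0//.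
  by rewrite -expR0 ler_expR oppr_le0 divr_ge0 ?sq_ge0// ltW.
have t2 : 0 < t / 2 by rewrite divr_gt0.
have nu1 : 0 < nu + 1 by rewrite ltr_wpDl// divr_ge0.
have [C C0 hC] := @Hk_om k.+1 (nu + 1) (t / 2) (2 * t) nu1 t2.
have near2 r : `|r - t| < t / 2 -> t / 2 <= r <= 2 * t.
  by rewrite ltr_distl => /andP[h1 h2]; apply/andP; split; lra.
have Lom : L1 mu (fun z => s `^ (- nu) * (C * om (nu + 1) (x - z))).
  by apply/L1Z/L1Z/(L1_reflect x); apply: L1_om; rewrite ltrDl.
have D1' : is_derive t 1 (fun r => \int[mu]_z (G s z * Hk k r (x - z)))
    (\int[mu]_z (G s z * - Hk k.+1 t (x - z))).
  apply: (@RI_derive1 R _ _ mu (fun r z => G s z * Hk k r (x - z))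
     (fun r z => G s z * - Hk k.+1 r (x - z)) t (t / 2) _ t2 _ _ Lom).
  - move=> r z /near2/andP[r1 _]; have r0 : 0 < r by exact: lt_le_trans r1.
    exact: (is_deriveZ (G s z) (is_derive_Hk k (x - z) r0)).
  - by move=> r /near2/andP[r1 _]; apply: LG; exact: lt_le_trans r1.
  move=> r z /near2 hr; rewrite normrM normrN; apply: ler_pM => //; last exact: hC.
  rewrite ger0_norm ?G_ge0// /G ler_piMr ?powR_ge0//.
  by rewrite -expR0 ler_expR oppr_le0 divr_ge0 ?sq_ge0// ltW.
have D2' : is_derive t 1 (fun r => gmass R n * Hk k (s + r) x) (gmass R n * - Hk k.+1 (s + t) x).
  have st0 : 0 < s + t by rewrite addr_gt0.
  have h : is_derive t 1 (fun r : R => s + r) 1.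
    by apply: (is_derive_val (is_deriveD (is_derive_cst s t 1) (is_derive_id t 1))); rewrite add0r.
  have h2 := @is_derive1_comp R (fun r => Hk k r x) (fun r => s + r) t _ _ (is_derive_Hk k x st0) h.
  by apply: (is_derive_val (is_deriveZ (gmass R n) h2)); rewrite mulr1.
have E : 'D_1 (fun r => \int[mu]_z (G s z * Hk k r (x - z))) t = 'D_1 (fun r => gmass R n * Hk k (s + r) x) t.
  apply: near_eq_derive; near=> r; apply: IH; near: r; exact: lt_nbhsr.
move: E; rewrite (@derive_val _ _ _ _ _ _ _ D1') (@derive_val _ _ _ _ _ _ _ D2').
under eq_Rintegral do rewrite mulrN -mulN1r.
rewrite (RIZ _ (LG k.+1 t t0)) mulrN mulN1r => /oppr_inj ->.
by [].
Unshelve. all: by end_near. Qed.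

End HeatDerivatives.

Ltac mleaf ::= match goal with
  | |- measurable_fun _ (fun x => Hk _ (@?f x) (@?g x)) =>
    apply: (measurable_Hk _ (f := f) (g := g)); mfun
  | |- measurable_fun _ (Hk _ ?t) => exact: (measurable_Hk _ (f := fun=> t) (g := id))
  | |- _ => progress munfold; mfun
  end.

Section ParameterIntegral.

Lemma L1_indic (R : realType) (d : measure_display) (T : measurableType d) (m : {measure set T -> \bar R})
   (f : T -> R) (A : set T) : measurable A -> L1 m f -> L1 m (fun x => f x * \1_A x).
Proof.
move=> mA Lf; apply: (L1_le _ _ (L1_norm Lf)).
  by mfun.
by move=> x; rewrite normrM ler_piMr// indicE; case: (_ \in _); rewrite ?normr1 ?normr0.
Qed.

Lemma powR_mulN (R : realType) (a x : R) : 0 < x -> x `^ a * x `^ (- a) = 1.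
Proof. by move=> x0; rewrite powRN mulfV// gt_eqF// powR_gt0. Qed.

Lemma powR_pred (R : realType) (a x : R) : 0 < x -> x `^ (a - 1) = x `^ a / x.
Proof. by move=> x0; rewrite powRDp// [x `^ (- 1)]powR_inv1// ltW. Qed.

Lemma RI_measurable (R : realType) (d1 d2 : measure_display) (T1 : measurableType d1) (T2 : measurableType d2)
   (m2 : {sigma_finite_measure set T2 -> \bar R}) (f : T1 * T2 -> R) :
  mfunT f -> mfunT (fun x => \int[m2]_y f (x, y)).
Proof.
move=> mf; have mE : mfunT (EFin \o f) by exact/measurable_EFinP.
have e x : (\int[m2]_y (f (x, y))%:E = \int[m2]_y (EFin \o f)^\+%E (x, y) - \int[m2]_y (EFin \o f)^\-%E (x, y))%E.
  rewrite integralE; congr (_ - _)%E; apply: eq_integral => y _; rewrite ?funeposE ?funenegE//.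
apply: (measurableT_comp (f := fine)) => //; under eq_fun do rewrite e.
apply: emeasurable_funB.
  apply: (@measurable_fun_fubini_tonelli_F _ _ _ _ _ m2 (EFin \o f)^\+%E); first exact: measurable_funepos.
  by move=> x; exact: funepos_ge0.
apply: (@measurable_fun_fubini_tonelli_F _ _ _ _ _ m2 (EFin \o f)^\-%E); first exact: measurable_funeneg.
by move=> x; exact: funeneg_ge0.
Qed.

End ParameterIntegral.

(** * Marchaud derivatives and fractional integrals in time *)

Section HalfLineIdentities.
Context (R : realType).
Notation hl := (@hl R).

Lemma RI_le_hl (f g : R -> R) : L1 hl f -> L1 hl g -> (forall s, 0 < s -> f s <= g s) ->
  \int[hl]_s f s <= \int[hl]_s g s.
Proof.
move=> Lf Lg fg.
have mpos : measurable (`]0%R, +oo[%classic : set (measurableTypeR R)) by exact: measurable_itv.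
have ind (h : R -> R) : L1 hl h -> L1 hl (fun s => h s * \1_(`]0%R, +oo[%classic) s) /\
   \int[hl]_s h s = \int[hl]_s (h s * \1_(`]0%R, +oo[%classic) s).
  move=> Lh; have mh : mfunT (fun s => h s * \1_(`]0%R, +oo[%classic) s).
    by mfun.
  have E s : 0 < s -> h s = h s * \1_(`]0%R, +oo[%classic) s.
    by move=> s0; rewrite indicE mem_set ?mulr1//= in_itv/= s0.
  split; last by apply: RI_eq_hl => //; exact: L1_meas Lh.
  by apply: (L1_le_hl mh _ (L1_norm Lh)) => s s0; rewrite -E.
have [Lf' ->] := ind f Lf; have [Lg' ->] := ind g Lg.
apply: RI_le => // s; rewrite indicE; have [|sN] := boolP (s \in _); last by rewrite !mulr0.
by rewrite inE/= in_itv/= andbT !mulr1; exact: fg.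
Qed.

Lemma L1_hl_scale (c : R) (f : R -> R) : 0 < c -> L1 hl f -> L1 hl (fun s => f (c * s)).
Proof.
move=> c0 Lf; have mf := L1_meas Lf.
have mN : mfunT (fun s => `|f s|%:E) by mfun.
apply: L1P; first by apply: measurableT_comp mf _; exact: measurable_funM.
rewrite (@ge0_integral_hl_scale R c (fun s => `|f s|%:E) c0 mN)//.
by rewrite lte_mul_pinfty ?lee_fin ?invr_ge0 ?(ltW c0)//; exact: L1_lty.
Qed.

Lemma RI_hl_scale (c : R) (f : R -> R) : 0 < c -> L1 hl f ->
  \int[hl]_s f (c * s) = c^-1 * \int[hl]_s f s.
Proof.
move=> c0 Lf.
have P (g : R -> R) : L1 hl g -> (forall s, 0 <= g s) -> \int[hl]_s g (c * s) = c^-1 * \int[hl]_s g s.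
  move=> Lg g0; have mg : mfunT (EFin \o g) by apply/measurable_EFinP; exact: L1_meas Lg.
  have gE s : (0 <= (EFin \o g) s)%E by rewrite lee_fin.
  have := @ge0_integral_hl_scale R c (EFin \o g) c0 mg gE.
  by rewrite /comp (L1_EFin (L1_hl_scale c0 Lg)) (L1_EFin Lg) -EFinM => -[].
have La := L1D (L1_norm Lf) Lf; have Lb := L1_norm Lf.
have a0 s : 0 <= `|f s| + f s by rewrite -lerBlDr sub0r -normrN ler_norm.
have := P _ La a0; have := P _ Lb (fun s => normr_ge0 _).
rewrite (RID (L1_hl_scale c0 Lb) (L1_hl_scale c0 Lf)) (RID Lb Lf) => ->.
by rewrite mulrDr => /addrI.
Qed.

Lemma hl_tail (th r : R) : 0 < th -> 0 < r ->
  L1 hl (fun s => s `^ (- 1 - th) * \1_(`[r, +oo[%classic) s) /\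
  \int[hl]_s (s `^ (- 1 - th) * \1_(`[r, +oo[%classic) s) = th^-1 * r `^ (- th).
Proof.
move=> th0 r0.
have m1 (a : R) : mfunT (fun s : R => s `^ (- 1 - th) * \1_(`[a, +oo[%classic) s) by mfun.
have L1' : L1 hl (fun s : R => s `^ (- 1 - th) * \1_(`[1, +oo[%classic) s).
  have g0 (s : R) : 0 <= s `^ (- 1 - th) * \1_(`[1, +oo[%classic) s by rewrite mulr_ge0 ?powR_ge0.
  apply: (proj2 (@ge0_L1_EFin _ _ R hl _ (m1 1) g0)).
  by have := hl_pow_tail th0; rewrite (_ : - th - 1 = - 1 - th) ?[- th - 1]addrC// => ->; rewrite ltry.
have I1 : \int[hl]_s (s `^ (- 1 - th) * \1_(`[1, +oo[%classic) s) = th^-1.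
  by have := hl_pow_tail th0; rewrite (_ : - th - 1 = - 1 - th) ?[- th - 1]addrC// (L1_EFin L1') => -[].
have ri : 0 < r^-1 by rewrite invr_gt0.
have E s : 0 < s -> s `^ (- 1 - th) * \1_(`[r, +oo[%classic) s =
    r `^ (- 1 - th) * ((r^-1 * s) `^ (- 1 - th) * \1_(`[1, +oo[%classic) (r^-1 * s)).
  move=> s0; rewrite mulrA -powRM ?(ltW r0) ?mulr_ge0 ?(ltW ri) ?(ltW s0)// mulrA mulfV ?gt_eqF// mul1r.
  congr (_ * _); rewrite !indicE; congr (nat_of_bool _)%:R; apply/idP/idP; rewrite !inE/= !in_itv/= !andbT.
    by rewrite mulrC ler_pdivlMr// mul1r.
  by rewrite mulrC ler_pdivlMr// mul1r.
have Ls := L1Z (r `^ (- 1 - th)) (L1_hl_scale ri L1').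
split.
  apply: (L1_le_hl (m1 r) _ (L1_norm Ls)) => s s0; rewrite -E//.
rewrite (RI_eq_hl (m1 r) (L1_meas Ls) E) (RIZ _ (L1_hl_scale ri L1')) (RI_hl_scale ri L1') I1 invrK.
by rewrite powRDp// [r `^ (- 1)]powR_inv1 ?(ltW r0)//; field; rewrite !gt_eqF.
Qed.

Section Primitive.
Context (h0 h : R -> R) (D e : R) (e0 : 0 < e).
Hypothesis mh : mfunT h.
Hypothesis mh0 : mfunT h0.
Hypothesis dh : forall s : R, 0 < s -> is_derive s 1 h0 (- h s).
Hypothesis ch : forall s : R, 0 < s -> {for s, continuous h}.
Hypothesis bh : forall s : R, 0 < s -> `|h s| <= D * s `^ (- 1 - e).

Lemma FTC_tail (t rho : R) : 0 < t -> 0 <= rho ->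
  \int[hl]_r (h (t + r) * \1_(`]-oo, rho]%classic) r) = h0 t - h0 (t + rho).
Proof.
move=> t0 r0; have dN (s : R) : 0 < s -> is_derive s 1 (fun s => - h0 s) (h s).
  by move=> s0; apply: (is_derive_val (is_deriveN (dh s0))); rewrite opprK.
by rewrite (hl_FTC t0 r0 mh dN ch) opprK addrC.
Qed.

Lemma D_ge0 : 0 <= D.
Proof.
have := le_trans (normr_ge0 _) (bh ltr01).
by rewrite powR1 mulr1.
Qed.

Lemma L1_pow_h th t : 0 <= th -> th < 1 -> 0 < t -> L1 hl (fun r => r `^ (- th) * h (t + r)).
Proof.
move=> th0 th1 t0; have D0 := D_ge0.
have tp : 0 <= t `^ (- 1 - e) by exact: powR_ge0.
have mht : mfunT (fun r => h (t + r)) by mfun.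
apply: (@hl_L1_crit R _ (1 - th) (th + e) (D * (t `^ (- 1 - e) + 1))).
- by rewrite subr_gt0.
- by rewrite ltr_wpDl.
- by mfun.
- move=> s /andP[s0 s1]; rewrite normrM (ger0_norm (powR_ge0 _ _)) mulrC.
  rewrite (_ : 1 - th - 1 = - th); last by ring.
  rewrite ler_wpM2r ?powR_ge0//; apply: (le_trans (bh _)); first by rewrite addr_gt0.
  rewrite ler_wpM2l//; apply: (@le_trans _ _ (t `^ (- 1 - e))); last by rewrite lerDl.
  rewrite (_ : - 1 - e = - (1 + e)); last by ring.
  rewrite !powRN lef_pV2 ?posrE ?powR_gt0 ?addr_gt0//.
  by apply: ler_powR_base; rewrite ?addr_ge0 ?(ltW e0) ?(ltW t0)// lerDl ltW.
- move=> s s1; have s0 : 0 < s by exact: lt_le_trans s1.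
  rewrite normrM (ger0_norm (powR_ge0 _ _)) (_ : - (th + e) - 1 = - th + (- 1 - e)); last by ring.
  rewrite [s `^ (- th + _)]powRDp// [leRHS]mulrCA ler_wpM2l ?powR_ge0//.
  apply: (le_trans (bh _)); first by rewrite addr_gt0.
  rewrite -mulrA ler_wpM2l//; apply: (@le_trans _ _ (s `^ (- 1 - e))); last first.
    by rewrite ler_peMl ?powR_ge0// lerDr.
  rewrite (_ : - 1 - e = - (1 + e)); last by ring.
  rewrite !powRN lef_pV2 ?posrE ?powR_gt0 ?addr_gt0//.
  by apply: ler_powR_base; rewrite ?addr_ge0 ?(ltW e0) ?(ltW s0)// lerDr ltW.
Qed.

Lemma L1_h t : 0 < t -> L1 hl (fun r => h (t + r)).
Proof.
move=> t0; have := L1_pow_h (lexx 0) ltr01 t0; rewrite oppr0.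
by under eq_fun do rewrite powRr0 mul1r.
Qed.

(** h0(t) - h0(t + s) is the integral of h over ]t, t + s]. Fubini on 0 < r <= s and the integral of
    s^(-1-th) over [r, +oo[ turn the Marchaud form on the left into the Weyl form on the right. *)
Lemma marchaud_weyl th t : 0 < th -> th < 1 -> 0 < t ->
  \int[hl]_s (s `^ (- 1 - th) * (h0 t - h0 (t + s))) = th^-1 * \int[hl]_r (r `^ (- th) * h (t + r)).
Proof.
move=> th0 th1 t0.
have Lp := L1_pow_h (ltW th0) th1 t0.
pose A := [set p : (measurableTypeR R) * (measurableTypeR R) | 0 < p.1 <= p.2].
have mA : measurable A.
  rewrite (_ : A = (fst @^-1` `]0, +oo[%classic) `&` ((fun p => p.2 - p.1) @^-1` `[0, +oo[%classic)).
    apply: measurableI.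
      have := @measurable_fst _ _ (measurableTypeR R) (measurableTypeR R) measurableT _ (measurable_itv `]0, +oo[).
      by rewrite setTI.
    have m1 : mfunT (fun p : (measurableTypeR R) * (measurableTypeR R) => p.2 - p.1) by mfun.
    by have := m1 measurableT _ (measurable_itv `[0, +oo[); rewrite setTI.
  apply/seteqP; split => p; rewrite /A /= !in_itv/= !andbT subr_ge0.
    by move=> /andP[-> ->].
  by move=> [-> ->].
pose f (p : (measurableTypeR R) * (measurableTypeR R)) : R := h (t + p.1) * (p.2 `^ (- 1 - th) * \1_A p).
have mf : mfunT f by mfun.
have fE r s : 0 < r -> f (r, s) = h (t + r) * (s `^ (- 1 - th) * \1_(`[r, +oo[%classic) s).
  move=> r0; rewrite /f /= !indicE; congr (_ * (_ * (nat_of_bool _)%:R)).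
  by apply/idP/idP; rewrite !inE /A/= in_itv/= andbT r0.
have f0 r s : r <= 0 -> f (r, s) = 0 by move=> r0; rewrite /f /= indicE memNset ?mulr0// /A/= ltNge r0.
have Lf r : L1 hl (fun s => f (r, s)).
  have [r0|r0] := ltP 0 r.
    under eq_fun do rewrite fE//; apply: L1Z; exact: (hl_tail th0 r0).1.
  under eq_fun do rewrite f0//.
  have := L1Z 0 (hl_tail th0 ltr01).1; by under eq_fun do rewrite mul0r.
have fin : (\int[hl]_r \int[hl]_s `|f (r, s)|%:E < +oo)%E.
  apply: (@fubini_fin R _ _ _ _ hl hl f (fun r => th^-1 * `|r `^ (- th) * h (t + r)|)) => //.
    exact/L1Z/L1_norm.
  move=> r; have [r0|r0] := ltP 0 r; last first.
    rewrite (_ : (fun s => _) = fun=> 0) ?Rintegral0 ?mulr_ge0 ?invr_ge0 ?(ltW th0)//.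
      by rewrite /Rintegral integral0//= mulr_ge0 ?invr_ge0 ?(ltW th0).
    by apply/funext => s; rewrite f0// normr0.
  have [La Ia] := hl_tail th0 r0.
  rewrite (_ : (fun s => `|f (r, s)|) = fun s => `|h (t + r)| * (s `^ (- 1 - th) * \1_(`[r, +oo[%classic) s)).
    by rewrite (RIZ _ La) Ia normrM (ger0_norm (powR_ge0 _ _)); rewrite le_eqVlt; apply/orP; left; apply/eqP; ring.
  apply/funext => s; rewrite fE// normrM; congr (_ * _); rewrite ger0_norm// mulr_ge0 ?powR_ge0//.
have := RI_fubini mf fin.
have -> : \int[hl]_r \int[hl]_s f (r, s) = th^-1 * \int[hl]_r (r `^ (- th) * h (t + r)).
  rewrite -(RIZ _ Lp); apply: RI_eq_hl => [||r r0].
  - exact: L1_meas (L1_fubini1 mf fin).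
  - by mfun.
  have [La Ia] := hl_tail th0 r0.
  under eq_Rintegral do rewrite fE//.
  by rewrite (RIZ _ La) Ia; ring.
move=> ->; apply: RI_eq_hl => [||s s0].
- by mfun.
- exact: L1_meas (L1_fubini2 mf fin).
rewrite -(FTC_tail t0 (ltW s0)).
have LI : L1 hl (fun r => h (t + r) * \1_(`]-oo, s]%classic) r).
  apply: (L1_le _ _ (L1_norm (L1_h t0))).
    by mfun.
  by move=> r; rewrite normrM ler_piMr// indicE; case: (_ \in _); rewrite ?normr1 ?normr0.
rewrite -(RIZ _ LI); apply: RI_eq_hl => [||r r0].
- by mfun.
- by mfun.
rewrite fE//; rewrite [LHS]mulrCA; congr (_ * (_ * _)); rewrite !indicE; congr (nat_of_bool _)%:R.
by apply/idP/idP; rewrite !inE/= !in_itv/= ?andbT.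
Qed.

(* With [h] the opposite of the derivative of [h0], composing the fractional integral over ]0, N] with the
   Marchaud derivative averages the increments of [h0]; r = rho w turns the double integral into a product. *)
Lemma weyl_average th t N : 0 < th -> th < 1 -> 0 < t -> 0 < N ->
  \int[hl]_rho (rho `^ (th - 1) * (\int[hl]_r (r `^ (- th) * h (t + rho + r))) * \1_(`]-oo, N]%classic) rho) =
  \int[hl]_w (w `^ (- th) / (1 + w) * (h0 t - h0 (t + N * (1 + w)))).
Proof.
move=> th0 th1 t0 N0.
(* The factor [ip] makes the integrand vanish for w <= 0, where the estimates make no sense; it
   equals 1 almost everywhere for [hl]. *)
pose ip (w : R) : R := \1_(`]0, +oo[%classic) w.
have mip : mfunT ip by mfun.
have ipE (w : R) : 0 < w -> ip w = 1 by move=> w0; rewrite /ip indicE mem_set//= in_itv/= w0.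
have ip0 (w : R) : w <= 0 -> ip w = 0 by move=> w0; rewrite /ip indicE memNset//= in_itv/= ltNge w0.
pose iN (r : R) : R := \1_(`]-oo, N]%classic) r.
have miN : mfunT iN by mfun.
pose f (p : (measurableTypeR R) * (measurableTypeR R)) : R :=
  ip p.1 * p.1 `^ (- th) * (h (t + p.2 * (1 + p.1)) * iN p.2).
have mf : mfunT f by mfun.
have Lh := L1_h t0.
have iN1 (g : R -> R) : L1 hl g -> L1 hl (fun r => g r * iN r).
  move=> Lg; apply: (L1_le _ _ (L1_norm Lg)); first by apply: measurable_funM => //; exact: L1_meas Lg.
  by move=> r; rewrite normrM ler_piMr// /iN indicE; case: (_ \in _); rewrite ?normr1 ?normr0.
have Lw w : 0 < w -> L1 hl (fun r => h (t + r * (1 + w))).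
  move=> w0; have w1 : 0 < 1 + w by rewrite addr_gt0.
  by have := L1_hl_scale w1 Lh; under eq_fun do rewrite mulrC.
have L0 : L1 hl (fun _ : R => 0 : R) by have := L1Z 0 Lh; under eq_fun do rewrite mul0r.
have f0 w r : w <= 0 -> f (w, r) = 0 by move=> w0; rewrite /f /= ip0// !mul0r.
have Lf w : L1 hl (fun r => f (w, r)).
  have [w0|w0] := ltP 0 w; last by under eq_fun do rewrite f0//.
  by have := L1Z (ip w * w `^ (- th)) (iN1 _ (Lw w w0)).
pose I := \int[hl]_r `|h (t + r)|.
have I0 : 0 <= I by apply: RI_ge0.
have Lk : L1 hl (fun w => w `^ (- th) / (1 + w)).
  apply: (@hl_L1_crit R _ (1 - th) th 1) => //; first by rewrite subr_gt0.
  - by mfun.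
  - move=> s /andP[s0 s1]; have s10 : 0 < 1 + s by rewrite addr_gt0.
    rewrite mul1r ger0_norm ?divr_ge0 ?powR_ge0 ?(ltW s10)// (_ : 1 - th - 1 = - th); last by ring.
    by rewrite ler_pdivrMr// ler_peMr ?powR_ge0// lerDl ltW.
  - move=> s s1; have s0 : 0 < s by exact: lt_le_trans s1.
    have s10 : 0 < 1 + s by rewrite addr_gt0.
    rewrite mul1r ger0_norm ?divr_ge0 ?powR_ge0 ?(ltW s10)// powRDp// ler_wpM2l ?powR_ge0//.
    by rewrite powR_inv1 ?(ltW s0)// lef_pV2 ?posrE// lerDr.
have fin : (\int[hl]_w \int[hl]_r `|f (w, r)|%:E < +oo)%E.
  apply: (@fubini_fin R _ _ _ _ hl hl f (fun w => `|I * (w `^ (- th) / (1 + w))|)) => //.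
    exact/L1_norm/L1Z.
  move=> w; have [w0|w0] := ltP 0 w; last first.
    rewrite (_ : (fun r => _) = fun=> 0); last by apply/funext => s; rewrite f0// normr0.
    by rewrite /Rintegral integral0/=.
  have w1 : 0 < 1 + w by rewrite addr_gt0.
  have Lhn := L1_hl_scale w1 (L1_norm Lh).
  apply: (@le_trans _ _ (\int[hl]_r (w `^ (- th) * `|h (t + (1 + w) * r)|))).
    apply: RI_le; [exact: L1_norm|exact: L1Z|].
    move=> r; rewrite /f /= ipE// mul1r !normrM (ger0_norm (powR_ge0 _ _)) ler_wpM2l ?powR_ge0// mulrC [(1 + w) * r]mulrC.
    by rewrite ler_piMl// /iN indicE; case: (_ \in _); rewrite ?normr1 ?normr0.
  rewrite (RIZ _ Lhn) (RI_hl_scale w1 (L1_norm Lh)) -/I ger0_norm; last by rewrite mulr_ge0 ?divr_ge0 ?powR_ge0// ltW.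
  by rewrite le_eqVlt; apply/orP; left; apply/eqP; ring.
have Ef := RI_fubini mf fin.
have mkp : mfunT (fun w : R => w `^ (- th) / (1 + w)) by mfun.
transitivity (\int[hl]_r \int[hl]_w f (w, r)).
  apply: RI_eq_hl => [||rho rho0].
  - apply: measurable_funM; last exact: miN.
    apply: measurable_funM; first exact: measurable_powR.
    apply: (RI_measurable hl (f := fun p : (measurableTypeR R) * (measurableTypeR R) => p.2 `^ (- th) * h (t + p.1 + p.2))).
    by mfun.
  - exact: L1_meas (L1_fubini2 mf fin).
  have trho : 0 < t + rho by rewrite addr_gt0.
  have Lp := L1_pow_h (ltW th0) th1 trho.
  have Lps := L1_hl_scale rho0 Lp.
  transitivity (\int[hl]_w (rho `^ th * iN rho * ((rho * w) `^ (- th) * h (t + rho + rho * w)))).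
    have e2 := RI_hl_scale rho0 Lp; rewrite (RIZ (rho `^ th * iN rho) Lps) e2 -/(iN rho).
    rewrite (powR_pred th rho0).
    by move: (\int[hl]_r _) (iN rho) => a b; ring.
  apply: RI_eq_hl => [||w w0].
  - by mfun.
  - by mfun.
  rewrite /f /= (ipE w w0) (powRM _ (ltW rho0) (ltW w0)).
  have e1 := powR_mulN th rho0.
  rewrite mulrDr mulr1 addrA; move: e1; move: (rho `^ th) (rho `^ (- th)) (iN rho) (w `^ (- th)) (h _) => a b c1 c2 c3 e1.
  have -> : a * c1 * (b * c2 * c3) = (a * b) * (c1 * c2 * c3) by ring.
  by rewrite e1; ring.
rewrite -Ef; apply: RI_eq_hl => [||w w0].
- exact: L1_meas (L1_fubini1 mf fin).
- by mfun.
have w1 : 0 < 1 + w := addr_gt0 ltr01 w0.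
have N1 : 0 < N * (1 + w) := mulr_gt0 N0 w1.
have Lg := @L1_indic R _ _ hl _ _ (measurable_itv `]-oo, N * (1 + w)]) Lh.
rewrite -(FTC_tail t0 (ltW N1)).
have Es := RI_hl_scale w1 Lg.
rewrite -[_ / (1 + w) * _]mulrA -Es -(RIZ _ (L1_hl_scale w1 Lg)); apply: eq_Rintegral => r _.
rewrite /f /= (ipE w w0) mul1r [r * _]mulrC; congr (_ * (_ * _)); rewrite /iN !indicE; congr (nat_of_bool _)%:R.
by apply/idP/idP; rewrite !inE/= !in_itv/= mulrC ler_pM2r.
Qed.

End Primitive.
End HalfLineIdentities.

(** * Fractional Laplacian of the Gaussian and its time derivatives *)

Section GaussianTransform.
Context (R : realType) (n : nat).
Notation mu := (leb R n).
Notation hl := (@hl R).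
Notation nu := (n%:R / 2 : R).
Implicit Types (x y z c : 'rV[R]_n) (t s r : R).
Context (n0 : (0 < n)%N).

Lemma nu_gt0 : 0 < nu.
Proof. by rewrite divr_gt0// ltr0n. Qed.

Lemma expRN_le1 (a : R) : 0 <= a -> expR (- a) <= 1.
Proof. by move=> a0; rewrite -[leRHS](@expR0 R) ler_expR oppr_le0. Qed.

Lemma G_le_pow t x : 0 < t -> G t x <= t `^ (- nu).
Proof. by move=> t0; rewrite /G ler_piMr ?powR_ge0// expRN_le1// divr_ge0 ?sq_ge0// ltW. Qed.

Lemma G_sup t x : 0 < t -> G (2 * t) x <= t `^ (- nu).
Proof.
move=> t0; have t2 : 0 < 2 * t by rewrite mulr_gt0.
apply: (le_trans (G_le_pow x t2)).
rewrite !powRN lef_pV2 ?posrE ?powR_gt0//.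
by apply: ler_powR_base; rewrite ?(ltW nu_gt0) ?(ltW t0)//; lra.
Qed.

Lemma Hk_pow k : exists2 D : R, 0 <= D & forall t x, 0 < t -> `|Hk k t x| <= D * t `^ (- nu - k%:R).
Proof.
have [C C0 hC] := Hk_bound R n k; exists C => // t x t0.
apply: (le_trans (hC t x t0)); rewrite -mulrA ler_wpM2l//.
rewrite powRDp// (powRN t k%:R) powR_mulrn ?(ltW t0)// mulrC.
by rewrite ler_wpM2r ?invr_ge0 ?exprn_ge0 ?(ltW t0)// G_sup.
Qed.

Section HkPrimitive.
Context (k : nat) (y : 'rV[R]_n).

Lemma mHk j x : mfunT (fun t : R => Hk j t x).
Proof. by mfun. Qed.

Lemma cHk j x s : 0 < s -> {for s, continuous (fun t : R => Hk j t x)}.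
Proof.
move=> s0; apply: differentiable_continuous; apply/derivable1_diffP.
by case: (is_derive_Hk j x s0).
Qed.

Lemma bHk : exists D : R, forall x s, 0 < s -> `|Hk k.+1 s x| <= D * s `^ (- 1 - (nu + k%:R)).
Proof.
have [D _ hD] := Hk_pow k.+1; exists D => x s s0; apply: (le_trans (hD s x s0)).
by rewrite (_ : - nu - k.+1%:R = - 1 - (nu + k%:R))// -[k.+1%:R]natr1; ring.
Qed.

End HkPrimitive.

Lemma nuk_gt0 k : 0 < nu + k%:R.
Proof. by rewrite ltr_wpDr// nu_gt0. Qed.

Definition Phi (th : R) k t y : R := \int[hl]_r (r `^ (- th) * Hk k.+1 (t + r) y).

(** By [hl_G] the kernel is a superposition of [G s]; by the semigroup property, integrating the
    second difference of [Hk k t] against [G s] gives 2 [gmass] times the increment from time t to t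
    + s; [marchaud_weyl] trades the increments for the next time derivative. *)
Lemma frac_Hk (th t : R) k y : 0 < th -> th < 1 -> 0 < t ->
  L1 mu (fun z => dd (Hk k t) y z * rker th z) ->
  \int[mu]_z (dd (Hk k t) y z * rker th z) = 2 * gmass R n / Gam (nu + th) / th * Phi th k t y.
Proof.
move=> th0 th1 t0 Ld.
have q0 := q_gt0 n th0; have Gq := Gam_gt0 q0.
have mH : mfunT (Hk (n := n) k t) by mfun.
have mG : mfunT (fun p : 'rV[R]_n * (measurableTypeR R) => G p.2 p.1) by mfun.
pose f (p : 'rV[R]_n * (measurableTypeR R)) : R := dd (Hk k t) y p.1 * (p.2 `^ (- 1 - th) * G p.2 p.1).
have mf : mfunT f by mfun.
have LG z : z != 0 -> L1 hl (fun s => s `^ (- 1 - th) * G s z) /\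
    \int[hl]_s (s `^ (- 1 - th) * G s z) = Gam (nu + th) * rker th z.
  move=> z0; have sz : 0 < sq z by rewrite lt0r sq_eq0 z0 sq_ge0.
  have h := hl_G (ltW th0) sz q0.
  have mg : mfunT (fun s : R => s `^ (- 1 - th) * G s z) by mfun.
  have g0 s : 0 <= s `^ (- 1 - th) * G s z by rewrite mulr_ge0 ?powR_ge0 ?G_ge0.
  have L : L1 hl (fun s => s `^ (- 1 - th) * G s z).
    by apply: (proj2 (@ge0_L1_EFin _ _ R hl _ mg g0)); rewrite h ltry.
  by split => //; move: h; rewrite (L1_EFin L) => -[].
have f0 s : f (0, s) = 0 by rewrite /f /= dd0 mul0r.
have L0 : L1 hl (fun _ : R => 0 : R) by have := L1Z 0 (hl_tail th0 ltr01).1; under eq_fun do rewrite mul0r.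
have Lf z : L1 hl (fun s => f (z, s)).
  have [->|z0] := eqVneq z 0; first by under eq_fun do rewrite f0.
  by have := L1Z (dd (Hk k t) y z) (LG z z0).1.
have If z : \int[hl]_s f (z, s) = Gam (nu + th) * (dd (Hk k t) y z * rker th z).
  have [->|z0] := eqVneq z 0; first by under eq_Rintegral do rewrite f0; rewrite dd0 mul0r mulr0 /Rintegral integral0.
  by rewrite (RIZ (dd (Hk k t) y z) (LG z z0).1) (LG z z0).2; ring.
have fin : (\int[mu]_z \int[hl]_s `|f (z, s)|%:E < +oo)%E.
  apply: (@fubini_fin R _ _ _ _ mu hl f (fun z => Gam (nu + th) * `|dd (Hk k t) y z * rker th z|)) => //.
    exact/L1Z/L1_norm.
  move=> z; have [->|z0] := eqVneq z 0.
    under eq_Rintegral do rewrite f0 normr0; rewrite /Rintegral integral0/=.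
    by rewrite mulr_ge0// ltW.
  have -> : (fun s => `|f (z, s)|) = fun s => `|dd (Hk k t) y z| * (s `^ (- 1 - th) * G s z).
    by apply/funext => s; rewrite /f /= normrM (ger0_norm (mulr_ge0 (powR_ge0 _ _) (G_ge0 _ _))).
  rewrite (RIZ _ (LG z z0).1) (LG z z0).2 normrM (ger0_norm (rker_ge0 _ _)).
  by rewrite le_eqVlt; apply/orP; left; apply/eqP; ring.
have := RI_fubini mf fin.
have -> : \int[mu]_z \int[hl]_s f (z, s) = Gam (nu + th) * \int[mu]_z (dd (Hk k t) y z * rker th z).
  by rewrite -(RIZ _ Ld); apply: eq_Rintegral => z _; exact: If.
have [D hD] := bHk k.
have pr : \int[hl]_s (s `^ (- 1 - th) * (Hk k t y - Hk k (t + s) y)) = th^-1 * Phi th k t y.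
  apply: (@marchaud_weyl R (fun t => Hk k t y) (fun t => Hk k.+1 t y) D (nu + k%:R)) => //.
  - exact: nuk_gt0.
  - by mfun.
  - by mfun.
  - by move=> s s0; exact: is_derive_Hk.
  - by move=> s s0; exact: cHk.
  - exact: hD.
have -> : \int[hl]_s \int[mu]_z f (z, s) = 2 * gmass R n * \int[hl]_s (s `^ (- 1 - th) * (Hk k t y - Hk k (t + s) y)).
  have inner s : 0 < s -> \int[mu]_z f (z, s) = 2 * gmass R n * (s `^ (- 1 - th) * (Hk k t y - Hk k (t + s) y)).
    move=> s0.
    have La : L1 mu (fun z => G s z * Hk k t (y - z)).
      have := L1Z (s `^ (- nu)) (L1_norm (L1_Hk k y t0)); apply: L1_le.
        by mfun.
      by move=> z; rewrite normrM ler_wpM2r// ger0_norm ?G_ge0// G_le_pow.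
    have Ia := Hk_semigroup k y s0 t0.
    have Lb : L1 mu (fun z => G s z * Hk k t (y + z)).
      by have := L1_reflect 0 La; under eq_fun do rewrite sub0r GN opprK.
    have Ib : \int[mu]_z (G s z * Hk k t (y + z)) = gmass R n * Hk k (s + t) y.
      rewrite -Ia -(RI_reflect 0 (L1_meas La)); apply: eq_Rintegral => z _.
      by rewrite sub0r GN opprK.
    have Lg : L1 mu (G s) .
      by apply: (proj2 (@ge0_L1_EFin _ _ R mu _ (@measurable_G R n s) (G_ge0 s))); rewrite integral_G// ltry.
    have Ig : \int[mu]_z G s z = gmass R n by have := integral_G n s0; rewrite (L1_EFin Lg) => -[].
    have Lc := L1Z (2 * Hk k t y) Lg.
    transitivity (\int[mu]_z (s `^ (- 1 - th) * (2 * Hk k t y * G s z - G s z * Hk k t (y + z) - G s z * Hk k t (y - z)))).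
      by apply: eq_Rintegral => z _; rewrite /f /dd /=; ring.
    rewrite (RIZ _ (L1B (L1B Lc Lb) La)) (RIB (L1B Lc Lb) La) (RIB Lc Lb) (RIZ _ Lg) Ia Ib Ig [s + t]addrC.
    by ring.
  have mr : mfunT (fun s : R => 2 * gmass R n * (s `^ (- 1 - th) * (Hk k t y - Hk k (t + s) y))).
    by mfun.
  have e := RI_eq_hl (L1_meas (L1_fubini2 mf fin)) mr inner.
  rewrite e; have [E0|E0] := eqVneq (2 * gmass R n) 0.
    by exfalso; move: E0; apply/eqP; rewrite mulf_neq0 ?gt_eqF ?gmass_gt0.
  have L2 := L1_fubini2 mf fin.
  have L3 : L1 hl (fun s : R => 2 * gmass R n * (s `^ (- 1 - th) * (Hk k t y - Hk k (t + s) y))).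
    by apply: (L1_le_hl mr _ (L1_norm L2)) => s s0; rewrite inner.
  have L4 : L1 hl (fun s : R => s `^ (- 1 - th) * (Hk k t y - Hk k (t + s) y)).
    have := L1Z (2 * gmass R n)^-1 L3; under eq_fun do rewrite mulrA mulVf// mul1r.
    by [].
  exact: (RIZ _ L4).
rewrite pr => e.
apply: (mulfI (x := Gam (nu + th))); first by rewrite gt_eqF.
by rewrite e; field; rewrite !gt_eqF.
Qed.

(** For r <= T the Gaussian factor is at most exp(-|y|^2/(4 T)). For r > T the integrand is below a
    multiple of r^(-q-1) exp(-|y|^2/(4 r)) with q = n/2 + th, a Gamma integral proportional to
    |y|^(-2q). Both fit the weight, uniformly for times between t and T. *)
Lemma Phi_bound (th : R) k t T : 0 < th -> th < 1 -> 0 < t -> exists2 C : R, 0 <= C &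
  forall s y, t <= s <= T -> \int[hl]_r `|r `^ (- th) * Hk k.+1 (s + r) y| <= C * om (nu + th) y.
Proof.
move=> th0 th1 t0; have q0 := q_gt0 n th0; have nu0 := nu_gt0.
have [C1 C10 h1] := Hk_bound R n k.+1.
pose g X (r : R) : R := r `^ (- th) * ((t + r) `^ (- 1 - nu) * expR (- (X / (2 * (T + r))))).
have tT s : t <= s <= T -> 0 < T by move=> /andP[a b]; exact: lt_le_trans (lt_le_trans t0 a) b.
have [T0|T0] := ltP 0 T; last first.
  by exists 0 => // s y /tT; rewrite ltNge T0.
have mg X : mfunT (g X).
  apply: measurable_funM; first exact: measurable_powR.
  by mfun.
pose g0 (r : R) : R := r `^ (- th) * (t + r) `^ (- 1 - nu).
have Lg0 : L1 hl g0.
  have L := @L1_pow_h R (fun s => s `^ (- 1 - nu)) 1 nu nu0 (measurable_powR _) _ th t (ltW th0) th1 t0.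
  by apply: L => s s0; rewrite mul1r ger0_norm ?powR_ge0.
have gle X r : 0 <= X -> 0 < r -> 0 <= g X r <= g0 r.
  move=> X0 r0; rewrite /g /g0 !mulr_ge0 ?powR_ge0 ?expR_ge0//= ler_wpM2l ?powR_ge0// ler_piMr ?powR_ge0//.
  by rewrite expRN_le1// divr_ge0// mulr_ge0// addr_ge0// ltW.
have Lg X : 0 <= X -> L1 hl (g X).
  move=> X0; apply: (L1_le_hl (mg X) _ Lg0) => r r0; case/andP: (gle X r X0 r0) => a b.
  by rewrite ger0_norm.
pose I0 := \int[hl]_r g0 r.
have I00 : 0 <= I0 by apply: RI_ge0 => r; rewrite mulr_ge0 ?powR_ge0.
pose q := nu + th.
pose h X (r : R) : R := r `^ (- q - 1) * expR (- (X / r)).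
have Lh X : 0 < X -> L1 hl (h X) /\ \int[hl]_r h X r = Gam q * X `^ (- q).
  move=> X0; have e := hl_inv_exp_pow q0 X0.
  have mh : mfunT (h X).
    apply: measurable_funM; first exact: measurable_powR.
    by mfun.
  have h0 r : 0 <= h X r by rewrite mulr_ge0 ?powR_ge0 ?expR_ge0.
  have L : L1 hl (h X) by apply: (proj2 (@ge0_L1_EFin _ _ R hl _ mh h0)); rewrite e ltry.
  by split => //; move: e; rewrite (L1_EFin L) => -[].
have T40 : 0 < (4 * T)^-1 by rewrite invr_gt0 mulr_gt0.
have [C2 C20 h2] := exp_le_om n th0 T40.
pose hd (r : R) : R := t `^ (- 1 - nu) * (r `^ (- th) * \1_(`]-oo, T]%classic) r).
have Lhd : L1 hl hd.
  apply: L1Z; apply: (@hl_L1_crit R _ (1 - th) 1 (1 + T `^ 2)).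
  - by rewrite subr_gt0.
  - by [].
  - by mfun.
  - move=> r /andP[r0 r1]; rewrite normrM (ger0_norm (powR_ge0 _ _)) (_ : 1 - th - 1 = - th); last by ring.
    apply: (@le_trans _ _ (r `^ (- th))); last by rewrite ler_peMl ?powR_ge0// lerDl powR_ge0.
    by rewrite ler_piMr ?powR_ge0// indicE; case: (_ \in _); rewrite ?normr1 ?normr0.
  move=> r r1; have r0 : 0 < r by exact: lt_le_trans r1.
  rewrite normrM (ger0_norm (powR_ge0 _ _)) indicE; have [|rT] := boolP (r \in _); last first.
    by rewrite normr0 mulr0 mulr_ge0 ?powR_ge0// addr_ge0// powR_ge0.
  rewrite inE/= in_itv/= => rT; rewrite normr1 mulr1.
  rewrite (_ : - 1 - 1 = - 2 :> R) ?powRN ?ler_pdivlMr ?powR_gt0//; last by ring.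
  apply: (@le_trans _ _ (r `^ 2)).
    by rewrite ler_piMl ?powR_ge0// -powRN powRN invf_le1 ?powR_gt0// -(powRr0 r) ler_powR// ltW.
  apply: (@le_trans _ _ (T `^ 2)); last by rewrite lerDr.
  by apply: ler_powR_base => //; exact: ltW.
pose I1 := \int[hl]_r hd r.
have I10 : 0 <= I1 by apply: RI_ge0 => r; rewrite !mulr_ge0 ?powR_ge0.
have gh X r : 0 <= X -> 0 < r -> g X r <= expR (- ((4 * T)^-1 * X)) * hd r + h (X / 4) r.
  move=> X0 r0; rewrite /g /hd /h.
  have Tr : 0 < T + r by rewrite addr_gt0.
  have e0 : 0 <= expR (- ((4 * T)^-1 * X)) := expR_ge0 _.
  have h0 : 0 <= r `^ (- q - 1) * expR (- (X / 4 / r)) by rewrite mulr_ge0 ?powR_ge0 ?expR_ge0.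
  have hd0 : 0 <= expR (- ((4 * T)^-1 * X)) * (t `^ (- 1 - nu) * (r `^ (- th) * \1_(`]-oo, T]%classic) r)).
    by rewrite !mulr_ge0 ?powR_ge0.
  have pm (a b : R) : 0 < a -> a <= b -> b `^ (- 1 - nu) <= a `^ (- 1 - nu).
    move=> a0 ab; rewrite (_ : - 1 - nu = - (1 + nu)); last by ring.
    rewrite !powRN lef_pV2 ?posrE ?powR_gt0 ?(lt_le_trans a0)//.
    by apply: ler_powR_base => //; rewrite ?addr_ge0 ?(ltW nu0) ?(ltW a0).
  have [rT|rT] := leP r T.
    rewrite -[leLHS]addr0 lerD// indicE mem_set ?mulr1/=; last by rewrite in_itv.
    rewrite [leRHS](_ : _ = r `^ (- th) * (t `^ (- 1 - nu) * expR (- ((4 * T)^-1 * X)))); last by ring.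
    rewrite ler_wpM2l ?powR_ge0//.
    apply: ler_pM; rewrite ?powR_ge0 ?expR_ge0//; first by apply: pm => //; rewrite lerDl ltW.
    rewrite ler_expR lerN2 mulrC ler_wpM2l// lef_pV2 ?posrE ?mulr_gt0//; lra.
  rewrite -[leLHS]add0r lerD// (_ : - q - 1 = - th + (- 1 - nu)); last by rewrite /q; ring.
  rewrite [r `^ (- th + _)]powRDp// -[leRHS]mulrA ler_wpM2l ?powR_ge0//.
  apply: ler_pM; rewrite ?powR_ge0 ?expR_ge0//; first by apply: pm => //; rewrite lerDr ltW.
  rewrite ler_expR lerN2 -mulrA ler_wpM2l// -invfM lef_pV2 ?posrE ?mulr_gt0//; lra.
pose C3 := I0 * 2 `^ q + C2 * I1 + Gam q * (4 `^ q * 2 `^ q).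
have Gq := Gam_gt0 q0.
have C30 : 0 <= C3 by rewrite !addr_ge0 ?mulr_ge0 ?powR_ge0// ltW.
have gC y : \int[hl]_r g (sq y) r <= C3 * om q y.
  have o0 := om_gt0 q y; have X0 := sq_ge0 y.
  have [y1|y1] := leP (sq y) 1.
    apply: (@le_trans _ _ I0).
      by apply: RI_le_hl => //; [exact: Lg|move=> r r0; case/andP: (gle (sq y) r X0 r0)].
    apply: (@le_trans _ _ (I0 * (2 `^ q * om q y))).
      rewrite ler_peMr// omE ler_pdivlMr ?powR_gt0 ?sq1_gt0// mul1r.
      by apply: ler_powR_base; rewrite ?(ltW q0) ?addr_ge0//; lra.
    rewrite mulrA ler_wpM2r ?(ltW o0)// /C3 -addrA lerDl addr_ge0 ?mulr_ge0 ?powR_ge0//; exact: ltW.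
  have X4 : 0 < sq y / 4 by rewrite divr_gt0// (lt_trans _ y1).
  have [Lhy Ihy] := Lh _ X4.
  apply: (@le_trans _ _ (\int[hl]_r (expR (- ((4 * T)^-1 * sq y)) * hd r + h (sq y / 4) r))).
    by apply: RI_le_hl; [exact: Lg|apply: L1D => //; exact: L1Z|move=> r; exact: gh].
  rewrite (RID (L1Z _ Lhd) Lhy) (RIZ _ Lhd) -/I1 Ihy.
  apply: (@le_trans _ _ (C2 * om q y * I1 + Gam q * (4 `^ q * (2 `^ q * om q y)))).
    apply: lerD; first by rewrite ler_wpM2r// h2.
    rewrite ler_wpM2l ?(ltW Gq)// powRM// ?invr_ge0// -[4^-1]powR_inv1// -powRrM mulN1r opprK mulrC ler_wpM2l ?powR_ge0//.
    have := rker_far th0 ltr01 (ltW y1); rewrite invr1; exact.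
  rewrite /C3 !mulrDl -addrA [leLHS](_ : _ = C2 * I1 * om q y + Gam q * (4 `^ q * 2 `^ q) * om q y); last by ring.
  by rewrite lerDr !mulr_ge0 ?powR_ge0// ltW.
exists (C1 * t `^ (- k%:R) * C3); first by rewrite !mulr_ge0 ?powR_ge0.
move=> s y /andP[ts sT]; have s0 : 0 < s by exact: lt_le_trans ts.
have mf : mfunT (fun r : R => `|r `^ (- th) * Hk k.+1 (s + r) y|) by mfun.
have bd r : 0 < r -> `|r `^ (- th) * Hk k.+1 (s + r) y| <= C1 * t `^ (- k%:R) * g (sq y) r.
  move=> r0; have sr : 0 < s + r by rewrite addr_gt0.
  have tr : 0 < t + r by rewrite addr_gt0.
  rewrite normrM (ger0_norm (powR_ge0 _ _)).
  apply: (@le_trans _ _ (r `^ (- th) * (C1 * (s + r) ^- k.+1 * G (2 * (s + r)) y))).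
    by rewrite ler_wpM2l ?powR_ge0// h1.
  rewrite /g /G.
  have p1 : (s + r) ^- k.+1 <= t `^ (- k%:R) * (t + r)^-1.
    rewrite powRN powR_mulrn ?(ltW t0)// exprS invfM mulrC.
    apply: ler_pM; rewrite ?invr_ge0 ?exprn_ge0 ?(ltW sr)//.
      by rewrite lef_pV2 ?posrE ?exprn_gt0// lerXn2r ?nnegrE ?(ltW t0) ?(ltW sr)// (le_trans ts)// lerDl ltW.
    by rewrite lef_pV2 ?posrE// lerD2r.
  have p2 : (2 * (s + r)) `^ (- nu) <= (t + r) `^ (- nu).
    rewrite !powRN lef_pV2 ?posrE ?powR_gt0 ?mulr_gt0//.
    by apply: ler_powR_base; rewrite ?(ltW nu0) ?(ltW tr)//; lra.
  have p3 : expR (- (sq y / (2 * (s + r)))) <= expR (- (sq y / (2 * (T + r)))).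
    rewrite ler_expR lerN2 ler_wpM2l ?sq_ge0// lef_pV2 ?posrE ?mulr_gt0 ?addr_gt0//.
    by rewrite ler_pM2l// lerD2r.
  rewrite [leRHS]mulrCA ler_wpM2l ?powR_ge0// -!mulrA ler_wpM2l// powRDp// [(t + r) `^ (- 1)]powR_inv1 ?(ltW tr)//.
  rewrite [leRHS](_ : _ = (t `^ (- k%:R) * (t + r)^-1) * ((t + r) `^ (- nu) * expR (- (sq y / (2 * (T + r)))))); last by ring.
  apply: ler_pM; rewrite ?mulr_ge0 ?invr_ge0 ?exprn_ge0 ?powR_ge0 ?expR_ge0 ?(ltW sr)//.
  by apply: ler_pM; rewrite ?powR_ge0 ?expR_ge0.
have LgC := L1Z (C1 * t `^ (- k%:R)) (Lg _ (sq_ge0 y)).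
have Lf : L1 hl (fun r : R => `|r `^ (- th) * Hk k.+1 (s + r) y|).
  by apply: (L1_le_hl mf _ LgC) => r r0; rewrite normr_id bd.
apply: (le_trans (RI_le_hl Lf LgC bd)).
by rewrite (RIZ _ (Lg _ (sq_ge0 y))) -[leRHS]mulrA ler_wpM2l ?mulr_ge0 ?powR_ge0.
Qed.

End GaussianTransform.

(** * The tested equation, integrated in time *)

Section Transform.
Context (R : realType) (n : nat).
Notation mu := (leb R n).
Notation hl := (@hl R).
Notation nu := (n%:R / 2 : R).
Implicit Types (x y z c : 'rV[R]_n) (t s r : R).
Context (n0 : (0 < n)%N).
Context (th d : R) (th0 : 0 < th) (d0 : 0 < d) (dn : d < nu) (thd : th + d <= 1).
Notation q := (nu + th).
Context (k : nat) (u : 'rV[R]_n -> R) (al : R) (hal : al = 2 * th).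
Hypothesis cu : continuous u.
Hypothesis Lu : L1 mu (fun y => u y * om q y).
Hypothesis ru : Reg (th + d) (2 * k) u.
Hypothesis u0 : forall x, 0 <= u x.
Notation f := (poly_frac_laplacian k al u).
Hypothesis f0 : forall x, 0 <= f x.

Lemma th1 : th < 1.
Proof. by apply: lt_le_trans thd; rewrite ltrDl. Qed.

Definition Fg c t : R := \int[mu]_x (f x * G t (x - c)).
Definition yk (j : nat) c t : R := \int[mu]_x (u x * Hk j t (x - c)).
Definition kap (w : R) : R := w `^ (- th) / (1 + w).
(** Collects half the normalization of the fractional Laplacian, the factor 4^k from the Laplacians
    of the Gaussian and the constant of [frac_Hk]. *)
Definition C0 : R := frac_const n al / 2 * 4 ^+ k * (2 * gmass R n / Gam q / th).

Lemma C0_gt0 : 0 < C0.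
Proof.
have q0 := q_gt0 n th0.
have fc : 0 < frac_const n al by rewrite hal; apply: frac_const_gt0 => //; exact: th1.
have gm : 0 < 2 * gmass R n by apply: mulr_gt0; [exact: ltr0n|exact: gmass_gt0].
apply: mulr_gt0; first by apply: mulr_gt0; [exact: divr_gt0|exact: exprn_gt0].
by apply: divr_gt0; [apply: divr_gt0; [exact: gm|exact: Gam_gt0]|exact: th0].
Qed.

(** [weak_gauss] with tau = 1/t, where the test function is t^(n/2) times the Gaussian [G t] and its
    image is a multiple of [Phi]. *)
Lemma Fg_eq c t : 0 < t -> [/\ L1 mu (fun x => f x * G t (x - c)),
   L1 mu (fun x => u x * Phi th k t (x - c)) & Fg c t = C0 * \int[mu]_x (u x * Phi th k t (x - c))].
Proof.
move=> t0; have ti : 0 < t^-1 by rewrite invr_gt0.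
have [La [B B0 hB] Lb e] := @weak_gauss R n th d th0 d0 dn thd k t^-1 ti c u al hal cu Lu ru f0.
have tn : 0 < t `^ nu by rewrite powR_gt0.
have phiE x : phioo t^-1 c x = t `^ nu * G t (x - c) by rewrite /phioo /G mulrA powR_mulN// mul1r mulrC.
have psiE : psioo k t^-1 c = fun x => t `^ nu * 4 ^+ k * Hk k t (x - c).
  rewrite /psioo (_ : phioo t^-1 c = fun x => t `^ nu * G t (x - c)); last exact/funext.
  exact: iter_laplacian_G.
pose b := t `^ nu * 4 ^+ k.
have b0 : 0 < b by rewrite mulr_gt0// exprn_gt0.
have ddE x z : dd (psioo k t^-1 c) x z = b * dd (Hk k t) (x - c) z.
  by rewrite psiE /dd -/b ![x + _ - c]addrAC; ring.
have LdH x : L1 mu (fun z => dd (Hk k t) (x - c) z * rker th z).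
  have := L1Z b^-1 (Lb x); rewrite (_ : (fun _ => _) = fun z => dd (Hk k t) (x - c) z * rker th z)//.
  by apply/funext => z; rewrite ddE -mulrA mulKf// gt_eqF.
have JE x : \int[mu]_z (dd (psioo k t^-1 c) x z * rker th z) = b * (2 * gmass R n / Gam q / th) * Phi th k t (x - c).
  rewrite -mulrA -(frac_Hk n0 th0 th1 t0 (LdH x)) -(RIZ _ (LdH x)).
  by apply: eq_Rintegral => z _; rewrite ddE mulrA.
have E0 : 0 < b * (2 * gmass R n / Gam q / th).
  by rewrite mulr_gt0// !divr_gt0 ?mulr_gt0 ?gmass_gt0 ?Gam_gt0// q_gt0.
set E1 := b * _ in JE E0.
have LG : L1 mu (fun x => f x * G t (x - c)).
  have := L1Z (t `^ nu)^-1 La; rewrite (_ : (fun _ => _) = fun x => f x * G t (x - c))//.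
  by apply/funext => x; rewrite phiE [f x * _]mulrCA mulKf// gt_eqF.
have mPhi : mfunT (fun x => Phi th k t (x - c)).
  apply: (RI_measurable hl (f := fun p : 'rV[R]_n * (measurableTypeR R) => p.2 `^ (- th) * Hk k.+1 (t + p.2) (p.1 - c))).
  by mfun.
have LP : L1 mu (fun x => u x * Phi th k t (x - c)).
  apply: (L1_le _ _ (L1Z (B / E1) (L1_norm (L1_u_om th0 cu Lu c)))).
    by mfun.
  move=> x; have := hB x; rewrite JE [`|E1 * _|]normrM (gtr0_norm E0) !normrM (ger0_norm (ltW (om_gt0 q (x - c)))) => h.
  rewrite mulrCA ler_wpM2l// mulrAC ler_pdivlMr// mulrC.
  exact: h.
split => //.
have := e; under eq_Rintegral do rewrite phiE mulrCA.
rewrite (RIZ _ LG) -/(Fg c t); under eq_Rintegral do rewrite JE mulrCA.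
rewrite (RIZ _ LP) => e2; apply: (mulfI (x := t `^ nu)); first by rewrite gt_eqF.
by rewrite e2 /E1 /b /C0; ring.
Qed.

Lemma L1_kap : L1 hl kap.
Proof.
have t1 := th1.
apply: (@hl_L1_crit R _ (1 - th) th 1) => //; first by rewrite subr_gt0.
- apply: measurable_funM; first exact: measurable_powR.
  by mfun.
- move=> s /andP[s0 s1]; have s10 : 0 < 1 + s by rewrite addr_gt0.
  rewrite mul1r ger0_norm ?divr_ge0 ?powR_ge0 ?(ltW s10)// (_ : 1 - th - 1 = - th); last by ring.
  by rewrite ler_pdivrMr// ler_peMr ?powR_ge0// lerDl ltW.
- move=> s s1; have s0 : 0 < s by exact: lt_le_trans s1.
  have s10 : 0 < 1 + s by rewrite addr_gt0.
  rewrite mul1r ger0_norm ?divr_ge0 ?powR_ge0 ?(ltW s10)// powR_pred// /kap ler_wpM2l ?powR_ge0//.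
  by rewrite lef_pV2 ?posrE// lerDr.
Qed.

Definition AN t N y : R := \int[hl]_w (kap w * (Hk k t y - Hk k (t + N * (1 + w)) y)).

Lemma weyl_Hk t N y : 0 < t -> 0 < N ->
  \int[hl]_rho (rho `^ (th - 1) * Phi th k (t + rho) y * \1_(`]-oo, N]%classic) rho) = AN t N y.
Proof.
move=> t0 N0; have [D hD] := bHk R n0 k.
apply: (@weyl_average R (fun t => Hk k t y) (fun t => Hk k.+1 t y) D (nu + k%:R)).
- exact: nuk_gt0.
- by mfun.
- by mfun.
- by move=> s s0; exact: is_derive_Hk.
- by move=> s s0; exact: cHk.
- exact: hD.
- exact: th0.
- exact: th1.
- exact: t0.
- exact: N0.
Qed.

(** [Fg_eq] integrated against rho^(th - 1). The cutoff at [N] confines the times to [t, t + N],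
    where [Phi_bound] is uniform and Fubini is justified; [weyl_Hk] evaluates the inner integral. *)
Lemma transform_average c t N : 0 < t -> 0 < N ->
  [/\ L1 hl (fun rho => rho `^ (th - 1) * Fg c (t + rho) * \1_(`]-oo, N]%classic) rho),
     L1 mu (fun x => u x * AN t N (x - c)) &
     \int[hl]_rho (rho `^ (th - 1) * Fg c (t + rho) * \1_(`]-oo, N]%classic) rho) =
       C0 * \int[mu]_x (u x * AN t N (x - c))].
Proof.
move=> t0 N0.
pose ip (w : R) : R := \1_(`]0, +oo[%classic) w.
have mip : mfunT ip by mfun.
have ipE (w : R) : 0 < w -> ip w = 1 by move=> w0; rewrite /ip indicE mem_set//= in_itv/= w0.
have ip0 (w : R) : w <= 0 -> ip w = 0 by move=> w0; rewrite /ip indicE memNset//= in_itv/= ltNge w0.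
pose iN (r : R) : R := \1_(`]-oo, N]%classic) r.
have miN : mfunT iN by mfun.
pose g (p : 'rV[R]_n * (measurableTypeR R)) : R :=
  u p.1 * (ip p.2 * (p.2 `^ (th - 1) * Phi th k (t + p.2) (p.1 - c) * iN p.2)).
have mPhi : mfunT (fun p : 'rV[R]_n * (measurableTypeR R) => Phi th k (t + p.2) (p.1 - c)).
  apply: (RI_measurable hl (f := fun p : ('rV[R]_n * (measurableTypeR R)) * (measurableTypeR R) =>
     p.2 `^ (- th) * Hk k.+1 (t + p.1.2 + p.2) (p.1.1 - c))).
  by mfun.
have mg : mfunT g by mfun.
have [C C1 hC] := @Phi_bound R n n0 th k t (t + N) th0 th1 t0.
have LN : L1 hl (fun r : R => r `^ (th - 1) * iN r).
  apply: (@hl_L1_crit R _ th 1 (1 + N `^ (th + 1))) => //.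
  - by mfun.
  - move=> r /andP[r0 r1]; rewrite normrM (ger0_norm (powR_ge0 _ _)).
    apply: (@le_trans _ _ (r `^ (th - 1))); last by rewrite ler_peMl ?powR_ge0// lerDl powR_ge0.
    by rewrite ler_piMr ?powR_ge0// /iN indicE; case: (_ \in _); rewrite ?normr1 ?normr0.
  move=> r r1; have r0 : 0 < r by exact: lt_le_trans r1.
  rewrite normrM (ger0_norm (powR_ge0 _ _)) /iN indicE; have [|rN] := boolP (r \in _); last first.
    by rewrite normr0 mulr0 mulr_ge0 ?powR_ge0// addr_ge0// powR_ge0.
  rewrite inE/= in_itv/= => rN; rewrite normr1 mulr1.
  rewrite (_ : th - 1 = (th + 1) + (- 1 - 1)) ?[r `^ (_ + (- 1 - 1))]powRDp//; last by ring.
  rewrite ler_wpM2r ?powR_ge0//; apply: (@le_trans _ _ (N `^ (th + 1))); last by rewrite lerDr.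
  by apply: ler_powR_base => //; rewrite ?addr_ge0 ?(ltW th0) ?(ltW r0).
pose I := \int[hl]_r `|r `^ (th - 1) * iN r|.
have hPhi rho y : 0 < rho -> rho <= N -> `|Phi th k (t + rho) y| <= C * om q y.
  move=> r0 rN; have tr : 0 < t + rho by rewrite addr_gt0.
  have [D hD] := bHk R n0 k.
  have Lp : L1 hl (fun r => r `^ (- th) * Hk k.+1 (t + rho + r) y).
    apply: (@L1_pow_h R (fun t => Hk k.+1 t y) D (nu + k%:R) (nuk_gt0 R n0 k) (mHk k.+1 y) (hD y) th (t + rho) (ltW th0) th1 tr).
  by apply: (le_trans (RI_norm Lp)); apply: hC; rewrite lerDl (ltW r0)/= lerD2l.
have gb x r : `|g (x, r)| <= (C * `|u x * om q (x - c)|) * `|r `^ (th - 1) * iN r|.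
  rewrite /g /=; have [r0|r0] := ltP 0 r; last by rewrite ip0// mul0r mulr0 normr0 !mulr_ge0.
  rewrite ipE// mul1r !normrM (ger0_norm (ltW (om_gt0 q (x - c)))).
  have [rN|rN] := leP r N; last first.
    by rewrite /iN indicE memNset ?normr0 ?mulr0//= in_itv/= leNgt rN.
  rewrite (_ : C * _ * _ = `|u x| * (`|r `^ (th - 1)| * (C * om q (x - c)) * `|iN r|)); last by ring.
  by rewrite ler_wpM2l// ler_wpM2r// ler_wpM2l// hPhi.
have Lg x : L1 hl (fun r => g (x, r)).
  apply: (L1_le _ _ (L1Z (C * `|u x * om q (x - c)|) (L1_norm LN))); last exact: gb.
  by mfun.
have fin : (\int[mu]_x \int[hl]_r `|g (x, r)|%:E < +oo)%E.
  apply: (@fubini_fin R _ _ _ _ mu hl g (fun x => I * (C * `|u x * om q (x - c)|))) => //.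
    by apply/L1Z/L1Z/L1_norm; exact: (L1_u_om th0 cu Lu).
  move=> x; apply: (le_trans (RI_le (L1_norm (Lg x)) (L1Z _ (L1_norm LN)) (gb x))).
  by rewrite (RIZ _ (L1_norm LN)) mulrC.
have E1 x : \int[hl]_r g (x, r) = u x * AN t N (x - c).
  rewrite -(weyl_Hk (x - c) t0 N0).
  have mh : mfunT (fun r : R => ip r * (r `^ (th - 1) * Phi th k (t + r) (x - c) * iN r)).
    apply: measurable_funM; first exact: mip.
    apply: measurable_funM; last exact: miN.
    apply: measurable_funM; first exact: measurable_powR.
    exact: (measurableT_comp mPhi (measurable_pair1 x)).
  have Lh : L1 hl (fun r : R => ip r * (r `^ (th - 1) * Phi th k (t + r) (x - c) * iN r)).
    have LL := L1Z (C * om q (x - c)) (L1_norm LN).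
    apply: (L1_le_hl mh _ LL) => r r0.
    rewrite ipE// mul1r !normrM; have [rN|rN] := leP r N; last first.
      by rewrite /iN indicE memNset ?normr0 ?mulr0//= in_itv/= leNgt rN.
    rewrite [leRHS]mulrCA mulrA ler_wpM2r// ler_wpM2l// hPhi//.
  rewrite (RIZ (u x) Lh); congr (_ * _); apply: RI_eq_hl => [//||r r0]; last by rewrite ipE// mul1r.
  apply: measurable_funM; last exact: miN.
  apply: measurable_funM; first exact: measurable_powR.
  exact: (measurableT_comp mPhi (measurable_pair1 x)).
have LAN : L1 mu (fun x => u x * AN t N (x - c)) by have := L1_fubini1 mg fin; under eq_fun do rewrite E1.
have E2 r : 0 < r -> C0 * \int[mu]_x g (x, r) = r `^ (th - 1) * Fg c (t + r) * iN r.
  move=> r0; have [_ LP ->] := Fg_eq c (addr_gt0 t0 r0).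
  have -> : \int[mu]_x g (x, r) = \int[mu]_x (r `^ (th - 1) * iN r * (u x * Phi th k (t + r) (x - c))).
    by apply: eq_Rintegral => x _; rewrite /g /= ipE//; ring.
  by rewrite (RIZ _ LP); ring.
have L2 := L1Z C0 (L1_fubini2 mg fin).
have mF : mfunT (fun r : R => r `^ (th - 1) * Fg c (t + r) * iN r).
  apply: measurable_funM; last exact: miN.
  apply: measurable_funM; first exact: measurable_powR.
  apply: (RI_measurable mu (f := fun p : (measurableTypeR R) * 'rV[R]_n => f p.2 * G (t + p.1) (p.2 - c))).
  apply: measurable_funM.
    have := continuous_measurable_row (@continuous_poly_frac R n th d th0 d0 dn k u al hal cu Lu ru) => mfu.
    by mfun.
  by mfun.
split => //.
- by apply: (L1_le_hl mF _ (L1_norm L2)) => r r0; rewrite -E2.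
have -> : \int[mu]_x (u x * AN t N (x - c)) = \int[mu]_x \int[hl]_r g (x, r) by apply: eq_Rintegral => x _.
rewrite (RI_fubini mg fin) -(RIZ _ (L1_fubini2 mg fin)).
by apply: RI_eq_hl => [//||r r0]; [exact: L1_meas L2|rewrite E2].
Qed.

End Transform.

(** * Repeated integration in time *)

Section OneDim.
Context (R : realType).
Notation hl := (@hl R).
Implicit Types (f g F Y : R -> R) (a c r s t N : R).

(** Substituting s = r w and then rescaling r by 1 + w makes the double integral factor. *)
Lemma beta_tonelli_gen a g : 0 < a -> mfunT g -> (forall s, 0 <= g s) ->
  (\int[hl]_r \int[hl]_s (s `^ (a - 1) * g (r + s))%:E =
   (\int[hl]_w (w `^ (a - 1) * (1 + w) `^ (- a - 1))%:E) * \int[hl]_r (r `^ a * g r)%:E)%E.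
Proof.
move=> a0 mg g0.
have mp b : mfunT (fun s : R => s `^ b) by mfun.
pose h1 (p : measurableTypeR R * measurableTypeR R) := (p.2 `^ (a - 1) * g (p.1 + p.2))%:E.
have mh1 : mfunT h1 by mfun.
pose h2 (p : measurableTypeR R * measurableTypeR R) := (p.1 `^ a * (p.2 `^ (a - 1) * g ((1 + p.2) * p.1)))%:E.
have mh2 : mfunT h2 by mfun.
have h10 p : (0 <= h1 p)%E by rewrite lee_fin mulr_ge0 ?powR_ge0.
have h20 p : (0 <= h2 p)%E by rewrite lee_fin !mulr_ge0 ?powR_ge0.
transitivity (\int[hl]_r \int[hl]_w h2 (r, w))%E.
  apply: ge0_eq_hl.
  - exact: (@measurable_fun_fubini_tonelli_F _ _ _ _ _ hl h1 mh1).
  - exact: (@measurable_fun_fubini_tonelli_F _ _ _ _ _ hl h2 mh2).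
  - by move=> r; apply: integral_ge0 => s _; exact: (h10 (r, s)).
  - by move=> r; apply: integral_ge0 => s _; exact: (h20 (r, s)).
  move=> r r0.
  have mh1r : mfunT (fun s => h1 (r, s)) by mfun.
  have mh2r : mfunT (fun s => h2 (r, s)) by mfun.
  have := @ge0_integral_hl_scale R r (fun s => h1 (r, s)) r0 mh1r (fun s => h10 (r, s)).
  move=> /(congr1 (fun x => r%:E * x)%E); rewrite muleA -EFinM mulfV ?gt_eqF// mul1e => <-.
  rewrite -ge0_integralZl ?lee_fin ?(ltW r0)//; last first.
    by apply: measurableT_comp mh1r _; exact: measurable_funM.
  apply: ge0_eq_hl.
  - by apply: measurable_funeM; apply: measurableT_comp mh1r _; exact: measurable_funM.
  - by mfun.
  - by move=> s; rewrite mule_ge0// lee_fin ltW.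
  - by move=> s; exact: h20.
  move=> w w0; rewrite /h1 /h2 /= -EFinM powRM ?(ltW r0) ?(ltW w0)// powR_pred// powR_pred//.
  rewrite (_ : (1 + w) * r = r + r * w); last by ring.
  by congr EFin; move: (r `^ a) (w `^ a) (g _) => x y z; field; rewrite !gt_eqF.
rewrite (@fubini_tonelli _ _ _ _ _ hl hl h2 mh2 h20).
pose X := (\int[hl]_r (r `^ a * g r)%:E)%E.
have mX : mfunT (fun r : R => (r `^ a * g r)%:E) by mfun.
have X0r r : (0 <= (r `^ a * g r)%:E)%E by rewrite lee_fin mulr_ge0 ?powR_ge0.
have m1w b : mfunT (fun w : R => (1 + w) `^ b) by mfun.
have mB : mfunT (fun w : R => (w `^ (a - 1) * (1 + w) `^ (- a - 1))%:E) by mfun.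
have X0 : (0 <= X)%E by apply: integral_ge0 => r _; exact: X0r.
rewrite -/X -ge0_integralZr//; last first.
  by move=> w _; rewrite lee_fin mulr_ge0 ?powR_ge0.
apply: ge0_eq_hl.
- exact: (@measurable_fun_fubini_tonelli_G _ _ _ _ _ hl h2 mh2).
- by mfun.
- by move=> r; exact: integral_ge0.
- by move=> w; rewrite mule_ge0// lee_fin mulr_ge0 ?powR_ge0.
move=> w w0; have w10 : 0 < 1 + w by rewrite addr_gt0.
have := @ge0_integral_hl_scale R (1 + w) _ w10 mX X0r; rewrite -/X => e.
transitivity ((w `^ (a - 1) * (1 + w) `^ (- a))%:E *
    \int[hl]_s (((1 + w) * s) `^ a * g ((1 + w) * s))%:E)%E; last first.
  by rewrite e muleA -EFinM -mulrA -powR_pred.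
rewrite -ge0_integralZl; last 4 first.
- exact: measurableT.
- by mfun.
- by move=> s _; exact: X0r.
- by rewrite lee_fin mulr_ge0 ?powR_ge0.
have mh2w : mfunT (fun s => h2 (s, w)) by mfun.
apply: ge0_eq_hl.
- by mfun.
- by mfun.
- by move=> s; exact: h20.
- by move=> s; rewrite mule_ge0// lee_fin mulr_ge0 ?powR_ge0.
move=> s s0; rewrite /h2/= -EFinM powRM ?(ltW w10) ?(ltW s0)//; congr EFin.
have := powR_mulN a w10; move: (g _) (s `^ a) (w `^ _) ((1 + w) `^ a) ((1 + w) `^ (- a)) => x y z b b' e1.
by rewrite -[LHS]mul1r -e1; ring.
Qed.

Definition bta a : R := Gam a * Gam 1 / Gam (a + 1).

Lemma bta_gt0 a : 0 < a -> 0 < bta a.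
Proof. by move=> a0; rewrite divr_gt0 ?mulr_gt0 ?Gam_gt0// addr_gt0. Qed.

(** The constant of the factorization is read off by testing it on g(r) = exp(-r); it is the value
    B(a, 1), obtained without computing a Beta integral. *)
Lemma beta_tonelli a g : 0 < a -> mfunT g -> (forall s, 0 <= g s) ->
  (\int[hl]_r \int[hl]_s (s `^ (a - 1) * g (r + s))%:E =
   (bta a)%:E * \int[hl]_r (r `^ a * g r)%:E)%E.
Proof.
move=> a0 mg g0; rewrite beta_tonelli_gen//; congr (_ * _)%E.
have a1 : 0 < a + 1 by rewrite addr_gt0.
have := @beta_tonelli_gen a (fun s => expR (- s)) a0.
have -> : (\int[hl]_r (r `^ a * expR (- r))%:E = (Gam (a + 1))%:E)%E.
  by rewrite -(Gam_E a1); apply: eq_integral => r _; rewrite addrK.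
have -> : (\int[hl]_r \int[hl]_s (s `^ (a - 1) * expR (- (r + s)))%:E = (Gam a * Gam 1)%:E)%E.
  transitivity (\int[hl]_r ((Gam a)%:E * (expR (- r))%:E))%E.
    apply: eq_integral => r _.
    transitivity (\int[hl]_s ((expR (- r))%:E * (s `^ (a - 1) * expR (- s))%:E))%E.
      by apply: eq_integral => s _; rewrite -EFinM opprD expRD; congr EFin; ring.
    rewrite ge0_integralZl ?lee_fin ?expR_ge0// ?Gam_E 1?muleC//.
      by mfun.
    by move=> s _; rewrite lee_fin mulr_ge0 ?powR_ge0 ?expR_ge0.
  have me : mfunT (fun r : R => (expR (- r))%:E) by mfun.
  rewrite ge0_integralZl ?lee_fin ?(ltW (Gam_gt0 a0))//.
  rewrite EFinM -(@Gam_E R 1 ltr01); apply: (congr1 (fun x => (Gam a)%:E * x)%E); apply: ge0_eq_hl.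
  - by mfun.
  - by mfun.
  - by move=> s; rewrite lee_fin expR_ge0.
  - by move=> s; rewrite lee_fin mulr_ge0 ?powR_ge0 ?expR_ge0.
  by move=> s s0; rewrite subrr powRr0 mul1r.
move=> /(_ ltac:(by apply: measurableT_comp) (fun s => expR_ge0 _)) => e.
have := congr1 (fun x => x * ((Gam (a + 1))^-1)%:E)%E e.
rewrite -muleA -!EFinM mulfV ?gt_eqF ?Gam_gt0// mule1 => <-.
by [].
Qed.

Definition iN N s : R := \1_(`]-oo, N]%classic) s.

Lemma iN1 N s : s <= N -> iN N s = 1.
Proof. by move=> h; rewrite /iN indicE mem_set//= in_itv. Qed.

Lemma iN_itv N s : 0 <= iN N s <= 1.
Proof. by rewrite /iN indicE; case: (_ \in _); rewrite /= ?lexx ?ler01. Qed.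

Lemma cvg_mulS r s : 0 < r -> \forall m \near \oo, s <= r * m.+1%:R.
Proof.
move=> r0; exists (Num.truncn (`|s| / r)) => // m /= hm.
have h : `|s| / r < (Num.truncn (`|s| / r)).+1%:R.
  by have /andP[] := @truncn_itv R (`|s| / r) ltac:(by rewrite divr_ge0// ltW).
rewrite mulrC -ler_pdivrMr//; apply: (@le_trans _ _ (`|s| / r)).
  by rewrite ler_wpM2r ?invr_ge0 ?(ltW r0) ?ler_norm.
by apply: (le_trans (ltW h)); rewrite ler_nat.
Qed.

Lemma measurable_iN N : mfunT (iN N).
Proof. exact: measurable_indic. Qed.

Lemma trunc_bd f N s : `|f s * iN N s| <= `|f s|.
Proof.
have /andP[h0 h1] := iN_itv N s.
by rewrite normrM (ger0_norm h0) ler_piMr.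
Qed.

Lemma trunc_cvg f r : 0 < r -> L1 hl f ->
  \int[hl]_s (f s * iN (r * m.+1%:R) s) @[m --> \oo] --> \int[hl]_s f s.
Proof.
move=> r0 Lf; have mf := L1_meas Lf.
refine (proj2 (@RI_dct _ _ R hl (fun m s => f s * iN (r * m.+1%:R) s) f (fun s => `|f s|) _ _ (L1_norm Lf) _)).
- by move=> m; apply: measurable_funM => //; exact: measurable_iN.
- move=> s; apply: cvg_near_cst; near=> m; rewrite iN1 ?mulr1//.
  by near: m; exact: cvg_mulS.
- by move=> m s; exact: trunc_bd.
Unshelve. all: by end_near. Qed.

Lemma trunc_L1 f M : mfunT f -> (forall s, 0 <= f s) ->
  (forall N, 0 < N -> L1 hl (fun s => f s * iN N s) /\ \int[hl]_s (f s * iN N s) <= M) -> L1 hl f.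
Proof.
move=> mf f0 h.
have hm m : L1 hl (fun s => f s * iN (1 * m.+1%:R) s) /\ \int[hl]_s (f s * iN (1 * m.+1%:R) s) <= M.
  by apply: h; rewrite mul1r ltr0n.
apply: (@fatou_L1 R _ _ hl (fun m s => f s * iN (1 * m.+1%:R) s) f (limn (fun m => \int[hl]_s (f s * iN (1 * m.+1%:R) s)))).
- by move=> m; have [] := hm m.
- by move=> m s; have /andP[i0 _] := iN_itv (1 * m.+1%:R) s; rewrite mulr_ge0.
- move=> s; apply: cvg_near_cst; near=> m; rewrite iN1 ?mulr1//.
  by near: m; exact: cvg_mulS.
apply: nondecreasing_is_cvgn.
  move=> m m' mm'; apply: RI_le => [||s]; [by have [] := hm m|by have [] := hm m'|].
  rewrite ler_wpM2l//; have /andP[i0 i1] := iN_itv (1 * m.+1%:R) s.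
  have [sm|sm] := leP s (1 * m'.+1%:R); first by rewrite [leRHS]iN1.
  rewrite [leLHS]/iN indicE memNset; first by have /andP[] := iN_itv (1 * m'.+1%:R) s.
  rewrite /= in_itv/=; apply/negP; rewrite -ltNge; apply: le_lt_trans sm.
  by rewrite !mul1r ler_nat.
by exists M => _ [m _ <-]; have [] := hm m.
Unshelve. all: by end_near. Qed.

(** Integrating [Y1] over ]t, t + N] raises the power of s by one, through [beta_tonelli]. As F >=
    0, the lower bound on [Y0] bounds the truncated integrals, so integrability is obtained before
    the limit N -> oo is taken. *)
Lemma step1D a c Y1 Y0 F : 0 < a -> 0 < c -> mfunT F -> (forall s, 0 <= F s) ->
  (forall t, 0 < t -> L1 hl (fun s => s `^ (a - 1) * F (t + s)) /\
                      Y1 t = c * \int[hl]_s (s `^ (a - 1) * F (t + s))) ->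
  (forall t N, 0 < t -> 0 < N -> L1 hl (fun r => Y1 (t + r) * iN N r) /\
                      \int[hl]_r (Y1 (t + r) * iN N r) = Y0 t - Y0 (t + N)) ->
  (forall t, 0 < t -> exists M, forall N, 0 < N -> M <= Y0 (t + N)) ->
  forall t, 0 < t -> L1 hl (fun s => s `^ a * F (t + s)) /\
    forall r, 0 < r -> Y0 (t + r * m.+1%:R) @[m --> \oo] --> Y0 t - c * bta a * \int[hl]_s (s `^ a * F (t + s)).
Proof.
move=> a0 c0 mF F0 h1 h0 hM t t0.
pose y r : R := c * \int[hl]_s (s `^ (a - 1) * F (t + r + s)).
have y0 r : 0 <= y r by rewrite mulr_ge0 ?(ltW c0)//; apply: RI_ge0 => s; rewrite mulr_ge0 ?powR_ge0.
have my : mfunT y.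
  apply: measurable_funM => //.
  apply: (RI_measurable hl (f := fun p : (measurableTypeR R) * (measurableTypeR R) => p.2 `^ (a - 1) * F (t + p.1 + p.2))).
  by mfun.
have yE r : 0 < r -> y r = Y1 (t + r) by move=> r0; have [_ ->] := h1 (t + r) (addr_gt0 t0 r0).
have [M hM'] := hM t t0.
have tr N : 0 < N -> L1 hl (fun r => y r * iN N r) /\ \int[hl]_r (y r * iN N r) = Y0 t - Y0 (t + N).
  move=> N0; have [L <-] := h0 t N t0 N0.
  have m1 : mfunT (fun r => y r * iN N r) by apply: measurable_funM => //; exact: measurable_iN.
  split; last by apply: RI_eq_hl => [//||r r0]; [exact: L1_meas L|rewrite yE].
  by apply: (L1_le_hl m1 _ (L1_norm L)) => r r0; rewrite yE.
have Ly : L1 hl y.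
  apply: (@trunc_L1 y (Y0 t - M)) => // N N0; have [L ->] := tr N N0; split => //.
  by rewrite lerD2l lerN2 hM'.
have mFt : mfunT (fun s => F (t + s)) by mfun.
have mG : mfunT (fun s => s `^ a * F (t + s)) by mfun.
have G0 s : 0 <= s `^ a * F (t + s) by rewrite mulr_ge0 ?powR_ge0.
have key : ((bta a)%:E * \int[hl]_s (s `^ a * F (t + s))%:E = (c^-1 * \int[hl]_r y r)%:E)%E.
  rewrite -(beta_tonelli a0 mFt (fun s => F0 _)) -(RIZ _ Ly) -(L1_EFin (L1Z _ Ly)).
  pose h (p : measurableTypeR R * measurableTypeR R) := (p.2 `^ (a - 1) * F (t + (p.1 + p.2)))%:E.
  have mh : mfunT h by mfun.
  have hh0 p : (0 <= h p)%E by rewrite lee_fin mulr_ge0 ?powR_ge0.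
  apply: ge0_eq_hl.
  - exact: (@measurable_fun_fubini_tonelli_F _ _ _ _ _ hl h mh).
  - by mfun.
  - by move=> r; apply: integral_ge0 => s _; exact: (hh0 (r, s)).
  - by move=> r; rewrite lee_fin mulr_ge0// invr_ge0 ltW.
  move=> r r0; have [L _] := h1 (t + r) (addr_gt0 t0 r0).
  rewrite /y mulKf ?gt_eqF// -(L1_EFin L).
  by apply: eq_integral => s _; rewrite addrA.
have LG : L1 hl (fun s => s `^ a * F (t + s)).
  apply: (@ge0_L1_scaled R _ _ hl (bta a)) => //; first exact: bta_gt0.
  under eq_integral do rewrite EFinM.
  rewrite ge0_integralZl//; first by rewrite key ltry.
  - by mfun.
  - by move=> s _; rewrite lee_fin G0.
  - by rewrite lee_fin ltW// bta_gt0.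
split => // r r0.
have E : \int[hl]_r y r = c * bta a * \int[hl]_s (s `^ a * F (t + s)).
  move: key; rewrite (L1_EFin LG) -EFinM => -[/(congr1 (fun x => c * x))].
  by rewrite mulrA mulVKf ?gt_eqF.
rewrite -E.
have h : Y0 t - \int[hl]_s (y s * iN (r * m.+1%:R) s) @[m --> \oo] --> Y0 t - \int[hl]_s y s.
  by apply: cvgB; [exact: cvg_cst|exact: trunc_cvg].
apply: cvg_trans h; apply: near_eq_cvg; near=> m.
have mr : 0 < r * m.+1%:R by rewrite mulr_gt0.
by have [_ ->] := tr _ mr; rewrite opprB addrCA subrr addr0.
Unshelve. all: by end_near. Qed.

(** N and (1 + 2 d) N lead to the same limits by the first hypothesis, so N -> oo compares the
    limits up to exp(K d), and then d -> 0. Used in both directions it makes the limit constant in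
    time and space. *)
Lemma harnack_limit (T : Type) (V : R -> R -> T -> R) (l : R -> T -> R) (K : R) :
  (forall t x r, 0 < t -> 0 < r -> V t (r * m.+1%:R) x @[m --> \oo] --> l t x) ->
  (forall t t' x x' d, 0 < t -> 0 < t' -> 0 < d <= 1 ->
     exists N0, forall N, N0 <= N -> V t N x <= expR (K * d) * V t' ((1 + 2 * d) * N) x') ->
  forall t t' x x', 0 < t -> 0 < t' -> l t x <= l t' x'.
Proof.
move=> hV hH t t' c c' t0 t'0.
have step d : 0 < d <= 1 -> l t c <= expR (K * d) * l t' c'.
  move=> /andP[d0 d1]; have [N0 hN] := hH t t' c c' d t0 t'0 ltac:(by rewrite d0).
  have d2 : 0 < 1 + 2 * d by rewrite addr_gt0// mulr_gt0.
  have c1 := hV t c 1 t0 ltr01.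
  have c2 : expR (K * d) * V t' ((1 + 2 * d) * m.+1%:R) c' @[m --> \oo] --> expR (K * d) * l t' c'.
    by apply: cvgM; [exact: cvg_cst|exact: hV].
  apply: (ler_cvg_to c1 c2); near=> m; rewrite mul1r; apply: hN.
  by rewrite -[leRHS]mul1r; near: m; exact: cvg_mulS.
have c3 : expR (K * (m.+1%:R^-1 : R)) * l t' c' @[m --> \oo] --> l t' c'.
  rewrite -[X in _ --> X]mul1r -[1 in X in _ --> X](@expR0 R) -(mulr0 K).
  apply: cvgM; last exact: cvg_cst.
  apply: (cvg_comp (fun m => K * (m.+1%:R^-1 : R)) expR); last exact: continuous_expR.
  by apply: cvgM; [exact: cvg_cst|exact: cvg_natSinv].
apply: (@cvgr_to_ge _ _ _ _ _ _ _ c3); near=> m; apply: step.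
by rewrite invr_gt0 ltr0n /= invf_le1 ?ltr0n// ler1n.
Unshelve. all: by end_near. Qed.

End OneDim.

Ltac munfold ::= cbv beta delta [G om dd rker iN].

Lemma cvg_powN (R : realType) (e r t : R) : 0 < e -> 0 < r -> 0 <= t ->
  (t + r * m.+1%:R) `^ (- e) @[m --> \oo] --> (0 : R).
Proof.
move=> e0 r0 t0; apply/cvgrPdist_lt => d d0; near=> m.
have s0 : 0 < t + r * m.+1%:R by rewrite ltr_wpDl// mulr_gt0.
have hm : d `^ (- e^-1) + 1 <= r * m.+1%:R by near: m; exact: cvg_mulS.
rewrite sub0r normrN ger0_norm ?powR_ge0// powRN invf_plt ?posrE ?powR_gt0//.
apply: (@lt_le_trans _ _ ((d `^ (- e^-1) + 1) `^ e)).
  have -> : d^-1 = (d `^ (- e^-1)) `^ e by rewrite -powRrM mulNr mulVf ?gt_eqF// powR_inv1// ltW.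
  by apply: gt0_ltr_powR; rewrite ?nnegrE ?addr_ge0 ?powR_ge0// ltrDl.
by apply: ler_powR_base; rewrite ?addr_ge0 ?powR_ge0 ?(ltW e0)//; lra.
Unshelve. all: by end_near. Qed.

(** * The heat flow of u at late times *)

Section HeatFormula.
Context (R : realType) (n : nat).
Notation mu := (leb R n).
Notation hl := (@hl R).
Notation nu := (n%:R / 2 : R).
Implicit Types (x y z c : 'rV[R]_n) (t s r N : R).
Context (n0 : (0 < n)%N).
Context (th d : R) (th0 : 0 < th) (d0 : 0 < d) (dn : d < nu) (thd : th + d <= 1).
Notation q := (nu + th).

(** Measured against the weight, the Gaussian may grow like s^th, but every time derivative gains
    1/s. As th < 1, the terms with j >= 1 vanish at late times and only j = 0 can leave a limit. *)
Lemma Hk_decay j t : 0 < t -> exists2 C : R, 0 <= C &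
  forall s y, t <= s -> `|Hk j s y| <= C * s `^ (th - j%:R) * om q y.
Proof.
move=> t0; have [C C0 hC] := Hk_bound R n j; have q0 := q_gt0 n th0.
pose E : R := 2 `^ q * ((2 * t) `^ (- q) + q `^ q) * 2 `^ th.
exists (C * E); first by rewrite !(mulr_ge0, addr_ge0) ?powR_ge0.
move=> s y ts; have s0 : 0 < s by exact: lt_le_trans ts.
have s20 : 0 < 2 * s by rewrite mulr_gt0.
apply: (le_trans (hC s y s0)).
have h : G (2 * s) y <= E * s `^ th * om q y.
  apply: (le_trans (G_le_om y q0 s20)); rewrite ler_wpM2r ?(ltW (om_gt0 _ _))// /E -!mulrA ler_wpM2l ?powR_ge0//.
  have -> : 2 `^ th * s `^ th = (2 * s) `^ th by rewrite powRM// ltW.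
  rewrite [leRHS]mulrDl; apply: lerD; last first.
    by rewrite ler_wpM2l ?powR_ge0// (_ : q - nu = th)//; ring.
  rewrite (_ : - nu = - q + th) ?[(2 * s) `^ (- q + th)]powRDp//; last by ring.
  rewrite ler_wpM2r ?powR_ge0// !powRN lef_pV2 ?posrE ?powR_gt0 ?mulr_gt0//.
  by apply: ler_powR_base; rewrite ?(ltW q0) ?ler_pM2l// mulr_ge0// ltW.
rewrite powRDp// powRN powR_mulrn ?(ltW s0)//.
apply: (@le_trans _ _ (C * s ^- j * (E * s `^ th * om q y))).
  by rewrite ler_wpM2l// mulr_ge0// invr_ge0 exprn_ge0// ltW.
by rewrite le_eqVlt; apply/orP; left; apply/eqP; ring.
Qed.

Section Function.
Context (u : 'rV[R]_n -> R).
Hypothesis cu : continuous u.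
Hypothesis Lu : L1 mu (fun y => u y * om q y).
Notation yk := (yk u).

Lemma L1_u_om_norm c : L1 mu (fun x => `|u x| * om q (x - c)).
Proof.
have := L1_norm (L1_u_om th0 cu Lu c); congr (L1 mu _); apply/funext => x.
by rewrite normrM (ger0_norm (ltW (om_gt0 _ _))).
Qed.

Lemma L1_u_le (g : 'rV[R]_n -> R) C c : mfunT g -> (forall x, `|g x| <= C * om q (x - c)) ->
  L1 mu (fun x => u x * g x).
Proof.
move=> mg hg; apply: (L1_le _ _ (L1Z C (L1_u_om_norm c))).
  by mfun.
by move=> x; rewrite normrM [leRHS]mulrCA ler_wpM2l.
Qed.

Lemma mHk_shift j t c : mfunT (fun x => Hk j t (x - c)).
Proof. by mfun. Qed.

Lemma L1_yk j c t : 0 < t -> L1 mu (fun x => u x * Hk j t (x - c)).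
Proof.
move=> t0; have [C _ hC] := Hk_decay j t0.
by apply: (L1_u_le (mHk_shift j t c)) => x; exact: hC.
Qed.

Lemma yk_bound j c t : 0 < t -> exists2 C, 0 <= C & forall s, t <= s -> `|yk j c s| <= C * s `^ (th - j%:R).
Proof.
move=> t0; have [C C0 hC] := Hk_decay j t0.
exists (C * \int[mu]_x (`|u x| * om q (x - c))).
  by rewrite mulr_ge0//; apply: RI_ge0 => x; rewrite mulr_ge0// ltW// om_gt0.
move=> s ts; have s0 : 0 < s by exact: lt_le_trans ts.
apply: (le_trans (RI_norm (L1_yk j c s0))).
rewrite mulrAC -(RIZ _ (L1_u_om_norm c)).
apply: (RI_le (L1_norm (L1_yk j c s0)) (L1Z _ (L1_u_om_norm c))) => x.
by rewrite normrM [leRHS]mulrCA ler_wpM2l// hC.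
Qed.

Lemma yk_lim j c t r : (0 < j)%N -> 0 < t -> 0 < r -> yk j c (t + r * m.+1%:R) @[m --> \oo] --> 0.
Proof.
move=> j0 t0 r0; have [C C0 hC] := yk_bound j c t0.
have e0 : 0 < j%:R - th.
  rewrite subr_gt0; apply: (@lt_le_trans _ _ 1); last by rewrite ler1n.
  by apply: lt_le_trans thd; rewrite ltrDl.
have h : C * (t + r * m.+1%:R) `^ (- (j%:R - th)) @[m --> \oo] --> 0.
  by rewrite -(mulr0 C); apply: cvgM; [exact: cvg_cst|exact: (cvg_powN e0 r0 (ltW t0))].
apply: norm_cvg0; apply: (squeeze_cvgr _ (cvg_cst (0 : R)) h); near=> m.
by rewrite normr_ge0 opprB hC// lerDl mulr_ge0// ltW.
Unshelve. all: by end_near. Qed.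

Lemma L1_iN N : 0 < N -> L1 hl (fun r => iN N r).
Proof.
move=> N0; apply: (@hl_L1_crit R _ 1 1 (1 + N ^+ 2)) => //; first exact: measurable_iN.
  move=> s /andP[s0 s1]; have /andP[h0 h1] := iN_itv N s.
  by rewrite ger0_norm// subrr powRr0 mulr1; apply: (le_trans h1); rewrite lerDl sqr_ge0.
move=> s s1; have s0 : 0 < s by exact: lt_le_trans s1.
have /andP[h0 h1] := iN_itv N s; rewrite ger0_norm//.
have -> : - 1 - 1 = - 2%:R :> R by ring.
rewrite powRN powR_mulrn ?(ltW s0)// ler_pdivlMr ?exprn_gt0//.
have [sN|sN] := leP s N.
  rewrite iN1// mul1r; apply: (@le_trans _ _ (N ^+ 2)); last by rewrite lerDr.
  by rewrite ler_pXn2r ?nnegrE ?(ltW s0) ?(ltW N0).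
rewrite /iN indicE memNset ?mul0r ?addr_ge0 ?sqr_ge0//=.
by rewrite in_itv/= leNgt sN.
Qed.

Lemma yk_int j c t N : 0 < t -> 0 < N -> L1 hl (fun r => yk j.+1 c (t + r) * iN N r) /\
  \int[hl]_r (yk j.+1 c (t + r) * iN N r) = yk j c t - yk j c (t + N).
Proof.
move=> t0 N0.
pose ip (w : R) : R := \1_(`]0, +oo[%classic) w.
have mip : mfunT ip by mfun.
have ipE (w : R) : 0 < w -> ip w = 1 by move=> w0; rewrite /ip indicE mem_set//= in_itv/= w0.
have ip0 (w : R) : w <= 0 -> ip w = 0 by move=> w0; rewrite /ip indicE memNset//= in_itv/= ltNge w0.
pose g (p : 'rV[R]_n * (measurableTypeR R)) : R := u p.1 * (ip p.2 * (Hk j.+1 (t + p.2) (p.1 - c) * iN N p.2)).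
have mh x : mfunT (fun r : R => Hk j.+1 (t + r) x * iN N r) by mfun.
have mg : mfunT g by mfun.
have [C C0 hC] := @Hk_om R n j.+1 q t (t + N) (q_gt0 n th0) t0.
have LN := L1_iN N0.
have hb r x : 0 < r -> `|Hk j.+1 (t + r) x * iN N r| <= C * om q x * iN N r.
  move=> r0; have /andP[i0 i1] := iN_itv N r; rewrite normrM (ger0_norm i0).
  have [rN|rN] := leP r N; last by rewrite /iN indicE memNset ?mulr0//= in_itv/= leNgt rN.
  by rewrite ler_wpM2r// hC// lerDl (ltW r0)/= lerD2l.
have gb x r : `|g (x, r)| <= (C * (`|u x| * om q (x - c))) * iN N r.
  have /andP[i0 i1] := iN_itv N r; have o0 := ltW (om_gt0 q (x - c)).
  rewrite /g /=; have [r0|r0] := ltP 0 r; last first.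
    by rewrite ip0// mul0r mulr0 normr0; do 2?apply: mulr_ge0 => //; exact: mulr_ge0.
  rewrite ipE// mul1r normrM (_ : C * _ * _ = `|u x| * (C * om q (x - c) * iN N r)); last by ring.
  by rewrite ler_wpM2l// hb.
have Lg x : L1 hl (fun r => g (x, r)).
  apply: (L1_le _ _ (L1Z (C * (`|u x| * om q (x - c))) LN)); last exact: gb.
  by mfun.
have fin : (\int[mu]_x \int[hl]_r `|g (x, r)|%:E < +oo)%E.
  apply: (@fubini_fin R _ _ _ _ mu hl g (fun x => (\int[hl]_r iN N r) * (C * (`|u x| * om q (x - c))))) => //.
    by apply/L1Z/L1Z; exact: L1_u_om_norm.
  move=> x; apply: (le_trans (RI_le (L1_norm (Lg x)) (L1Z _ LN) (gb x))).
  by rewrite (RIZ _ LN) mulrC.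
have Lh x : L1 hl (fun r : R => Hk j.+1 (t + r) x * iN N r).
  by apply: (L1_le_hl (mh x) _ (L1Z (C * om q x) LN)) => r r0; exact: hb.
have E1 x : \int[hl]_r g (x, r) = u x * Hk j t (x - c) - u x * Hk j (t + N) (x - c).
  have [D hD] := bHk R n0 j.
  have dH (s : R) : 0 < s -> is_derive s 1 (fun t => Hk j t (x - c)) (- Hk j.+1 s (x - c)).
    by move=> s0; exact: is_derive_Hk.
  have cH (s : R) : 0 < s -> {for s, continuous (fun t => Hk j.+1 t (x - c))} by move=> s0; exact: cHk.
  have := @FTC_tail R _ _ (mHk j.+1 (x - c)) dH cH t N t0 (ltW N0).
  rewrite -mulrBr => <-; rewrite -(RIZ (u x) (Lh _)).
  apply: RI_eq_hl => [||r r0]; [exact: L1_meas (Lg x)|exact: L1_meas (L1Z _ (Lh _))|].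
  by rewrite /g /= ipE// mul1r.
have E2 r : 0 < r -> \int[mu]_x g (x, r) = yk j.+1 c (t + r) * iN N r.
  move=> r0; rewrite mulrC -(RIZ _ (L1_yk _ _ (addr_gt0 t0 r0))).
  by apply: eq_Rintegral => x _; rewrite /g /= ipE// mul1r; ring.
have L2 := L1_fubini2 mg fin.
have my : mfunT (fun r : R => yk j.+1 c (t + r) * iN N r).
  apply: measurable_funM; last exact: measurable_iN.
  apply: (RI_measurable mu (f := fun p : (measurableTypeR R) * 'rV[R]_n => u p.2 * Hk j.+1 (t + p.1) (p.2 - c))).
  by mfun.
split; first by apply: (L1_le_hl my _ (L1_norm L2)) => r r0; rewrite -E2.
rewrite -(RI_eq_hl (L1_meas L2) my E2) -(RI_fubini mg fin).
rewrite /yk -(RIB (L1_yk _ _ t0) (L1_yk _ _ (addr_gt0 t0 N0))).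
by apply: eq_Rintegral => x _; exact: E1.
Qed.

End Function.
End HeatFormula.

(** Peter-Paul with parameter d costs a factor 1 + d in |x - c|^2, absorbed by s' >= (1 + d) s, and
    a remainder at most d; this is the 1 in the constant. The term 3 nu pays for the ratio of the
    normalizations, at most (1 + 3 d)^nu. *)
Lemma G_harnack (R : realType) (n : nat) (nu := n%:R / 2 : R) (s s' d : R) (x c c' : 'rV[R]_n) :
  0 < s -> 0 < d -> (1 + d) * s <= s' -> s' <= (1 + 3 * d) * s -> sq (c - c') <= d ^+ 2 * s ->
  G s (x - c) <= expR ((3 * nu + 1) * d) * G s' (x - c').
Proof.
move=> s0 d0 h1 h2 hD.
have d10 : 0 < 1 + d by rewrite addr_gt0.
have s'0 : 0 < s' by apply: lt_le_trans h1; rewrite mulr_gt0.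
have nu0 : 0 <= nu by rewrite divr_ge0.
have e1 : s `^ (- nu) <= expR (3 * nu * d) * s' `^ (- nu).
  rewrite !powRN ler_pdivlMr ?powR_gt0// mulrC ler_pdivrMr ?powR_gt0//.
  apply: (@le_trans _ _ (((1 + 3 * d) * s) `^ nu)); first by apply: ler_powR_base => //; exact: ltW.
  have d30 : 0 <= 1 + 3 * d by rewrite addr_ge0// mulr_ge0// ltW.
  rewrite powRM ?(ltW s0)// ler_wpM2r ?powR_ge0//.
  rewrite -mulrA mulrCA [nu * _]mulrC -[expR (_ * nu)]powR_expR.
  by apply: ler_powR_base; rewrite ?expR_ge1Dx.
have e2 : expR (- (sq (x - c) / s)) <= expR d * expR (- (sq (x - c') / s')).
  rewrite -expRD ler_expR lerNl opprD opprK.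
  have h3 := sqD_le (x - c) (c - c') d0.
  rewrite addrA subrK in h3.
  have h4 : sq (x - c') / s' <= ((1 + d) * sq (x - c) + (1 + d^-1) * sq (c - c')) / ((1 + d) * s).
    apply: ler_pM => //; rewrite ?sq_ge0 ?invr_ge0 ?(ltW s'0)//.
    by rewrite lef_pV2 ?posrE ?mulr_gt0.
  have h5 : ((1 + d) * sq (x - c) + (1 + d^-1) * sq (c - c')) / ((1 + d) * s) = sq (x - c) / s + sq (c - c') / (d * s).
    by field; rewrite !gt_eqF.
  rewrite h5 in h4; have h6 : sq (c - c') / (d * s) <= d.
    by rewrite ler_pdivrMr ?mulr_gt0// mulrA -expr2.
  lra.
rewrite /G -/nu; apply: (@le_trans _ _ (expR (3 * nu * d) * s' `^ (- nu) * (expR d * expR (- (sq (x - c') / s'))))).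
  by apply: ler_pM; rewrite ?powR_ge0 ?expR_ge0.
by rewrite [(_ + 1) * d]mulrDl mul1r expRD le_eqVlt; apply/orP; left; apply/eqP; ring.
Qed.

(** The ratio 1 + 2 d lies between the bounds 1 + d and 1 + 3 d of [G_harnack], which leaves room
    for t and t' once N is large. *)
Lemma G_harnack_ev (R : realType) (n : nat) (nu := n%:R / 2 : R) (t t' d : R) (c c' : 'rV[R]_n) :
  0 < t -> 0 < t' -> 0 < d <= 1 -> exists2 N0 : R, 0 < N0 & forall N w x, N0 <= N -> 0 <= w ->
    G (t + N * (1 + w)) (x - c) <= expR ((3 * nu + 1) * d) * G (t' + (1 + 2 * d) * N * (1 + w)) (x - c').
Proof.
move=> t0 t'0 /andP[d0 d1].
have D0 : 0 <= sq (c - c') by exact: sq_ge0.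
exists ((2 * t + t') / d + sq (c - c') / d ^+ 2).
  by rewrite ltr_wpDr ?divr_ge0 ?exprn_ge0 ?(ltW d0)// divr_gt0// addr_gt0// mulr_gt0.
move=> N w x hN w0.
have a1 : 0 <= sq (c - c') / d ^+ 2 by rewrite divr_ge0// exprn_ge0// ltW.
have a2 : 0 <= (2 * t + t') / d by rewrite divr_ge0 ?(ltW d0)// ltW// addr_gt0// mulr_gt0.
have b1 : 2 * t + t' <= d * N by rewrite [d * N]mulrC -ler_pdivrMr//; apply: le_trans hN; rewrite lerDl.
have b2 : sq (c - c') <= d ^+ 2 * N.
  by rewrite [_ * N]mulrC -ler_pdivrMr ?exprn_gt0//; apply: le_trans hN; rewrite lerDr.
have N0 : 0 < N by apply: lt_le_trans hN; rewrite ltr_wpDr// divr_gt0// addr_gt0// mulr_gt0.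
have NN : N <= N * (1 + w) by rewrite ler_peMr ?(ltW N0)// lerDl.
have M0 : 0 < N * (1 + w) by exact: lt_le_trans NN.
rewrite -[(1 + 2 * d) * N * _]mulrA; move: (N * (1 + w)) NN M0 => M NN M0.
have dM : d * N <= d * M by rewrite ler_wpM2l// ltW.
have dt : d * t <= t by rewrite ler_piMl// ltW.
have dt0 : 0 < d * t by rewrite mulr_gt0.
apply: G_harnack; [by rewrite addr_gt0|by []|lra|lra|].
by apply: (le_trans b2); rewrite ler_wpM2l ?exprn_ge0 ?(ltW d0)//; lra.
Qed.

(** * The integral formula for the heat flow of u *)

Section HeatRepr.
Context (R : realType) (n : nat).
Notation mu := (leb R n).
Notation hl := (@hl R).
Notation nu := (n%:R / 2 : R).
Implicit Types (x y z c : 'rV[R]_n) (t s r N : R).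
Context (n0 : (0 < n)%N).
Context (th d : R) (th0 : 0 < th) (d0 : 0 < d) (dn : d < nu) (thd : th + d <= 1).
Notation q := (nu + th).
Context (k : nat) (u : 'rV[R]_n -> R) (al : R) (hal : al = 2 * th).
Hypothesis cu : continuous u.
Hypothesis Lu : L1 mu (fun y => u y * om q y).
Hypothesis ru : Reg (th + d) (2 * k) u.
Hypothesis u0 : forall x, 0 <= u x.
Notation f := (poly_frac_laplacian k al u).
Hypothesis f0 : forall x, 0 <= f x.
Notation F := (Fg k u al).
Notation yk := (yk u).
Notation kap := (kap th).
Notation C0 := (C0 n th k al).

Definition Bk : R := \int[hl]_w kap w.

Lemma kap_ge0 w : 0 < w -> 0 <= kap w.
Proof. by move=> w0; rewrite divr_ge0 ?powR_ge0// addr_ge0// ltW. Qed.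

Lemma Bk_gt0 : 0 < Bk.
Proof.
have t1 : 0 < 1 - th by rewrite subr_gt0 (th1 d0 thd).
apply: lt_le_trans (Gam_gt0 t1) _; rewrite /Gam.
apply: RI_le_hl; [exact: hl_gamma|exact: L1_kap th0 d0 thd|] => w w0.
rewrite (_ : 1 - th - 1 = - th); last by ring.
rewrite ler_wpM2l ?powR_ge0// expRN lef_pV2 ?posrE ?expR_gt0 ?addr_gt0//.
exact: expR_ge1Dx.
Qed.

Lemma Fg_ge0 c t : 0 <= F c t.
Proof. by apply: RI_ge0 => x; rewrite mulr_ge0// G_ge0. Qed.

Lemma measurable_Fg c : mfunT (F c).
Proof.
apply: (RI_measurable mu (f := fun p : (measurableTypeR R) * 'rV[R]_n => f p.2 * G p.1 (p.2 - c))).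
apply: measurable_funM.
  have := continuous_measurable_row (@continuous_poly_frac R n th d th0 d0 dn k u al hal cu Lu ru) => mfu.
  by mfun.
Proof. by mfun. Qed.

(** The late-time part of the average [AN]: the only part that depends on N, hence the one to be
    followed as N -> oo. *)
Definition KN t N y : R := \int[hl]_w (kap w * Hk k (t + N * (1 + w)) y).

Lemma tN_ge t N w : 0 < t -> 0 < N -> 0 < w -> t + N <= t + N * (1 + w).
Proof. by move=> t0 N0 w0; rewrite lerD2l ler_peMr ?(ltW N0)// lerDl ltW. Qed.

Lemma L1_KN t N y : 0 < t -> 0 < N -> L1 hl (fun w => kap w * Hk k (t + N * (1 + w)) y).
Proof.
move=> t0 N0; have [C C1 hC] := Hk_decay n th0 k (addr_gt0 t0 N0).
have Lk := L1_kap th0 d0 thd; have [D D0 hD] := Hk_pow R n0 k.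
apply: (L1_le_hl _ _ (L1Z (D * (t + N) `^ (- nu - k%:R)) Lk)).
  by mfun.
move=> w w0; have h := tN_ge t0 N0 w0; have tN0 : 0 < t + N by exact: addr_gt0.
have s0 : 0 < t + N * (1 + w) by exact: lt_le_trans h.
rewrite normrM (ger0_norm (kap_ge0 w0)) mulrC ler_wpM2r ?kap_ge0//.
apply: (le_trans (hD _ y s0)); rewrite ler_wpM2l//.
rewrite -opprD !powRN lef_pV2 ?posrE ?powR_gt0//.
by apply: ler_powR_base; rewrite ?(ltW tN0)// addr_ge0.
Qed.

Lemma AN_split t N y : 0 < t -> 0 < N -> AN th k t N y = Bk * Hk k t y - KN t N y.
Proof.
move=> t0 N0; have Lk := L1_kap th0 d0 thd.
rewrite mulrC -(RIZ _ Lk) -(RIB (L1Z _ Lk) (L1_KN y t0 N0)).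
by apply: eq_Rintegral => w _; rewrite [_ * kap w]mulrC -mulrBr.
Qed.

Lemma L1_uKN c t N : 0 < t -> 0 < N -> L1 mu (fun x => u x * KN t N (x - c)).
Proof.
move=> t0 N0; have [_ L _] := transform_average n0 th0 d0 dn thd hal cu Lu ru f0 c t0 N0.
have := L1B (L1Z Bk (L1_yk th0 cu Lu k c t0)) L; congr (L1 mu _); apply/funext => x.
by rewrite AN_split//; ring.
Qed.

Lemma transform_split c t N : 0 < t -> 0 < N ->
  L1 hl (fun r => r `^ (th - 1) * F c (t + r) * iN N r) /\
  \int[hl]_r (r `^ (th - 1) * F c (t + r) * iN N r) =
    C0 * (Bk * yk k c t - \int[mu]_x (u x * KN t N (x - c))).
Proof.
move=> t0 N0; have [L1' L2 e] := transform_average n0 th0 d0 dn thd hal cu Lu ru f0 c t0 N0.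
split; first exact: L1'.
rewrite /iN e; congr (_ * _); have Ly := L1_yk th0 cu Lu k c t0.
rewrite -(RIZ _ Ly) -(RIB (L1Z _ Ly) (L1_uKN c t0 N0)).
by apply: eq_Rintegral => x _; rewrite AN_split//; ring.
Qed.

Lemma uKN_bound c t N : (0 < k)%N -> 0 < t -> exists2 C : R, 0 <= C &
  forall N, 0 < N -> `|\int[mu]_x (u x * KN t N (x - c))| <= C * (t + N) `^ (- (k%:R - th)).
Proof.
move=> k0 t0; have [C C1 hC] := Hk_decay n th0 k t0.
have Lk := L1_kap th0 d0 thd; have Lo := L1_u_om_norm th0 cu Lu c.
have e0 : 0 <= k%:R - th by rewrite subr_ge0; apply: le_trans (ltW (th1 d0 thd)) _; rewrite ler1n.
exists (Bk * C * \int[mu]_x (`|u x| * om q (x - c))).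
  apply: mulr_ge0; first by rewrite mulr_ge0 ?(ltW Bk_gt0).
  by apply: RI_ge0 => x; rewrite mulr_ge0// ltW// om_gt0.
move=> {}N N0; have tN0 : 0 < t + N by exact: addr_gt0.
apply: (le_trans (RI_norm (L1_uKN c t0 N0))).
rewrite mulrAC -(RIZ _ Lo); apply: (RI_le (L1_norm (L1_uKN c t0 N0)) (L1Z _ Lo)) => x.
rewrite normrM [leRHS]mulrCA ler_wpM2l//.
apply: (le_trans (RI_norm (L1_KN (x - c) t0 N0))).
rewrite -!mulrA mulrC -(RIZ _ Lk).
apply: (RI_le_hl (L1_norm (L1_KN (x - c) t0 N0)) (L1Z _ Lk)) => w w0.
have h := tN_ge t0 N0 w0.
rewrite normrM (ger0_norm (kap_ge0 w0)) mulrC ler_wpM2r ?kap_ge0//.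
have ts : t <= t + N * (1 + w) by apply: le_trans h; rewrite lerDl ltW.
apply: (le_trans (hC _ (x - c) ts)); rewrite -mulrA ler_wpM2l// ler_wpM2r ?(ltW (om_gt0 _ _))//.
rewrite -(opprB k%:R th) !powRN lef_pV2 ?posrE ?powR_gt0 ?(lt_le_trans tN0)//.
by apply: ler_powR_base => //; exact: ltW.
Qed.

(** For k = 0 the late part averages Gaussians against u >= 0; for k > 0 it is bounded by
    [uKN_bound]. Through [transform_split], this bounds the truncated integrals of the source
    uniformly in N. *)
Lemma uKN_lower c t : 0 < t -> exists M, forall N, 0 < N -> M <= \int[mu]_x (u x * KN t N (x - c)).
Proof.
move=> t0; case: (posnP k) => [k0|k0].
  exists 0 => N N0; apply: RI_ge0 => x; rewrite mulr_ge0//.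
  have L := L1_KN (x - c) t0 N0.
  have := RI_le_hl (L1Z 0 L) L; rewrite (RIZ 0 L) mul0r; apply => w w0.
  by rewrite mul0r mulr_ge0 ?kap_ge0// k0 Hk0 G_ge0.
have [C C1 hC] := @uKN_bound c t 1 k0 t0; exists (- (C * t `^ (- (k%:R - th)))) => N N0.
have h := hC N N0; rewrite lerNl; apply: le_trans (_ : `|\int[mu]_x (u x * KN t N (x - c))| <= _).
  by rewrite -normrN ler_norm.
apply: (le_trans h); rewrite ler_wpM2l// !powRN lef_pV2 ?posrE ?powR_gt0 ?addr_gt0//.
apply: ler_powR_base; rewrite ?(ltW t0)// ?lerDl ?(ltW N0)//.
by rewrite subr_ge0; apply: le_trans (ltW (th1 d0 thd)) _; rewrite ler1n.
Qed.

Lemma C0g : 0 < C0. Proof. exact: (C0_gt0 n th0 d0 thd k hal). Qed.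

Lemma heat_first c t : 0 < t -> L1 hl (fun r => r `^ (th - 1) * F c (t + r)) /\
  forall r, 0 < r -> \int[mu]_x (u x * KN t (r * m.+1%:R) (x - c)) @[m --> \oo] -->
    Bk * yk k c t - C0^-1 * \int[hl]_r (r `^ (th - 1) * F c (t + r)).
Proof.
move=> t0; have [M hM] := uKN_lower c t0.
have mF : mfunT (fun r : R => r `^ (th - 1) * F c (t + r)).
  apply: measurable_funM; first exact: measurable_powR.
  by apply: (measurableT_comp (measurable_Fg c)); exact: measurable_funD.
have LF : L1 hl (fun r => r `^ (th - 1) * F c (t + r)).
  apply: (@trunc_L1 R _ (C0 * (Bk * yk k c t - M)) mF).
    by move=> s; rewrite mulr_ge0 ?powR_ge0 ?Fg_ge0.
  move=> N N0; have [L ->] := transform_split c t0 N0; split => //.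
  by rewrite ler_wpM2l ?(ltW C0g)// lerD2l lerN2 hM.
split => // r r0; have := trunc_cvg r0 LF => h.
have h2 : Bk * yk k c t - C0^-1 * \int[hl]_s (s `^ (th - 1) * F c (t + s) * iN (r * m.+1%:R) s) @[m --> \oo] -->
   Bk * yk k c t - C0^-1 * \int[hl]_r (r `^ (th - 1) * F c (t + r)).
  by apply: cvgB; [exact: cvg_cst|apply: cvgM; [exact: cvg_cst|exact: h]].
apply: cvg_trans h2; apply: near_eq_cvg; near=> m.
have mr : 0 < r * m.+1%:R by rewrite mulr_gt0.
have [_ ->] := transform_split c t0 mr; rewrite mulKf ?gt_eqF ?C0g//.
by rewrite opprB addrCA subrr addr0.
Unshelve. all: by end_near. Qed.

Lemma heat_step i j (cc : R) : 0 < cc ->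
  (forall c t, 0 < t -> L1 hl (fun s => s `^ (th + i%:R - 1) * F c (t + s)) /\
     yk j.+1 c t = cc * \int[hl]_s (s `^ (th + i%:R - 1) * F c (t + s))) ->
  forall c t, 0 < t -> L1 hl (fun s => s `^ (th + i.+1%:R - 1) * F c (t + s)) /\
    forall r, 0 < r -> yk j c (t + r * m.+1%:R) @[m --> \oo] -->
      yk j c t - cc * bta (th + i%:R) * \int[hl]_s (s `^ (th + i.+1%:R - 1) * F c (t + s)).
Proof.
move=> cc0 h c t t0.
have -> : th + i.+1%:R - 1 = th + i%:R by rewrite -[i.+1%:R]natr1; ring.
apply: (@step1D R (th + i%:R) cc (yk j.+1 c) (yk j c) (F c)) => //.
- by rewrite ltr_wpDr.
- exact: measurable_Fg.
- exact: Fg_ge0.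
- by move=> s s0; exact: h.
- by move=> s N s0 N0; exact: (yk_int n0 th0 cu Lu j c s0 N0).
move=> s s0; case: j h => [_|j _].
  by exists 0 => N N0; apply: RI_ge0 => x; rewrite mulr_ge0// Hk0 G_ge0.
have [C C1 hC] := yk_bound th0 cu Lu j.+1 c s0.
exists (- (C * s `^ (th - j.+1%:R))) => N N0; rewrite lerNl.
have sN : s <= s + N by rewrite lerDl ltW.
apply: le_trans (_ : `|yk j.+1 c (s + N)| <= _); first by rewrite -normrN ler_norm.
apply: (le_trans (hC _ sN)); rewrite ler_wpM2l// -(opprB j.+1%:R th) !powRN lef_pV2 ?posrE ?powR_gt0 ?addr_gt0//.
apply: ler_powR_base; rewrite ?(ltW s0)//.
by rewrite subr_ge0; apply: le_trans (ltW (th1 d0 thd)) _; rewrite ler1n.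
Qed.

(** Descends from the k-th time derivative of the heat flow of u to the first, one [heat_step] at a
    time. No constant appears, because all these derivatives vanish at late times. *)
Lemma heat_down i : (i < k)%N -> exists2 cc : R, 0 < cc &
  forall c t, 0 < t -> L1 hl (fun s => s `^ (th + i%:R - 1) * F c (t + s)) /\
     yk (k - i) c t = cc * \int[hl]_s (s `^ (th + i%:R - 1) * F c (t + s)).
Proof.
elim: i => [k0|i IH ik].
  exists (Bk * C0)^-1; first by rewrite invr_gt0 mulr_gt0 ?Bk_gt0 ?C0g.
  move=> c t t0; rewrite addr0 subn0; have [L h] := heat_first c t0; split => //.
  have [C C1 hC] := @uKN_bound c t 1 k0 t0.
  have e0 : 0 < k%:R - th by rewrite subr_gt0; apply: lt_le_trans (th1 d0 thd) _; rewrite ler1n.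
  have h0 : \int[mu]_x (u x * KN t (1 * m.+1%:R) (x - c)) @[m --> \oo] --> 0.
    have h1 : C * (t + 1 * m.+1%:R) `^ (- (k%:R - th)) @[m --> \oo] --> 0.
      by rewrite -(mulr0 C); apply: cvgM; [exact: cvg_cst|exact: (cvg_powN e0 ltr01 (ltW t0))].
    apply: norm_cvg0; apply: (squeeze_cvgr _ (cvg_cst (0 : R)) h1); near=> m.
    by rewrite normr_ge0 hC// mul1r ltr0n.
  have e := cvg_unique (@Rhausdorff R) (h 1 ltr01) h0.
  have B0 := Bk_gt0; have C00 := C0g; move: e; move: (\int[hl]_s _) => X e.
  apply: (mulfI (x := Bk)); first by rewrite gt_eqF.
  by rewrite invfM mulrA mulrA mulfV ?mul1r ?gt_eqF//; apply/eqP; rewrite -subr_eq0 e.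
have [cc cc0 h] := IH (ltnW ik).
have h' c t : 0 < t -> L1 hl (fun s => s `^ (th + i%:R - 1) * F c (t + s)) /\
     yk (k - i.+1).+1 c t = cc * \int[hl]_s (s `^ (th + i%:R - 1) * F c (t + s)).
  by rewrite subnSK ?(ltnW ik)//; exact: h.
exists (cc * bta (th + i%:R)); first by rewrite mulr_gt0// bta_gt0// ltr_wpDr.
move=> c t t0; have [L hr] := heat_step cc0 h' c t0; split => //.
have hl' := yk_lim th0 d0 thd cu Lu c (j := k - i.+1) ltac:(by rewrite subn_gt0) t0 ltr01.
have e := cvg_unique (@Rhausdorff R) (hr 1 ltr01) hl'.
by apply/eqP; rewrite -subr_eq0 e.
Unshelve. all: by end_near. Qed.

(** [V] unifies two forms of the late-time term: for k = 0 it is the normalized integral of u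
    against [KN], for k > 0 the heat flow of u at time t + N. Both are positive superpositions of
    Gaussians against u, so both inherit the Harnack inequality. *)
Lemma heat_repr : exists cc (V : R -> R -> 'rV[R]_n -> R), [/\ 0 < cc,
  forall t N c, 0 < t -> 0 < N -> 0 <= V t N c,
  forall t t' c c' e, 0 < t -> 0 < t' -> 0 < e <= 1 ->
     exists N0, forall N, N0 <= N -> V t N c <= expR ((3 * nu + 1) * e) * V t' ((1 + 2 * e) * N) c' &
  forall c t, 0 < t -> L1 hl (fun s => s `^ (th + k%:R - 1) * F c (t + s)) /\
    forall r, 0 < r -> V t (r * m.+1%:R) c @[m --> \oo] -->
      yk 0 c t - cc * \int[hl]_s (s `^ (th + k%:R - 1) * F c (t + s))].
Proof.
have B0 := Bk_gt0; have C00 := C0g.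
case: (posnP k) => [k0|k0].
  exists (Bk * C0)^-1, (fun t N c => Bk^-1 * \int[mu]_x (u x * KN t N (x - c))); split.
  - by rewrite invr_gt0 mulr_gt0.
  - move=> t N c t0 N0; rewrite mulr_ge0 ?invr_ge0 ?(ltW B0)//; apply: RI_ge0 => x; rewrite mulr_ge0//.
    have L := L1_KN (x - c) t0 N0.
    have := RI_le_hl (L1Z 0 L) L; rewrite (RIZ 0 L) mul0r; apply => w w0.
    by rewrite mul0r mulr_ge0 ?kap_ge0// k0 Hk0 G_ge0.
  - move=> t t' c c' e t0 t'0 e01; have [N0 N00 hN] := G_harnack_ev c c' t0 t'0 e01.
    exists N0 => N NN; have NN0 : 0 < N by exact: lt_le_trans NN.
    have e0 : 0 < e by case/andP: e01.
    have N'0 : 0 < (1 + 2 * e) * N by rewrite mulr_gt0// addr_gt0// mulr_gt0.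
    rewrite mulrCA ler_wpM2l ?invr_ge0 ?(ltW B0)// -(RIZ _ (L1_uKN c' t'0 N'0)).
    apply: (RI_le (L1_uKN c t0 NN0) (L1Z _ (L1_uKN c' t'0 N'0))) => x.
    rewrite mulrCA ler_wpM2l// -(RIZ _ (L1_KN (x - c') t'0 N'0)).
    apply: (RI_le_hl (L1_KN (x - c) t0 NN0) (L1Z _ (L1_KN (x - c') t'0 N'0))) => w w0.
    by rewrite [leRHS]mulrCA ler_wpM2l ?kap_ge0// k0 !Hk0; apply: hN => //; exact: ltW.
  move=> c t t0; have [L h] := heat_first c t0; have eth : th + k%:R - 1 = th - 1 by rewrite k0 addr0.
  rewrite eth; split; [exact: L|move=> r r0].
  have h2 : Bk^-1 * \int[mu]_x (u x * KN t (r * m.+1%:R) (x - c)) @[m --> \oo] -->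
    Bk^-1 * (Bk * yk k c t - C0^-1 * \int[hl]_r (r `^ (th - 1) * F c (t + r))).
    by apply: cvgM; [exact: cvg_cst|exact: h].
  have -> : yk 0 c t = yk k c t by rewrite k0.
  rewrite mulrBr mulKf ?gt_eqF// mulrA -invfM in h2; exact: h2.
have [cc cc0 h] := heat_down (i := k.-1) ltac:(by rewrite prednK).
have h' c t : 0 < t -> L1 hl (fun s => s `^ (th + k.-1%:R - 1) * F c (t + s)) /\
     yk 1 c t = cc * \int[hl]_s (s `^ (th + k.-1%:R - 1) * F c (t + s)).
  by move=> t0; have := h c t t0; rewrite (_ : (k - k.-1 = 1)%N)//; lia.
exists (cc * bta (th + k.-1%:R)), (fun t N c => yk 0 c (t + N)); split.
- by rewrite mulr_gt0// bta_gt0// ltr_wpDr.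
- by move=> t N c t0 N0; apply: RI_ge0 => x; rewrite mulr_ge0// Hk0 G_ge0.
- move=> t t' c c' e t0 t'0 e01; have [N0 N00 hN] := G_harnack_ev c c' t0 t'0 e01.
  exists N0 => N NN; have NN0 : 0 < N by exact: lt_le_trans NN.
  have e0 : 0 < e by case/andP: e01.
  have N'0 : 0 < (1 + 2 * e) * N by rewrite mulr_gt0// addr_gt0// mulr_gt0.
  have La := L1_yk th0 cu Lu 0 c (addr_gt0 t0 NN0).
  have Lb := L1_yk th0 cu Lu 0 c' (addr_gt0 t'0 N'0).
  rewrite -(RIZ _ Lb); apply: (RI_le La (L1Z _ Lb)) => x.
  rewrite [leRHS]mulrCA ler_wpM2l// !Hk0.
  by have := hN N 0 x NN (lexx 0); rewrite !addr0 !mulr1.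
move=> c t t0; have := heat_step cc0 h' c t0; rewrite prednK//.
Qed.

(* The constant part does not depend on the point: Harnack for the Gaussian. *)
Lemma heat_formula : exists cc l : R, [/\ 0 < cc, 0 <= l & forall c t, 0 < t ->
  L1 hl (fun s => s `^ (th + k%:R - 1) * F c (t + s)) /\
  \int[mu]_x (u x * G t (x - c)) = l + cc * \int[hl]_s (s `^ (th + k%:R - 1) * F c (t + s))].
Proof.
have [cc [V [cc0 V0 hV h]]] := heat_repr.
pose L t c := yk 0 c t - cc * \int[hl]_s (s `^ (th + k%:R - 1) * F c (t + s)).
have hL : forall t c r, 0 < t -> 0 < r -> V t (r * m.+1%:R) c @[m --> \oo] --> L t c.
  by move=> t c r t0 r0; exact: ((h c t t0).2 r r0).
have hle := harnack_limit hL hV.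
exists cc, (L 1 0); split => //.
  apply: (@cvgr_to_ge _ _ _ _ _ _ _ (hL 1 0 1 ltr01 ltr01)); near=> m.
  by apply: V0 => //; rewrite mul1r ltr0n.
move=> c t t0; split; first by have [] := h c t t0.
have anti (A B : R) : A <= B -> B <= A -> A = B by move=> AB BA; apply: le_anti; rewrite AB.
have e := anti _ _ (hle 1 t 0 c ltr01 t0) (hle t 1 c 0 t0 ltr01).
rewrite e /L subrK; apply: eq_Rintegral => x _; by rewrite Hk0.
Unshelve. all: by end_near. Qed.

End HeatRepr.

(** * Volume of balls and null sets *)

Section Balls.
Context (R : realType) (n : nat).
Notation mu := (leb R n).
Notation nu := (n%:R / 2 : R).
Implicit Types (x y z c : 'rV[R]_n) (t s r L : R).
Context (n0 : (0 < n)%N).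

Definition inB L y : R := \1_(`]-oo, L[%classic) (sq y).

Lemma inB1 L y : sq y < L -> inB L y = 1.
Proof. by move=> h; rewrite /inB indicE mem_set//= in_itv. Qed.

Lemma inB0 L y : L <= sq y -> inB L y = 0.
Proof. by move=> h; rewrite /inB indicE memNset//= in_itv/= ltNge h. Qed.

Lemma inB_itv L y : 0 <= inB L y <= 1.
Proof. by rewrite /inB indicE; case: (_ \in _); rewrite /= ?lexx ?ler01. Qed.

Lemma measurable_inB L : mfunT (inB L).
Proof. by apply: (measurableT_comp (measurable_indic _)) => //; exact: measurable_sq. Qed.

Lemma L1_inB L : L1 mu (inB L).
Proof.
apply: (@L1_bounded_supp R n _ L 1) => [|x _|x Lx]; first exact: measurable_inB.
  by have /andP[h0 h1] := inB_itv L x; rewrite ger0_norm.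
by rewrite inB0// ltW.
Qed.

Definition vol1 : R := \int[mu]_y inB 1 y.

Lemma vol_ball L : 0 < L -> \int[mu]_y inB L y = L `^ nu * vol1.
Proof.
move=> L0; have sL : 0 < Num.sqrt L by rewrite sqrtr_gt0.
have m1 : mfunT (fun y => (inB 1 y)%:E) by apply/measurable_EFinP; exact: measurable_inB.
have i0 y : (0 <= (inB 1 y)%:E)%E by rewrite lee_fin; have /andP[] := inB_itv 1 y.
have := @ge0_integral_leb_affine R n (Num.sqrt L)^-1 0 _ ltac:(by rewrite invr_eq0 gt_eqF) m1 i0.
have -> : (fun y => (inB 1 ((Num.sqrt L)^-1 *: y + 0))%:E) = (fun y => (inB L y)%:E).
  apply/funext => y; rewrite addr0 /inB sqZ !indicE; congr (_%:R)%:E; congr (nat_of_bool _).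
  apply/idP/idP; rewrite !inE/= !in_itv/= exprVn sqr_sqrtr ?(ltW L0)//.
    by rewrite ltr_pdivrMl// mulr1.
  by rewrite ltr_pdivrMl// mulr1.
rewrite (L1_EFin (L1_inB _)) (L1_EFin (L1_inB _)) -EFinM => -[->]; congr (_ * _).
rewrite normrV ?unitfE ?gt_eqF// ger0_norm ?(ltW sL)// exprVn invrK.
by rewrite -powR12_sqrt ?(ltW L0)// -powR_mulrn ?powR_ge0// -powRrM mulrC.
Qed.

(** If the unit ball were null, every ball would be null by scaling, and the Gaussian would have
    integral 0. *)
Lemma vol1_gt0 : 0 < vol1.
Proof.
rewrite lt_neqAle; apply/andP; split; last first.
  by apply: RI_ge0 => y; have /andP[] := inB_itv 1 y.
apply/eqP => v0; have Le := @L1_exp_sq R n.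
have h := @RI_dct _ _ R mu (fun m y => expR (- sq y) * inB m.+1%:R y) (fun y => expR (- sq y)) _ _ _ Le _.
have {h} [m|y|m y|_ h] := h.
- apply: measurable_funM; [exact: L1_meas Le|exact: measurable_inB].
- apply: cvg_near_cst; near=> m; rewrite inB1 ?mulr1//.
  have : sq y + 1 <= 1 * m.+1%:R by near: m; exact: cvg_mulS.
  by rewrite mul1r; apply: lt_le_trans; rewrite ltrDl.
- have /andP[b0 b1] := inB_itv m.+1%:R y.
  by rewrite ger0_norm ?mulr_ge0 ?expR_ge0// ler_piMr// expR_ge0.
have h0 : \int[mu]_y (expR (- sq y) * inB m.+1%:R y) @[m --> \oo] --> 0.
  apply: cvg_near_cst; near=> m; apply/eqP; rewrite eq_le; apply/andP; split; last first.
    by apply: RI_ge0 => y; have /andP[b0 _] := inB_itv m.+1%:R y; rewrite mulr_ge0// expR_ge0.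
  rewrite -(mulr0 (m.+1%:R `^ nu)) v0 -vol_ball//; apply: RI_le; last 2 first.
  - exact: L1_inB.
  - move=> y; have /andP[b0 b1] := inB_itv m.+1%:R y.
    by rewrite ler_piMl// -expR0 ler_expR oppr_le0 sq_ge0.
  apply: (L1_le _ _ Le); first by apply: measurable_funM; [exact: L1_meas Le|exact: measurable_inB].
  move=> y; have /andP[b0 b1] := inB_itv m.+1%:R y.
  by rewrite ger0_norm ?mulr_ge0 ?expR_ge0// ler_piMr// expR_ge0.
have e := cvg_unique (@Rhausdorff R) h h0.
have := integral_exp_sq R n; rewrite (L1_EFin Le) e => -[/eqP].
by rewrite lt_eqF// gmass_gt0.
Unshelve. all: by end_near. Qed.

(** A point lies in balls of arbitrarily small volume. Kernels take a conventional value at their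
    singularity, and this allows identities and bounds to be checked away from it. *)
Lemma ae_neq x : {ae mu, forall y, y != x}.
Proof.
have nu0 : 0 < nu by rewrite divr_gt0// ltr0n.
pose A : set 'rV[R]_n := (fun y => sq (y - x)) @^-1` [set 0].
have ms : mfunT (fun y => sq (y - x)) by mfun.
have mA : measurable A by rewrite -[A]setTI; apply: ms => //; exact: measurable_set1.
have Li L : L1 mu (fun y => inB L (y - x)) by exact: (L1_shift (- x) (L1_inB L)).
have hL L : 0 < L -> (mu A <= (L `^ nu * vol1)%:E)%E.
  move=> L0; rewrite -vol_ball// -(RI_shift (- x) (measurable_inB L)) -(L1_EFin (Li L)).
  rewrite -(setIT A) -integral_indic//; apply: ge0_le_integral => //.
  - by mfun.
  - by apply/measurable_EFinP; exact: L1_meas (Li L).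
  move=> y _; rewrite lee_fin indicE; case: (boolP (y \in A)) => [|_]; last by have /andP[] := inB_itv L (y - x).
  by rewrite inE /A /= => e; rewrite inB1// e.
exists A; split => //; last first.
  by move=> y /= /negP; rewrite negbK => /eqP ->; rewrite /A /= subrr sq0.
apply/eqP; rewrite eq_le measure_ge0 andbT; apply/lee_addgt0Pr => d d0; rewrite add0e.
have v0 := vol1_gt0; have dv : 0 < d / vol1 by rewrite divr_gt0.
apply: (le_trans (hL ((d / vol1) `^ nu^-1) _)); first by rewrite powR_gt0.
by rewrite lee_fin -powRrM mulVf ?gt_eqF// powRr1 ?(ltW dv)// divfK ?gt_eqF.
Qed.

Lemma RI_eq_off x (f g : 'rV[R]_n -> R) : mfunT f -> mfunT g ->
  (forall y, y != x -> f y = g y) -> \int[mu]_y f y = \int[mu]_y g y.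
Proof. by move=> mf mg h; apply: ae_RI_eq => //; apply: filterS (ae_neq x) => y; exact: h. Qed.

Lemma L1_le_off x (f g : 'rV[R]_n -> R) : mfunT f -> L1 mu g ->
  (forall y, y != x -> `|f y| <= g y) -> L1 mu f.
Proof. by move=> mf Lg h; apply: (ae_L1_le mf _ Lg); apply: filterS (ae_neq x) => y; exact: h. Qed.

Lemma RI_le_off x (f g : 'rV[R]_n -> R) : L1 mu f -> L1 mu g ->
  (forall y, y != x -> f y <= g y) -> \int[mu]_y f y <= \int[mu]_y g y.
Proof.
move=> Lf Lg h; rewrite -subr_ge0 -(RIB Lg Lf).
have mB := L1_meas (L1B Lg Lf).
rewrite (@RI_eq_off x _ (fun y => `|g y - f y|))//; first by apply: RI_ge0.
  by mfun.
by move=> y yx; rewrite ger0_norm// subr_ge0 h.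
Qed.

End Balls.

Ltac munfold ::= cbv beta delta [G om dd rker iN inB].

(** * Inversion in a sphere *)

Section LineInversion.
Context (R : realType).
Notation lam := (@lebesgue_measure R).
Notation hl := (@hl R).
Implicit Types (f : R -> \bar R) (c r : R).

Lemma ae_neq0 (P : R -> Prop) : (forall r : R, r != 0 -> P r) -> {ae lam, forall r : R, P r}.
Proof.
move=> h; exists [set 0 : R]; split; first exact: measurable_set1.
  by rewrite lebesgue_measure_set1.
by move=> r /= hr; apply/eqP/negPn/negP => r0; exact: hr (h r r0).
Qed.

Lemma line_split f : mfunT f -> (forall r, 0 <= f r)%E ->
  (\int[lam]_r f r = \int[hl]_r f r + \int[hl]_r f (- r)%R)%E.
Proof.
move=> mf f0.
have mN : mfunT (fun r : R => f (- r)%R) by mfun.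
pose i1 (r : R) : R := \1_(`]0, +oo[%classic) r.
have mi1 : mfunT i1 by mfun.
have i10 r : 0 <= i1 r by rewrite /i1 indicE.
have E g : mfunT g -> (forall r, 0 <= g r)%E ->
    (\int[hl]_r g r = \int[lam]_r ((i1 r)%:E * g r))%E.
  move=> mg g0; rewrite ge0_integral_hl// integral_mkcond; apply: eq_integral => r _.
  by rewrite patchE /i1 indicE; case: (_ \in _); rewrite ?mul1e ?mul0e.
rewrite !E//.
have m1 g : mfunT g -> mfunT (fun r => (i1 r)%:E * g r)%E.
  by move=> mg; apply: emeasurable_funM => //; exact/measurable_EFinP.
have N1 : (-1 : R) != 0 by rewrite oppr_eq0 oner_eq0.
pose h r := ((i1 (- r))%:E * f r)%E.
have mh : mfunT h by mfun.
have h0 r : (0 <= h r)%E by rewrite mule_ge0// lee_fin.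
have e2 : (\int[lam]_r ((i1 r)%:E * f (- r)%R) = \int[lam]_r h r)%E.
  have := @ge0_integral_affine R (-1) 0 h N1 mh h0.
  rewrite normrN1 invr1 mul1e => <-; apply: eq_integral => r _.
  by rewrite /h addr0 mulN1r opprK.
rewrite e2 -ge0_integralD//; last 2 first.
- by move=> r _; rewrite mule_ge0// lee_fin.
- by mfun.
apply: ge0_ae_eq_integral => //.
- by apply: emeasurable_funD => //; exact: m1.
- by move=> r _; rewrite adde_ge0 ?h0// mule_ge0// lee_fin.
have ip r : 0 < r -> i1 r = 1 by move=> r0; rewrite /i1 indicE mem_set//= in_itv/= r0.
have iN' r : r < 0 -> i1 r = 0 by move=> r0; rewrite /i1 indicE memNset//= in_itv/= ltNge (ltW r0).
apply: ae_neq0 => r /lt_total/orP[r0|r0] _; rewrite /h.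
  by rewrite (iN' _ r0) ip ?oppr_gt0// mul0e mul1e add0e.
by rewrite (ip _ r0) iN' ?oppr_lt0// mul0e mul1e adde0.
Qed.

Lemma hl_inversion c f : 0 < c -> mfunT f -> (forall r, 0 <= f r)%E ->
  (\int[hl]_r ((c / r ^+ 2)%:E * f (c / r)%R) = \int[hl]_r f r)%E.
Proof.
move=> c0 mf f0.
have mfc : mfunT (fun s : R => c%:E * f (c * s)%R)%E by mfun.
have g0 s : (0 <= c%:E * f (c * s)%R)%E by rewrite mule_ge0// lee_fin ltW.
have := ge0_integral_hl_inv mfc g0.
rewrite ge0_integralZl//; last 2 first.
- by mfun.
- by rewrite lee_fin ltW.
rewrite ge0_integral_hl_scale// muleA -EFinM mulfV ?gt_eqF// mul1e => <-.
by apply: eq_integral => s _; rewrite muleA -EFinM mulrC.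
Qed.

Lemma line_inversion c f : 0 < c -> mfunT f -> (forall r, 0 <= f r)%E ->
  (\int[lam]_r ((c / r ^+ 2)%:E * f (c / r)%R) = \int[lam]_r f r)%E.
Proof.
move=> c0 mf f0.
have mV := @measurable_funV R.
have mg : mfunT (fun r : R => (c / r ^+ 2)%:E * f (c / r)%R)%E by mfun.
have g0 r : (0 <= (c / r ^+ 2)%:E * f (c / r)%R)%E by rewrite mule_ge0// lee_fin divr_ge0 ?sqr_ge0// ltW.
have mN : mfunT (fun r : R => f (- r)%R) by mfun.
rewrite !line_split// (hl_inversion c0 mf f0); congr (_ + _)%E.
rewrite -(hl_inversion c0 mN (fun r => f0 _)); apply: eq_integral => r _.
by rewrite sqrrN invrN mulrN.
Qed.

End LineInversion.

Section Inversion.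
Context (R : realType).
Notation lam := (@lebesgue_measure R).

(* Points are written (r, r s): the inversion then acts on r alone. *)
Lemma integral_polar m (h : 'rV[R]_m.+1 -> R) : mfunT h -> (forall x, 0 <= h x) ->
  (\int[leb R m.+1]_x (h x)%:E =
   \int[leb R m]_s \int[lam]_r (`|r| ^+ m * h (rcons0 r (r *: s)))%:E)%E.
Proof.
move=> mh h0; have mE : mfunT (fun x => (h x)%:E) by exact/measurable_EFinP.
rewrite ge0_integral_lebS//.
pose f1 (p : 'rV[R]_m * measurableTypeR R) := (h (rcons0 p.2 p.1))%:E.
pose f2 (p : 'rV[R]_m * measurableTypeR R) := (`|p.2| ^+ m * h (rcons0 p.2 (p.2 *: p.1)))%:E.
have mf1 : mfunT f1 by exact: measurableT_comp mE (@measurable_rcons0 R m).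
have msc : mfunT (fun p : 'rV[R]_m * measurableTypeR R => p.2 *: p.1).
  apply: measurable_row => i; under eq_fun do rewrite mxE.
  apply: measurable_funM; first exact: measurable_snd.
  by mfun.
have mf2 : mfunT f2.
  apply/measurable_EFinP; apply: measurable_funM.
    by mfun.
  apply: (measurableT_comp mh); apply: (measurableT_comp (@measurable_rcons0 R m)
    (g := fun p : 'rV[R]_m * measurableTypeR R => (p.2 *: p.1, p.2))).
  by mfun.
have f10 p : (0 <= f1 p)%E by rewrite lee_fin.
have f20 p : (0 <= f2 p)%E by rewrite lee_fin mulr_ge0 ?exprn_ge0.
rewrite (@fubini_tonelli _ _ _ _ _ (leb R m) lam f1 mf1 f10).
rewrite (@fubini_tonelli _ _ _ _ _ (leb R m) lam f2 mf2 f20).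
apply: ge0_ae_eq_integral => //.
- exact: (@measurable_fun_fubini_tonelli_G _ _ _ _ _ (leb R m) f1 mf1).
- exact: (@measurable_fun_fubini_tonelli_G _ _ _ _ _ (leb R m) f2 mf2).
- by move=> r _; apply: integral_ge0 => s _; exact: (f10 (s, r)).
- by move=> r _; apply: integral_ge0 => s _; exact: (f20 (s, r)).
apply: ae_neq0 => r r0 _.
have m1 : mfunT (fun s => f1 (s, r)) by mfun.
have := @ge0_integral_leb_affine R m r 0 (fun s => f1 (s, r)) r0 m1 (fun s => f10 (s, r)).
move=> /(congr1 (fun x => (`|r| ^+ m)%:E * x)%E); rewrite muleA -EFinM mulfV ?mul1e; last first.
  by rewrite expf_neq0// normr_eq0.
move=> <-; rewrite -ge0_integralZl//; last by apply: (measurableT_comp m1); exact: measurable_row_affine.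
by apply: eq_integral => s _; rewrite /f1 /f2 /= addr0 -EFinM.
Qed.

Lemma measurable_inv n (L : R) : mfunT (fun y : 'rV[R]_n => (L / sq y) *: y).
Proof.
apply: measurable_row => i; under eq_fun do rewrite mxE.
apply: measurable_funM; last exact: measurable_coord.
Proof. by mfun. Qed.

Lemma measurable_invw n (L : R) m : mfunT (fun y : 'rV[R]_n => (L / sq y) ^+ m).
Proof. by mfun. Qed.

(** In the coordinates (r, r s) the inversion keeps s and sends r to c/r with c = L/(1 + |s|^2). The
    Jacobian (L/|y|^2)^n combines that of the line inversion with the weight |r|^m, where n = m +
    1. *)
Lemma ge0_integral_inversion n (L : R) (h : 'rV[R]_n -> R) : (0 < n)%N -> 0 < L ->
  mfunT h -> (forall x, 0 <= h x) ->
  (\int[leb R n]_y ((L / sq y) ^+ n * h ((L / sq y) *: y))%:E = \int[leb R n]_x (h x)%:E)%E.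
Proof.
case: n h => // m h _ L0 mh h0.
rewrite !integral_polar//; last 2 first.
- by apply: measurable_funM; [exact: measurable_invw|exact: (measurableT_comp mh (@measurable_inv m.+1 L))].
- by move=> y; rewrite mulr_ge0// exprn_ge0// divr_ge0 ?sq_ge0// ltW.
apply: eq_integral => s _.
have s1 : 0 < 1 + sq s by rewrite ltr_wpDr ?sq_ge0.
pose c := L / (1 + sq s); have c0 : 0 < c by rewrite divr_gt0.
pose phi r := (`|r| ^+ m * h (rcons0 r (r *: s)))%:E.
have mphi : mfunT phi.
  apply/measurable_EFinP; apply: measurable_funM; first by apply: measurable_funX; exact: normr_measurable.
  apply: (measurableT_comp mh); apply: measurable_row => i; under eq_fun do rewrite mxE.
  case: unliftP => [j _|_]; last exact: measurable_id.
  by under eq_fun do rewrite mxE; exact: measurable_funM.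
have phi0 r : (0 <= phi r)%E by rewrite lee_fin mulr_ge0 ?exprn_ge0.
rewrite -/phi -(line_inversion c0 mphi phi0); apply: eq_integral => r _.
rewrite /phi -EFinM; congr EFin.
have E : sq (rcons0 r (r *: s)) = r ^+ 2 * (1 + sq s) by rewrite sq_rcons0 sqZ; ring.
have -> : L / sq (rcons0 r (r *: s)) = c / r ^+ 2 by rewrite E /c invfM; ring.
have -> : (c / r ^+ 2) *: rcons0 r (r *: s) = rcons0 (c / r) ((c / r) *: s).
  rewrite rcons0Z scalerA.
  have [->|r0] := eqVneq r 0; first by rewrite invr0 !mulr0.
  by congr (rcons0 _ (_ *: _)); field.
rewrite !mulrA; congr (_ * _).
have [->|r0] := eqVneq r 0; first by rewrite expr0n invr0 !(mulr0, mul0r) expr0n/= mulr0.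
rewrite exprS mulrCA; congr (_ * _); rewrite -exprMn; congr (_ ^+ _).
rewrite normrM normrV ?unitfE// (gtr0_norm c0) -[r ^+ 2]real_normK ?num_real//.
by field; rewrite normr_eq0.
Qed.

Lemma RI_inversion n (L : R) (h : 'rV[R]_n -> R) : (0 < n)%N -> 0 < L -> L1 (leb R n) h ->
  (forall x, 0 <= h x) -> L1 (leb R n) (fun y => (L / sq y) ^+ n * h ((L / sq y) *: y)) /\
  \int[leb R n]_y ((L / sq y) ^+ n * h ((L / sq y) *: y)) = \int[leb R n]_x h x.
Proof.
move=> n0 L0 Lh h0; have mh := L1_meas Lh.
have e := ge0_integral_inversion n0 L0 mh h0.
have Li : L1 (leb R n) (fun y => (L / sq y) ^+ n * h ((L / sq y) *: y)).
  apply/ge0_L1_EFin.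
  - by apply: measurable_funM; [exact: measurable_invw|exact: (measurableT_comp mh (@measurable_inv n L))].
  - by move=> y; rewrite mulr_ge0// exprn_ge0// divr_ge0 ?sq_ge0// ltW.
  by rewrite e (L1_EFin Lh) ltry.
by split => //; move: e; rewrite (L1_EFin Li) (L1_EFin Lh) => -[].
Qed.

End Inversion.

(** * Small times: approximate identity and Riesz kernel *)

Section ApproximateIdentity.
Context (R : realType) (n : nat).
Notation mu := (leb R n).
Notation hl := (@hl R).
Notation nu := (n%:R / 2 : R).
Implicit Types (x y z c : 'rV[R]_n) (t s r : R).
Context (n0 : (0 < n)%N).

(** Trading exp(-|z|^2/t) for a power q + 1 of t/|z|^2 leaves t^(q + 1 - n/2), which is at most t
    for t <= 1: away from 0 the Gaussian is O(t) relative to the weight. *)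
Lemma G_far (q de : R) t z : nu <= q -> 0 < de -> 0 < t -> t <= 1 -> de <= sq z ->
  G t z <= (q + 1) `^ (q + 1) * de^-1 * (1 + de^-1) `^ q * t * om q z.
Proof.
move=> nuq d0 t0 t1 dz; have q0 : 0 < q by apply: lt_le_trans nuq; exact: nu_gt0.
have X0 : 0 < sq z by exact: lt_le_trans dz.
have q1 : 0 <= q + 1 by rewrite addr_ge0// ltW.
have Xt : 0 <= sq z / t by rewrite divr_ge0 ?(ltW X0)// ltW.
have h1 := powR_expR_le q1 Xt.
have h2 : expR (- (sq z / t)) <= (q + 1) `^ (q + 1) * (sq z / t) `^ (- (q + 1)).
  by rewrite powRN ler_pdivlMr ?powR_gt0 ?divr_gt0// mulrC.
have h3 : (sq z / t) `^ (- (q + 1)) = t `^ (q + 1) * sq z `^ (- (q + 1)).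
  rewrite powRM ?(ltW X0) ?invr_ge0 ?(ltW t0)// mulrC; congr (_ * _).
  by rewrite -powR_inv1 ?(ltW t0)// -powRrM; congr (_ `^ _); ring.
have h4 : t `^ (- nu) * t `^ (q + 1) <= t.
  rewrite -powRDp// -[leRHS]powRr1 ?(ltW t0)//.
  apply: ger_powR; first by rewrite t0 t1.
  by move: nuq; rewrite -subr_ge0 => h; lra.
have h5 : sq z `^ (- (q + 1)) <= de^-1 * ((1 + de^-1) `^ q * om q z).
  rewrite opprD powRDp// mulrC; apply: ler_pM; rewrite ?powR_ge0//.
    by rewrite powR_inv1 ?(ltW X0)// lef_pV2 ?posrE.
  rewrite omE powRN ler_pdivlMr ?powR_gt0 ?sq1_gt0// mulrC ler_pdivrMr ?powR_gt0//.
  rewrite -powRM ?(ltW X0) ?addr_ge0 ?invr_ge0 ?(ltW d0)//.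
  apply: ler_powR_base; rewrite ?(ltW q0)// ?addr_ge0 ?(ltW X0)//.
  by rewrite mulrDl mul1r [leRHS]addrC lerD2r ler_pdivlMl// mulr1.
apply: (@le_trans _ _ (t `^ (- nu) * ((q + 1) `^ (q + 1) * (t `^ (q + 1) * sq z `^ (- (q + 1)))))).
  by rewrite /G ler_wpM2l ?powR_ge0// -h3.
rewrite (_ : _ * (_ * (_ * _)) = (q + 1) `^ (q + 1) * ((t `^ (- nu) * t `^ (q + 1)) * sq z `^ (- (q + 1)))); last by ring.
rewrite (_ : _ * t * om q z = (q + 1) `^ (q + 1) * (t * (de^-1 * ((1 + de^-1) `^ q * om q z)))); last by ring.
rewrite ler_wpM2l ?powR_ge0//; apply: ler_pM => //; rewrite ?powR_ge0//.
by rewrite mulr_ge0 ?powR_ge0.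
Qed.

(** Near [c] continuity controls u; away from [c] only integrability against the weight is
    available, and [G_far] makes that part O(t). *)
Lemma approx_identity (th : R) (u : 'rV[R]_n -> R) c : 0 < th -> continuous u ->
  L1 mu (fun y => u y * om (nu + th) y) ->
  \int[mu]_x (u x * G m.+1%:R^-1 (x - c)) @[m --> \oo] --> gmass R n * u c.
Proof.
move=> th0 cu Lu; have q0 := q_gt0 n th0; set q := nu + th in Lu q0 *.
have gm := @gmass_gt0 R n.
have Lu' := L1_u_om_norm th0 cu Lu c; rewrite -/q in Lu'.
have Lo : L1 mu (fun x => om q (x - c)) by have := L1_shift (- c) (@L1_om R n q _); apply; rewrite ltrDl.
have LG t : 0 < t -> L1 mu (fun x => G t (x - c)).
  by move=> t0; have := L1_Hk 0 c t0; under eq_fun do rewrite Hk0 -GN opprB.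
have IG t : 0 < t -> \int[mu]_x G t (x - c) = gmass R n.
  move=> t0; rewrite (RI_shift (- c) (@measurable_G R n t)).
  have Lg : L1 mu (G t) by have := L1_shift c (LG t t0); under eq_fun do rewrite addrK.
  by have := integral_G n t0; rewrite (L1_EFin Lg) => -[].
have LuG t : 0 < t -> L1 mu (fun x => u x * G t (x - c)).
  by move=> t0; have := L1_yk th0 cu Lu 0 c t0; under eq_fun do rewrite Hk0.
apply/cvgrPdist_le => eps eps0.
pose e1 := eps / (2 * gmass R n); have e10 : 0 < e1 by rewrite divr_gt0// mulr_gt0.
have /cvgrPdist_le/(_ e1 e10)/nbhs_rowP := cu c; move=> [de' d0' hd'].
pose de := de' ^+ 2; have d0 : 0 < de by rewrite exprn_gt0.
have hd y : sq (y - c) < de -> `|u c - u y| <= e1.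
  move=> yd; apply: hd' => i; rewrite -(ltr_pXn2r (n := 2)) ?nnegrE ?(ltW d0')//.
  apply: le_lt_trans yd; rewrite real_normK ?num_real// -sqrrN opprB.
  by have := coord_le_sq (y - c) i; rewrite !mxE.
pose K := (q + 1) `^ (q + 1) * de^-1 * (1 + de^-1) `^ q.
have K0 : 0 <= K by rewrite !mulr_ge0 ?powR_ge0 ?invr_ge0 ?(ltW d0).
pose A := \int[mu]_x (`|u x| * om q (x - c)) + `|u c| * \int[mu]_x om q (x - c).
near=> m; set t := m.+1%:R^-1 : R.
have t0 : 0 < t by rewrite invr_gt0.
have t1 : t <= 1 by rewrite /t invf_le1// ler1n.
have hm : K * A * t <= eps / 2.
  have hA : 2 * (K * A) / eps <= 1 * m.+1%:R by near: m; exact: cvg_mulS.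
  move: hA; rewrite mul1r ler_pdivrMr// /t ler_pdivrMr// => hA.
  by rewrite [leRHS]mulrAC ler_pdivlMr// mulrC [eps * _]mulrC.
rewrite -(IG t t0) mulrC -(RIZ _ (LG t t0)) distrC -(RIB (LuG t t0) (L1Z _ (LG t t0))).
apply: (le_trans (RI_norm (L1B (LuG t t0) (L1Z _ (LG t t0))))).
have Lr := L1D (L1Z e1 (LG t t0)) (L1Z (K * t) (L1D Lu' (L1Z `|u c| Lo))).
apply: (le_trans (RI_le (L1_norm (L1B (LuG t t0) (L1Z _ (LG t t0)))) Lr _)).
  move=> x; rewrite -mulrBl normrM (ger0_norm (G_ge0 _ _)).
  have o0 := ltW (om_gt0 q (x - c)); have Kt : 0 <= K * t by rewrite mulr_ge0// ltW.
  have [xd|xd] := ltP (sq (x - c)) de.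
    rewrite -[leLHS]addr0; apply: lerD; last by rewrite mulr_ge0// addr_ge0 ?mulr_ge0.
    by rewrite ler_wpM2r ?G_ge0// distrC; exact: hd.
  rewrite -[leLHS]add0r; apply: lerD; first by rewrite mulr_ge0 ?G_ge0// ltW.
  have h := G_far (q := q) ltac:(by rewrite lerDl ltW) d0 t0 t1 xd; rewrite -/K in h.
  apply: (le_trans (ler_wpM2l (normr_ge0 _) h)).
  rewrite -mulrDl mulrCA ler_wpM2l// ler_wpM2r//.
  by apply: (le_trans (ler_normB _ _)).
rewrite (RID (L1Z e1 (LG t t0)) (L1Z (K * t) (L1D Lu' (L1Z `|u c| Lo)))).
rewrite (RIZ e1 (LG t t0)) (RIZ _ (L1D Lu' (L1Z `|u c| Lo))) (RID Lu' (L1Z `|u c| Lo)) (RIZ _ Lo) -/A (IG t t0).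
have -> : e1 * gmass R n = eps / 2 by rewrite /e1; field; rewrite gt_eqF.
by rewrite [leRHS]splitr lerD2l mulrAC.
Unshelve. all: by end_near. Qed.

Section RieszKernel.
Context (s0 : R) (s00 : 0 < s0) (s0n : s0 < nu).
Notation e := (nu - s0).

Lemma e_gt0 : 0 < e. Proof. by rewrite subr_gt0. Qed.

(** The Riesz kernel |z|^(2 s0 - n) without its constant, 2 [s0] being the order of the operator. It
    is 0 at the origin by the convention for powers. *)
Definition riesz z : R := sq z `^ (- e).

Lemma ker0 : riesz 0 = 0.
Proof. by rewrite /riesz sq0 powR0// oppr_eq0 gt_eqF// e_gt0. Qed.

Lemma ker_ge0 z : 0 <= riesz z. Proof. exact: powR_ge0. Qed.

Lemma measurable_ker : mfunT riesz.
Proof. by apply: (measurableT_comp (@measurable_powR R (- e))); exact: measurable_sq. Qed.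

Definition polec : R := 2 `^ nu * (1 + nu `^ nu).

(** A majorant free of t, for use as t -> 0. If |z|^2 <= s the value at the centre suffices;
    otherwise r^(-n/2) exp(-|z|^2/r) is bounded by a multiple of |z|^(-n) for all r > 0. *)
Lemma G_le_pole t s z : 0 <= t -> 0 < s -> 0 < sq z -> G (t + s) z <= polec * (sq z + s) `^ (- nu).
Proof.
move=> t0 sp X0; have nu0 := nu_gt0 R n0; have T0 : 0 < t + s by rewrite ltr_wpDl.
have Xs : 0 < sq z + s by rewrite addr_gt0.
have half r : 0 < r -> sq z + s <= 2 * r -> r `^ (- nu) <= 2 `^ nu * (sq z + s) `^ (- nu).
  move=> r0 h; rewrite !powRN ler_pdivlMr ?powR_gt0// mulrC ler_pdivrMr ?powR_gt0//.
  by rewrite -powRM ?(ltW r0)//; apply: ler_powR_base => //; exact: ltW.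
have p0 : 0 <= (sq z + s) `^ (- nu) by exact: powR_ge0.
rewrite /polec -mulrA mulrDl mul1r mulrDr.
have [h|h] := leP (sq z) s.
  rewrite -[leLHS]addr0; apply: lerD; last by rewrite !mulr_ge0 ?powR_ge0.
  apply: le_trans (half s sp _); last by lra.
  apply: (le_trans (G_le_pow z T0)); rewrite !powRN lef_pV2 ?posrE ?powR_gt0//.
  by apply: ler_powR_base; rewrite ?(ltW nu0) ?(ltW sp)// lerDr.
rewrite -[leLHS]add0r; apply: lerD; first by rewrite mulr_ge0 ?powR_ge0.
rewrite mulrCA; apply: (@le_trans _ _ (nu `^ nu * sq z `^ (- nu))); last first.
  by rewrite ler_wpM2l ?powR_ge0// half//; lra.
have Xt : 0 <= sq z / (t + s) by rewrite divr_ge0// ltW.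
have h1 := powR_expR_le (ltW nu0) Xt.
rewrite [sq z `^ _]powRN ler_pdivlMr ?powR_gt0//; apply: le_trans h1.
rewrite /G powRM ?(ltW X0) ?invr_ge0 ?(ltW T0)// -[(t + s)^-1]powR_inv1 ?(ltW T0)// -powRrM mulN1r.
by rewrite le_eqVlt; apply/orP; left; apply/eqP; ring.
Qed.

Lemma L1_pole X : 0 < X -> L1 hl (fun s => s `^ (s0 - 1) * (X + s) `^ (- nu)).
Proof.
move=> X0; have nu0 := nu_gt0 R n0; apply: (@hl_L1_crit R _ s0 e (X `^ (- nu) + 1)) => //.
- exact: e_gt0.
- by mfun.
- move=> s /andP[sp s1]; rewrite ger0_norm ?mulr_ge0 ?powR_ge0// mulrC ler_wpM2r ?powR_ge0//.
  apply: (@le_trans _ _ (X `^ (- nu))); last by rewrite lerDl.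
  rewrite !powRN lef_pV2 ?posrE ?powR_gt0 ?addr_gt0//.
  by apply: ler_powR_base; rewrite ?(ltW nu0) ?(ltW X0)// lerDl ltW.
- move=> s s1; have sp : 0 < s by exact: lt_le_trans s1.
  rewrite ger0_norm ?mulr_ge0 ?powR_ge0//.
  have -> : - e - 1 = (s0 - 1) + - nu by ring.
  rewrite [s `^ (s0 - 1 + _)]powRDp// mulrCA ler_wpM2l ?powR_ge0//.
  apply: (@le_trans _ _ (s `^ (- nu))); last by rewrite ler_peMl ?powR_ge0// lerDr powR_ge0.
  rewrite !powRN lef_pV2 ?posrE ?powR_gt0 ?addr_gt0//.
  by apply: ler_powR_base; rewrite ?(ltW nu0) ?(ltW sp)// lerDr ltW.
Qed.

Definition It t z : R := \int[hl]_s (s `^ (s0 - 1) * G (t + s) z).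

Lemma It_ge0 t z : 0 <= It t z.
Proof. by apply: RI_ge0 => s; rewrite mulr_ge0 ?powR_ge0 ?G_ge0. Qed.

Lemma measurable_Its t z : mfunT (fun s => s `^ (s0 - 1) * G (t + s) z).
Proof. by mfun. Qed.

Lemma L1_It t z : 0 <= t -> 0 < sq z -> L1 hl (fun s => s `^ (s0 - 1) * G (t + s) z).
Proof.
move=> t0 X0; apply: (L1_le_hl (measurable_Its t z) _ (L1Z polec (L1_pole X0))) => s sp.
rewrite ger0_norm ?mulr_ge0 ?powR_ge0 ?G_ge0// [leRHS]mulrCA ler_wpM2l ?powR_ge0//.
exact: G_le_pole.
Qed.

Definition Itc : R := polec * \int[hl]_s (s `^ (s0 - 1) * (1 + s) `^ (- nu)).

Lemma It_le t z : 0 <= t -> 0 < sq z -> It t z <= Itc * riesz z.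
Proof.
move=> t0 X0; have L := L1_pole X0.
apply: (@le_trans _ _ (polec * \int[hl]_s (s `^ (s0 - 1) * (sq z + s) `^ (- nu)))).
  rewrite -(RIZ _ L); apply: (RI_le_hl (L1_It t0 X0) (L1Z _ L)) => s sp.
  by rewrite [leRHS]mulrCA ler_wpM2l ?powR_ge0// G_le_pole.
rewrite /Itc -mulrA ler_wpM2l ?mulr_ge0 ?addr_ge0 ?powR_ge0//.
have h := RI_hl_scale X0 L.
rewrite (_ : \int[hl]_s _ = sq z * ((sq z)^-1 * \int[hl]_s (s `^ (s0 - 1) * (sq z + s) `^ (- nu)))); last first.
  by rewrite mulVKf ?gt_eqF.
rewrite -h.
have -> : \int[hl]_s ((sq z * s) `^ (s0 - 1) * (sq z + sq z * s) `^ (- nu)) =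
    \int[hl]_s (sq z `^ (s0 - 1 - nu) * (s `^ (s0 - 1) * (1 + s) `^ (- nu))).
  apply: RI_eq_hl => [||s sp].
  - by mfun.
  - by mfun.
  have -> : sq z + sq z * s = sq z * (1 + s) by ring.
  rewrite !powRM ?(ltW X0) ?(ltW sp) ?addr_ge0 ?(ltW sp)// [sq z `^ (_ - nu)]powRDp//.
  by rewrite mulrACA.
rewrite (RIZ _ (L1_pole ltr01)) /riesz mulrA mulrC ler_wpM2l//.
  by apply: RI_ge0 => s; rewrite mulr_ge0 ?powR_ge0.
rewrite (_ : - e = 1 + (s0 - 1 - nu)); last by ring.
by rewrite [leRHS]powRDp// powRr1// ltW.
Qed.

Lemma It_cvg z : 0 < sq z -> It m.+1%:R^-1 z @[m --> \oo] --> Gam e * riesz z.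
Proof.
move=> X0.
pose ip (w : R) : R := \1_(`]0, +oo[%classic) w.
have mip : mfunT ip by mfun.
have ipE (w : R) : 0 < w -> ip w = 1 by move=> w0; rewrite /ip indicE mem_set//= in_itv/= w0.
have ip0 (w : R) : w <= 0 -> ip w = 0 by move=> w0; rewrite /ip indicE memNset//= in_itv/= ltNge w0.
have mf t : mfunT (fun s => ip s * (s `^ (s0 - 1) * G (t + s) z)) by mfun.
have E t : It t z = \int[hl]_s (ip s * (s `^ (s0 - 1) * G (t + s) z)).
  by apply: RI_eq_hl => [|//|s sp]; [exact: measurable_Its|rewrite ipE ?mul1r].
have -> : Gam e * riesz z = \int[hl]_s (ip s * (s `^ (s0 - 1) * G (0 + s) z)).
  rewrite -E /It; have L := L1_It (lexx 0) X0.
  have := hl_inv_exp_pow e_gt0 X0; have mfi : mfunT (fun s : R => (s `^ (- e - 1) * expR (- (sq z / s)))%:E).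
    by mfun.
  have -> : (\int[hl]_s (s `^ (- e - 1) * expR (- (sq z / s)))%:E = \int[hl]_s (s `^ (s0 - 1) * G (0 + s) z)%:E)%E.
    apply: ge0_eq_hl => //.
    - by mfun.
    - by move=> s; rewrite lee_fin mulr_ge0 ?powR_ge0 ?expR_ge0.
    - by move=> s; rewrite lee_fin mulr_ge0 ?powR_ge0 ?G_ge0.
    by move=> s sp; rewrite add0r /G mulrA -powRDp//; congr (_ `^ _ * _)%:E; ring.
  by rewrite (L1_EFin L) => -[->].
under eq_fun do rewrite E.
have Lp := L1Z polec (L1_pole X0).
refine (proj2 (@RI_dct _ _ R hl (fun m s => ip s * (s `^ (s0 - 1) * G (m.+1%:R^-1 + s) z)) (fun s => ip s * (s `^ (s0 - 1) * G (0 + s) z)) (fun s => `|polec * (s `^ (s0 - 1) * (sq z + s) `^ (- nu))|) _ _ (L1_norm Lp) _)).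
- by move=> m; exact: mf.
- move=> s; have [sp|sp] := ltP 0 s; last by under eq_fun do rewrite ip0// mul0r; rewrite ip0// mul0r; exact: cvg_cst.
  rewrite ipE// mul1r; under eq_fun do rewrite mul1r.
  apply: cvgM; first exact: cvg_cst.
  have c1 : {for 0 + s, continuous (fun t : R => G t z)}.
    have := cHk (j := 0) (x := z) (s := 0 + s) ltac:(by rewrite add0r).
    by have -> : (fun t : R => Hk 0 t z) = (fun t => G t z) by apply/funext => t; rewrite Hk0.
  apply: (continuous_cvg _ c1); apply: cvgD; [exact: cvg_natSinv|exact: cvg_cst].
- move=> m s; have [sp|sp] := ltP 0 s; last by rewrite ip0// mul0r normr0.
  rewrite ipE// mul1r !ger0_norm ?mulr_ge0 ?powR_ge0 ?G_ge0 ?addr_ge0 ?powR_ge0//.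
  by rewrite [leRHS]mulrCA ler_wpM2l ?powR_ge0// G_le_pole// invr_ge0.
Qed.

End RieszKernel.
End ApproximateIdentity.

Ltac munfold ::= cbv beta delta [G om dd rker iN inB riesz].

(** * Vanishing of the source and Riesz representation *)

Section RieszRepresentation.
Context (R : realType) (n : nat).
Notation mu := (leb R n).
Notation hl := (@hl R).
Notation nu := (n%:R / 2 : R).
Implicit Types (x y z c : 'rV[R]_n) (t s r : R).
Context (n0 : (0 < n)%N).
Context (th d : R) (th0 : 0 < th) (d0 : 0 < d) (dn : d < nu) (thd : th + d <= 1).
Notation q := (nu + th).
Context (k : nat) (u : 'rV[R]_n -> R) (al : R) (hal : al = 2 * th).
Hypothesis cu : continuous u.
Hypothesis Lu : L1 mu (fun y => u y * om q y).
Hypothesis ru : Reg (th + d) (2 * k) u.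
Hypothesis u0 : forall x, 0 <= u x.
Notation f := (poly_frac_laplacian k al u).
Hypothesis f0 : forall x, 0 <= f x.
Notation F := (Fg k u al).
Notation s0 := (th + k%:R).

Lemma cf : continuous f.
Proof. exact: (@continuous_poly_frac R n th d th0 d0 dn k u al hal cu Lu ru). Qed.

Lemma mf : mfunT f. Proof. exact: continuous_measurable_row cf. Qed.

Lemma s0_gt0 : 0 < s0. Proof. by rewrite ltr_wpDr. Qed.

Lemma L1_fG c t : 0 < t -> L1 mu (fun x => f x * G t (x - c)).
Proof. by move=> t0; have [] := Fg_eq n0 th0 d0 dn thd hal cu Lu ru f0 c t0. Qed.

(** If f > 0 at c then F(c, 1) > 0 and F(c, t) >= t^(-n/2) F(c, 1) for t >= 1. With s0 >= n/2 this
    puts s^(s0 - 1) F(c, 1 + s) above a multiple of 1/s, against the integrability in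
    [heat_formula]. *)
Lemma poly_frac_eq0 : nu <= s0 -> forall x, f x = 0.
Proof.
have nu0 := nu_gt0 R n0; have s00 := s0_gt0.
move=> h c; apply/eqP/negPn/negP => fc.
have {}fc : 0 < f c by rewrite lt0r fc f0.
have F1 : 0 < F c 1.
  have /cvgrPdist_le/(_ (f c / 2) ltac:(by rewrite divr_gt0))/nbhs_rowP := @cf c; move=> [de' d0' hd'].
  pose de := de' ^+ 2; have de0 : 0 < de by rewrite exprn_gt0.
  have hd y : sq (y - c) < de -> f c / 2 <= f y.
    move=> yd; have : `|f c - f y| <= f c / 2.
      apply: hd' => i; rewrite -(ltr_pXn2r (n := 2)) ?nnegrE ?(ltW d0')//.
      apply: le_lt_trans yd; rewrite real_normK ?num_real// -sqrrN opprB.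
      by have := coord_le_sq (y - c) i; rewrite !mxE.
    by move=> h1; have := le_trans (ler_norm _) h1; lra.
  have Lb := L1_shift (- c) (@L1_inB R n de).
  apply: (@lt_le_trans _ _ (f c / 2 * expR (- de) * (de `^ nu * vol1 R n))).
    by rewrite !mulr_gt0 ?expR_gt0 ?powR_gt0 ?vol1_gt0 ?divr_gt0.
  rewrite -vol_ball// -(RI_shift (- c) (@measurable_inB R n de)) -(RIZ _ Lb).
  apply: (RI_le (L1Z _ Lb) (L1_fG c ltr01)) => x.
  have [xd|xd] := ltP (sq (x - c)) de; last by rewrite inB0// mulr0 mulr_ge0 ?G_ge0.
  rewrite inB1// mulr1; apply: ler_pM; rewrite ?expR_ge0 ?divr_ge0 ?(ltW fc) ?hd//.
  by rewrite /G powR1 mul1r divr1 ler_expR lerN2 ltW.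
have FG t : 1 <= t -> t `^ (- nu) * F c 1 <= F c t.
  move=> t1; have t0 : 0 < t by exact: lt_le_trans t1.
  rewrite -(RIZ _ (L1_fG c ltr01)); apply: (RI_le (L1Z _ (L1_fG c ltr01)) (L1_fG c t0)) => x.
  rewrite mulrCA ler_wpM2l// /G powR1 mul1r divr1 ler_wpM2l ?powR_ge0// ler_expR lerN2.
  by rewrite ler_pdivrMr// ler_peMr ?sq_ge0.
have [cc [l [_ _ H]]] := heat_formula n0 th0 d0 dn thd hal cu Lu ru u0 f0.
have [L _] := H c 1 ltr01.
pose w s : R := 2 `^ (- nu) * F c 1 * (s^-1 * \1_(`[1, +oo[%classic) s).
have mi : mfunT (fun s : R => s^-1 * \1_(`[1, +oo[%classic) s) by mfun.
have Lw : L1 hl w.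
  apply: (L1_le_hl _ _ L); first exact: measurable_funM.
  move=> s sp; have A0 : 0 <= 2 `^ (- nu) * F c 1 by rewrite mulr_ge0 ?powR_ge0 ?(ltW F1).
  have [s1|s1] := leP 1 s; last first.
    rewrite /w indicE memNset ?mulr0 ?normr0; last by rewrite /= in_itv/= leNgt s1.
    by rewrite mulr_ge0 ?powR_ge0// (Fg_ge0 f0).
  rewrite /w indicE mem_set ?mulr1; last by rewrite /= in_itv/= s1.
  have w0 : 0 <= 2 `^ (- nu) * F c 1 * s^-1 by apply: mulr_ge0 => //; rewrite invr_ge0 ltW.
  rewrite (ger0_norm w0).
  apply: le_trans (ler_wpM2l (powR_ge0 _ _) (FG (1 + s) _)); last by rewrite lerDl ltW.
  rewrite mulrA mulrAC ler_wpM2r ?(ltW F1)//.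
  apply: (@le_trans _ _ (s `^ (nu - 1) * (2 * s) `^ (- nu))).
    rewrite powRM ?(ltW sp)// mulrCA -powRDp// ler_wpM2l ?powR_ge0//.
    by rewrite (_ : nu - 1 - nu = - 1) ?powR_inv1 ?(ltW sp)//; ring.
  apply: ler_pM; rewrite ?powR_ge0//.
    by apply: ler_powR => //; rewrite lerD2r.
  rewrite !powRN lef_pV2 ?posrE ?powR_gt0 ?mulr_gt0 ?addr_gt0//.
  by apply: ler_powR_base; rewrite ?(ltW nu0) ?addr_ge0 ?(ltW sp)//; lra.
have A0 : 0 < 2 `^ (- nu) * F c 1 by rewrite mulr_gt0 ?powR_gt0.
have Ld : L1 hl (fun s : R => s^-1 * \1_(`[1, +oo[%classic) s).
  have := L1Z (2 `^ (- nu) * F c 1)^-1 Lw; congr (L1 hl _); apply/funext => s.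
  by rewrite /w mulKf// gt_eqF.
by have := hl_inv_div (@ltr01 R); rewrite (L1_EFin Ld).
Qed.

Hypothesis s0n : s0 < nu.
Notation e := (nu - s0).
Notation ker := (@riesz R n s0).

Lemma Fg_It c t : 0 < t -> L1 hl (fun s => s `^ (s0 - 1) * F c (t + s)) ->
  L1 mu (fun x => f x * It s0 t (x - c)) /\
  \int[hl]_s (s `^ (s0 - 1) * F c (t + s)) = \int[mu]_x (f x * It s0 t (x - c)).
Proof.
move=> t0 L.
pose ip (w : R) : R := \1_(`]0, +oo[%classic) w.
have mip : mfunT ip by mfun.
have ipE (w : R) : 0 < w -> ip w = 1 by move=> w0; rewrite /ip indicE mem_set//= in_itv/= w0.
have ip0 (w : R) : w <= 0 -> ip w = 0 by move=> w0; rewrite /ip indicE memNset//= in_itv/= ltNge w0.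
pose g (p : (measurableTypeR R) * 'rV[R]_n) : R := ip p.1 * (p.1 `^ (s0 - 1) * (f p.2 * G (t + p.1) (p.2 - c))).
have mg : mfunT g.
  apply: measurable_funM; first exact: (measurableT_comp mip measurable_fst).
  apply: measurable_funM; first exact: (measurableT_comp (measurable_powR _) measurable_fst).
  apply: measurable_funM; first exact: (measurableT_comp mf measurable_snd).
  by mfun.
have g0 p : 0 <= g p by rewrite !mulr_ge0 ?powR_ge0 ?G_ge0// /ip indicE.
have Lg s : L1 mu (fun x => g (s, x)).
  have [sp|sp] := ltP 0 s; last first.
    rewrite /g /=; under eq_fun do rewrite ip0// mul0r.
    by have := L1Z 0 (L1_fG c ltr01); under eq_fun do rewrite mul0r.
  exact: (L1Z (ip s) (L1Z (s `^ (s0 - 1)) (L1_fG c (addr_gt0 t0 sp)))).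
have E1 s : \int[mu]_x g (s, x) = ip s * (s `^ (s0 - 1) * F c (t + s)).
  have [sp|sp] := ltP 0 s; last first.
    rewrite /g /= ip0// mul0r; under eq_Rintegral do rewrite mul0r.
    by rewrite /Rintegral integral0.
  have L' := L1_fG c (addr_gt0 t0 sp).
  by rewrite -(RIZ _ L') -(RIZ _ (L1Z _ L')).
have mh : mfunT (fun s => ip s * (s `^ (s0 - 1) * F c (t + s))).
  by apply: measurable_funM => //; exact: L1_meas L.
have fin : (\int[hl]_s \int[mu]_x `|g (s, x)|%:E < +oo)%E.
  apply: (@fubini_fin R _ _ _ _ hl mu g (fun s => ip s * (s `^ (s0 - 1) * F c (t + s)))) => //.
    apply: (L1_le_hl mh _ (L1_norm L)) => s sp; rewrite ipE ?mul1r//.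
  move=> s; rewrite -E1; apply: (RI_le (L1_norm (Lg s)) (Lg s)) => x.
  by rewrite ger0_norm.
have E2 x : \int[hl]_s g (s, x) = f x * It s0 t (x - c).
  have mI := @measurable_Its R n s0 t (x - c).
  have L2 : mfunT (fun s => g (s, x)) by mfun.
  have [fx0|fx0] := eqVneq (f x) 0.
    rewrite /g /= fx0 mul0r; under eq_Rintegral do rewrite mul0r !mulr0.
    by rewrite /Rintegral integral0.
  have [xc|xc] := eqVneq x c.
    have mff : mfunT (fun s => f x * (s `^ (s0 - 1) * G (t + s) (x - c))) by mfun.
    transitivity (\int[hl]_s (f x * (s `^ (s0 - 1) * G (t + s) (x - c)))).
      by apply: RI_eq_hl => // s sp; rewrite /g /= ipE// mul1r mulrCA.
    apply: RIZ; apply: (@hl_L1_crit R _ s0 e (t `^ (- nu) + 1)) => //.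
    - exact: s0_gt0.
    - by rewrite subr_gt0.
    - move=> s /andP[sp s1]; rewrite ger0_norm ?mulr_ge0 ?powR_ge0 ?G_ge0// mulrC ler_wpM2r ?powR_ge0//.
      have ts : 0 < t + s by rewrite addr_gt0.
      apply: (le_trans (G_le_pow _ ts)); apply: (@le_trans _ _ (t `^ (- nu))); last by rewrite lerDl.
      rewrite !powRN lef_pV2 ?posrE ?powR_gt0//.
      by apply: ler_powR_base; rewrite ?(ltW (nu_gt0 R n0)) ?(ltW t0)// lerDl ltW.
    - move=> s s1; have sp : 0 < s by exact: lt_le_trans s1.
      have ts : 0 < t + s by rewrite addr_gt0.
      rewrite ger0_norm ?mulr_ge0 ?powR_ge0 ?G_ge0//.
      have -> : - e - 1 = (s0 - 1) + - nu by ring.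
      rewrite [s `^ (s0 - 1 + _)]powRDp// [leRHS]mulrCA ler_wpM2l ?powR_ge0//.
      apply: (le_trans (G_le_pow _ ts)).
      apply: (@le_trans _ _ (s `^ (- nu))); last by rewrite ler_peMl ?powR_ge0// lerDr powR_ge0.
      rewrite !powRN lef_pV2 ?posrE ?powR_gt0//.
      by apply: ler_powR_base; rewrite ?(ltW (nu_gt0 R n0)) ?(ltW sp)// lerDr ltW.
  have X0 : 0 < sq (x - c) by rewrite lt0r sq_eq0 subr_eq0 xc sq_ge0.
  rewrite -(RIZ _ (L1_It n0 s0_gt0 s0n (ltW t0) X0)).
  apply: RI_eq_hl => [//||s sp]; first exact: measurable_funM.
  by rewrite /g /= ipE// mul1r mulrCA.
split; first by have := L1_fubini2 mg fin; under eq_fun do rewrite E2.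
transitivity (\int[hl]_s \int[mu]_x g (s, x)).
  by apply: RI_eq_hl => [||s sp]; [exact: L1_meas L|exact: L1_meas (L1_fubini1 mg fin)|rewrite E1 ipE// mul1r].
by rewrite (RI_fubini mg fin); apply: eq_Rintegral => x _; exact: E2.
Qed.

(** [heat_formula] at t = 1/(m+1), as m -> oo: the left side is an approximate identity and [It]
    tends to a multiple of the Riesz kernel. Fatou gives integrability of the source against that
    kernel, which by [It_le] then serves as the majorant. *)
Lemma riesz_representation : exists cc l : R, [/\ 0 < cc, 0 <= l & forall c,
  L1 mu (fun x => f x * ker (x - c)) /\ u c = l + cc * \int[mu]_x (f x * ker (x - c))].
Proof.
have [cc [l [cc0 l0 H]]] := heat_formula n0 th0 d0 dn thd hal cu Lu ru u0 f0.
have gm := @gmass_gt0 R n; have G0 : 0 < Gam e by rewrite Gam_gt0// subr_gt0.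
exists (cc * Gam e / gmass R n), (l / gmass R n); split.
- by rewrite divr_gt0// mulr_gt0.
- by rewrite divr_ge0// ltW.
move=> c; pose t m : R := m.+1%:R^-1.
have t0 m : 0 < t m by rewrite invr_gt0.
have HF m := Fg_It (t0 m) (proj1 (H c (t m) (t0 m))).
(* The pointwise limit of [It] is available away from x = c only, [riesz] being 0 there by
   convention; the indicator [nz] removes this null set. *)
pose nz x : R := \1_(~` [set 0 : R]) (sq (x - c)).
have mnz : mfunT nz.
  apply: (measurableT_comp (measurable_indic _)); last exact: (measurableT_comp (@measurable_sq R n) (measurable_shift (- c))).
  by apply: measurableC; exact: measurable_set1.
have nz1 x : x != c -> nz x = 1.
  by move=> xc; rewrite /nz indicE mem_set//= => /eqP; rewrite sq_eq0 subr_eq0 (negbTE xc).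
have nz0 : nz c = 0 by rewrite /nz subrr sq0 indicE memNset//= => h; exact: h.
pose g m x : R := nz x * (f x * It s0 (t m) (x - c)).
have mg m : mfunT (g m) by apply: measurable_funM => //; exact: L1_meas (HF m).1.
have nzi x : 0 <= nz x by rewrite /nz indicE.
have g0 m x : 0 <= g m x by rewrite !mulr_ge0// It_ge0.
have Lg m : L1 mu (g m).
  apply: (L1_le_off n0 (x := c) (mg m) (HF m).1) => x xc.
  by rewrite /g nz1// mul1r ger0_norm// mulr_ge0// It_ge0.
have Ig m : \int[mu]_x g m x = cc^-1 * (\int[mu]_x (u x * G (t m) (x - c)) - l).
  have [_ ->] := H c (t m) (t0 m); rewrite addrAC subrr add0r mulKf ?gt_eqF// (HF m).2.
  by apply: (RI_eq_off n0 (x := c)) => [||x xc]; [exact: mg|exact: L1_meas (HF m).1|rewrite /g nz1 ?mul1r].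
have cI : \int[mu]_x g m x @[m --> \oo] --> cc^-1 * (gmass R n * u c - l).
  under eq_fun do rewrite Ig; apply: cvgM; first exact: cvg_cst.
  by apply: cvgB; [exact: (@approx_identity R n n0 th u c th0 cu Lu)|exact: cvg_cst].
have cg x : g m x @[m --> \oo] --> Gam e * (f x * ker (x - c)).
  have [->|xc] := eqVneq x c.
    rewrite subrr (ker0 s0n) !mulr0; rewrite /g; under eq_fun do rewrite nz0 mul0r; exact: cvg_cst.
  have X0 : 0 < sq (x - c) by rewrite lt0r sq_eq0 subr_eq0 xc sq_ge0.
  rewrite /g; under eq_fun do rewrite nz1// mul1r; rewrite mulrCA.
  by apply: cvgM; [exact: cvg_cst|exact: (It_cvg n0 s0_gt0 s0n X0)].
have Lk := fatou_L1 Lg g0 cg cI.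
have Lk1 : L1 mu (fun x => f x * ker (x - c)).
  by have := L1Z (Gam e)^-1 Lk; congr (L1 mu _); apply/funext => x; rewrite mulKf ?gt_eqF.
split => //.
have Itc0 : 0 <= Itc n s0.
  by rewrite /Itc mulr_ge0 ?mulr_ge0 ?addr_ge0 ?powR_ge0//; apply: RI_ge0 => s; rewrite mulr_ge0 ?powR_ge0.
have cI2 : \int[mu]_x g m x @[m --> \oo] --> \int[mu]_x (Gam e * (f x * ker (x - c))).
  apply: (proj2 (RI_dct mg cg (L1Z (Itc n s0) Lk1) _)) => m x.
  rewrite ger0_norm//; have [->|xc] := eqVneq x c.
    by rewrite /g nz0 mul0r; apply: mulr_ge0 => //; apply: mulr_ge0 => //; exact: ker_ge0.
  have X0 : 0 < sq (x - c) by rewrite lt0r sq_eq0 subr_eq0 xc sq_ge0.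
  rewrite /g nz1// mul1r mulrCA ler_wpM2l//.
  exact: (It_le n0 s0_gt0 s0n (ltW (t0 m)) X0).
have e0 : cc^-1 * (gmass R n * u c - l) = \int[mu]_x (Gam e * (f x * ker (x - c))).
  by rewrite -(cvg_lim (@Rhausdorff R) cI) (cvg_lim (@Rhausdorff R) cI2).
move: e0; rewrite (RIZ _ Lk1) => /(congr1 (fun y : R => cc * y)); rewrite mulVKf ?gt_eqF// => e1.
apply: (mulfI (x := gmass R n)); first by rewrite gt_eqF.
rewrite mulrDr !(mulrC (gmass R n)) divfK ?gt_eqF// mulrAC divfK ?gt_eqF//.
by rewrite mulrC -[LHS](subrK l) e1 addrC mulrA.
Qed.

End RieszRepresentation.

(** * Kelvin transforms of potentials *)

Section KelvinTransform.
Context (R : realType) (n : nat).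
Notation mu := (leb R n).
Notation nu := (n%:R / 2 : R).
Implicit Types (x y z c : 'rV[R]_n) (t s r L A : R).
Context (n0 : (0 < n)%N).

Definition kinv L y : 'rV[R]_n := (L / sq y) *: y.

(** [L] is the squared radius of the sphere. [Kq] is |kinv L x - y|^2 rescaled by |x|^2/L, which
    makes it symmetric; it is at least |x - y|^2 inside the ball and equal to it when y is on the
    sphere. *)
Definition Kq L x y : R := sq (x - y) + (L - sq x) * (L - sq y) / L.

Lemma sq_lin (a : R) x y : sq (a *: x - y) = a ^+ 2 * sq x + sq y - a * (sq x + sq y - sq (x - y)).
Proof.
have key b : sq (b *: x - y) = b ^+ 2 * sq x + sq y - 2 * b * \sum_i x ord0 i * y ord0 i.
  rewrite /sq !mulr_sumr -big_split/= -sumrB.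
  by apply: eq_bigr => i _; rewrite !mxE; ring.
have := key 1; rewrite scale1r => ->; rewrite key; ring.
Qed.

Lemma sq_gt0 x : (0 < sq x) = (x != 0).
Proof. by rewrite lt0r sq_eq0 sq_ge0 andbT. Qed.

Lemma sq_inv L x : 0 < sq x -> sq (kinv L x) = L ^+ 2 / sq x.
Proof. by move=> x0; rewrite sqZ; field; rewrite gt_eqF. Qed.

Lemma sq_invB L x y : 0 < L -> 0 < sq x -> sq (kinv L x - y) = L / sq x * Kq L x y.
Proof. by move=> L0 x0; rewrite /kinv sq_lin /Kq; field; rewrite !gt_eqF. Qed.

Lemma KqC L x y : Kq L x y = Kq L y x.
Proof. by rewrite /Kq sqBC -mulrA mulrCA mulrA. Qed.

Lemma Kq_inv L x y : 0 < L -> 0 < sq x -> Kq L (kinv L x) y = L / sq x * sq (x - y).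
Proof.
move=> L0 x0; rewrite /Kq sq_invB// sq_inv// /Kq; field.
by rewrite !gt_eqF.
Qed.

Lemma Kq_ge L x y : 0 < L -> sq x <= L -> sq y <= L -> sq (x - y) <= Kq L x y.
Proof. by move=> L0 xL yL; rewrite lerDl divr_ge0 ?(ltW L0)// mulr_ge0// subr_ge0. Qed.

Lemma Kq_sphere L x y : sq y = L -> Kq L x y = sq (x - y).
Proof. by move=> h; rewrite /Kq h subrr mulr0 mul0r addr0. Qed.

Section OneFunction.
Context (s0 : R) (s00 : 0 < s0) (s0n : s0 < nu).
Notation e := (nu - s0).
Notation ker := (@riesz R n s0).
Context (c1 : R) (f u : 'rV[R]_n -> R).
Hypothesis f0 : forall x, 0 <= f x.
Hypothesis mf : mfunT f.
Hypothesis Lf : forall c, L1 mu (fun x => f x * ker (x - c)).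
Hypothesis uE : forall c, u c = c1 * \int[mu]_x (f x * ker (x - c)).

(** The Kelvin transform in the sphere |x|^2 = L. The weight [b] is n/2 - s0 for the potential and
    n/2 + s0 for its source. *)
Definition kel (b L : R) (g : 'rV[R]_n -> R) x : R := (L / sq x) `^ b * g (kinv L x).

Lemma iN_inv L y : 0 < L -> 0 < sq y -> 1 - inB L (kinv L y) = iN L (sq y).
Proof.
move=> L0 y0; have e1 : (L <= L ^+ 2 / sq y) = (sq y <= L).
  by rewrite ler_pdivlMr// expr2 ler_pM2l.
have [h|h] := leP (sq y) L; first by rewrite iN1// inB0 ?subr0// sq_inv// e1.
by rewrite inB1 ?subrr ?sq_inv// ?ltNge ?e1 -?ltNge// /iN indicE memNset//= in_itv/= leNgt h.
Qed.

(** The part of the potential outside the ball is brought inside by inversion; the power n of the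
    Jacobian splits as (n/2 + s0) + (n/2 - s0) between source and kernel. *)
Lemma Kelvin_repr L x : 0 < L ->
  [/\ L1 mu (fun y => f y * ker (y - x) * inB L y),
      L1 mu (fun y => iN L (sq y) * (kel (nu + s0) L f y * Kq L x y `^ (- e))) &
      u x = c1 * (\int[mu]_y (f y * ker (y - x) * inB L y) +
                  \int[mu]_y (iN L (sq y) * (kel (nu + s0) L f y * Kq L x y `^ (- e))))].
Proof.
move=> L0; have mB := @measurable_inB R n L.
have La : L1 mu (fun y => f y * ker (y - x) * inB L y).
  apply: (L1_le _ _ (Lf x)); first by apply: measurable_funM => //; exact: L1_meas (Lf x).
  move=> y; have /andP[i0 i1] := inB_itv L y.
  by rewrite ger0_norm ?mulr_ge0 ?ker_ge0// ler_piMr// mulr_ge0// ker_ge0.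
have Lb := L1B (Lf x) La.
have b0 y : 0 <= f y * ker (y - x) - f y * ker (y - x) * inB L y.
  by have /andP[i0 i1] := inB_itv L y; rewrite subr_ge0 ler_piMr// mulr_ge0// ker_ge0.
have [Li ei] := RI_inversion n0 L0 Lb b0.
have E y : y != 0 -> (L / sq y) ^+ n * (f ((L / sq y) *: y) * ker ((L / sq y) *: y - x) -
    f ((L / sq y) *: y) * ker ((L / sq y) *: y - x) * inB L ((L / sq y) *: y)) =
    iN L (sq y) * (kel (nu + s0) L f y * Kq L x y `^ (- e)).
  rewrite -sq_gt0 => y0; rewrite -/(kinv L y) -[X in X - _]mulr1 -mulrBr iN_inv// [f _ * _ * _]mulrC mulrCA; congr (_ * _).
  have q0 : 0 < L / sq y by rewrite divr_gt0.
  rewrite /riesz sq_invB// powRM ?(ltW q0)//; last first.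
    have [h|h] := eqVneq (Kq L y x) 0; first by rewrite h.
    have : 0 <= L / sq y * Kq L y x by rewrite -sq_invB// sq_ge0.
    by rewrite pmulr_rge0.
  rewrite KqC /kel -powR_mulrn ?(ltW q0)//.
  have -> : (L / sq y) `^ n%:R = (L / sq y) `^ (nu + s0) * (L / sq y) `^ e.
    by rewrite -powRDp//; congr (_ `^ _); field.
  by have := powR_mulN e q0; move: (_ `^ (nu + s0)) (_ `^ e) (_ `^ (- e)) (_ `^ (- e)) => D A B C h; rewrite -[RHS]mul1r -h; ring.
have mK : mfunT (fun y => iN L (sq y) * (kel (nu + s0) L f y * Kq L x y `^ (- e))).
  apply: measurable_funM; first exact: (measurableT_comp (measurable_iN L) (@measurable_sq R n)).
  apply: measurable_funM.
    apply: measurable_funM; last exact: (measurableT_comp mf (@measurable_inv R n L)).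
    by mfun.
  apply: (measurableT_comp (@measurable_powR R (- e))); apply: measurable_funD.
    by mfun.
  by mfun.
have Lc : L1 mu (fun y => iN L (sq y) * (kel (nu + s0) L f y * Kq L x y `^ (- e))).
  apply: (L1_le_off n0 (x := 0) mK (L1_norm Li)) => y y0; rewrite -E//.
split => //; rewrite uE; congr (_ * _).
have -> : \int[mu]_y (iN L (sq y) * (kel (nu + s0) L f y * Kq L x y `^ (- e))) =
   \int[mu]_y (f y * ker (y - x) - f y * ker (y - x) * inB L y).
  rewrite -ei; apply: (RI_eq_off n0 (x := 0) mK (L1_meas Li)) => y y0; by rewrite E.
by rewrite (RIB (Lf x) La) addrC subrK.
Qed.

Definition Dk L x y : R := ker (y - x) - Kq L x y `^ (- e).

(** [Kelvin_repr] at x and at its reflection, subtracted: the four integrals combine into one whose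
    integrand is a product of differences. As [Dk] >= 0 inside the ball, everything depends on the
    sign of the source difference. *)
Lemma Kelvin_diff L x : 0 < L -> x != 0 ->
  L1 mu (fun y => inB L y * (Dk L x y * (kel (nu + s0) L f y - f y))) /\
  kel e L u x - u x = c1 * \int[mu]_y (inB L y * (Dk L x y * (kel (nu + s0) L f y - f y))).
Proof.
move=> L0; rewrite -sq_gt0 => x0; have q0 : 0 < L / sq x by rewrite divr_gt0.
have [La Lb e1] := Kelvin_repr x L0; have [Lc Ld e2] := Kelvin_repr (kinv L x) L0.
pose w := (L / sq x) `^ e.
have Ec y : w * (f y * ker (y - kinv L x) * inB L y) = f y * Kq L x y `^ (- e) * inB L y.
  rewrite /riesz sqBC sq_invB// powRM ?(ltW q0)//; last first.
    have : 0 <= L / sq x * Kq L x y by rewrite -sq_invB// sq_ge0.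
    by rewrite pmulr_rge0.
  have := powR_mulN e q0; rewrite -/w; move: w (_ `^ (- e)) (_ `^ (- e)) => A B C h.
  by rewrite -[RHS]mul1r -h; ring.
have Ed y : w * (iN L (sq y) * (kel (nu + s0) L f y * Kq L (kinv L x) y `^ (- e))) =
    iN L (sq y) * (kel (nu + s0) L f y * ker (y - x)).
  rewrite Kq_inv// /riesz [sq (y - x)]sqBC powRM ?(ltW q0) ?sq_ge0//.
  have := powR_mulN e q0; rewrite -/w; move: (_ `^ (- e)) (_ `^ (- e)) (kel _ _ _ _) => B C D h.
  by rewrite -[RHS]mul1r -h; ring.
have Lc' : L1 mu (fun y => f y * Kq L x y `^ (- e) * inB L y).
  by have := L1Z w Lc; congr (L1 mu _); apply/funext => y; rewrite Ec.
have Ld' : L1 mu (fun y => iN L (sq y) * (kel (nu + s0) L f y * ker (y - x))).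
  by have := L1Z w Ld; congr (L1 mu _); apply/funext => y; rewrite Ed.
have e3 : kel e L u x = c1 * (\int[mu]_y (f y * Kq L x y `^ (- e) * inB L y) +
    \int[mu]_y (iN L (sq y) * (kel (nu + s0) L f y * ker (y - x)))).
  rewrite /kel e2 mulrCA -/w mulrDr -(RIZ _ Lc) -(RIZ _ Ld).
  by congr (_ * (_ + _)); apply: eq_Rintegral => y _; [exact: Ec|exact: Ed].
have E y : inB L y * (Dk L x y * (kel (nu + s0) L f y - f y)) =
   (f y * Kq L x y `^ (- e) * inB L y + iN L (sq y) * (kel (nu + s0) L f y * ker (y - x))) -
   (f y * ker (y - x) * inB L y + iN L (sq y) * (kel (nu + s0) L f y * Kq L x y `^ (- e))).
  rewrite /Dk; case: (ltgtP (sq y) L) => h.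
  - by rewrite inB1// iN1 ?(ltW h)//; ring.
  - rewrite inB0 ?(ltW h)// /iN indicE memNset/= ?in_itv/= ?leNgt ?h//; ring.
  rewrite inB0 ?h// Kq_sphere// /riesz (sqBC y x); ring.
have LT := L1B (L1D Lc' Ld') (L1D La Lb).
split; first by move: LT; congr (L1 mu _); apply/funext => y; rewrite E.
under eq_Rintegral do rewrite E.
rewrite e3 e1 -mulrBr (RIB (L1D Lc' Ld') (L1D La Lb)) (RID Lc' Ld').
by rewrite (RID La Lb).
Qed.

Lemma Dk_ge0 L x y : 0 < L -> sq x <= L -> sq y <= L -> y != x -> 0 <= Dk L x y <= ker (y - x).
Proof.
move=> L0 xL yL yx; have h := Kq_ge L0 xL yL.
have d0 : 0 < sq (x - y) by rewrite sq_gt0 subr_eq0 eq_sym.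
have K0 := lt_le_trans d0 h.
rewrite /Dk subr_ge0 lerBlDr lerDl powR_ge0 andbT /riesz (sqBC y x) !powRN.
rewrite lef_pV2 ?posrE ?powR_gt0//; apply: ler_powR_base; rewrite ?subr_ge0 ?(ltW s0n)//.
exact: ltW.
Qed.

(** On this region [Kq] exceeds |x - y|^2 by at least [ka], while |x - y|^2 <= 4 L; the constant is
    the drop of t^(-e) over a step [ka] at t = 4 L, where it is smallest. *)
Lemma Dk_lower L R0 : 0 < L -> R0 < L -> exists2 d, 0 < d &
  forall x y, sq x <= R0 -> sq y <= L / 2 -> y != x -> d <= Dk L x y.
Proof.
move=> L0 RL; have e0 : 0 < e by rewrite subr_gt0.
pose ka := (L - R0) / 2; have ka0 : 0 < ka by rewrite divr_gt0// subr_gt0.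
have L40 : 0 < 4 * L by rewrite mulr_gt0.
exists ((4 * L) `^ (- e) * (1 - (4 * L / (4 * L + ka)) `^ e)).
  rewrite mulr_gt0 ?powR_gt0// subr_gt0.
  have h1 : 4 * L / (4 * L + ka) < 1 by rewrite ltr_pdivrMr ?addr_gt0// mul1r ltrDl.
  have h0 : 0 < 4 * L / (4 * L + ka) by rewrite divr_gt0// addr_gt0.
  have p1 : 1 `^ e = 1 :> R by rewrite powR1.
  by rewrite -[ltRHS]p1; apply: gt0_ltr_powR; rewrite ?nnegrE ?(ltW h0) ?ler01.
move=> x y xR yL yx; set X := sq (x - y).
have X0 : 0 < X by rewrite sq_gt0 subr_eq0 eq_sym.
have XL : X <= 4 * L.
  have := sqD_le2 x (- y); rewrite sqN -/X => h; have x0 := sq_ge0 x; have y0 := sq_ge0 y.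
  by lra.
have KX : X + ka <= Kq L x y.
  rewrite lerD2l ler_pdivlMr// /ka -mulrA.
  rewrite (_ : (L - R0) * (2^-1 * L) = (L - R0) * (L / 2)); last by ring.
  apply: ler_pM; rewrite ?subr_ge0 ?(ltW RL) ?divr_ge0 ?(ltW L0)//; lra.
have Xk := addr_gt0 X0 ka0.
rewrite /Dk /riesz (sqBC y x) -/X.
apply: (@le_trans _ _ (X `^ (- e) - (X + ka) `^ (- e))); last first.
  have K0 := lt_le_trans Xk KX.
  rewrite lerD2l lerN2 !powRN lef_pV2 ?posrE ?powR_gt0 ?Xk ?K0//.
  by apply: ler_powR_base; rewrite ?(ltW e0) ?addr_ge0 ?(ltW X0) ?(ltW ka0).
have -> : (X + ka) `^ (- e) = X `^ (- e) * (X / (X + ka)) `^ e.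
  rewrite powRM ?(ltW X0) ?invr_ge0 ?addr_ge0 ?(ltW X0) ?(ltW ka0)// mulrA [X `^ (- e) * _]mulrC powR_mulN// mul1r.
  by rewrite -[(X + ka)^-1]powR_inv1 ?(ltW Xk)// -powRrM mulN1r.
have fac (A B : R) : A - A * B = A * (1 - B) by ring.
rewrite fac; apply: ler_pM; rewrite ?powR_ge0//.
- have p1 : 1 `^ e = 1 :> R by rewrite powR1.
  rewrite subr_ge0 -[leRHS]p1; apply: ler_powR_base; rewrite ?(ltW e0)//.
    by rewrite divr_ge0 ?addr_ge0 ?(ltW ka0) ?(ltW L40).
  by rewrite ler_pdivrMr ?addr_gt0// mul1r lerDl ltW.
- by rewrite !powRN lef_pV2 ?posrE ?powR_gt0//; apply: ler_powR_base; rewrite ?(ltW e0) ?(ltW X0).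
rewrite lerD2l lerN2; apply: ler_powR_base; rewrite ?(ltW e0)//.
  by rewrite divr_ge0 ?addr_ge0 ?(ltW X0) ?(ltW ka0).
rewrite ler_pdivrMr ?addr_gt0// mulrAC ler_pdivlMr ?addr_gt0//.
by rewrite !mulrDr [4 * L * X]mulrC lerD2l ler_wpM2r ?(ltW ka0).
Qed.

(** A change of radius amounts to a dilation of the argument. Spheres of different radii can thus be
    compared even near the origin, whose reflections escape to infinity. *)
Lemma kel_scale b L L0 (g : 'rV[R]_n -> R) x : 0 < L -> 0 < L0 -> 0 < sq x ->
  kel b L g x = (L0 / L) `^ b * kel b L0 g ((L0 / L) *: x).
Proof.
move=> L_0 L00 x0; have q : 0 < L0 / L by rewrite divr_gt0.
rewrite /kel sqZ mulrA -powRM ?divr_ge0 ?mulr_ge0 ?exprn_ge0 ?invr_ge0 ?(ltW L_0) ?(ltW q) ?(ltW L00) ?(ltW x0)//.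
congr (_ `^ _ * g _); first by field; rewrite !gt_eqF.
by rewrite /kinv sqZ scalerA; congr (_ *: _); field; rewrite !gt_eqF.
Qed.

Lemma L1_kerB : L1 mu (fun z => ker z * inB 1 z).
Proof.
apply: (L1_le _ _ (L1Z (expR 1) (L1_riesz_gauss s00 s0n))).
  by mfun.
move=> z; have [h|h] := ltP (sq z) 1; last first.
  rewrite inB0// mulr0 normr0 mulr_ge0 ?expR_ge0//; exact: riesz_gauss_ge0.
rewrite inB1// mulr1 ger0_norm ?ker_ge0// /riesz_gauss /riesz mulrCA ler_peMr ?powR_ge0//.
by rewrite -expRD -[leLHS](@expR0 R) ler_expR subr_ge0 ltW.
Qed.

End OneFunction.
End KelvinTransform.

(** Powers p < 1 are Lipschitz only away from 0, hence the bound [m] > 0; it will come from the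
    positive lower bounds on u and v. *)
Lemma powR_lip (R : realType) (m V p : R) : 0 < m -> 0 < p -> exists2 K : R, 0 <= K &
  forall s t, m <= s -> s <= t -> t <= V -> t `^ p - s `^ p <= K * (t - s).
Proof.
move=> m0 p0; exists (V `^ p * (p / m * expR (p * (`|V| / m)))).
  by rewrite !mulr_ge0 ?powR_ge0 ?expR_ge0 ?invr_ge0// ltW.
move=> s t ms st tV; have s0 : 0 < s by exact: lt_le_trans ms.
have t0 : 0 < t by exact: lt_le_trans st.
pose h := (t - s) / s; have h0 : 0 <= h by rewrite divr_ge0 ?subr_ge0// ltW.
have hm : h <= (t - s) / m by rewrite ler_wpM2l ?subr_ge0// lef_pV2 ?posrE.
have hV : h <= `|V| / m.
  apply: (le_trans hm); rewrite ler_wpM2r ?invr_ge0 ?(ltW m0)//.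
  by apply: (le_trans _ (ler_norm _)); apply: le_trans tV; rewrite gerBl ltW.
have tE : t = s * (1 + h) by rewrite /h; field; rewrite gt_eqF.
clearbody h.
have e1 : (1 + h) `^ p <= expR (p * h).
  rewrite mulrC -powR_expR; apply: ler_powR_base; rewrite ?(ltW p0) ?addr_ge0//.
  exact: expR_ge1Dx.
have e2 : expR (p * h) - 1 <= p * h * expR (p * h).
  have := expR_ge1Dx (- (p * h)); rewrite expRN => /(ler_wpM2r (expR_ge0 (p * h))).
  by rewrite mulVf ?gt_eqF ?expR_gt0// => e3; lra.
have sV : s `^ p <= V `^ p by apply: ler_powR_base; rewrite ?(ltW p0) ?(ltW s0)// (le_trans st).
have {1}-> : t `^ p = s `^ p * (1 + h) `^ p by rewrite {1}tE powRM ?addr_ge0// ltW.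
rewrite -[X in _ - X]mulr1 -mulrBr -mulrA; apply: (@le_trans _ _ (s `^ p * (p * h * expR (p * h)))).
  by rewrite ler_wpM2l ?powR_ge0//; apply: le_trans e2; rewrite lerD2r.
apply: ler_pM; rewrite ?powR_ge0 ?mulr_ge0 ?expR_ge0 ?(ltW p0)//.
rewrite (_ : p / m * _ * _ = p * ((t - s) / m) * expR (p * (`|V| / m))); last by ring.
apply: ler_pM; rewrite ?mulr_ge0 ?expR_ge0 ?(ltW p0)//.
  by rewrite ler_wpM2l ?(ltW p0).
by rewrite ler_expR ler_wpM2l ?(ltW p0).
Qed.

(** * Comparison in narrow shells and strict comparison *)

Section NarrowRegion.
Context (R : realType) (n : nat).
Notation mu := (leb R n).
Notation nu := (n%:R / 2 : R).
Implicit Types (x y z c : 'rV[R]_n) (t s r L A : R).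
Context (n0 : (0 < n)%N).

Lemma RI_le_off2 x z (f g : 'rV[R]_n -> R) : L1 mu f -> L1 mu g ->
  (forall y, y != x -> y != z -> f y <= g y) -> \int[mu]_y f y <= \int[mu]_y g y.
Proof.
move=> Lf Lg h; rewrite -subr_ge0 -(RIB Lg Lf).
have mB := L1_meas (L1B Lg Lf).
rewrite (@ae_RI_eq _ _ _ mu _ (fun y => `|g y - f y|))//; first by apply: RI_ge0.
  by mfun.
apply: filterS2 (ae_neq n0 x) (ae_neq n0 z) => y yx yz.
by rewrite ger0_norm// subr_ge0 h.
Qed.

Definition ann r L y : R := inB L y - inB r y.

Lemma ann1 r L y : r <= sq y -> sq y < L -> ann r L y = 1.
Proof. by move=> h1 h2; rewrite /ann inB1// inB0// subr0. Qed.

Lemma ann0 r L y : r <= L -> sq y < r \/ L <= sq y -> ann r L y = 0.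
Proof.
move=> rL [h|h]; rewrite /ann; first by rewrite !inB1 ?subrr// (lt_le_trans h).
by rewrite !inB0 ?subrr// (le_trans rL).
Qed.

Lemma ann_ge0 r L y : r <= L -> 0 <= ann r L y.
Proof.
move=> rL; have [h|h] := ltP (sq y) r; first by rewrite ann0//; left.
by have [h2|h2] := ltP (sq y) L; [rewrite ann1|rewrite ann0//; right].
Qed.

Lemma L1_ann r L : L1 mu (ann r L).
Proof. by apply: L1B; exact: L1_inB. Qed.

Lemma vol_ann r L : 0 <= r -> r < L -> \int[mu]_y ann r L y = (L `^ nu - r `^ nu) * vol1 R n.
Proof.
move=> r0 rL; have L0 : 0 < L by exact: le_lt_trans rL.
rewrite (RIB (@L1_inB R n _) (@L1_inB R n _)) vol_ball// mulrBl; congr (_ - _).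
move: r0; rewrite le_eqVlt => /predU1P[<-|r0]; last by rewrite vol_ball.
rewrite powR0 ?gt_eqF ?nu_gt0// mul0r; under eq_Rintegral do rewrite inB0 ?sq_ge0//.
by rewrite /Rintegral integral0.
Qed.

Section OneKernel.
Context (s0 : R) (s00 : 0 < s0) (s0n : s0 < nu).
Notation e := (nu - s0).
Notation ker := (@riesz R n s0).

Lemma small_ker (eta : R) : 0 < eta -> exists eps : R,
  [/\ 0 < eps, L1 mu (fun z => ker z * inB eps z) & \int[mu]_z (ker z * inB eps z) <= eta].
Proof.
move=> eta0; have L := L1_kerB s00 s0n.
have mk := @measurable_ker R n s0.
have m1 m : mfunT (fun z => ker z * inB m.+1%:R^-1 z) by mfun.
have bd m z : `|ker z * inB m.+1%:R^-1 z| <= ker z * inB 1 z.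
  have /andP[i0 i1] := inB_itv m.+1%:R^-1 z.
  rewrite ger0_norm ?mulr_ge0 ?ker_ge0// ler_wpM2l ?ker_ge0//.
  have [h|h] := ltP (sq z) 1; first by rewrite [leRHS]inB1.
  rewrite inB0; first by have /andP[] := inB_itv 1 z.
  by apply: le_trans h; rewrite invf_le1 ?ltr0n// ler1n.
have c0 z : ker z * inB m.+1%:R^-1 z @[m --> \oo] --> (0 : R).
  have [->|z0] := eqVneq z 0; first by rewrite (ker0 s0n); under eq_fun do rewrite mul0r; exact: cvg_cst.
  rewrite -sq_gt0 in z0; apply: cvg_near_cst; near=> m.
  rewrite inB0 ?mulr0// -[leRHS]invrK lef_pV2 ?posrE ?invr_gt0 ?ltr0n//.
  by rewrite -[leRHS]mul1r; near: m; exact: cvg_mulS.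
have [_ h] := RI_dct m1 c0 L bd.
have i0 : \int[mu]_z (0 : R) = 0 by rewrite /Rintegral integral0.
rewrite i0 in h; have /cvgrPdist_le/(_ eta eta0) := h; move=> [N _ hN].
exists N.+1%:R^-1; split; [by rewrite invr_gt0|exact: (L1_le (m1 N) (bd N) L)|].
have := hN N (leqnn N); rewrite /= sub0r normrN; exact: le_trans (ler_norm _).
Unshelve. all: by end_near. Qed.

(** Uniform in x: the kernel has small mass on a small ball around x and is bounded off it, so a
    small volume of the shell suffices. *)
Lemma ann_small (eta : R) : 0 < eta -> exists2 d : R, 0 < d & forall r L x, 0 <= r -> r < L ->
  L `^ nu - r `^ nu <= d -> L1 mu (fun y => ann r L y * ker (y - x)) /\
  \int[mu]_y (ann r L y * ker (y - x)) <= eta.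
Proof.
move=> eta0; have e20 : 0 < eta / 2 by rewrite divr_gt0.
have [eps [eps0 Le he]] := small_ker e20; have e0 : 0 < e by rewrite subr_gt0.
have v0 := vol1_gt0 R n.
exists (eta / 2 / (eps `^ (- e) * vol1 R n)); first by rewrite divr_gt0// mulr_gt0 ?powR_gt0.
move=> r L x r0 rL hd; have Ls := L1_shift (- x) Le; have La := L1Z (eps `^ (- e)) (L1_ann r L).
have bd y : ann r L y * ker (y - x) <= ker (y - x) * inB eps (y - x) + eps `^ (- e) * ann r L y.
  have a0 := ann_ge0 y (ltW rL).
  have a1 : ann r L y <= 1.
    have [h|h] := ltP (sq y) r; first by rewrite ann0 ?ler01 ?(ltW rL)//; left.
    by have [h2|h2] := ltP (sq y) L; [rewrite ann1|rewrite ann0 ?ler01 ?(ltW rL)//; right].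
  have [h|h] := ltP (sq (y - x)) eps.
    rewrite inB1// mulr1 -[leLHS]addr0; apply: lerD; last by rewrite mulr_ge0 ?powR_ge0.
    by rewrite ler_piMl// ker_ge0.
  rewrite inB0// mulr0 add0r mulrC ler_wpM2r// /riesz !powRN lef_pV2 ?posrE ?powR_gt0 ?(lt_le_trans eps0)//.
  by apply: ler_powR_base; rewrite ?(ltW e0) ?(ltW eps0).
have LA : L1 mu (fun y => ann r L y * ker (y - x)).
  apply: (L1_le _ _ (L1D Ls La)); last first.
    by move=> y; rewrite ger0_norm ?mulr_ge0 ?ker_ge0 ?ann_ge0 ?(ltW rL)//; exact: bd.
  apply: measurable_funM; first exact: L1_meas (L1_ann r L).
  by mfun.
split => //; apply: (le_trans (RI_le LA (L1D Ls La) bd)).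
rewrite (RID Ls La) (RI_shift (- x) (L1_meas Le)) (RIZ _ (L1_ann r L)) vol_ann//.
rewrite [leRHS]splitr; apply: lerD => //.
by rewrite mulrCA -ler_pdivlMr ?mulr_gt0 ?powR_gt0.
Qed.

Context (s1 : R) (s10 : 0 < s1) (s1n : s1 < nu).
Notation e1 := (nu - s1).
Context (a p : R) (a0 : 0 <= a) (p0 : 0 < p).
(** Twice this number is n + 2 s0 + 2 a - p (n - 2 s1): it is nonnegative when p obeys the upper
    bound of case (1), and positive when that bound is strict. *)
Notation sp := (nu + s0 + a - e1 * p).
Context (u v : 'rV[R]_n -> R) (c1 : R) (c10 : 0 < c1).
Notation f := (fun y => sq y `^ (a / 2) * v y `^ p).
Hypothesis sp0 : 0 <= sp.
Hypothesis v0 : forall x, 0 <= v x.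
Hypothesis mv : mfunT v.
Hypothesis Lf : forall c, L1 mu (fun x => f x * ker (x - c)).
Hypothesis uE : forall c, u c = c1 * \int[mu]_x (f x * ker (x - c)).
Context (c0 : R) (c00 : 0 < c0).
Hypothesis hv : forall z, c0 * (1 + sq z) `^ (- e1) <= v z.

Lemma f_ge0 y : 0 <= f y. Proof. by rewrite mulr_ge0 ?powR_ge0. Qed.

Lemma mf' : mfunT f.
Proof. by mfun. Qed.

(** Here [sp] arises: it is what remains of the weight n/2 + s0 of the source once |x|^a and the
    transform of v have taken their share. Inside the ball L/|y|^2 > 1, so sp >= 0 gives a factor at
    least 1. *)
Lemma kel_power L y : 0 < L -> 0 < sq y ->
  kel (nu + s0) L f y = (L / sq y) `^ sp * (sq y `^ (a / 2) * kel e1 L v y `^ p).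
Proof.
move=> L0 y0; have q0 : 0 < L / sq y by rewrite divr_gt0.
have ek : kel e1 L v y `^ p = (L / sq y) `^ (e1 * p) * v (kinv L y) `^ p by rewrite /kel powRM ?powR_ge0// -powRrM.
rewrite ek /kel sq_inv//.
have -> : L ^+ 2 / sq y = (L / sq y) `^ 2 * sq y by rewrite powR_mulrn ?(ltW q0)//; field; rewrite gt_eqF.
rewrite [(_ * sq y) `^ _]powRM ?powR_ge0 ?(ltW y0)// -[(_ `^ 2) `^ _]powRrM (_ : 2 * (a / 2) = a); last by field.
have -> : (L / sq y) `^ (nu + s0) = (L / sq y) `^ sp * ((L / sq y) `^ (e1 * p) * (L / sq y) `^ (- a)).
  by rewrite -!powRDp//; congr (_ `^ _); ring.
have := powR_mulN a q0; move: (_ `^ sp) (_ `^ (e1 * p)) (_ `^ (- a)) (_ `^ a) (_ `^ (a / 2)) (v _ `^ p).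
by move=> A B C D E F h; rewrite -[RHS]mul1r -h; ring.
Qed.

Lemma kel_lower L y : 0 < L -> 0 < sq y -> sq y < L -> c0 * (1 + L) `^ (- e1) <= kel e1 L v y.
Proof.
move=> L0 y0 yL; have q0 : 0 < L / sq y by rewrite divr_gt0.
have e10 : 0 < e1 by rewrite subr_gt0.
have k0 := sq1_gt0 (kinv L y).
apply: (@le_trans _ _ ((L / sq y) `^ e1 * (c0 * (1 + sq (kinv L y)) `^ (- e1)))); last first.
  by rewrite ler_wpM2l ?powR_ge0.
rewrite mulrCA ler_wpM2l ?(ltW c00)// !powRN ler_pdivlMr ?powR_gt0// mulrC ler_pdivrMr ?powR_gt0 ?addr_gt0//.
rewrite -powRM ?(ltW q0) ?addr_ge0 ?(ltW L0)//; apply: ler_powR_base; rewrite ?(ltW e10) ?(ltW k0)//.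
rewrite sq_inv// -(ler_pM2r y0) mulrDl mul1r divfK ?gt_eqF//.
rewrite (_ : L / sq y * (1 + L) * sq y = L * (1 + L)); last by field; rewrite gt_eqF.
by rewrite mulrDr mulr1 -expr2 lerD2r ltW.
Qed.

(** A deficit [A] of v against its transform costs u at most K A times the kernel mass of the shell,
    with K independent of sphere, shell and point. Where v does not exceed its transform the source
    difference is nonnegative; elsewhere [powR_lip] bounds it by a multiple of the deficit. *)
Lemma narrow Lmax V : 0 < Lmax -> (forall z, sq z <= Lmax -> v z <= V) -> exists2 K, 0 <= K &
  forall L r A x, 0 < L -> L <= Lmax -> r < L -> 0 <= A ->
    (forall y, 0 < sq y -> sq y < L -> v y - A <= kel e1 L v y) ->
    (forall y, 0 < sq y -> sq y < r -> v y <= kel e1 L v y) ->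
    L1 mu (fun y => ann r L y * ker (y - x)) -> 0 < sq x -> sq x < L ->
    u x - K * A * \int[mu]_y (ann r L y * ker (y - x)) <= kel e L u x.
Proof.
move=> Lm0 hV; have e10 : 0 < e1 by rewrite subr_gt0.
pose m := c0 * (1 + Lmax) `^ (- e1).
have m0 : 0 < m by rewrite mulr_gt0 ?powR_gt0// addr_gt0.
have [K K0 hK] := powR_lip V m0 p0.
exists (c1 * (Lmax `^ (a / 2) * K)); first by rewrite !mulr_ge0 ?powR_ge0 ?(ltW c10).
move=> L r A x L0 LL rL A0 hA hr La x0 xL.
have xn0 : x != 0 by rewrite -sq_gt0.
have [LD eD] := Kelvin_diff n0 f_ge0 mf' Lf uE L0 xn0.
set M := Lmax `^ (a / 2) * K; have M0 : 0 <= M by rewrite mulr_ge0 ?powR_ge0.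
have LM := L1Z (- (M * A)) La.
have h : - (M * A) * \int[mu]_y (ann r L y * ker (y - x)) <=
   \int[mu]_y (inB L y * (Dk s0 L x y * (kel (nu + s0) L f y - f y))).
  rewrite -(RIZ _ La); apply: (RI_le_off2 (x := x) (z := 0) LM LD) => y yx yn0.
  have y0 : 0 < sq y by rewrite sq_gt0.
  have [yL|yL] := ltP (sq y) L; last by rewrite ann0 ?(ltW rL)//; [rewrite inB0// !mul0r mulr0|right].
  rewrite inB1// mul1r; have /andP[D0 Dk'] := Dk_ge0 s0n L0 (ltW xL) (ltW yL) yx.
  have ag := ann_ge0 y (ltW rL).
  have key : - (M * A * ann r L y) <= kel (nu + s0) L f y - f y.
    rewrite kel_power//; set vL := kel e1 L v y.
    have w1 : 1 <= (L / sq y) `^ sp.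
      rewrite -[leLHS](powRr0 (L / sq y)); apply: ler_powR => //.
      by rewrite ler_pdivlMr// mul1r ltW.
    have vLm : m <= vL.
      apply: le_trans (kel_lower L0 y0 yL); rewrite ler_wpM2l ?(ltW c00)// !powRN lef_pV2 ?posrE ?powR_gt0 ?addr_gt0//.
      by apply: ler_powR_base; rewrite ?(ltW e10) ?addr_ge0 ?(ltW L0)// lerD2l.
    have vL0 : 0 <= sq y `^ (a / 2) * vL `^ p by rewrite mulr_ge0 ?powR_ge0.
    apply: (@le_trans _ _ (sq y `^ (a / 2) * vL `^ p - f y)); last by rewrite lerD2r ler_peMl.
    rewrite -mulrBr; have [vv|vv] := leP (v y) vL.
      apply: (@le_trans _ _ 0); first by rewrite oppr_le0; apply: mulr_ge0 => //; exact: mulr_ge0.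
      by rewrite mulr_ge0 ?powR_ge0// subr_ge0 ler_powR_base// ltW.
    have ry : r <= sq y by rewrite leNgt; apply/negP => /(hr y y0); rewrite -/vL leNgt vv.
    rewrite ann1// mulr1 lerNl -mulrN opprB /M -mulrA.
    apply: ler_pM; rewrite ?powR_ge0//; first by rewrite subr_ge0; apply: ler_powR_base; [exact: ltW p0|exact: le_trans (ltW m0) vLm|exact: ltW vv].
      by apply: ler_powR_base; rewrite ?divr_ge0 ?(ltW y0)// (le_trans (ltW yL)).
    apply: (le_trans (hK _ _ vLm (ltW vv) (hV y _))); first exact: le_trans (ltW yL) LL.
    by rewrite ler_wpM2l// lerBlDr addrC -lerBlDr hA.
  apply: (@le_trans _ _ (Dk s0 L x y * - (M * A * ann r L y))); last by rewrite ler_wpM2l.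
  rewrite mulrN mulNr lerN2 [leRHS]mulrA mulrC ler_wpM2l// mulr_ge0// mulr_ge0//.
have := ler_wpM2l (ltW c10) h; rewrite -eD; move: (\int[mu]_y (ann r L y * _)) (kel e L u x) => I k h3; lra.
Qed.

(** Strictness comes either from sp > 0 or from a gap already known for v. Each makes the
    transformed source at least g times the source, with g > 1, on |y|^2 < L/2. The shell between
    L/4 and L/2 then contributes a positive amount, uniform in x by [Dk_lower]. *)
Lemma strict L V r : 0 < L -> r < L -> (forall z, sq z <= L -> v z <= V) ->
  (forall y, 0 < sq y -> sq y < L -> v y <= kel e1 L v y) ->
  (0 < sp \/ exists2 eps : R, 0 < eps & forall y, 0 < sq y -> sq y < L / 2 -> v y + eps <= kel e1 L v y) ->
  exists2 eps : R, 0 < eps & forall x, 0 < sq x -> sq x < r -> u x + eps <= kel e L u x.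
Proof.
move=> L0 rL hV hw hs; have e10 : 0 < e1 by rewrite subr_gt0.
pose m := c0 * (1 + L) `^ (- e1).
have m0 : 0 < m by rewrite mulr_gt0 ?powR_gt0// addr_gt0.
have vm y : sq y <= L -> m <= v y.
  move=> yL; apply: le_trans (hv y); rewrite ler_wpM2l ?(ltW c00)// !powRN lef_pV2 ?posrE ?powR_gt0 ?sq1_gt0 ?(addr_gt0 ltr01 L0)//.
  by apply: ler_powR_base; rewrite ?(ltW e10) ?addr_ge0 ?sq_ge0// lerD2l.
have V0 : 0 < V by apply: lt_le_trans m0 _; apply: le_trans (vm 0 _) (hV 0 _); rewrite sq0 ltW.
have w1 y : 0 < sq y -> sq y < L -> 1 <= (L / sq y) `^ sp.
  move=> y0 yL; rewrite -[leLHS](powRr0 (L / sq y)); apply: ler_powR => //.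
  by rewrite ler_pdivlMr// mul1r ltW.
have fge y : 0 < sq y -> sq y < L -> 0 <= kel (nu + s0) L f y - f y.
  move=> y0 yL; rewrite kel_power// subr_ge0.
  apply: (@le_trans _ _ (sq y `^ (a / 2) * kel e1 L v y `^ p)).
    by rewrite ler_wpM2l ?powR_ge0// ler_powR_base ?(ltW p0)// hw.
  by rewrite ler_peMl ?w1// mulr_ge0 ?powR_ge0.
have [g g1 hg] : exists2 g : R, 1 < g & forall y, 0 < sq y -> sq y < L / 2 -> g * f y <= kel (nu + s0) L f y.
  case: hs => [sp1|[eps eps0 heps]].
    exists (2 `^ sp).
      have p1 : 1 `^ sp = 1 :> R by rewrite powR1.
      by rewrite -[ltLHS]p1; apply: gt0_ltr_powR; rewrite ?nnegrE ?ler01 ?ler0n ?ltr1n.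
    move=> y y0 yL2; have yL : sq y < L by apply: lt_le_trans yL2 _; rewrite ler_pdivrMr// ler_peMr ?(ltW L0)//; lra.
    rewrite kel_power//; apply: ler_pM; rewrite ?powR_ge0 ?f_ge0//.
      apply: ler_powR_base; rewrite ?(ltW sp1)//.
      by rewrite ler_pdivlMr// mulrC -ler_pdivlMr// ltW.
    by rewrite ler_wpM2l ?powR_ge0// ler_powR_base ?(ltW p0)// hw.
  exists ((1 + eps / V) `^ p).
    have h1 : 1 < 1 + eps / V by rewrite ltrDl divr_gt0.
    have p1 : 1 `^ p = 1 :> R by rewrite powR1.
    by rewrite -[ltLHS]p1; apply: gt0_ltr_powR; rewrite ?nnegrE ?ler01// (le_trans ler01)// ltW.
  move=> y y0 yL2; have yL : sq y < L by apply: lt_le_trans yL2 _; rewrite ler_pdivrMr// ler_peMr ?(ltW L0)//; lra.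
  rewrite kel_power// mulrCA; apply: (@le_trans _ _ (sq y `^ (a / 2) * kel e1 L v y `^ p)); last first.
    by rewrite ler_peMl ?w1// mulr_ge0 ?powR_ge0.
  rewrite ler_wpM2l ?powR_ge0// -powRM ?addr_ge0 ?divr_ge0 ?(ltW eps0) ?(ltW V0)//.
  apply: ler_powR_base; rewrite ?(ltW p0) ?mulr_ge0 ?addr_ge0 ?divr_ge0 ?(ltW eps0) ?(ltW V0)//.
  apply: le_trans (heps y y0 yL2); rewrite mulrDl mul1r lerD2l mulrAC ler_pdivrMr//.
  by rewrite ler_wpM2l ?(ltW eps0)// hV// ltW.
have [d d0 hd] := Dk_lower s0n L0 rL.
pose mf := (g - 1) * ((L / 4) `^ (a / 2) * m `^ p).
have L4 : 0 < L / 4 by rewrite divr_gt0.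
have mf0 : 0 < mf by rewrite !mulr_gt0 ?subr_gt0 ?powR_gt0.
have L42 : L / 4 < L / 2 by lra.
have vol0 : 0 < \int[mu]_y ann (L / 4) (L / 2) y.
  rewrite vol_ann ?(ltW L4)// mulr_gt0 ?vol1_gt0// subr_gt0.
  by apply: gt0_ltr_powR; rewrite ?nnegrE ?nu_gt0 ?(ltW L4)//; lra.
exists (c1 * (d * mf * \int[mu]_y ann (L / 4) (L / 2) y)).
  by apply: mulr_gt0 => //; apply: mulr_gt0 => //; exact: mulr_gt0.
move=> x x0 xr; have xL := lt_trans xr rL; have xn0 : x != 0 by rewrite -sq_gt0.
have [LD eD] := Kelvin_diff n0 f_ge0 mf' Lf uE L0 xn0.
rewrite addrC -lerBrDr eD ler_wpM2l ?(ltW c10)// -(RIZ _ (L1_ann _ _)).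
apply: (RI_le_off2 (x := x) (z := 0) (L1Z _ (L1_ann _ _)) LD) => y yx yn0.
have y0 : 0 < sq y by rewrite sq_gt0.
have [yL|yL] := ltP (sq y) L; last first.
  by rewrite ann0 ?(ltW L42) ?inB0 ?mulr0 ?mul0r//; right; lra.
rewrite inB1// mul1r; have /andP[D0 _] := Dk_ge0 s0n L0 (ltW xL) (ltW yL) yx.
have [y4|y4] := ltP (sq y) (L / 4).
  by rewrite ann0 ?(ltW L42) ?mulr0 ?mulr_ge0 ?fge//; left.
have [y2|y2] := ltP (sq y) (L / 2); last first.
  by rewrite ann0 ?(ltW L42) ?mulr0 ?mulr_ge0 ?fge//; right.
rewrite ann1// mulr1; apply: ler_pM; rewrite ?(ltW d0) ?(ltW mf0) ?hd ?(ltW xr) ?(ltW y2)//.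
apply: (@le_trans _ _ ((g - 1) * f y)); last by rewrite mulrBl mul1r lerD2r hg.
rewrite ler_wpM2l ?subr_ge0 ?(ltW g1)//; apply: ler_pM; rewrite ?powR_ge0//.
  by apply: ler_powR_base; rewrite ?divr_ge0 ?(ltW L0).
by apply: ler_powR_base; rewrite ?(ltW p0) ?(ltW m0)// vm// ltW.
Qed.

End OneKernel.
End NarrowRegion.

Ltac munfold ::= cbv beta delta [G om dd rker iN inB riesz ann].

(** * Dependence of Kelvin transforms on the radius *)

Section Transfer.
Context (R : realType) (n : nat).
Implicit Types (x y z : 'rV[R]_n) (t L : R).

Lemma powR_cts (e t : R) : 0 < t -> {for t, continuous (fun t : R => t `^ e)}.
Proof.
move=> t0; have := is_derive1_powR e t0 => -[h1 _].
by apply: differentiable_continuous; exact/derivable1_diffP.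
Qed.

(** By [kel_scale] it is enough that u(x) < t^e (u(t x) + eps) for t = L0/L near 1. This involves u
    alone, so it holds uniformly on a compact ball, and the singular point of the reflection does no
    harm. *)
Lemma kel_transfer (e L0 r eps : R) (u : 'rV[R]_n -> R) : continuous u -> 0 < L0 -> 0 < eps ->
  (forall x, 0 < sq x -> sq x < r -> u x + eps <= kel e L0 u x) ->
  exists2 d : R, 0 < d & forall L, L0 < L -> L < L0 + d ->
    forall x, 0 < sq x -> sq x < r -> u x <= kel e L u x.
Proof.
move=> cu L00 eps0 h.
have near1 x : [set x : 'rV[R]_n | sq x <= r] x ->
    \forall x' \near x & t \near (1 : R), u x' < t `^ e * (u (t *: x') + eps).
  move=> _.
  pose H (z : 'rV[R]_n * R) : R := z.2 `^ e * (u (z.2 *: z.1) + eps) - u z.1.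
  have cH : H z @[z --> (x, 1 : R)] --> 1 `^ e * (u (1 *: x) + eps) - u x.
    have c2 : z.2 @[z --> (x, 1 : R)] --> (1 : R) by exact: cvg_snd.
    have c1 : z.1 @[z --> (x, 1 : R)] --> x by exact: cvg_fst.
    apply: cvgB; last exact: (continuous_cvg _ (@cu x) c1).
    apply: cvgM.
      exact: (continuous_cvg _ (@powR_cts e 1 ltr01) c2).
    apply: cvgD; last exact: cvg_cst.
    apply: (continuous_cvg _ (@cu (1 *: x))); apply: cvg_row => i.
    rewrite mxE; under eq_fun do rewrite mxE; apply: cvgM => //.
    exact: (continuous_cvg _ (@coord_continuous R 1 n ord0 i x) c1).
  rewrite powR1 mul1r scale1r addrAC subrr add0r in cH.
  have hn : \forall z \near (x, 1 : R), 0 < H z by exact: (cvgr_gt _ cH 0 eps0).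
  case: hn => -[A B] [/= hA hB] hAB; exists (A, B); first by split.
  by move=> [y t] /= hyt; have := hAB (y, t) hyt; rewrite /H /= subr_gt0.
have := (compact_near_coveringP _).1 (compact_sq (R := R) (n := n) (rho := r)) R (nbhs (1 : R))
  (fun t x => u x < t `^ e * (u (t *: x) + eps)) _ near1.
move=> [rho /= rho0 hrho].
exists (rho * L0); first by rewrite mulr_gt0.
move=> L L0L Ld x x0 xr; have L_0 : 0 < L by exact: lt_trans L0L.
have t0 : 0 < L0 / L by rewrite divr_gt0.
have t1 : L0 / L <= 1 by rewrite ler_pdivrMr// mul1r ltW.
have hb : `|1 - L0 / L| < rho.
  rewrite ger0_norm ?subr_ge0// ltrBlDr -ltrBlDl ltr_pdivlMr// mulrBl mul1r.
  by rewrite ltrBlDl -ltrBlDr (lt_trans _ (_ : rho * L0 < rho * L))// ?ltr_pM2l//; lra.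
have := hrho _ hb x (ltW xr); rewrite (kel_scale e u L_0 L00 x0) => h1.
apply: (le_trans (ltW h1)); rewrite ler_wpM2l ?powR_ge0//; apply: h.
  by rewrite sqZ mulr_gt0// exprn_gt0.
by apply: le_lt_trans xr; rewrite sqZ ler_piMl ?sq_ge0// exprn_ile1// ltW.
Qed.

Lemma kel_cvg (e S : R) (u : 'rV[R]_n -> R) x : continuous u -> 0 < S -> 0 < sq x ->
  kel e L u x @[L --> S] --> kel e S u x.
Proof.
move=> cu S0 x0; have c1 : L / sq x @[L --> S] --> S / sq x.
  by apply: cvgM; [exact: cvg_id|exact: cvg_cst].
apply: cvgM.
  exact: (continuous_cvg _ (@powR_cts e _ (divr_gt0 S0 x0)) c1).
apply: (continuous_cvg _ (@cu (kinv S x))); apply: cvg_row => i.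
rewrite /kinv mxE; under eq_fun do rewrite mxE.
by apply: cvgM => //; exact: cvg_cst.
Qed.

End Transfer.

(** * The method of scaling spheres *)

Section ScalingSpheres.
Context (R : realType) (n : nat).
Notation mu := (leb R n).
Notation nu := (n%:R / 2 : R).
Implicit Types (x y z c : 'rV[R]_n) (t r L A : R).
Context (n0 : (0 < n)%N).
Context (s0 s1 : R) (s00 : 0 < s0) (s0n : s0 < nu) (s10 : 0 < s1) (s1n : s1 < nu).
Notation e0 := (nu - s0).
Notation e1 := (nu - s1).
Context (a b p q : R) (a0 : 0 <= a) (b0 : 0 <= b) (p0 : 0 < p) (q0 : 0 < q).
Notation sp := (nu + s0 + a - e1 * p).
Notation sr := (nu + s1 + b - e0 * q).
Hypothesis sp0 : 0 <= sp.
Hypothesis sr0 : 0 <= sr.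
Hypothesis sps : 0 < sp \/ 0 < sr.
Context (u v : 'rV[R]_n -> R) (c1 c2 : R) (c10 : 0 < c1) (c20 : 0 < c2).
Hypothesis cu : continuous u.
Hypothesis cv : continuous v.
Hypothesis u0 : forall x, 0 <= u x.
Hypothesis v0 : forall x, 0 <= v x.
Notation f := (fun y => sq y `^ (a / 2) * v y `^ p).
Notation g := (fun y => sq y `^ (b / 2) * u y `^ q).
Hypothesis Lf : forall c, L1 mu (fun x => f x * riesz s0 (x - c)).
Hypothesis uE : forall c, u c = c1 * \int[mu]_x (f x * riesz s0 (x - c)).
Hypothesis Lg : forall c, L1 mu (fun x => g x * riesz s1 (x - c)).
Hypothesis vE : forall c, v c = c2 * \int[mu]_x (g x * riesz s1 (x - c)).
Context (cl : R) (cl0 : 0 < cl).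
Hypothesis hu : forall z, cl * (1 + sq z) `^ (- e0) <= u z.
Hypothesis hv : forall z, cl * (1 + sq z) `^ (- e1) <= v z.

Let mu' : mfunT u. by mfun. Qed.
Let mv' : mfunT v. by mfun. Qed.

Definition sphere_le L := forall x, 0 < sq x -> sq x < L -> u x <= kel e0 L u x /\ v x <= kel e1 L v x.

Lemma ball_bound L : exists2 V : R, 0 <= V & forall x, sq x <= L -> u x <= V /\ v x <= V.
Proof.
have [A A0 hA] := continuous_bounded_sq L cu; have [B B0 hB] := continuous_bounded_sq L cv.
exists (A + B) => [|x xL]; first exact: addr_ge0.
have h1 := le_trans (ler_norm _) (hA x xL); have h2 := le_trans (ler_norm _) (hB x xL).
by split; lra.
Qed.

(** The deficits of both functions start from the trivial bound V and are halved in each round by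
    [narrow], applied to the two equations simultaneously; in the limit no deficit is left. *)
Lemma narrow_spheres Lmax : 0 < Lmax -> exists2 d : R, 0 < d & forall L r, 0 < L -> L <= Lmax ->
  0 <= r -> r < L -> L `^ nu - r `^ nu <= d ->
  (forall x, 0 < sq x -> sq x < r -> u x <= kel e0 L u x /\ v x <= kel e1 L v x) -> sphere_le L.
Proof.
move=> Lm0; have [V V0 hV] := ball_bound Lmax.
have [K1 K10 hK1] := narrow n0 s0n s1n a0 p0 c10 sp0 v0 mv' Lf uE cl0 hv Lm0 (fun z h => (hV z h).2).
have [K2 K20 hK2] := narrow n0 s1n s0n b0 q0 c20 sr0 u0 mu' Lg vE cl0 hu Lm0 (fun z h => (hV z h).1).
(* The kernel mass at which either estimate at most halves the deficit, whichever of [K1] and [K2]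
   is larger. *)
have E0 : 0 < (2 * (K1 + K2 + 1))^-1 by rewrite invr_gt0 mulr_gt0// ltr_wpDl// addr_ge0.
have [d1 d10 h1] := ann_small n0 s00 s0n E0.
have [d2 d20 h2] := ann_small n0 s10 s1n E0.
exists (Num.min d1 d2); first by rewrite lt_min d10.
move=> L r L0 LL r0 rL; rewrite le_min => /andP[dd1 dd2] hr.
have small K (I A : R) : 0 <= K -> K <= K1 + K2 -> 0 <= A -> I <= (2 * (K1 + K2 + 1))^-1 -> K * A * I <= A / 2.
  move=> KK KL A0 hI; apply: (@le_trans _ _ (K * A * (2 * (K1 + K2 + 1))^-1)).
    by rewrite ler_wpM2l// mulr_ge0.
  have P0 : 0 < K1 + K2 + 1 by rewrite ltr_wpDl// addr_ge0.
  rewrite ler_pdivrMr ?mulr_gt0// (_ : A / 2 * _ = (K1 + K2 + 1) * A); last by field.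
  by rewrite ler_wpM2r// (le_trans KL)// lerDl.
have key m : forall x, 0 < sq x -> sq x < L -> u x - V / 2 ^+ m <= kel e0 L u x /\ v x - V / 2 ^+ m <= kel e1 L v x.
  elim: m => [|m IH] x x0 xL.
    have [hu1 hv1] := hV x (le_trans (ltW xL) LL).
    by rewrite expr0 divr1; split; apply: (@le_trans _ _ 0); rewrite ?subr_le0// mulr_ge0 ?powR_ge0.
  have A0 : 0 <= V / 2 ^+ m by rewrite divr_ge0 ?exprn_ge0.
  have [La Ia] := h1 r L x r0 rL dd1; have [Lb Ib] := h2 r L x r0 rL dd2.
  have n1 : u x - K1 * (V / 2 ^+ m) * \int[mu]_y (ann r L y * riesz s0 (y - x)) <= kel e0 L u x.
    by apply: hK1 => // y y0 yr; [have [] := IH y y0 yr|have [] := hr y y0 yr].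
  have n2 : v x - K2 * (V / 2 ^+ m) * \int[mu]_y (ann r L y * riesz s1 (y - x)) <= kel e1 L v x.
    by apply: hK2 => // y y0 yr; [have [] := IH y y0 yr|have [] := hr y y0 yr].
  have e2 : V / 2 ^+ m.+1 = V / 2 ^+ m / 2 by rewrite exprSr invfM mulrA.
  have k1 : K1 <= K1 + K2 by rewrite lerDl.
  have k2 : K2 <= K1 + K2 by rewrite lerDr.
  split; [apply: le_trans n1|apply: le_trans n2]; rewrite lerD2l lerN2 e2.
    exact: (small _ _ _ K10 k1 A0 Ia).
  exact: (small _ _ _ K20 k2 A0 Ib).
move=> x x0 xL.
have fin (A B : R) : (forall m, A - V / 2 ^+ m <= B) -> A <= B.
  move=> h; apply/ler_addgt0Pr => eps eps0.
  have [N _ hN] := cvg_mulS (R := R) (V / eps) ltr01; have {}hN := hN N (leqnn N).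
  have hV2 : V / 2 ^+ N <= eps.
    rewrite ler_pdivrMr ?exprn_gt0// mulrC -ler_pdivrMr//; apply: (le_trans hN).
    by rewrite mul1r -natrX ler_nat ltn_expl.
  by have := h N; lra.
by split; apply: fin => m; have [] := key m x x0 xL.
Qed.

Lemma powR_continuous_at t : 0 < t -> forall eps : R, 0 < eps -> exists2 d : R, 0 < d &
  forall t', `|t - t'| < d -> `|t `^ nu - t' `^ nu| <= eps.
Proof.
move=> t0 eps eps0.
by have /cvgrPdist_le/(_ eps eps0) := @powR_cts R nu t t0; move=> [d /= d0 hd]; exists d.
Qed.

(** For small L the whole ball is a narrow region, with r = 0. *)
Lemma sphere_start : exists2 L1 : R, 0 < L1 & forall L, 0 < L -> L < L1 -> sphere_le L.
Proof.
have nu0 := nu_gt0 R n0; have [d d0 hd] := narrow_spheres ltr01.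
exists (Num.min 1 (d `^ nu^-1)); first by rewrite lt_min ltr01 powR_gt0.
move=> L L0; rewrite lt_min => /andP[LL Ld].
apply: (hd L 0) => //; first exact: ltW.
  rewrite powR0 ?gt_eqF// subr0.
  have -> : d = (d `^ nu^-1) `^ nu by rewrite -powRrM mulVf ?gt_eqF// powRr1// ltW.
  by apply: ler_powR_base; rewrite ?(ltW nu0) ?(ltW L0)// ltW.
by move=> x x0 xr; have := lt_trans x0 xr; rewrite ltxx.
Qed.

(** The gap on |x|^2 < r survives a small increase of the radius, and the shell from r to L is left
    to [narrow_spheres]. If only one of the two exponents is positive, the gap it produces for one
    function supplies the strictness in the equation of the other. *)
Lemma sphere_extend L0 : 0 < L0 -> sphere_le L0 -> exists2 d : R, 0 < d &
  forall L, L0 < L -> L < L0 + d -> sphere_le L.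
Proof.
move=> L00 hP; have nu0 := nu_gt0 R n0.
have Lm : 0 < L0 + 1 by rewrite addr_gt0.
have [d d0 hd] := narrow_spheres Lm.
have d20 : 0 < d / 2 by rewrite divr_gt0.
have [dl dl0 hl'] := powR_continuous_at L00 d20.
(* Close enough to L0 for a thin shell, and at least L0/2, the region where a gap for one function
   is needed to obtain one for the other. *)
pose r := Num.max (L0 / 2) (L0 - dl / 2).
have L20 : 0 < L0 / 2 by rewrite divr_gt0.
have r2 : L0 / 2 <= r by rewrite le_max lexx.
have rL : r < L0 by rewrite gt_max; apply/andP; split; lra.
have rd : L0 - dl / 2 <= r by rewrite le_max lexx orbT.
have [V V0 hV] := ball_bound L0.
have hu' y : 0 < sq y -> sq y < L0 -> u y <= kel e0 L0 u y by move=> y0 yL; have [] := hP y y0 yL.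
have hv' y : 0 < sq y -> sq y < L0 -> v y <= kel e1 L0 v y by move=> y0 yL; have [] := hP y y0 yL.
have su := strict n0 s0n s1n a0 p0 c10 sp0 v0 mv' Lf uE cl0 hv L00 rL (fun z h => (hV z h).2) hv'.
have sv := strict n0 s1n s0n b0 q0 c20 sr0 u0 mu' Lg vE cl0 hu L00 rL (fun z h => (hV z h).1) hu'.
have [[eu eu0 heu] [ev ev0 hev]] :
   (exists2 eps : R, 0 < eps & forall x, 0 < sq x -> sq x < r -> u x + eps <= kel e0 L0 u x) /\
   (exists2 eps : R, 0 < eps & forall x, 0 < sq x -> sq x < r -> v x + eps <= kel e1 L0 v x).
  case: sps => h.
    have [eu eu0 heu] := su (or_introl h); split; first by exists eu.
    by apply: sv; right; exists eu => // y y0 yL; apply: heu => //; exact: lt_le_trans r2.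
  have [ev ev0 hev] := sv (or_introl h); split; last by exists ev.
  by apply: su; right; exists ev => // y y0 yL; apply: hev => //; exact: lt_le_trans r2.
have [du du0 hdu] := kel_transfer cu L00 eu0 heu.
have [dv dv0 hdv] := kel_transfer cv L00 ev0 hev.
exists (Num.min (Num.min du dv) (Num.min dl 1)); first by rewrite !lt_min du0 dv0 dl0 ltr01.
move=> L L0L; rewrite -ltrBlDl !lt_min => /andP[/andP[Ldu Ldv] /andP[Ldl Ld1]].
have L_0 : 0 < L by exact: lt_trans L0L.
apply: (hd L r) => //.
- by lra.
- exact: le_trans (ltW L20) r2.
- exact: lt_trans L0L.
- have a1 : `|L0 `^ nu - L `^ nu| <= d / 2 by apply: hl'; rewrite distrC gtr0_norm ?subr_gt0.
  have a2 : `|L0 `^ nu - r `^ nu| <= d / 2 by apply: hl'; rewrite gtr0_norm ?subr_gt0//; lra.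
  have := le_trans (ler_norm _) a2; rewrite distrC in a1; have := le_trans (ler_norm _) a1.
  by lra.
by move=> x x0 xr; split; [apply: hdu|apply: hdv] => //; lra.
Qed.

(** Continuity method: otherwise the radii up to which the comparison holds have a finite supremum,
    which is attained since [kel] is continuous in L, and [sphere_extend] goes beyond it. *)
Lemma sphere_all L : 0 < L -> sphere_le L.
Proof.
move=> L_0; apply: contrapT => nP.
pose A : set R := [set M | 0 < M /\ forall L', 0 < L' -> L' <= M -> sphere_le L'].
have [L1' L10 h1] := sphere_start.
have A1 : A (L1' / 2).
  split; first by rewrite divr_gt0.
  by move=> L' L'0 hL'; apply: h1 => //; lra.
have hub : has_ubound A.
  exists L => M [M0 hM]; rewrite leNgt; apply/negP => LM; apply: nP; apply: hM => //; exact: ltW.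
have hs : has_sup A by split => //; exists (L1' / 2).
set S := sup A.
have S0 : 0 < S by apply: lt_le_trans (ub_le_sup hub A1); rewrite divr_gt0.
have below L' : 0 < L' -> L' < S -> sphere_le L'.
  move=> L'0 L'S; have e0' : 0 < S - L' by rewrite subr_gt0.
  have [M [M0 hM]] := sup_adherent e0' hs; rewrite -/S opprB addrC subrK => LM.
  by apply: hM => //; exact: ltW.
have PS : sphere_le S.
  move=> x x0 xS; split.
    have c := cvg_at_left_filter (kel_cvg (e := e0) cu S0 x0).
    apply: (@cvgr_to_ge _ _ _ _ _ _ _ c); near=> L'.
    have L'S : L' < S by near: L'; exact: nbhs_left_lt.
    have xL' : sq x < L' by near: L'; exact: nbhs_left_gt.
    by have [] := below L' (lt_trans x0 xL') L'S x x0 xL'.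
  have c := cvg_at_left_filter (kel_cvg (e := e1) cv S0 x0).
  apply: (@cvgr_to_ge _ _ _ _ _ _ _ c); near=> L'.
  have L'S : L' < S by near: L'; exact: nbhs_left_lt.
  have xL' : sq x < L' by near: L'; exact: nbhs_left_gt.
  by have [] := below L' (lt_trans x0 xL') L'S x x0 xL'.
have [d d0 hd] := sphere_extend S0 PS.
have AS : A (S + d / 2).
  split; first by rewrite addr_gt0// divr_gt0.
  move=> L' L'0 hL'; case: (ltgtP L' S) => h; [exact: below| |by rewrite h].
  by apply: hd => //; lra.
by have := ub_le_sup hub AS; rewrite -/S; lra.
Unshelve. all: by end_near. Qed.

(** The sphere of squared radius |z| reflects z/|z| to z, so u(z) >= |z|^(-e0) u(z/|z|). The
    exponent e0 = n/2 - s0 is half the decay n - 2 s0 of the Riesz kernel, and this is the gain over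
    the trivial bound. *)
Lemma sphere_lower z : 1 <= sq z ->
  cl * 2 `^ (- e0) * sq z `^ (- (e0 / 2)) <= u z /\ cl * 2 `^ (- e1) * sq z `^ (- (e1 / 2)) <= v z.
Proof.
move=> z1; have zz : 0 < sq z by exact: lt_le_trans z1.
pose L := Num.sqrt (sq z); have L0 : 0 < L by rewrite sqrtr_gt0.
have L2 : L ^+ 2 = sq z by rewrite sqr_sqrtr// ltW.
pose x := L^-1 *: z; have x1 : sq x = 1 by rewrite sqZ exprVn L2 mulVf// gt_eqF.
have kx : kinv L x = z by rewrite /kinv x1 divr1 /x scalerA mulfV ?scale1r// gt_eqF.
have low e (w : 'rV[R]_n -> R) : (forall y, cl * (1 + sq y) `^ (- e) <= w y) -> w x <= kel e L w x ->
    cl * 2 `^ (- e) * sq z `^ (- (e / 2)) <= w z.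
  move=> hw; rewrite /kel kx x1 divr1 => h.
  have := le_trans (hw x) h; rewrite x1 (_ : 1 + 1 = 2); last by ring.
  move=> h2; have -> : sq z `^ (- (e / 2)) = L `^ (- e).
    by rewrite -L2 -powR_mulrn ?(ltW L0)// -powRrM; congr (_ `^ _); field.
  rewrite mulrC; have pL : 0 < L `^ e by rewrite powR_gt0.
  by rewrite [L `^ _]powRN ler_pdivrMl.
(* For |z| = 1 the point lies on the sphere, where [sphere_le] says nothing; the bounds [hu] and
   [hv] give the claim directly. *)
have [zl|zl] := ltP 1 L.
  have [hx1 hx2] := sphere_all L0 (x := x) ltac:(by rewrite x1) ltac:(by rewrite x1).
  by split; apply: low.
have Le : L = 1.
  apply/eqP; rewrite eq_le zl /= -(@ler_pXn2r _ 2)// ?nnegrE ?(ltW L0)// L2 expr1n//.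
have s1' : sq z = 1 by rewrite -L2 Le expr1n.
have hz1 := hu z; have hz2 := hv z; rewrite s1' !powR1 !mulr1 in hz1 hz2 *.
by rewrite (_ : 1 + 1 = 2) in hz1 hz2; last by ring.
Qed.

End ScalingSpheres.

(** * Improving lower bounds until the potentials diverge *)

Section Bootstrap.
Context (R : realType) (n : nat).
Notation mu := (leb R n).
Notation nu := (n%:R / 2 : R).
Implicit Types (x y z c : 'rV[R]_n) (t r : R).
Context (n0 : (0 < n)%N).

Section OneSide.
Context (s1 : R) (s10 : 0 < s1) (s1n : s1 < nu).
Notation e1 := (nu - s1).
Context (c2 : R) (c20 : 0 < c2) (g v : 'rV[R]_n -> R).
Hypothesis g0 : forall x, 0 <= g x.
Hypothesis Lg : forall c, L1 mu (fun x => g x * riesz s1 (x - c)).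
Hypothesis vE : forall c, c2 * \int[mu]_x (g x * riesz s1 (x - c)) <= v c.

Lemma ker_lower D z : 0 < sq z -> sq z <= D -> D `^ (- e1) <= riesz s1 z.
Proof.
move=> z0 zD; rewrite /riesz !powRN lef_pV2 ?posrE ?powR_gt0 ?(lt_le_trans z0)//.
by apply: ler_powR_base; rewrite ?subr_ge0 ?(ltW s1n) ?(ltW z0).
Qed.

Lemma potential_lower c m (h : 'rV[R]_n -> R) : L1 mu h ->
  (forall y, y != c -> h y * m <= g y * riesz s1 (y - c)) -> c2 * (m * \int[mu]_y h y) <= v c.
Proof.
move=> Lh hle; apply: le_trans (vE c); rewrite ler_wpM2l ?(ltW c20)// -(RIZ _ Lh).
by apply: (RI_le_off n0 (x := c) (L1Z _ Lh) (Lg c)) => y yc; rewrite mulrC hle.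
Qed.

(** A source positive near one point makes its potential at least a multiple of the kernel. This
    lower bound starts the argument and also keeps u and v away from 0 on bounded sets, as
    [powR_lip] needs. *)
Lemma potential_positive y0 : continuous g -> 0 < g y0 ->
  exists2 cl : R, 0 < cl & forall z, cl * (1 + sq z) `^ (- e1) <= v z.
Proof.
move=> cg gy0.
have /cvgrPdist_le/(_ (g y0 / 2) ltac:(by rewrite divr_gt0))/nbhs_rowP := @cg y0; move=> [de' d0' hd'].
pose de := de' ^+ 2; have de0 : 0 < de by rewrite exprn_gt0.
have hd y : sq (y - y0) < de -> g y0 / 2 <= g y.
  move=> yd; have : `|g y0 - g y| <= g y0 / 2.
    apply: hd' => i; rewrite -(ltr_pXn2r (n := 2)) ?nnegrE ?(ltW d0')//.
    apply: le_lt_trans yd; rewrite real_normK ?num_real// -sqrrN opprB.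
    by have := coord_le_sq (y - y0) i; rewrite !mxE.
  by move=> h1; have := le_trans (ler_norm _) h1; lra.
pose C := 2 + 4 * de + 4 * sq y0; have y00 := sq_ge0 y0.
have C0 : 0 < C by rewrite /C; lra.
have v0 := vol1_gt0 R n.
exists (c2 * (g y0 / 2 * C `^ (- e1) * (de `^ nu * vol1 R n))).
  by apply: mulr_gt0 => //; rewrite !mulr_gt0 ?powR_gt0 ?divr_gt0.
move=> z; have Lb := L1_shift (- y0) (@L1_inB R n de).
have := @potential_lower z (g y0 / 2 * (C * (1 + sq z)) `^ (- e1)) _ Lb.
rewrite (RI_shift (- y0) (@measurable_inB R n de)) vol_ball// => h.
apply: le_trans (h _).
  rewrite powRM ?(ltW C0) ?(ltW (sq1_gt0 z))// -mulrA ler_wpM2l ?(ltW c20)//.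
  by rewrite le_eqVlt; apply/orP; left; apply/eqP; ring.
move=> y yz; have yz0 : 0 < sq (y - z) by rewrite sq_gt0 subr_eq0.
have [yd|yd] := ltP (sq (y - y0)) de; last by rewrite inB0// mul0r mulr_ge0// ker_ge0.
rewrite inB1// mul1r; apply: ler_pM; rewrite ?powR_ge0 ?divr_ge0 ?hd ?(ltW gy0)//.
apply: ker_lower => //.
have h1 := sqD_le2 y (- z); rewrite sqN in h1.
have h2 := sqD_le2 (y - y0) y0; rewrite subrK in h2.
have z0 := sq_ge0 z; have Cz : 0 <= (4 * de + 4 * sq y0) * sq z by rewrite mulr_ge0// addr_ge0// ?mulr_ge0// ltW.
by rewrite /C; lra.
Qed.

Context (b q : R) (b0 : 0 <= b) (q0 : 0 < q) (u : 'rV[R]_n -> R).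
Hypothesis gE : forall x, g x = sq x `^ (b / 2) * u x `^ q.

(** Only the shell r <= |y|^2 < 4 r is kept. There |y - x|^2 <= 2 |y|^2 + 2 |x|^2 <= 10 r, which
    bounds the kernel below by (10 r)^(-e1). *)
Lemma annulus_lower : exists2 C : R, 0 < C & forall x r m, 0 < r -> sq x <= r -> 0 <= m ->
  (forall y, r <= sq y -> sq y < 4 * r -> m <= u y) -> C * r `^ (s1 + b / 2) * m `^ q <= v x.
Proof.
have nu0 := nu_gt0 R n0; have v0 := vol1_gt0 R n.
have p4 : 0 < 4 `^ nu - 1 :> R.
  rewrite subr_gt0; have p1 : 1 `^ nu = 1 :> R by rewrite powR1.
  by rewrite -[ltLHS]p1; apply: gt0_ltr_powR; rewrite ?nnegrE ?ler01 ?ler0n ?ltr1n.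
exists (c2 * (10 `^ (- e1) * ((4 `^ nu - 1) * vol1 R n))).
  by apply: mulr_gt0 => //; rewrite !mulr_gt0 ?powR_gt0.
move=> x r m r0 xr m0 hm; have r4 : r < 4 * r by lra.
have := @potential_lower x (r `^ (b / 2) * m `^ q * (10 * r) `^ (- e1)) _ (@L1_ann R n r (4 * r)).
rewrite vol_ann ?(ltW r0)// => h; apply: le_trans (h _).
  rewrite !powRM ?(ltW r0)// -!mulrA ler_wpM2l ?(ltW c20)//.
  rewrite (_ : s1 + b / 2 = nu + (b / 2 + - e1)); last by ring.
  rewrite !powRDp// le_eqVlt; apply/orP; left; apply/eqP.
  by move: (_ `^ nu) (4 `^ nu) (_ `^ (b / 2)) (_ `^ (- e1)) (_ `^ (- e1)) (_ `^ q) (vol1 _ _) => *; ring.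
move=> y yx; have yx0 : 0 < sq (y - x) by rewrite sq_gt0 subr_eq0.
have [yr|yr] := ltP (sq y) r.
  by rewrite ann0 ?(ltW r4)//; [rewrite mul0r mulr_ge0// ker_ge0|left].
have [y4|y4] := ltP (sq y) (4 * r); last first.
  by rewrite ann0 ?(ltW r4)//; [rewrite mul0r mulr_ge0// ker_ge0|right].
rewrite ann1// mul1r gE; apply: ler_pM; rewrite ?mulr_ge0 ?powR_ge0//.
  apply: ler_pM; rewrite ?powR_ge0//; apply: ler_powR_base; rewrite ?divr_ge0 ?(ltW q0) ?(ltW r0)//.
  exact: hm.
apply: ker_lower => //; have h1 := sqD_le2 y (- x); rewrite sqN in h1; lra.
Qed.

(** The shell of [annulus_lower] with r = |x|^2. The minimum [w] handles both signs of [mm]: over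
    that shell |y|^(-2 mm) is at least [w] times |x|^(-2 mm). *)
Lemma lower_step (mm : R) : (exists2 k : R, 0 < k & forall x, 1 <= sq x -> k * sq x `^ (- mm) <= u x) ->
  exists2 k : R, 0 < k & forall x, 1 <= sq x -> k * sq x `^ (- (q * mm - b / 2 - s1)) <= v x.
Proof.
move=> [k k0 hk]; have [C C0 hC] := annulus_lower.
pose w : R := Num.min 1 (4 `^ (- mm)); have w0 : 0 < w by rewrite lt_min ltr01 powR_gt0.
exists (C * (k * w) `^ q).
  by apply: mulr_gt0 => //; apply: powR_gt0; exact: mulr_gt0.
move=> x x1; have x0 : 0 < sq x by exact: lt_le_trans x1.
have kw : 0 <= k * w by rewrite mulr_ge0// ltW.
have := hC x (sq x) (k * w * sq x `^ (- mm)) x0 (lexx _) _ _.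
rewrite powRM ?powR_ge0// -powRrM => h; apply: le_trans (h _ _).
- rewrite (_ : - (q * mm - b / 2 - s1) = (s1 + b / 2) + - mm * q); last by ring.
  rewrite powRDp// le_eqVlt; apply/orP; left; apply/eqP; ring.
- by rewrite mulr_ge0 ?powR_ge0.
move=> y xy y4; have y0 : 0 < sq y by exact: lt_le_trans xy.
apply: le_trans (hk y (le_trans x1 xy)); rewrite -mulrA ler_wpM2l ?(ltW k0)//.
have [m0|m0] := leP 0 mm.
  apply: (@le_trans _ _ (4 `^ (- mm) * sq x `^ (- mm))).
    by rewrite ler_wpM2r ?powR_ge0// ge_min lexx orbT.
  rewrite -powRM ?(ltW x0)// !powRN lef_pV2 ?posrE ?powR_gt0 ?mulr_gt0//.
  by apply: ler_powR_base; rewrite ?(ltW y0)// ltW.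
apply: (@le_trans _ _ (sq x `^ (- mm))); first by rewrite ler_piMl ?powR_ge0// ge_min lexx.
by apply: ler_powR_base; rewrite ?oppr_ge0 ?(ltW m0) ?(ltW x0).
Qed.

(** Otherwise v(0) would exceed a multiple of r^(s1 + b/2) for every large r. This serves twice: it
    excludes the constant in the Riesz representation, and it ends the improvement of exponents. *)
Lemma lower_unbounded k : 0 < k -> (forall x, 1 <= sq x -> k <= u x) -> False.
Proof.
move=> k0 hk; have [C C0 hC] := annulus_lower.
have s0 : 0 < s1 + b / 2 by rewrite ltr_wpDr// divr_ge0.
pose B := C * k `^ q; have B0 : 0 < B by rewrite mulr_gt0 ?powR_gt0.
pose V := `|v 0| + 1; have V0 : 0 < V by rewrite ltr_wpDl.
pose r : R := Num.max 1 ((V / B) `^ (s1 + b / 2)^-1).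
have r1 : 1 <= r by rewrite le_max lexx.
have r0 : 0 < r by exact: lt_le_trans r1.
have := hC 0 r k r0 _ (ltW k0) (fun y ry _ => hk y (le_trans r1 ry)).
rewrite sq0 (ltW r0) => /(_ isT) h.
have h2 : V / B <= r `^ (s1 + b / 2).
  have -> : V / B = ((V / B) `^ (s1 + b / 2)^-1) `^ (s1 + b / 2).
    by rewrite -powRrM mulVf ?gt_eqF// powRr1// divr_ge0 ?(ltW V0) ?(ltW B0).
  by apply: ler_powR_base; rewrite ?powR_ge0 ?(ltW s0)// le_max lexx orbT.
have h3 : V <= C * r `^ (s1 + b / 2) * k `^ q by rewrite mulrAC -/B mulrC -ler_pdivrMr.
have := le_trans h3 (le_trans h (ler_norm _)); rewrite /V; lra.
Qed.

End OneSide.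

(** Two lower steps send the exponent m to T m, which is affine in m. So on ]0, mu0] the change T m
    - m is at most the larger of its values at the ends, which are -ka at 0 and -d at mu0 = (n/2 -
    s0)/2. Subcriticality makes d positive, and finitely many rounds lower the exponent to 0 or
    below. *)
Lemma no_decay (s0 s1 a b p q c1 c2 : R) (u v : 'rV[R]_n -> R) (f := fun y => sq y `^ (a / 2) * v y `^ p)
   (g := fun y => sq y `^ (b / 2) * u y `^ q) :
  0 < s0 -> s0 < nu -> 0 < s1 -> s1 < nu -> 0 <= a -> 0 <= b -> 0 < p -> 0 < q -> 0 < c1 -> 0 < c2 ->
  0 <= nu + s0 + a - (nu - s1) * p -> 0 <= nu + s1 + b - (nu - s0) * q ->
  0 < nu + s0 + a - (nu - s1) * p \/ 0 < nu + s1 + b - (nu - s0) * q ->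
  (forall c, L1 mu (fun x => f x * riesz s0 (x - c))) ->
  (forall c, c1 * \int[mu]_x (f x * riesz s0 (x - c)) <= u c) ->
  (forall c, L1 mu (fun x => g x * riesz s1 (x - c))) ->
  (forall c, c2 * \int[mu]_x (g x * riesz s1 (x - c)) <= v c) ->
  (exists2 k : R, 0 < k & forall x, 1 <= sq x -> k * sq x `^ (- ((nu - s0) / 2)) <= u x) -> False.
Proof.
move=> s00 s0n s10 s1n a0 b0 p0 q0 c10 c20 sp0 sr0 sps Lf uE Lg vE hstart.
have f0 x : 0 <= f x by rewrite mulr_ge0 ?powR_ge0.
have g0 x : 0 <= g x by rewrite mulr_ge0 ?powR_ge0.
pose Q m := exists2 k : R, 0 < k & forall x, 1 <= sq x -> k * sq x `^ (- m) <= u x.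
pose T m := p * (q * m - b / 2 - s1) - a / 2 - s0.
have QT m : Q m -> Q (T m).
  move=> /(lower_step s1n c20 g0 Lg vE b0 q0 (fun x => erefl))/(lower_step s0n c10 f0 Lf uE a0 p0 (fun x => erefl)).
  by [].
have Q0 m : m <= 0 -> Q m -> False.
  move=> m0 [k k0 hk]; apply: (lower_unbounded s10 s1n c20 g0 Lg vE b0 q0 (fun x => erefl) (k := k)) => // x x1.
  apply: le_trans (hk x x1); rewrite ler_peMr ?(ltW k0)//.
  rewrite -[leLHS](powRr0 (sq x)); apply: ler_powR => //; by rewrite oppr_ge0.
pose mu0 := (nu - s0) / 2.
pose ka := p * (b / 2 + s1) + a / 2 + s0.
have ka0 : 0 < ka by rewrite ltr_wpDl// addr_ge0 ?divr_ge0// mulr_ge0 ?(ltW p0)// addr_ge0 ?divr_ge0// ltW.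
pose sp := nu + s0 + a - (nu - s1) * p; pose sr := nu + s1 + b - (nu - s0) * q.
pose d := sp / 2 + p * sr / 2.
have d0 : 0 < d.
  have P0 : 0 <= p * sr / 2 by rewrite divr_ge0 ?mulr_ge0 ?(ltW p0).
  have S0 : 0 <= sp / 2 by rewrite divr_ge0.
  case: sps => h; first by rewrite ltr_wpDr// divr_gt0.
  by rewrite ltr_wpDl// divr_gt0// mulr_gt0.
pose de := Num.min ka d; have de0 : 0 < de by rewrite lt_min ka0.
have dka : de <= ka by rewrite ge_min lexx.
have dd : de <= d by rewrite ge_min lexx orbT.
have Tle m : 0 < m -> m <= mu0 -> T m <= m - de.
  move=> m0 mm; have E : T m = m + ((p * q - 1) * m - ka) by rewrite /T /ka; ring.
  have E0 : (p * q - 1) * mu0 - ka = - d by rewrite /ka /d /sp /sr /mu0; field.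
  rewrite E lerD2l; have [pq|pq] := leP (p * q) 1.
    have : (p * q - 1) * m <= 0 by rewrite mulr_le0_ge0 ?subr_le0// ltW.
    lra.
  have : (p * q - 1) * m <= (p * q - 1) * mu0 by rewrite ler_wpM2l// subr_ge0 ltW.
  lra.
have key j : exists m, [/\ m <= mu0, Q m & m <= 0 \/ m <= mu0 - j%:R * de].
  elim: j => [|j [m [m1 Qm hm]]]; first by exists mu0; split => //; right; rewrite mul0r subr0.
  have [m0|m0] := leP m 0; first by exists m; split => //; left.
  have h := Tle m m0 m1; exists (T m); split; [|exact: QT|].
    by apply: le_trans h _; apply: le_trans m1; rewrite gerBl ltW.
  right; case: hm => hm; first by move: m0; rewrite ltNge hm.
  apply: (le_trans h); rewrite -natr1 mulrDl mul1r opprD addrA lerD2r; exact: hm.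
have [N _ hN] := cvg_mulS (R := R) mu0 de0; have {}hN := hN N (leqnn N).
have [m [_ Qm hm]] := key N.+1; apply: (Q0 m) => //.
by case: hm => // hm; apply: (le_trans hm); rewrite subr_le0 mulrC.
Qed.

End Bootstrap.

(** * From the definition of a solution to the theorem *)

Section Assembly.
Context (R : realType) (n : nat).
Notation mu := (leb R n).
Notation nu := (n%:R / 2 : R).
Implicit Types (u v : 'rV[R]_n -> R).
Context (n0 : (0 < n)%N).

(** The Hoelder excess eps becomes d = eps/2, exponents being those of |z|^2. As alpha < 2 its
    integer part is 0 or 1, and the Hoelder exponent being below 1 gives alpha/2 + d <= 1. *)
Lemma admissible_regular (al : R) (k : nat) u : 0 < al < Num.min 2 n%:R -> admissible k al u ->
  exists d : R, [/\ 0 < d, d < nu, al / 2 + d <= 1, continuous u &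
    L1 mu (fun y => u y * om (nu + al / 2) y) /\ Reg (al / 2 + d) (2 * k) u].
Proof.
rewrite lt_min => /and3P[a0 a2 an] [[eps [e0 e1 hC]] hL].
have /andP[t0 t1] := @truncn_itv R al (ltW a0).
set t := Num.truncn al in e1 hC t0 t1.
have t2 : (t <= 1)%N by rewrite -ltnS -(ltr_nat R); apply: le_lt_trans a2.
have n1 : 1 <= n%:R :> R by rewrite ler1n.
have tR : t%:R <= 1 :> R by rewrite -[leRHS]/(1%:R) ler_nat.
have gam : 0 <= al - t%:R + eps <= 1 by apply/andP; split; lra.
have hR := CkHolder_Reg gam t2 hC.
have E : (t%:R + (al - t%:R + eps)) / 2 = al / 2 + eps / 2 by field.
rewrite E in hR; have cu := Reg_cont hR.
exists (eps / 2); split => //.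
- by rewrite divr_gt0.
- rewrite ltr_pM2r ?invr_gt0//; apply: lt_le_trans n1.
  case: (posnP t) => [tz|tp]; first by move: e1; rewrite tz; lra.
  have : 1 <= t%:R :> R by rewrite ler1n.
  by lra.
- by lra.
split => //; apply: in_L_om (ltW a0) _ hL; exact: continuous_measurable_row cu.
Qed.

Lemma poly_frac_zero (m : nat) (al : R) : @poly_frac_laplacian R n m al (fun=> 0) = fun=> 0.
Proof.
have h0 : frac_laplacian al (fun _ : 'rV[R]_n => 0) = fun=> 0.
  apply/funext => x; rewrite /frac_laplacian.
  have -> : (fun e : R => Rn_integral [set y : 'rV[R]_n | e <= enorm (y - x)]
      (fun y => (0 - 0) / enorm (x - y) `^ (n%:R + al))) = fun=> 0.
    apply/funext => e; rewrite /Rn_integral; under eq_Rintegral do rewrite subr0 mul0r.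
    by rewrite /Rintegral integral0.
  by rewrite lim_cst ?mulr0.
rewrite /poly_frac_laplacian h0; elim: m => // m IH.
rewrite iterS IH; apply/funext => x; rewrite /neg_laplacian /laplacian big1 ?oppr0// => i _.
have p0 : partial i (fun _ : 'rV[R]_n => 0 : R) = fun=> 0 by apply/funext => y; rewrite /partial derive_cst.
by rewrite !p0.
Qed.

(** Off the origin the weight |x|^a is positive, so v vanishes there; at the origin it vanishes by
    continuity, a positive dimension providing nearby points. *)
Lemma source_eq0 (a p : R) v : 0 <= p -> continuous v -> (forall x, 0 <= v x) ->
  (forall x, enorm x `^ a * v x `^ p = 0) -> v = fun=> 0.
Proof.
move=> p0 cv v0 h.
have vz x : x != 0 -> v x = 0.
  move=> x0; have := h x; have e0 : 0 < enorm x `^ a.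
    by rewrite powR_gt0// enormE sqrtr_gt0 sq_gt0.
  move=> /eqP; rewrite mulf_eq0 (gt_eqF e0) /= => /eqP vp.
  by apply/eqP/negPn/negP => vx; move: vp; apply/eqP; rewrite gt_eqF// powR_gt0// lt0r vx v0.
apply/funext => x; have [->|x0] := eqVneq x 0; last exact: vz.
apply/eqP/negPn/negP => v00; have vp : 0 < v 0 by rewrite lt0r v00 v0.
have /cvgrPdist_lt/(_ (v 0) vp)/nbhs_rowP := @cv 0; move=> [e e0 he].
pose y : 'rV[R]_n := (e / 2) *: ei R (Ordinal n0).
have e20 : 0 < e / 2 by rewrite divr_gt0.
have yn : y != 0 by rewrite -sq_gt0 sqZ sq_ei mulr1 exprn_gt0.
have := he y; rewrite (vz y yn) subr0 gtr0_norm// ltxx => hh; apply: (notF (hh _)) => i.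
rewrite mxE sub0r normrN -(ltr_pXn2r (n := 2)) ?nnegrE ?(ltW e0)//.
rewrite real_normK ?num_real//; apply: (le_lt_trans (coord_le_sq y i)).
by rewrite sqZ sq_ei mulr1 ltr_pXn2r ?nnegrE ?(ltW e0) ?(ltW e20)//; lra.
Qed.

(** If the first source vanishes then v = 0, so the left side of the second equation is 0; its
    source vanishes too, and u = 0. *)
Lemma solution_eq0 (k l : nat) (al be a b p q : R) u v : 0 <= p -> 0 <= q -> continuous u -> continuous v ->
  (forall x, 0 <= u x /\ 0 <= v x) ->
  (forall x, poly_frac_laplacian k al u x = enorm x `^ a * v x `^ p) ->
  (forall x, poly_frac_laplacian l be v x = enorm x `^ b * u x `^ q) ->
  (forall x, poly_frac_laplacian k al u x = 0) -> u = (fun=> 0) /\ v = (fun=> 0).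
Proof.
move=> p0 q0 cu cv uv e1 e2 h.
have v0 : v = fun=> 0 by apply: (@source_eq0 a p) => // x; [have [] := uv x|rewrite -e1].
split => //; apply: (@source_eq0 b q) => // x; first by have [] := uv x.
by rewrite -e2 v0 poly_frac_zero.
Qed.

End Assembly.

Theorem theorem1p4 (R : realType) (n : nat) (alpha beta : R) (k l : nat)
    (a b p q : R)
    (hn : (1 <= n)%N)
    (halpha : 0 < alpha < Num.min 2 n%:R)
    (hbeta : 0 < beta < Num.min 2 n%:R)
    (ha : 0 <= a) (hb : 0 <= b) (hp : 0 <= p) (hq : 0 <= q)
    (hcase :
      [/\ 0 < 2 * k%:R + alpha < n%:R,
          0 < 2 * l%:R + beta < n%:R,
          0 < p <= (n%:R + 2 * k%:R + alpha + 2 * a) / (n%:R - 2 * l%:R - beta),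
          0 < q <= (n%:R + 2 * l%:R + beta + 2 * b) / (n%:R - 2 * k%:R - alpha) &
          (p, q) <>
            ((n%:R + 2 * k%:R + alpha + 2 * a) / (n%:R - 2 * l%:R - beta),
             (n%:R + 2 * l%:R + beta + 2 * b) / (n%:R - 2 * k%:R - alpha))]
      \/
      (n%:R <= Num.max (2 * k%:R + alpha) (2 * l%:R + beta) /\ (2 <= n)%N)) :
  forall u v : 'rV[R]_n -> R,
    is_solution k l alpha beta a b p q u v ->
    u = (fun=> 0) /\ v = (fun=> 0).
Proof.
move=> u v [hu hv e1 e2 uv].
have [d [d0 dn td cu [Lu ru]]] := admissible_regular hn halpha hu.
have [d' [d0' dn' td' cv [Lv rv]]] := admissible_regular hn hbeta hv.
have u0 x : 0 <= u x by have [] := uv x.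
have v0 x : 0 <= v x by have [] := uv x.
have al0 : 0 < alpha / 2 by rewrite divr_gt0//; case/andP: halpha.
have be0 : 0 < beta / 2 by rewrite divr_gt0//; case/andP: hbeta.
have hal : alpha = 2 * (alpha / 2) by field.
have hbe : beta = 2 * (beta / 2) by field.
have f0 x : 0 <= poly_frac_laplacian k alpha u x by rewrite e1 mulr_ge0 ?powR_ge0.
have g0 x : 0 <= poly_frac_laplacian l beta v x by rewrite e2 mulr_ge0 ?powR_ge0.
have zu := @solution_eq0 R n hn k l alpha beta a b p q u v hp hq cu cv uv e1 e2.
have zv (h : forall x, poly_frac_laplacian l beta v x = 0) : u = (fun=> 0) /\ v = (fun=> 0).
  have vu x : 0 <= v x /\ 0 <= u x by have [] := uv x.
  by have [] := @solution_eq0 R n hn l k beta alpha b a q p v u hq hp cv cu vu e2 e1 h.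
(* Case (2) is settled first: the equation whose order is at least n has an identically vanishing
   source. *)
case: hcase => [[/andP[k0 kn] /andP[l0 ln] /andP[p0 pl] /andP[q0 ql] pq]|[]]; last first.
  rewrite le_max => /orP[h|h] _; [apply: zu|apply: zv].
    by apply: (poly_frac_eq0 hn al0 d0 dn td hal cu Lu ru u0 f0); lra.
  by apply: (poly_frac_eq0 hn be0 d0' dn' td' hbe cv Lv rv v0 g0); lra.
pose s0 := alpha / 2 + k%:R; pose s1 := beta / 2 + l%:R.
have s00 : 0 < s0 by rewrite ltr_wpDr.
have s10 : 0 < s1 by rewrite ltr_wpDr.
have s0n : s0 < n%:R / 2 by rewrite /s0; lra.
have s1n : s1 < n%:R / 2 by rewrite /s1; lra.
have [c1 [l1 [c10 l10 repu]]] := riesz_representation hn al0 d0 dn td hal cu Lu ru u0 f0 s0n.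
have [c2 [l2 [c20 l20 repv]]] := riesz_representation hn be0 d0' dn' td' hbe cv Lv rv v0 g0 s1n.
rewrite -/s0 in repu; rewrite -/s1 in repv.
have cf : continuous (poly_frac_laplacian k alpha u).
  exact: (@continuous_poly_frac R n _ d al0 d0 dn k u alpha hal cu Lu ru).
have cg : continuous (poly_frac_laplacian l beta v).
  exact: (@continuous_poly_frac R n _ d' be0 d0' dn' l v beta hbe cv Lv rv).
apply: contrapT => nz.
(* Since either source vanishing identically forces (u, v) = (0, 0), a nontrivial solution has both
   sources positive somewhere. *)
have [y1 fy1] : exists y, 0 < poly_frac_laplacian k alpha u y.
  apply: contrapT => h; apply/nz/zu => x; apply/eqP/negPn/negP => fx; apply: h; exists x.
  by rewrite lt0r fx f0.
have [y2 gy2] : exists y, 0 < poly_frac_laplacian l beta v y.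
  apply: contrapT => h; apply/nz/zv => x; apply/eqP/negPn/negP => gx; apply: h; exists x.
  by rewrite lt0r gx g0.
have fE x : poly_frac_laplacian k alpha u x = sq x `^ (a / 2) * v x `^ p by rewrite e1 enorm_powR.
have gE x : poly_frac_laplacian l beta v x = sq x `^ (b / 2) * u x `^ q by rewrite e2 enorm_powR.
have Lf c := (repu c).1; have Lg c := (repv c).1.
have uge c : c1 * \int[leb R n]_x (poly_frac_laplacian k alpha u x * riesz s0 (x - c)) <= u c.
  by rewrite [leRHS](repu c).2 lerDr.
have vge c : c2 * \int[leb R n]_x (poly_frac_laplacian l beta v x * riesz s1 (x - c)) <= v c.
  by rewrite [leRHS](repv c).2 lerDr.
have f0' x : 0 <= sq x `^ (a / 2) * v x `^ p by rewrite -fE.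
have g0' x : 0 <= sq x `^ (b / 2) * u x `^ q by rewrite -gE.
have int0 s (h : 'rV[R]_n -> R) c : (forall x, 0 <= h x) -> 0 <= \int[leb R n]_x (h x * riesz s (x - c)).
  by move=> h0; apply: RI_ge0 => x; rewrite mulr_ge0// ker_ge0.
have [cu' cu0 hu'] := potential_positive hn s0n c10 f0 Lf uge cf fy1.
have [cv' cv0 hv'] := potential_positive hn s1n c20 g0 Lg vge cg gy2.
(* A positive [l1] would bound u below by a constant, and the potential v would then be infinite at
   the origin. *)
have l1z : l1 = 0.
  apply/eqP/negPn/negP => l1n; have l1p : 0 < l1 by rewrite lt0r l1n.
  apply: (lower_unbounded hn s10 s1n c20 g0 Lg vge hb q0 gE l1p) => x _.
  by rewrite (repu x).2 lerDl mulr_ge0 ?(ltW c10)// int0.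
have l2z : l2 = 0.
  apply/eqP/negPn/negP => l2n; have l2p : 0 < l2 by rewrite lt0r l2n.
  apply: (lower_unbounded hn s00 s0n c10 f0 Lf uge ha p0 fE l2p) => x _.
  by rewrite (repv x).2 lerDl mulr_ge0 ?(ltW c20)// int0.
have fF : poly_frac_laplacian k alpha u = fun x => sq x `^ (a / 2) * v x `^ p by apply/funext.
have gF : poly_frac_laplacian l beta v = fun x => sq x `^ (b / 2) * u x `^ q by apply/funext.
rewrite fF in Lf uge repu; rewrite gF in Lg vge repv.
have D1 : 0 < n%:R - 2 * l%:R - beta by lra.
have D2 : 0 < n%:R - 2 * k%:R - alpha by lra.
rewrite ler_pdivlMr// in pl; rewrite ler_pdivlMr// in ql.
have E1 : n%:R / 2 + s0 + a - (n%:R / 2 - s1) * p =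
    ((n%:R + 2 * k%:R + alpha + 2 * a) - p * (n%:R - 2 * l%:R - beta)) / 2.
  by rewrite /s0 /s1; field.
have E2 : n%:R / 2 + s1 + b - (n%:R / 2 - s0) * q =
    ((n%:R + 2 * l%:R + beta + 2 * b) - q * (n%:R - 2 * k%:R - alpha)) / 2.
  by rewrite /s0 /s1; field.
have sp0 : 0 <= n%:R / 2 + s0 + a - (n%:R / 2 - s1) * p by rewrite E1 divr_ge0// subr_ge0.
have sr0 : 0 <= n%:R / 2 + s1 + b - (n%:R / 2 - s0) * q by rewrite E2 divr_ge0// subr_ge0.
(* The pair (p, q) is not the critical pair, so one of the two nonnegative exponents is positive. *)
have sps : 0 < n%:R / 2 + s0 + a - (n%:R / 2 - s1) * p \/ 0 < n%:R / 2 + s1 + b - (n%:R / 2 - s0) * q.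
  rewrite E1 E2 !ltr_pdivlMr// !mul0r !subr_gt0; apply: contrapT => hh; apply: pq.
  congr pair; [rewrite -[LHS](mulfK (lt0r_neq0 D1))|rewrite -[LHS](mulfK (lt0r_neq0 D2))];
    congr (_ / _); apply/eqP.
    by rewrite eq_le pl leNgt; apply/negP => h; apply: hh; left.
  by rewrite eq_le ql leNgt; apply/negP => h; apply: hh; right.
pose cl := Num.min cu' cv'; have cl0 : 0 < cl by rewrite lt_min cu0.
have hu2 z : cl * (1 + sq z) `^ (- (n%:R / 2 - s0)) <= u z.
  by apply: le_trans (hu' z); rewrite ler_wpM2r ?powR_ge0// ge_min lexx.
have hv2 z : cl * (1 + sq z) `^ (- (n%:R / 2 - s1)) <= v z.
  by apply: le_trans (hv' z); rewrite ler_wpM2r ?powR_ge0// ge_min lexx orbT.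
have uE c : u c = c1 * \int[leb R n]_x (sq x `^ (a / 2) * v x `^ p * riesz s0 (x - c)).
  by rewrite {1}(repu c).2 l1z add0r.
have vE c : v c = c2 * \int[leb R n]_x (sq x `^ (b / 2) * u x `^ q * riesz s1 (x - c)).
  by rewrite {1}(repv c).2 l2z add0r.
apply: (no_decay hn s00 s0n s10 s1n ha hb p0 q0 c10 c20 sp0 sr0 sps Lf uge Lg vge).
exists (cl * 2 `^ (- (n%:R / 2 - s0))); first by rewrite mulr_gt0// powR_gt0.
move=> z z1.
by have [] := sphere_lower hn s00 s0n s10 s1n ha hb p0 q0 sp0 sr0 sps c10 c20 cu cv u0 v0 Lf uE Lg vE cl0 hu2 hv2 z1.
Qed.
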